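(* There is a Monte Carlo sensitive reachability oracle that preprocesses an $n$-node directed graph in $O(n^{\omega})$ time and stores $O(n^2\log n)$ bits. Then, given a set of $f$ edge insertions/deletions and node deletions, it updates the data structure in $O(f^{\omega})$ time and stores additional $O(f^2\log n)$ bits. Then, given a query pair of nodes $(u,v)$, it returns whether there is a directed path from $u$ to $v$ in the updated graph in $O(f^{2})$ time. The answers are correct with high probability.
   Context: $\omega$ is the exponent of $n\times n$ matrix multiplication, i.e., two $n\times n$ matrices can be multiplied in $O(n^\omega)$ arithmetic operations. Time is measured in the standard word-RAM model with $O(\log n)$-bit words. The update is applied once, as a single batch, to the preprocessed graph, and queries are then answered on the updated graph. *)

(* Defs.v *)
From HB Require Import structures.
From mathcomp Require Import all_boot all_order all_algebra.
From mathcomp Require Import all_classical all_reals all_analysis.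

Set Implicit Arguments.
Unset Strict Implicit.
Unset Printing Implicit Defensive.

Import Order.TTheory GRing.Theory Num.Theory numFieldNormedType.Exports.

Local Open Scope classical_set_scope.
Local Open Scope ring_scope.

(* [g = O(h)] for an integer-valued cost [g], as the argument tends to
   infinity. *)
Definition natO (R : realType) (g : nat -> nat) (h : nat -> R) : Prop :=
  (fun m => (g m)%:R : R^o) =O_\oo (fun m => h m : R^o).

(** * Randomized word RAM *)

(* All registers, memory cells and input entries hold [w]-bit words, that is,
   natural numbers reduced modulo [2 ^ w]; every instruction costs one step. A
   program has random access to several read-only input arrays, and to a
   read/write memory which is initially zero. *)

Inductive binop :=
  | OpAdd | OpSub | OpMul | OpDiv | OpMod | OpAnd | OpOr | OpXor
  | OpShl | OpShr | OpLt | OpEq.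

Inductive instr :=
  | Halt
  | Const of nat & nat         (* Const d k:   R[d] := k *)
  | Op of binop & nat & nat & nat (* Op o d a b: R[d] := o R[a] R[b] *)
  | Get of nat & nat           (* Get d a:     R[d] := M[R[a]] *)
  | Put of nat & nat           (* Put a b:     M[R[a]] := R[b] *)
  | Read of nat & nat & nat    (* Read d i a:  R[d] := entry R[a] of input i *)
  | InSize of nat & nat        (* InSize d i:  R[d] := length of input i *)
  | Rand of nat                (* Rand d:      R[d] := random word *)
  | Jump of nat & nat.         (* Jump a l:    go to line l if R[a] <> 0 *)

Definition program := seq instr.

Record state := State { pc : nat; regs : nat -> nat; memory : nat -> nat }.

Definition init_state : state := State 0 (fun=> 0%N) (fun=> 0%N).

(* Operands are words; the result is reduced modulo [2 ^ w] by [step]. *)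
Definition eval_binop (w : nat) (o : binop) (a b : nat) : nat :=
  match o with
  | OpAdd => a + b
  | OpSub => a + 2 ^ w - b
  | OpMul => a * b
  | OpDiv => a %/ b
  | OpMod => a %% b
  | OpAnd => Nat.land a b
  | OpOr => Nat.lor a b
  | OpXor => Nat.lxor a b
  | OpShl => a * 2 ^ b
  | OpShr => a %/ 2 ^ b
  | OpLt => a < b
  | OpEq => a == b
  end%N.

(* Running off the end of the program also halts. *)
Definition current (p : program) (s : state) : instr := nth Halt p (pc s).

Definition halted (p : program) (s : state) : bool :=
  if current p s is Halt then true else false.

(* [rho] is the random word available at this step. *)
Definition step (w : nat) (p : program) (ins : seq (seq nat))
    (s : state) (rho : nat) : state :=
  let R := regs s in
  let M := memory s in
  let next := (pc s).+1 in
  let set d x := State next [eta R with d |-> (x %% 2 ^ w)%N] M in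
  match current p s with
  | Halt => s
  | Const d k => set d k
  | Op o d a b => set d (eval_binop w o (R a) (R b))
  | Get d a => set d (M (R a))
  | Put a b => State next R [eta M with R a |-> R b]
  | Read d i a => set d (nth 0%N (nth [::] ins i) (R a))
  | InSize d i => set d (size (nth [::] ins i))
  | Rand d => set d rho
  | Jump a l => State (if R a == 0%N then next else l) R M
  end.

(* The tape [rs] supplies one random word per step, so its length is also the
   number of steps allowed. The result is [None] if the program has not halted
   by then; otherwise it is the array held in memory cells 0, ..., R[0] - 1. *)
Definition run (w : nat) (p : program) (ins : seq (seq nat)) (rs : seq nat) :
    option (seq nat) :=
  let s := foldl (step w p ins) init_state rs in
  if halted p s then Some (mkseq (memory s) (regs s 0)) else None.

(* The number of bits of [n]: it is Theta(log n), and positive when n = 1. *)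
Definition bitlen (n : nat) : nat := (trunc_log 2 n).+1.

(** * Matrix multiplication exponents *)

(* Division-free arithmetic straight-line programs: each instruction appends
   a value to the list of values available so far, which initially consists of
   the inputs; operands are positions in that list. *)
Inductive slp_instr :=
  | SConst of nat
  | SAdd of nat & nat
  | SSub of nat & nat
  | SMul of nat & nat.

Definition slp := seq slp_instr.

Definition slp_step (F : fieldType) (vs : seq F) (i : slp_instr) : seq F :=
  rcons vs match i with
           | SConst k => k%:R
           | SAdd a b => vs`_a + vs`_b
           | SSub a b => vs`_a - vs`_b
           | SMul a b => vs`_a * vs`_b
           end.

Definition slp_eval (F : fieldType) (inputs : seq F) (s : slp) : seq F :=
  foldl (@slp_step F) inputs s.

Definition entries (T : Type) (n : nat) (A : 'M[T]_n) : seq T :=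
  [seq A i j | i <- enum 'I_n, j <- enum 'I_n].

(* The last [n * n] values computed by [s] are the entries of the product. *)
Definition slp_multiplies (n : nat) (s : slp) : Prop :=
  forall (F : fieldType) (A B : 'M[F]_n),
    let vs := slp_eval (entries A ++ entries B) s in
    drop (size vs - n * n) vs = entries (A *m B).

Definition slp_instr_words (i : slp_instr) : seq nat :=
  match i with
  | SConst k => [:: 0; k; 0]
  | SAdd a b => [:: 1; a; b]
  | SSub a b => [:: 2; a; b]
  | SMul a b => [:: 3; a; b]
  end%N.

(* Two [n * n] matrices can be multiplied in O(n ^ omega) arithmetic
   operations, by a uniform algorithm: the sequence [s n] of arithmetic
   operations to perform is itself produced in O(n ^ omega) time by a word RAM
   program with O(log n)-bit words. The all-zero tape makes [p]
   deterministic. *)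
Definition matmul_exponent (R : realType) (omega : R) : Prop :=
  exists (p : program) (c : nat) (t : nat -> nat) (s : nat -> slp),
    natO t (fun n => n%:R `^ omega) /\
    forall n : nat, (0 < n)%N ->
      [/\ (size (s n) <= t n)%N,
          slp_multiplies n (s n) &
          run (c * bitlen n) p [:: [:: n]] (nseq (t n) 0%N)
            = Some (flatten (map slp_instr_words (s n)))].

(** * Batch updates of directed graphs *)

Inductive update (n : nat) :=
  | InsEdge of 'I_n & 'I_n
  | DelEdge of 'I_n & 'I_n
  | DelNode of 'I_n.

Arguments InsEdge {n}.
Arguments DelEdge {n}.
Arguments DelNode {n}.

Definition update_code n (x : update n) : 'I_n * 'I_n + 'I_n * 'I_n + 'I_n :=
  match x with
  | InsEdge u v => inl (inl (u, v))
  | DelEdge u v => inl (inr (u, v))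
  | DelNode u => inr u
  end.

Definition update_decode n (x : 'I_n * 'I_n + 'I_n * 'I_n + 'I_n) : update n :=
  match x with
  | inl (inl (u, v)) => InsEdge u v
  | inl (inr (u, v)) => DelEdge u v
  | inr u => DelNode u
  end.

Lemma update_codeK n : cancel (@update_code n) (@update_decode n).
Proof. by case. Qed.

HB.instance Definition _ n :=
  Equality.copy (update n) (can_type (@update_codeK n)).

Definition alive n (B : seq (update n)) (u : 'I_n) : bool :=
  DelNode u \notin B.

(* Since the batch is an unordered set, precedence is fixed by convention:
   node deletions prevail over edge updates, and the deletion of an edge
   prevails over its insertion. *)
Definition updated n (G : rel 'I_n) (B : seq (update n)) : rel 'I_n :=
  fun u v => [&& alive B u, alive B v, G u v || (InsEdge u v \in B)
               & DelEdge u v \notin B].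

(* Deleted nodes are not nodes of the updated graph, so that no path starts or
   ends there. *)
Definition reachable n (G : rel 'I_n) (B : seq (update n)) (u v : 'I_n) :
    bool :=
  [&& alive B u, alive B v & connect (updated G B) u v].

(** * Sensitive reachability oracles *)

Definition graph_words n (G : rel 'I_n) : seq nat :=
  [seq nat_of_bool (G u v) | u <- enum 'I_n, v <- enum 'I_n].

Definition update_words n (x : update n) : seq nat :=
  match x with
  | InsEdge u v => [:: 0; val u; val v]
  | DelEdge u v => [:: 1; val u; val v]
  | DelNode u => [:: 2; val u; val u]
  end%N.

(* [word_factor] is the constant in the O(log n)-bit word size. *)
Record oracle := Oracle {
  word_factor : nat;
  preprocess_prog : program;
  update_prog : program;
  query_prog : program
}.

Definition word_size (O : oracle) (n : nat) : nat := word_factor O * bitlen n.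

Definition tape (O : oracle) (n t : nat) := t.-tuple 'I_(2 ^ word_size O n).

Definition tape_words O n t (r : tape O n t) : seq nat :=
  [seq nat_of_ord x | x <- r].

Section Phases.
Variables (O : oracle) (n : nat).

(* The data structure computed from [G]. *)
Definition preprocess (G : rel 'I_n) t (r : tape O n t) : option (seq nat) :=
  run (word_size O n) (preprocess_prog O)
    [:: [:: n]; graph_words G] (tape_words r).

(* The additional data computed from the data structure [D] and the batch
   [B]. *)
Definition process_batch (D : seq nat) (B : seq (update n)) t (r : tape O n t) :
    option (seq nat) :=
  run (word_size O n) (update_prog O)
    [:: D; flatten (map (@update_words n) B)] (tape_words r).

Definition query (D U : seq nat) (u v : 'I_n) t (r : tape O n t) :
    option (seq nat) :=
  run (word_size O n) (query_prog O)
    [:: D; U; [:: val u; val v]] (tape_words r).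

(* Whatever the random words, all phases halt within [t1], [t2] and [t3]
   steps, and at most [b1], resp. [b2], bits are stored after the first,
   resp. second, phase. *)
Definition resource_bounds (G : rel 'I_n) (B : seq (update n))
    (t1 t2 t3 b1 b2 : nat) : Prop :=
  forall r1 : tape O n t1, exists D,
    [/\ preprocess G r1 = Some D, (size D * word_size O n <= b1)%N &
  forall r2 : tape O n t2, exists U,
    [/\ process_batch D B r2 = Some U, (size U * word_size O n <= b2)%N &
  forall (u v : 'I_n) (r3 : tape O n t3), query D U u v r3 <> None]].

(* [r3 (u, v)] is the random tape used by the query (u, v). *)
Definition all_correct (G : rel 'I_n) (B : seq (update n)) t1 t2 t3
    (r1 : tape O n t1) (r2 : tape O n t2)
    (r3 : {ffun 'I_n * 'I_n -> tape O n t3}) : bool :=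
  if preprocess G r1 is Some D then
    if process_batch D B r2 is Some U then
      [forall u, forall v,
        query D U u v (r3 (u, v)) == Some [:: nat_of_bool (reachable G B u v)]]
    else false
  else false.

End Phases.

Definition uniform_prob (R : realType) (T : finType) (E : pred T) : R :=
  #|E|%:R / #|T|%:R.

(* The probability, over independent uniform random words, that all queries
   are answered correctly. *)
Definition success_prob (R : realType) (O : oracle) n (G : rel 'I_n)
    (B : seq (update n)) (t1 t2 t3 : nat) : R :=
  uniform_prob R
    (fun r : tape O n t1 * tape O n t2 * {ffun 'I_n * 'I_n -> tape O n t3} =>
       all_correct G B r.1.1 r.1.2 r.2).

(* Main.v *)
(* Give the edges [(u, v)] random weights in the field of order [2 ^ (2 * 3 ^ l)],
   polynomially large in [n], and let [M = 1 + X], where [X] is the weighted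
   adjacency matrix. As a polynomial in the weights, the cofactor of [M] at
   [(u, v)] vanishes if and only if [v] is not reachable from [u], so that by the
   Schwartz-Zippel lemma reachability can be read off [M ^ -1] with high
   probability. A batch of [f] updates changes [M] into [M + P Q], where [P] has
   [f] columns; by the Woodbury formula, entries of the new inverse follow in time
   [O(f ^ 2)] from those of [M ^ -1] and of the inverse of an [f * f] matrix.
   Inverses are computed without divisions, as pairs [(N, d)] with [N M = d], by
   recursion on 2 * 2 blocks: with high probability all leading principal minors are
   nonzero. The straight-line programs for matrix multiplication are
   obtained for all powers of two by simulating the given word RAM program.
   With [h = 3 ^ l], the field is generated by a root [z] of [1 + z ^ h + z ^ (2 h)];
   its elements are stored as words, the coefficients of polynomials modulo
   [z ^ (3 h) - 1], which fit in [O(1)] chunks of [O(log n)] bits, so that they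
   are multiplied by table lookup. Such a polynomial vanishes at [z] if and only
   if its three blocks of [h] coefficients coincide. *)
Require Import Defs.
From Stdlib Require Import PeanoNat.
From mathcomp Require Import all_boot all_order all_algebra all_fingroup all_solvable all_field.
From mathcomp Require Import all_classical all_reals all_analysis.
From mathcomp Require Import zify ring.

Set Implicit Arguments.
Unset Strict Implicit.
Unset Printing Implicit Defensive.

Import Order.TTheory GRing.Theory Num.Theory numFieldNormedType.Exports.

(** * A structured language on top of the word RAM *)

(** Field operations must take $O(1)$ steps although no irreducible polynomial is given. As 2
    generates the units modulo $3^{l+1}$, the polynomial $1 + z^h + z^{2h}$ is irreducible for every
    $l$; rounding the degree up to this form costs a constant factor in the word size. The redundant
    representation makes reduction a mere fold, and the zero test, which it complicates, is run
    once, at the end of a query. Denominators are carried along because no constant-time inverse of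
    a word is at hand. Characteristic 2 turns addition into XOR and lets the same term insert or
    delete an edge.

    A node deletion must have rank one: it clears only the row of the node, which becomes a sink,
    and queries at deleted nodes are answered apart. Elimination on the $f \times f$ matrix needs
    nonzero leading minors; these follow from the nonsingularity of the matrices of the graph after
    the first $t$ updates. Every bad event is thus the vanishing of one of polynomially many
    determinants.

    All random words are drawn in preprocessing, at tape positions known exactly. This is why the
    semantics counts steps exactly, while most later statements only bound them. *)

Inductive exp :=
  | V of nat
  | K of nat
  | Bin of binop & exp & exp
  | Arr of nat & exp
  | Inp of nat & exp
  | Len of nat.

Inductive cmd :=
  | Skip
  | Asg of nat & exp
  | Sto of nat & exp & exp
  | Rnd of nat
  | Sq of cmd & cmd
  | Cond of exp & cmd & cmd
  | Loop of exp & cmd.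

(* Even registers hold the variables; register 1 holds the base address of the
   interleaved arrays, and the other odd registers hold temporaries. *)
Definition vreg v := v.*2.
Definition treg t := t.*2.+3.

(* Array 0 occupies the addresses 0, 1, ..., so that it is the output; entry
   [i] of array [0 < a < 32] lies at address [base + 32 * i + a]. *)
Definition addr_code r r' a : program :=
  if a is 0 then [::] else
  [:: Const r' 32; Op OpMul r r r'; Const r' a; Op OpAdd r r r';
      Op OpAdd r r 1].

Fixpoint cexp (t : nat) (x : exp) : program :=
  match x with
  | V v => [:: Op OpAnd (treg t) (vreg v) (vreg v)]
  | K k => [:: Const (treg t) k]
  | Bin o x y =>
      cexp t x ++ cexp t.+1 y ++ [:: Op o (treg t) (treg t) (treg t.+1)]
  | Arr a x =>
      cexp t x ++ addr_code (treg t) (treg t.+1) a ++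
      [:: Get (treg t) (treg t)]
  | Inp i x => cexp t x ++ [:: Read (treg t) i (treg t)]
  | Len i => [:: InSize (treg t) i]
  end.

(** Jumps of the machine are absolute, so [a] is the line where the code is placed. An unconditional
    jump is a jump on a temporary just set to 1. In a conditional the else branch comes first and
    has to jump over the other one. *)
Fixpoint ccmd (a : nat) (c : cmd) : program :=
  match c with
  | Skip => [::]
  | Asg v x => cexp 0 x ++ [:: Op OpAnd (vreg v) (treg 0) (treg 0)]
  | Sto b i x =>
      cexp 0 i ++ addr_code (treg 0) (treg 1) b ++ cexp 1 x ++
      [:: Put (treg 0) (treg 1)]
  | Rnd v => [:: Rand (vreg v)]
  | Sq c d => ccmd a c ++ ccmd (a + size (ccmd a c)) d
  | Cond x c d =>
      let px := cexp 0 x in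
      let pd := ccmd (a + size px + 1) d in
      let l := a + size px + 1 + size pd + 2 in
      let pc := ccmd l c in
      px ++ [:: Jump (treg 0) l] ++ pd ++
      [:: Const (treg 0) 1; Jump (treg 0) (l + size pc)] ++ pc
  | Loop x c =>
      let px := cexp 0 x in
      let l := a + size px + 3 in
      let pc := ccmd l c in
      px ++
      [:: Jump (treg 0) l; Const (treg 0) 1;
          Jump (treg 0) (l + size pc + 2)] ++
      pc ++ [:: Const (treg 0) 1; Jump (treg 0) a]
  end.

Definition ecost x := size (cexp 0 x).

Record env := Env { vr : nat -> nat; ar : nat -> nat -> nat }.

Definition setv e v x := Env [eta vr e with v |-> x] (ar e).
Definition seta e a i x :=
  Env (vr e) (fun b j => if (b == a) && (j == i) then x else ar e b j).

(* Unlike in the machine, values are not reduced: [safe] guarantees the absence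
   of overflows. *)
Definition bsem (o : binop) (a b : nat) : nat :=
  match o with
  | OpAdd => a + b
  | OpSub => a - b
  | OpMul => a * b
  | OpDiv => a %/ b
  | OpMod => a %% b
  | OpAnd => Nat.land a b
  | OpOr => Nat.lor a b
  | OpXor => Nat.lxor a b
  | OpShl => a * 2 ^ b
  | OpShr => a %/ 2 ^ b
  | OpLt => a < b
  | OpEq => a == b
  end.

Lemma size_cexp t x : size (cexp t x) = ecost x.
Proof.
suff h u : size (cexp t x) = size (cexp u x) by apply: h.
elim: x t u => [v|k|op x IHx y IHy|a x IH|i x IH|i] t u //=.
- by rewrite !size_cat (IHx t u) (IHy t.+1 u.+1).
- by rewrite !size_cat (IH t u); case: a.
- by rewrite !size_cat (IH t u).
Qed.

(** * Bitwise operations stay within a word *)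

Lemma modn_small_pow2 x w k : x < 2 ^ w -> w <= k -> x < 2 ^ k.
Proof. by move=> h wk; apply: (leq_trans h); rewrite leq_exp2l. Qed.

Lemma expn_pow a b : a ^ b = Nat.pow a b.
Proof. by elim: b => //= b IH; rewrite expnS IH multE. Qed.

Lemma divn_div a b : a %/ b.+1 = Nat.div a b.+1.
Proof.
apply: (Nat.div_unique _ _ _ (a %% b.+1)).
  by apply/ssrnat.ltP; rewrite ltn_mod.
by rewrite {1}(divn_eq a b.+1) mulnC.
Qed.

Lemma testbit_odd a i : Nat.testbit a i = odd (a %/ 2 ^ i).
Proof.
have [b eb] : exists b, 2 ^ i = b.+1.
  by exists (2 ^ i).-1; rewrite prednK // expn_gt0.
have e2 : Nat.pow 2 i = b.+1 by rewrite -expn_pow.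
have -> : odd (a %/ 2 ^ i) = Nat.odd (Nat.div a (Nat.pow 2 i)).
  rewrite eb e2 divn_div; move: (Nat.div _ _) => c.
  elim: c => // c IH /=; rewrite Nat.odd_succ IH -Nat.negb_odd.
  by case: Nat.odd.
by rewrite Nat.testbit_odd Nat.shiftr_div_pow2.
Qed.

Lemma testbit_small a w i : a < 2 ^ w -> w <= i -> Nat.testbit a i = false.
Proof.
move=> aw wi; rewrite testbit_odd divn_small //.
exact: modn_small_pow2 aw wi.
Qed.

Lemma small_testbit a w :
  (forall i, w <= i -> Nat.testbit a i = false) -> a < 2 ^ w.
Proof.
move=> h; rewrite ltnNge; apply/negP => wa.
have a0 : 0 < a by apply: leq_trans wa; rewrite expn_gt0.
have := h (trunc_log 2 a) (trunc_log_max (isT : 1 < 2) wa).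
have /andP[l1 l2] := trunc_log_bounds (isT : 1 < 2) a0.
rewrite testbit_odd; suff -> : a %/ 2 ^ trunc_log 2 a = 1 by [].
apply/eqP; rewrite eqn_leq -ltnS ltn_divLR ?expn_gt0 // -expnS l2 /=.
by rewrite divn_gt0 ?expn_gt0.
Qed.

Lemma lxor_lt a b w : a < 2 ^ w -> b < 2 ^ w -> Nat.lxor a b < 2 ^ w.
Proof.
move=> ha hb; apply: small_testbit => i wi; rewrite Nat.lxor_spec.
by rewrite (testbit_small ha) ?(testbit_small hb).
Qed.

Lemma lor_lt a b w : a < 2 ^ w -> b < 2 ^ w -> Nat.lor a b < 2 ^ w.
Proof.
move=> ha hb; apply: small_testbit => i wi; rewrite Nat.lor_spec.
by rewrite (testbit_small ha) ?(testbit_small hb).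
Qed.

Lemma land_lt a b w : a < 2 ^ w -> b < 2 ^ w -> Nat.land a b < 2 ^ w.
Proof.
move=> ha hb; apply: small_testbit => i wi; rewrite Nat.land_spec.
by rewrite (testbit_small ha) ?(testbit_small hb).
Qed.

(** * Timed semantics and correctness of the compiler *)

Section Semantics.

Variables (w : nat) (ins : seq (seq nat)) (rho : nat -> nat).

(** Interleaving with stride 32 above a base near $2^{w-1}$ uses fewer than $2^{w-2}$ further
    addresses, so that no address overflows and array 0 keeps everything below the base. *)
Definition lim := 2 ^ (w - 7).

Fixpoint ev (e : env) (x : exp) : nat :=
  match x with
  | V v => vr e v
  | K k => k
  | Bin o x y => bsem o (ev e x) (ev e y)
  | Arr a x => ar e a (ev e x)
  | Inp i x => nth 0 (nth [::] ins i) (ev e x)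
  | Len i => size (nth [::] ins i)
  end.

Definition bsafe (o : binop) (a b : nat) : bool :=
  match o with
  | OpAdd => a + b < 2 ^ w
  | OpMul => a * b < 2 ^ w
  | OpShl => a * 2 ^ b < 2 ^ w
  | OpSub => b <= a
  | _ => true
  end.

Fixpoint safe (e : env) (x : exp) : Prop :=
  match x with
  | V v => True
  | K k => k < 2 ^ w
  | Bin o x y => [/\ safe e x, safe e y & bsafe o (ev e x) (ev e y)]
  | Arr a x => [/\ safe e x, a < 32 & ev e x < lim]
  | Inp i x => safe e x
  | Len i => True
  end.

(** Absolute times are carried because [Rnd] reads the tape at the position of the current step. The
    two extra steps after an else branch or a loop body are those of the unconditional jump. *)
Inductive bs : cmd -> nat -> env -> nat -> env -> Prop :=
  | bs_skip t e : bs Skip t e t e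
  | bs_asg v x t e :
      safe e x -> bs (Asg v x) t e (t + (ecost x).+1) (setv e v (ev e x))
  | bs_sto a i x t e :
      safe e i -> safe e x -> a < 32 -> ev e i < lim ->
      bs (Sto a i x) t e (t + size (ccmd 0 (Sto a i x)))
        (seta e a (ev e i) (ev e x))
  | bs_rnd v t e : bs (Rnd v) t e t.+1 (setv e v (rho t %% 2 ^ w))
  | bs_sq c d t e t1 e1 t2 e2 :
      bs c t e t1 e1 -> bs d t1 e1 t2 e2 -> bs (Sq c d) t e t2 e2
  | bs_true x c d t e t1 e1 :
      safe e x -> ev e x != 0 -> bs c (t + (ecost x).+1) e t1 e1 ->
      bs (Cond x c d) t e t1 e1
  | bs_false x c d t e t1 e1 :
      safe e x -> ev e x = 0 -> bs d (t + (ecost x).+1) e t1 e1 ->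
      bs (Cond x c d) t e t1.+2 e1
  | bs_stop x c t e :
      safe e x -> ev e x = 0 -> bs (Loop x c) t e (t + (ecost x).+3) e
  | bs_iter x c t e t1 e1 t2 e2 :
      safe e x -> ev e x != 0 -> bs c (t + (ecost x).+1) e t1 e1 ->
      bs (Loop x c) t1.+2 e1 t2 e2 -> bs (Loop x c) t e t2 e2.

Definition wf (e : env) :=
  (forall v, vr e v < 2 ^ w) /\ (forall a i, ar e a i < 2 ^ w).

Hypothesis w_large : 7 < w.
Hypothesis small_ins : forall i j, nth 0 (nth [::] ins i) j < 2 ^ w.
Hypothesis small_len : forall i, size (nth [::] ins i) < 2 ^ w.

Let w0 : 0 < 2 ^ w. Proof. by rewrite expn_gt0. Qed.
Let w1 : 1 < 2 ^ w.
Proof. by rewrite -{1}(expn0 2) ltn_exp2l //; lia. Qed.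

Lemma bsem_lt o a b :
  a < 2 ^ w -> b < 2 ^ w -> bsafe o a b -> bsem o a b < 2 ^ w.
Proof.
move=> ha hb; case: o => //= h.
- by apply: leq_ltn_trans ha; rewrite leq_subr.
- by apply: leq_ltn_trans ha; rewrite leq_div.
- by apply: leq_ltn_trans ha; rewrite leq_mod.
- exact: land_lt.
- exact: lor_lt.
- exact: lxor_lt.
- by apply: leq_ltn_trans ha; rewrite leq_div.
- by case: (a < b).
- by case: (a == b).
Qed.

Lemma ev_lt e x : wf e -> safe e x -> ev e x < 2 ^ w.
Proof.
move=> [wv wa]; elim: x => /= [v _|k //|b x IHx y IHy [sx sy sb]|a x IH _|i x IH _|i _] //.
by apply: bsem_lt => //; auto.
Qed.

Lemma bs_wf c t e t' e' : bs c t e t' e' -> wf e -> wf e'.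
Proof.
elim=> //=.
- move=> v x {}t {}e sx [wv wa]; split=> // u /=.
  by case: eqP => _ //; apply: ev_lt.
- move=> a i x {}t {}e si sx _ _ [wv wa]; split=> // b j /=.
  by case: ifP => // _; apply: ev_lt.
- move=> v {}t {}e [wv wa]; split=> // u /=.
  by case: eqP => // _; rewrite ltn_mod.
- by move=> *; auto.
- by move=> *; auto.
Qed.

Lemma eval_bsem o a b : a < 2 ^ w -> b < 2 ^ w -> bsafe o a b ->
  eval_binop w o a b %% 2 ^ w = bsem o a b.
Proof.
move=> ha hb h.
have := bsem_lt ha hb h; case: o h => //= h; try by move=> ?; rewrite modn_small.
by move=> _; rewrite addnC -addnBA // modnDl modn_small //; lia.
Qed.

Section Compilation.

Variable p : program.

Fixpoint stp k t s :=
  if k is k'.+1 then stp k' t.+1 (step w p ins s (rho t)) else s.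

Lemma stpD j k t s : stp (j + k) t s = stp k (t + j) (stp j t s).
Proof.
by elim: j t s => [|j IH] t s /=; rewrite ?addn0 // IH addSnnS.
Qed.

Definition code_at (q : program) a :=
  forall i, i < size q -> nth Halt p (a + i) = nth Halt q i.

Lemma code_at_cat q1 q2 a :
  code_at (q1 ++ q2) a -> code_at q1 a /\ code_at q2 (a + size q1).
Proof.
move=> h; split=> i iq.
  by rewrite h ?size_cat ?ltn_addr // nth_cat iq.
by rewrite -addnA h ?size_cat ?ltn_add2l // nth_cat ltnNge leq_addr addKn.
Qed.

Lemma code_at_cons i q a :
  code_at (i :: q) a -> nth Halt p a = i /\ code_at q a.+1.
Proof.
move=> h; split; first by rewrite -(addn0 a) h.
by move=> j jq; rewrite addSnnS h.
Qed.

Definition base := 2 ^ w.-1 - 1.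
Definition adr a i := if a is 0 then i else base + 32 * i + a.

Record simu (e : env) (s : state) : Prop := Simu {
  simu_wf : wf e;
  simu_v : forall v, regs s (vreg v) = vr e v;
  simu_base : regs s 1 = base;
  simu_a : forall a i, a < 32 -> i < lim -> memory s (adr a i) = ar e a i }.

Let lim32 : lim * 64 = 2 ^ w.-1.
Proof. by rewrite /lim -[64]/(2 ^ 6) -expnD; congr (2 ^ _); lia. Qed.
Let wS : 2 ^ w.-1 * 2 = 2 ^ w.
Proof. by rewrite mulnC -expnS prednK //; lia. Qed.
Let lim_gt0 : 0 < lim. Proof. by rewrite expn_gt0. Qed.

Lemma adr_inj a i b j : a < 32 -> i < lim -> b < 32 -> j < lim ->
  adr a i = adr b j -> a = b /\ i = j.
Proof. by rewrite /adr /base; case: a => [|a]; case: b => [|b]; lia. Qed.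

Lemma step_op s r o d a b : current p s = Op o d a b ->
  step w p ins s r = State (pc s).+1
    [eta regs s with d |-> eval_binop w o (regs s a) (regs s b) %% 2 ^ w]
    (memory s).
Proof. by rewrite /step => ->. Qed.

Lemma step_const s r d k : current p s = Const d k -> k < 2 ^ w ->
  step w p ins s r = State (pc s).+1 [eta regs s with d |-> k] (memory s).
Proof. by rewrite /step => -> h; rewrite modn_small. Qed.

Lemma step_get s r d a : current p s = Get d a ->
  step w p ins s r = State (pc s).+1
    [eta regs s with d |-> memory s (regs s a) %% 2 ^ w] (memory s).
Proof. by rewrite /step => ->. Qed.

(** The registers which evaluation into temporary [t] must preserve: the operands already computed,
    in lower temporaries, the base address, and all variables. *)
Definition kept t r := (r < treg t) || ~~ odd r.

Lemma kept_treg t u r : kept t r -> t <= u -> (r == treg u) = false.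
Proof.
rewrite /kept /treg => /orP[h|h] tu; apply/eqP => e; first by lia.
by move: h; rewrite e /= odd_double.
Qed.

Lemma keptW t u r : t <= u -> kept t r -> kept u r.
Proof. by rewrite /kept /treg => tu /orP[h|->]; rewrite ?orbT //; lia. Qed.

Lemma kept_vreg t v : kept t (vreg v).
Proof. by rewrite /kept /vreg odd_double orbT. Qed.

Lemma addr_codeP a s t u i : code_at (addr_code (treg u) (treg u.+1) a) (pc s) ->
  regs s 1 = base -> regs s (treg u) = i -> i < lim -> a < 32 ->
  exists2 s', stp (size (addr_code (treg u) (treg u.+1) a)) t s = s' &
  [/\ pc s' = pc s + size (addr_code (treg u) (treg u.+1) a),
      memory s' = memory s, regs s' (treg u) = adr a i &
      forall r, kept u r -> regs s' r = regs s r].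
Proof.
case: a => [|a] /=.
  by move=> _ _ hi _ _; exists s => //; split; rewrite ?addn0 //=.
move=> h hb hi il al.
have [h0 /code_at_cons[h1 /code_at_cons[h2 /code_at_cons[h3 /code_at_cons[h4 _]]]]] := code_at_cons h.
have tu : (treg u == treg u.+1) = false by rewrite /treg; apply/eqP; lia.
have t1 v : (1 == treg v) = false by [].
have wl : lim * 128 = 2 ^ w by lia.
have E1 : i * 32 < 2 ^ w by lia.
have E2 : i * 32 + a.+1 < 2 ^ w by lia.
have E3 : i * 32 + a.+1 + base < 2 ^ w by rewrite /base; lia.
eexists; first by [].
rewrite (@step_const _ (rho t) (treg u.+1) 32) //=; last by lia.
rewrite (@step_op _ (rho t.+1) OpMul (treg u) (treg u) (treg u.+1)) //=.
rewrite (@step_const _ (rho t.+2) (treg u.+1) a.+1) //=; last by lia.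
rewrite (@step_op _ (rho t.+3) OpAdd (treg u) (treg u) (treg u.+1)) //=.
rewrite (@step_op _ (rho t.+4) OpAdd (treg u) (treg u) 1) //=.
rewrite !eqxx ?[treg u.+1 == _]eq_sym ?tu ?t1 /= hb hi.
split=> //; first by lia.
  by rewrite !modn_small // /adr; lia.
move=> r kr; rewrite !(kept_treg kr) //.
Qed.

Lemma cexpP x u e s t : code_at (cexp u x) (pc s) -> simu e s -> safe e x ->
  exists2 s', stp (ecost x) t s = s' &
  [/\ pc s' = pc s + ecost x, memory s' = memory s,
      regs s' (treg u) = ev e x & forall r, kept u r -> regs s' r = regs s r].
Proof.
elim: x u s t => [v|k|op x IHx y IHy|a x IH|i x IH|i] u s t /=.
- move=> /code_at_cons[h _] re _; eexists; first by [].
  rewrite (step_op _ h) /=; split=> //; first by rewrite addn1.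
    rewrite eqxx (simu_v re) Nat.land_diag modn_small //.
    by case: (simu_wf re).
  by move=> r kr; rewrite (kept_treg kr).
- move=> /code_at_cons[h _] re kw; eexists; first by [].
  rewrite (step_const _ h) //=; split=> //; first by rewrite addn1.
    by rewrite eqxx.
  by move=> r kr; rewrite (kept_treg kr).
- move=> /code_at_cat[h /code_at_cat[h' /code_at_cons[h'' _]]] re [sx sy sb].
  rewrite size_cexp in h' h''; rewrite size_cexp in h''.
  have [s1 e1 [p1 m1 r1 k1]] := IHx u s t h re sx.
  have re1 : simu e s1.
    case: re => w_ v_ b_ a_; split=> // [v||a i ha hi].
    - by rewrite k1 ?kept_vreg // v_.
    - by rewrite k1.
    - by rewrite m1 a_.
  rewrite -p1 in h'.
  have [s2 e2 [p2 m2 r2 k2]] := IHy u.+1 s1 (t + ecost x) h' re1 sy.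
  rewrite /ecost /= !size_cat /= -!/(ecost _) size_cexp addnA !stpD e1 e2 /=.
  have cur : current p s2 = Op op (treg u) (treg u) (treg u.+1).
    by rewrite /current p2 p1 h''.
  eexists; first by []; rewrite (step_op _ cur) /=.
  split.
  - by rewrite p2 p1; lia.
  - by rewrite m2.
  - rewrite eqxx r2 k2 ?r1 ?eval_bsem //; try exact: ev_lt (simu_wf re) _.
    by rewrite /kept /treg; apply/orP; left; lia.
  - by move=> r kr; rewrite (kept_treg kr) // k2 ?k1 //; apply: keptW kr.
- move=> /code_at_cat[h /code_at_cat[h' /code_at_cons[h'' _]]] re [sx ha hl].
  rewrite size_cexp in h' h''.
  have [s1 e1 [p1 m1 r1 k1]] := IH u s t h re sx.
  rewrite -p1 in h'.
  have b1 : regs s1 1 = base by rewrite k1 // (simu_base re).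
  have [s2 e2 [p2 m2 r2 k2]] := addr_codeP (t + ecost x) h' b1 r1 hl ha.
  have -> : ecost (Arr a x) =
      ecost x + size (addr_code (treg u) (treg u.+1) a) + 1.
    by rewrite {1}/ecost /= !size_cat /= addnA; case: (a).
  rewrite !stpD e1 e2 /=.
  have cur : current p s2 = Get (treg u) (treg u).
    by rewrite /current p2 p1 h''.
  eexists; first by []; rewrite (step_get _ cur) /=.
  split.
  - by rewrite p2 p1; lia.
  - by rewrite m2.
  - rewrite eqxx r2 m2 m1 (simu_a re) // modn_small //.
    by case: (simu_wf re).
  - by move=> r kr; rewrite (kept_treg kr) // k2 ?k1.
- move=> /code_at_cat[h /code_at_cons[h' _]] re sx.
  rewrite size_cexp in h'.
  have [s1 e1 [p1 m1 r1 k1]] := IH u s t h re sx.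
  have -> : ecost (Inp i x) = ecost x + 1 by rewrite {1}/ecost /= size_cat.
  rewrite stpD e1 /=; eexists; first by [].
  rewrite /step (_ : current p s1 = Read (treg u) i (treg u)); last first.
    by rewrite /current p1 h'.
  split=> //=; first by rewrite p1; lia.
    by rewrite eqxx r1 modn_small.
  by move=> r kr; rewrite (kept_treg kr) // k1.
- move=> /code_at_cons[h _] re _; eexists; first by [].
  rewrite /step /current h /=; split=> //; first by rewrite addn1.
    by rewrite eqxx modn_small.
  by move=> r kr; rewrite (kept_treg kr).
Qed.

Lemma simu_kept e s s' : simu e s -> memory s' = memory s ->
  (forall r, kept 0 r -> regs s' r = regs s r) -> simu e s'.
Proof.
case=> w_ v_ b_ a_ ms ks; split=> // [v||a i ha hi].
- by rewrite ks ?kept_vreg // v_.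
- by rewrite ks.
- by rewrite ms a_.
Qed.

Lemma vregK v u : (vreg v == vreg u) = (v == u).
Proof. by rewrite /vreg; apply/eqP/eqP => [|->]; lia. Qed.

Lemma ccmdP c t e t' e' s a : bs c t e t' e' -> pc s = a ->
  code_at (ccmd a c) (pc s) -> simu e s ->
  t <= t' /\ exists2 s', stp (t' - t) t s = s' &
    pc s' = a + size (ccmd a c) /\ simu e' s'.
Proof.
move=> b; elim: b s a => {c t e t' e'}.
- move=> t e s a <- _ re; split=> //; exists s; first by rewrite subnn.
  by rewrite addn0.
- move=> v x t e sx s a <- /= /code_at_cat[h /code_at_cons[h' _]] re.
  split; first by lia.
  have [s1 e1 [p1 m1 r1 k1]] := cexpP t h re sx.
  rewrite addKn -[(ecost x).+1]addn1 stpD e1; eexists; first by [].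
  have cur : current p s1 = Op OpAnd (vreg v) (treg 0) (treg 0).
    by rewrite /current p1 h'.
  rewrite /= (step_op _ cur) /=.
  rewrite size_cat /= -/(ecost x) p1; split; first by lia.
  have xw : ev e x < 2 ^ w := ev_lt (simu_wf re) sx.
  split=> /=.
  - case: (simu_wf re) => wv wa; split=> // u /=.
    by case: eqP.
  - move=> u; rewrite vregK r1 Nat.land_diag modn_small //; case: eqP => // _.
    by rewrite k1 ?kept_vreg // (simu_v re).
  - rewrite (_ : (1 == vreg v) = false) ?k1 ?(simu_base re) //.
    by apply/eqP; rewrite /vreg; lia.
  - by move=> b i hb hi; rewrite m1 (simu_a re).
- move=> b i x t e si sx hb hl s a <- /=.
  move=> /code_at_cat[h /code_at_cat[h' /code_at_cat[h'' /code_at_cons[h3 _]]]] re.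
  split; first by lia.
  have [s1 e1 [p1 m1 r1 k1]] := cexpP t h re si.
  rewrite -/(ecost i) -p1 in h' h'' h3.
  have b1 : regs s1 1 = base by rewrite k1 // (simu_base re).
  have [s2 e2 [p2 m2 r2 k2]] := addr_codeP (t + ecost i) h' b1 r1 hl hb.
  rewrite -p2 in h'' h3.
  have re2 : simu e s2.
    by apply: (simu_kept re); rewrite ?m2 // => r kr; rewrite k2 ?k1.
  have [s3 e3 [p3 m3 r3 k3]] := cexpP (t + ecost i + size (addr_code (treg 0) (treg 1) b)) h'' re2 sx.
  rewrite size_cexp -p3 in h3.
  rewrite addKn !size_cat /= -/(ecost i) size_cexp.
  rewrite stpD e1 stpD e2 stpD e3; eexists; first by [].
  rewrite /= /step (_ : current p s3 = Put (treg 0) (treg 1)) /=; last first.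
    by rewrite /current h3.
  split; first by rewrite p3 p2 p1; lia.
  have re3 : simu e s3.
    apply: (simu_kept re2); rewrite ?m3 // => r kr; rewrite k3 //.
    exact: keptW kr.
  have xw : ev e x < 2 ^ w := ev_lt (simu_wf re) sx.
  split=> /=.
  - case: (simu_wf re) => wv wa; split=> // c j /=.
    by case: ifP.
  - by move=> v; rewrite (simu_v re3).
  - by rewrite (simu_base re3).
  - move=> c j hc hj; rewrite r3 k3 ?r2 ?(simu_a re3) //.
    case: ifP => [/eqP E|/eqP E].
      by have [-> ->] := adr_inj hc hj hb hl E; rewrite !eqxx.
    case: ifP => // /andP[/eqP E1 /eqP E2].
    by case: E; rewrite E1 E2.
- move=> v t e s a <- /= /code_at_cons[h _] re; split=> //.
  rewrite subSnn; eexists; first by [].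
  rewrite /= /step /current h /= addn1; split=> //; split=> /=.
  - case: (simu_wf re) => wv wa; split=> // u /=.
    by case: eqP => // _; rewrite ltn_mod.
  - by move=> u; rewrite vregK; case: eqP => // _; rewrite (simu_v re).
  - rewrite (_ : (1 == vreg v) = false) ?(simu_base re) //.
    by apply/eqP; rewrite /vreg; lia.
  - by move=> b i hb hi; rewrite (simu_a re).
- move=> c d t e t1 e1 t2 e2 _ IHc _ IHd s a ps /= /code_at_cat[h h'] re.
  have [l1 [s1 E1 [p1 re1]]] := IHc s a ps h re.
  have {}h' : code_at (ccmd (a + size (ccmd a c)) d) (pc s1).
    by rewrite p1; rewrite ps in h'.
  have [l2 [s2 E2 [p2 re2]]] := IHd s1 _ p1 h' re1.
  split; first by lia.
  exists s2; last by rewrite size_cat addnA p2.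
  have -> : t2 - t = (t1 - t) + (t2 - t1) by lia.
  by rewrite stpD E1 subnKC.
- move=> x c d t e t1 e1 sx nx _ IHc s a <- /=.
  move=> /code_at_cat[h /code_at_cons[h0 /code_at_cat[_ /code_at_cons[_ /code_at_cons[_ h1]]]]] re.
  have [s1 E1 [p1 m1 r1 k1]] := cexpP t h re sx.
  have re1 := simu_kept re m1 k1.
  rewrite -/(ecost x) in h0 h1 *.
  have C1 : current p s1 = Jump (treg 0) (pc s + ecost x + 1 + size (ccmd (pc s + ecost x + 1) d) + 2).
    by rewrite /current p1 h0.
  set l := pc s + _ + _ + _ + _ in C1 h1 *.
  pose s2 := State l (regs s1) (memory s1).
  have re2 : simu e s2 by case: re1 => *; split.
  have {}h1 : code_at (ccmd l c) (pc s2).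
    have El : l = ((pc s + ecost x).+1 + size (ccmd (pc s + ecost x + 1) d)).+2.
      by rewrite /l addn1 addn2.
    by rewrite /s2 /= {2}El.
  have [l2 [s3 E3 [p3 re3]]] := IHc s2 l erefl h1 re2.
  split; first by lia.
  exists s3.
    have -> : t1 - t = ecost x + (1 + (t1 - (t + (ecost x).+1))) by lia.
    rewrite stpD E1 stpD /= /step C1 r1 (negbTE nx) -/s2.
    by rewrite (_ : t + ecost x + 1 = t + (ecost x).+1) ?E3 //; lia.
  split=> //; rewrite p3 !size_cat /= !size_cat /= -/(ecost x) -/l /l.
  by lia.
- move=> x c d t e t1 e1 sx nx _ IHd s a <- /=.
  move=> /code_at_cat[h /code_at_cons[h0 /code_at_cat[h1 /code_at_cons[h2 /code_at_cons[h3 _]]]]] re.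
  have [s1 E1 [p1 m1 r1 k1]] := cexpP t h re sx.
  have re1 := simu_kept re m1 k1.
  rewrite -/(ecost x) in h0 h1 h2 h3 *.
  set l := pc s + _ + _ + _ + _ in h0 h3 *.
  pose s2 := State (pc s + ecost x).+1 (regs s1) (memory s1).
  have re2 : simu e s2 by case: re1 => *; split.
  have {}h1 : code_at (ccmd (pc s + ecost x + 1) d) (pc s2).
    by [].
  have ps2 : pc s2 = pc s + ecost x + 1 by rewrite /= addn1.
  have [l2 [s3 E3 [p3 re3]]] := IHd s2 _ ps2 h1 re2.
  split; first by lia.
  pose s4 := State (pc s3).+1 [eta regs s3 with treg 0 |-> 1] (memory s3).
  have E4 r : step w p ins s3 r = s4.
    apply: step_const => //; rewrite /current p3 -h2 addn1 //.
  pose s5 := State (l + size (ccmd l c)) (regs s4) (memory s4).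
  have E5 r : step w p ins s4 r = s5.
    rewrite /step (_ : current p s4 = Jump (treg 0) (l + size (ccmd l c))) //.
    by rewrite -h3 /current /= p3; congr (nth _ _ _); lia.
  exists s5.
    have -> : t1.+2 - t = ecost x + (1 + ((t1 - (t + (ecost x).+1)) + 2)) by lia.
    rewrite stpD E1 stpD /= {1}/step /current p1 h0 r1 nx eqxx -/s2.
    rewrite (_ : t + ecost x + 1 = t + (ecost x).+1); last by lia.
    by rewrite stpD E3 /= E4 E5.
  split; first by rewrite /= !size_cat /= !size_cat /= -/(ecost x) -/l /l; lia.
  apply: (simu_kept re3) => // r kr /=.
  by rewrite (kept_treg kr).
- move=> x c t e sx nx s a <- /=.
  move=> /code_at_cat[h /code_at_cons[h0 /code_at_cons[h1 /code_at_cons[h2 _]]]] re.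
  have [s1 E1 [p1 m1 r1 k1]] := cexpP t h re sx.
  have re1 := simu_kept re m1 k1.
  rewrite -/(ecost x) in h0 h1 h2 *.
  set l := pc s + _ + _ in h0 h2 *.
  pose s2 := State (pc s + ecost x).+1 (regs s1) (memory s1).
  pose s4 := State (pc s2).+1 [eta regs s2 with treg 0 |-> 1] (memory s2).
  have E4 r : step w p ins s2 r = s4.
    by apply: step_const => //; rewrite /current /= p1.
  pose s5 := State (l + size (ccmd l c) + 2) (regs s4) (memory s4).
  have E5 r : step w p ins s4 r = s5.
    rewrite /step (_ : current p s4 = Jump (treg 0) (l + size (ccmd l c) + 2)) //.
  split; first by lia.
  exists s5.
    have E2 r : step w p ins s1 r = s2.
      by rewrite /step /current p1 h0 r1 nx eqxx.
    have -> : t + (ecost x).+3 - t = ecost x + 3 by lia.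
    by rewrite stpD E1 /= E2 E4 E5.
  split; first by rewrite /= !size_cat /= !size_cat /= -/(ecost x) /l; lia.
  apply: (simu_kept re1) => // r kr /=.
  by rewrite (kept_treg kr).
- move=> x c t e t1 e1 t2 e2 sx nx _ IHc _ IHl s a ps hh re.
  move: (hh) => /=.
  move=> /code_at_cat[h /code_at_cons[h0 /code_at_cons[h1 /code_at_cons[h2 /code_at_cat[h3 /code_at_cons[h4 /code_at_cons[h5 _]]]]]]].
  rewrite -ps in h hh h0 h1 h2 h3 h4 h5 *.
  have [s1 E1 [p1 m1 r1 k1]] := cexpP t h re sx.
  have re1 := simu_kept re m1 k1.
  rewrite -/(ecost x) in h0 h1 h2 h3 h4 h5 *.
  set l := pc s + _ + 3 in h0 h2 h3 h4 h5 *.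
  pose s2 := State l (regs s1) (memory s1).
  have re2 : simu e s2 by case: re1 => *; split.
  have lE : l = (pc s + ecost x).+3 by rewrite /l addn3.
  rewrite -lE in h3 h4 h5.
  have [l2 [s3 E3 [p3 re3]]] := IHc s2 l erefl h3 re2.
  pose s4 := State (pc s3).+1 [eta regs s3 with treg 0 |-> 1] (memory s3).
  have E4 r : step w p ins s3 r = s4.
    by apply: step_const => //; rewrite /current p3 h4.
  pose s5 := State (pc s) (regs s4) (memory s4).
  have E5 r : step w p ins s4 r = s5.
    rewrite /step (_ : current p s4 = Jump (treg 0) (pc s)) //.
    by rewrite /current /= p3 h5.
  have re5 : simu e1 s5.
    apply: (simu_kept re3) => // r kr /=.
    by rewrite (kept_treg kr).
  have [l3 [s6 E6 [p6 re6]]] := IHl s5 (pc s) erefl hh re5.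
  split; first by lia.
  exists s6 => //.
  have -> : t2 - t = ecost x + (1 + ((t1 - (t + (ecost x).+1)) + (2 + (t2 - t1.+2)))) by lia.
  have E2 r : step w p ins s1 r = s2.
    by rewrite /step /current p1 h0 r1 (negbTE nx).
  rewrite stpD E1 stpD /= E2.
  rewrite (_ : t + ecost x + 1 = t + (ecost x).+1); last by lia.
  rewrite stpD E3 /= E4 E5 -[RHS]E6; congr stp; lia.
Qed.

End Compilation.

(** The word size is unknown to the program: halving the word $0 - 1 = 2^w - 1$ produces [base]. *)
Definition prologue : program :=
  [:: Const 3 1; Op OpSub 1 1 3; Op OpShr 1 1 3; Const 3 0].

Definition compile (c : cmd) : program := prologue ++ ccmd 4 c.

Definition env0 := Env (fun=> 0) (fun _ _ => 0).

End Semantics.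

(** Time starts at 4, the length of the prologue. A derivation that ends before the tape does is
    enough, since a halted machine ignores the remaining words. *)
Lemma run_compile w ins c tp t e : 7 < w ->
  (forall i j, nth 0 (nth [::] ins i) j < 2 ^ w) ->
  (forall i, size (nth [::] ins i) < 2 ^ w) ->
  bs w ins (nth 0 tp) c 4 env0 t e ->
  t <= size tp -> vr e 0 <= lim w ->
  run w (compile c) ins tp = Some (mkseq (ar e 0) (vr e 0)).
Proof.
move=> w7 hi hl b st ol.
have stpE k s l : foldl (step w (compile c) ins) s (take k (drop l tp)) =
    stp w ins (nth 0 tp) (compile c) (size (take k (drop l tp))) l s.
  elim: k s l => [|k IH] s l; first by rewrite take0.
  have [ls|ls] := ltnP l (size tp).
    by rewrite (drop_nth 0 ls) /= IH.
  by rewrite drop_oversize.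
have w1 : 1 < 2 ^ w by rewrite -{1}(expn0 2) ltn_exp2l //; lia.
have wS : 2 ^ w.-1 * 2 = 2 ^ w by rewrite mulnC -expnS prednK //; lia.
have hc : code_at (compile c) (ccmd 4 c) 4.
  by move=> i ic; rewrite /compile nth_cat -[size prologue]/4 ltnNge leq_addr /= addKn.
pose s0 := stp w ins (nth 0 tp) (compile c) 4 0 init_state.
have ps0 : pc s0 = 4 by [].
have rs0 : regs s0 1 = base w.
  rewrite /s0 /= /step /=.
  rewrite (modn_small w1) add0n (@modn_small (2 ^ w - 1)); last by lia.
  by rewrite modn_small ?expn1 /base; lia.
have re0 : simu w env0 s0.
  split=> //.
  - by split=> //= *; lia.
  - move=> v; rewrite /s0 /= /vreg.
    have n3 : (v.*2 == 3) = false by apply/eqP; lia.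
    have n1 : (v.*2 == 1) = false by apply/eqP; lia.
    by rewrite !n3 !n1.
have [t4 [s1 E1 [p1 re1]]] := ccmdP w7 hi hl b ps0 hc re0.
have E : foldl (step w (compile c) ins) init_state (take t tp) = s1.
  rewrite -[tp]drop0 stpE drop0 size_takel //.
  by rewrite -(subnKC t4) stpD -/s0 add0n E1.
have hs1 : current (compile c) s1 = Halt.
  by rewrite /current p1 nth_default // /compile size_cat.
have halts l : foldl (step w (compile c) ins) s1 l = s1.
  by elim: l => //= r l IH; rewrite {2}/step hs1.
rewrite /run -{1 2 3}(cat_take_drop t tp) !foldl_cat E halts.
rewrite /halted hs1; congr Some.
have r0 : regs s1 0 = vr e 0 by rewrite -(simu_v re1).
rewrite r0; apply/eq_in_map => i; rewrite mem_iota => /andP[_ il].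
by rewrite -(simu_a re1 (a := 0)) //; lia.
Qed.

(** * The field of order [2 ^ (2 * 3 ^ l)] *)

(** Lifting the exponent: cubing $1 + 3^{l+1} u$ gains exactly one factor 3 and preserves the
    residue of $u$ modulo 3. *)
Lemma expn4_pow3 l : exists u, 4 ^ (3 ^ l) = 1 + 3 ^ l.+1 * u /\ u %% 3 = 1.
Proof.
elim: l => [|l [u [e u1]]]; first by exists 1.
set T := 3 ^ l.+1 in e *.
exists (u + T * (u * u) + 3 ^ (l + l.+1) * (u * u * u)); split.
  have eT : T * T = 3 * 3 ^ (l + l.+1).
    by rewrite -expnD -expnS; congr (_ ^ _); lia.
  have -> : 3 ^ l.+2 = 3 * T by rewrite expnS.
  have -> : 4 ^ T = (4 ^ (3 ^ l)) ^ 3 by rewrite -expnM -expnSr.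
  rewrite e.
  have -> : (1 + T * u) ^ 3 =
      1 + 3 * T * u + 3 * T * T * (u * u) + T * (T * T) * (u * u * u).
    by rewrite !expnS !expn0; ring.
  by rewrite eT; ring.
have [v ev] : exists v, T = 3 * v by exists (3 ^ l); rewrite -expnS.
have [v' ev'] : exists v, 3 ^ (l + l.+1) = 3 * v.
  by exists (3 ^ (l + l)); rewrite -expnS addnS.
by rewrite ev ev' -!mulnA -addnA -mulnDr addnC mulnC modnMDl.
Qed.

Lemma dvdn_expn4_sub1 l r : 3 ^ l.+1 %| 4 ^ r - 1 -> 3 ^ l %| r.
Proof.
elim: l r => [|l IH] r h; first by rewrite dvd1n.
have /IH/dvdnP[r' er] : 3 ^ l.+1 %| 4 ^ r - 1.
  by apply: dvdn_trans h; rewrite [3 ^ l.+2]expnS dvdn_mull.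
move: h; rewrite er.
have [u [e u1]] := expn4_pow3 l.
rewrite [r' * _]mulnC expnM e [_ * r']mulnC; set T := 3 ^ l.+1.
(* The binomial expansion to first order: modulo $3T$ only $r' T u$ survives, and since 3 does not
   divide $u$ it must divide $r'$. *)
have [v ->] : exists v, (1 + T * u) ^ r' = 1 + r' * T * u + T * T * v.
  elim: r' {er} => [|k [v IHk]]; first by exists 0; rewrite expn0; lia.
  exists (v + k * u * u + T * u * v).
  by rewrite expnS IHk; ring.
rewrite -addnA addnC addnK [3 ^ l.+2]expnS -/T => h.
have [T' eT] : exists v, T = 3 * v by exists (3 ^ l); rewrite /T expnS.
have : 3 * T %| r' * T * u.
  rewrite -(dvdn_addl (r' * T * u) (_ : 3 * T %| T * T * v)) //.
  by apply/dvdnP; exists (T' * v); rewrite {1}eT; ring.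
rewrite mulnAC dvdn_pmul2r ?expn_gt0 // Euclid_dvdM // => /orP[|].
  by move=> h3; rewrite /T expnS dvdn_mul.
by rewrite /dvdn u1.
Qed.

(** This says that 2 generates the units modulo $3^{l+1}$. Odd exponents are excluded modulo 3, and
    even ones reduce to powers of 4. *)
Lemma dvdn_expn2_sub1 l r : 3 ^ l.+1 %| 2 ^ r - 1 -> 2 * 3 ^ l %| r.
Proof.
move=> h; have evr : odd r = false.
  apply/negP => orr.
  have : 3 %| 2 ^ r - 1 by apply: dvdn_trans h; rewrite expnS dvdn_mulr.
  have -> : r = r./2.*2.+1 by lia.
  rewrite -mul2n expnS expnM -[2 ^ 2]/4.
  rewrite -eqn_mod_dvd; last by rewrite muln_gt0 expn_gt0.
  by rewrite -modnMmr -modnXm exp1n.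
have er : r = 2 * r./2 by lia.
rewrite er dvdn_pmul2l // (@dvdn_expn4_sub1 l) //.
by rewrite -[4]/(2 ^ 2) -expnM -er.
Qed.

Section FieldExistence.
Local Open Scope ring_scope.

Lemma finField_prim_root (L : finFieldType) d : (d %| #|L|.-1)%N ->
  exists z : L, d.-primitive_root z.
Proof.
move=> dL; have L1 : (1 < #|L|)%N := finNzRing_gt1 L.
have q0 : (0 < #|L|.-1)%N by lia.
pose rs := [seq x <- enum L | x != 0].
have /hasP[g _ gP] : has (#|L|.-1).-primitive_root rs.
  apply: has_prim_root => //.
  - apply/allP => x; rewrite mem_filter => /andP[x0 _].
    rewrite unity_rootE; apply/eqP/(mulfI x0).
    by rewrite -exprS prednK ?expf_card ?mulr1 //; lia.
  - exact/filter_uniq/enum_uniq.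
  - rewrite -(cardC1 (0 : L)) cardE /rs; apply: uniq_leq_size; first exact: enum_uniq.
    by move=> x; rewrite mem_enum mem_filter !inE mem_enum => ->.
exists (g ^+ (#|L|.-1 %/ d)).
have := exp_prim_root gP (#|L|.-1 %/ d).
have d0 : (0 < d)%N by case: d dL => //; rewrite dvd0n => /eqP e; rewrite e in q0.
rewrite (gcdn_idPl _); last by apply/dvdnP; exists d; rewrite mulnC divnK.
by rewrite divnA // mulKn // prednK //; rewrite -{1}(divnK dL) mulKn // divn_gt0 // dvdn_leq.
Qed.

(** The multiplicative group is cyclic of order $4^{3^l} - 1$, which [expn4_pow3] shows to be
    divisible by $3^{l+1}$. *)
Lemma exists_gf2 l : exists (L : finFieldType) (z : L),
  [/\ 2 \in [pchar L], #|L| = (2 ^ (2 * 3 ^ l))%N & (3 ^ l.+1).-primitive_root z].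
Proof.
have k0 : (0 < 2 * 3 ^ l)%N by rewrite muln_gt0 expn_gt0.
have [L L2 cL] := PrimePowerField (isT : prime 2) k0.
have [|z zP] := @finField_prim_root L (3 ^ l.+1); last by exists L, z.
have [u [e _]] := expn4_pow3 l.
have -> : #|L| = (4 ^ (3 ^ l))%N by rewrite cL expnM.
by rewrite e add1n dvdn_mulr.
Qed.

End FieldExistence.

Lemma testbit_half a i : Nat.testbit a./2 i = Nat.testbit a i.+1.
Proof. by rewrite !testbit_odd -divn2 -divnMA -expnS. Qed.

Lemma odd_lxor a b : odd (Nat.lxor a b) = odd a (+) odd b.
Proof.
have o c : odd c = Nat.testbit c 0 by rewrite testbit_odd divn1.
by rewrite !o Nat.lxor_spec; case: (Nat.testbit a 0); case: (Nat.testbit b 0).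
Qed.

Lemma half_lxor a b : (Nat.lxor a b)./2 = Nat.lxor a./2 b./2.
Proof.
apply: Nat.bits_inj => i.
by rewrite testbit_half !Nat.lxor_spec !testbit_half.
Qed.

Lemma lt_expn0 a : a < 2 ^ 0 -> a = 0.
Proof. by case: a. Qed.

Lemma half_mod_pow2 a j : (a %% 2 ^ j.+1)./2 = a./2 %% 2 ^ j.
Proof. by rewrite -!divn2 modn_divl expnS mulnC. Qed.

Lemma odd_mod_pow2 a j : odd (a %% 2 ^ j.+1) = odd a.
Proof. by rewrite expnS; move: (2 ^ j) (expn_gt0 2 j) => [|k] // _; rewrite odd_mod // oddM. Qed.

Lemma half_lt_pow2 a k : a < 2 ^ k.+1 -> a./2 < 2 ^ k.
Proof. by rewrite expnS; lia. Qed.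

(* Carry-less product. *)
Fixpoint ctf k x y :=
  if k is k'.+1 then Nat.lxor (ctf k' x./2 y * 2) (odd x * y) else 0.
Definition ct x y := ctf x x y.

Lemma ctf_stable k j x y : x <= k -> x <= j -> ctf k x y = ctf j x y.
Proof.
have c0 i : ctf i 0 y = 0 by elim: i => //= i ->.
elim: k j x => [|k IH] [|j] x xk xj.
- by [].
- by have -> : x = 0 by lia; rewrite !c0.
- by have -> : x = 0 by lia; rewrite !c0.
- by rewrite /= (IH j) //; lia.
Qed.

Lemma ctS x y : ct x y = Nat.lxor (ct x./2 y * 2) (odd x * y).
Proof.
case: x => [|x]; first by rewrite /ct.
by rewrite /ct [LHS]/= -/(half x.+1) (@ctf_stable x x.+1./2) //; lia.
Qed.

Lemma ct_lt u v x y : x < 2 ^ u -> y < 2 ^ v -> ct x y < 2 ^ (u + v).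
Proof.
move=> + hy; elim: u x => [|u IH] x hx.
  by rewrite (lt_expn0 hx) /ct /= expn_gt0.
rewrite ctS; apply: lxor_lt.
  by rewrite addSn expnS mulnC ltn_pmul2l // IH // half_lt_pow2.
apply: (@leq_ltn_trans y); first by case: odd; lia.
by apply: leq_trans hy _; rewrite leq_exp2l //; lia.
Qed.

(** * Carry-less products by chunks *)

Section WordProduct.

Variables (m s J : nat).

Definition chunk i a := a %/ 2 ^ (s * i) %% 2 ^ s.

Definition wprod a b :=
  foldr (fun ij acc =>
           Nat.lxor (ct (chunk ij.1 a) (chunk ij.2 b) * 2 ^ (s * (ij.1 + ij.2)))
             acc)
    0 (allpairs pair (iota 0 J) (iota 0 J)).

(** Adding the high half of the product to the low one is reduction modulo $z^m - 1$. *)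
Definition wmul a b :=
  let p := wprod a b in Nat.lxor (p %% 2 ^ m) (p %/ 2 ^ m).

Lemma chunk_lt i a : a < 2 ^ m -> chunk i a < 2 ^ (m - s * i).
Proof.
move=> am; have [h|h] := leqP m (s * i).
  rewrite /chunk divn_small ?mod0n ?expn_gt0 //.
  by apply: leq_trans am _; rewrite leq_exp2l.
apply: leq_ltn_trans (leq_mod _ _) _.
by rewrite ltn_divLR ?expn_gt0 // -expnD subnK // ltnW.
Qed.

Lemma ct_shift_lt a b i j : a < 2 ^ m -> b < 2 ^ m ->
  ct (chunk i a) (chunk j b) * 2 ^ (s * (i + j)) < 2 ^ (m + m).
Proof.
move=> am bm.
have z c k : m <= s * k -> c < 2 ^ m -> chunk k c = 0.
  by move=> mk /(@chunk_lt k); rewrite (eqP mk) ltnS leqn0 => /eqP.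
have [h|h] := leqP m (s * i); first by rewrite z // mul0n expn_gt0.
have [h'|h'] := leqP m (s * j).
  rewrite (z b) //; have -> : ct (chunk i a) 0 = 0; last by rewrite expn_gt0.
  rewrite /ct; move: {1}(chunk i a) => k; elim: k (chunk i a) => //= k IH c.
  by rewrite IH muln0.
have -> : m + m = (m - s * i + (m - s * j)) + s * (i + j).
  by rewrite mulnDr; lia.
rewrite [X in _ < X]expnD ltn_pmul2r ?expn_gt0 //.
by apply: ct_lt; apply: chunk_lt.
Qed.

Lemma wprod_lt a b : a < 2 ^ m -> b < 2 ^ m -> wprod a b < 2 ^ (m + m).
Proof.
move=> am bm; rewrite /wprod; elim: (allpairs _ _ _) => [|ij l IH] /=.
  by rewrite expn_gt0.
by apply: lxor_lt => //; apply: ct_shift_lt.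
Qed.

Lemma wmul_lt a b : a < 2 ^ m -> b < 2 ^ m -> wmul a b < 2 ^ m.
Proof.
move=> am bm; rewrite /wmul; apply: lxor_lt; first by rewrite ltn_mod expn_gt0.
by rewrite ltn_divLR ?expn_gt0 // -expnD wprod_lt.
Qed.

End WordProduct.

(** * Words as elements of the field *)

Section Evaluation.
Local Open Scope ring_scope.

Variables (L : fieldType) (char2 : 2%N \in [pchar L]).

Fixpoint phif (z : L) k a : L :=
  if k is k'.+1 then (odd a)%:R + z * phif z k' a./2 else 0.

(* The bits of [a] are the coefficients of a polynomial, evaluated at [z]. *)
Definition phi z a := phif z a a.

Lemma phif0 z k : phif z k 0 = 0.
Proof. by elim: k => //= k ->; rewrite mulr0 addr0. Qed.

Lemma phif_stable z k a : (a < 2 ^ k)%N -> phif z k a = phi z a.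
Proof.
have st : forall k j a, (a < 2 ^ k)%N -> (a < 2 ^ j)%N -> phif z k a = phif z j a.
  elim=> [|k' IH] [|j] b bk bj //.
  - by rewrite (lt_expn0 bk) !phif0.
  - by rewrite (lt_expn0 bj) !phif0.
  - by rewrite /= (IH j) // half_lt_pow2.
by move=> ak; apply: st => //; apply: ltn_expl.
Qed.

Lemma phi0 z : phi z 0 = 0. Proof. by []. Qed.

Lemma phiS z a : phi z a = (odd a)%:R + z * phi z a./2.
Proof.
have h1 : (a < 2 ^ a)%N by apply: ltn_expl.
have ha : (a < 2 ^ a.+1)%N by apply: (leq_trans h1); rewrite leq_exp2l.
by rewrite -(phif_stable z ha) /= phif_stable // half_lt_pow2.
Qed.

Lemma phi1 z : phi z 1 = 1.
Proof. by rewrite phiS /= phi0 mulr0 addr0. Qed.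

Lemma phi_odd z a : phi z (odd a) = a%:R.
Proof.
have -> : a%:R = (odd a)%:R :> L.
  rewrite -{1}(odd_double_half a) natrD -mul2n natrM.
  by rewrite (pcharf0 char2) mul0r addr0.
by case: (odd a); rewrite ?phi1 ?phi0.
Qed.

Lemma phi_xor z a b : phi z (Nat.lxor a b) = phi z a + phi z b.
Proof.
have [n] := ubnP (a + b); elim: n a b => // n IH a b le_n.
have [/eqP|ab] := posnP (a + b).
  by rewrite addn_eq0 => /andP[/eqP-> /eqP->]; rewrite /= phi0 addr0.
rewrite phiS odd_lxor half_lxor IH; last by lia.
rewrite [phi z a]phiS [phi z b]phiS mulrDr addrACA; congr (_ + _).
by case: (odd a); case: (odd b); rewrite ?addr0 ?add0r //= (addrr_pchar2 char2).
Qed.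

Lemma phi_shl z a j : phi z (a * 2 ^ j) = z ^+ j * phi z a.
Proof.
elim: j a => [|j IH] a; first by rewrite muln1 mul1r.
rewrite expnS mulnA IH exprSr -mulrA; congr (_ * _).
by rewrite phiS muln2 odd_double doubleK add0r.
Qed.

Lemma phi_double z a : phi z (a * 2) = z * phi z a.
Proof. by have := phi_shl z a 1; rewrite expn1 expr1. Qed.

Lemma phi_split z a j : phi z a = phi z (a %% 2 ^ j) + z ^+ j * phi z (a %/ 2 ^ j).
Proof.
elim: j a => [|j IH] a; first by rewrite modn1 divn1 phi0 add0r mul1r.
rewrite phiS IH [phi z (a %% _)]phiS half_mod_pow2 odd_mod_pow2 mulrDr -addrA.
by rewrite mulrA -exprS -divn2 -divnMA -expnS.
Qed.

Lemma phi_ct z x y : phi z (ct x y) = phi z x * phi z y.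
Proof.
have [n] := ubnP x; elim: n x => // n IH x le_n.
case: x le_n => [|x] le_n; first by rewrite phi0 mul0r.
rewrite ctS phi_xor phi_double IH; last by lia.
rewrite [phi z x.+1]phiS mulrDl mulrA addrC; congr (_ + _).
by case: odd; rewrite ?mul1n ?mul0n ?mul1r ?mul0r.
Qed.

Lemma phi_chunks z s J a : (a < 2 ^ (s * J))%N ->
  phi z a = \sum_(0 <= i < J) z ^+ (s * i) * phi z (chunk s i a).
Proof.
move=> aJ.
suff -> : phi z a = \sum_(0 <= i < J) z ^+ (s * i) * phi z (chunk s i a)
    + z ^+ (s * J) * phi z (a %/ 2 ^ (s * J)).
  by rewrite (divn_small aJ) phi0 mulr0 addr0.
elim: J {aJ} => [|J IH].
  by rewrite big_nil muln0 expr0 divn1 mul1r add0r.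
rewrite big_nat_recr //= IH -addrA; congr (_ + _).
rewrite (phi_split z (a %/ _) s) mulrDr mulrA -exprD -mulnSr; congr (_ + _ * phi z _).
by rewrite -divnMA -expnD -mulnSr.
Qed.

Lemma phi_wprod z m s J a b : (m <= s * J)%N -> (a < 2 ^ m)%N -> (b < 2 ^ m)%N ->
  phi z (wprod s J a b) = phi z a * phi z b.
Proof.
move=> mJ am bm.
have lt c : (c < 2 ^ m)%N -> (c < 2 ^ (s * J))%N.
  by move=> h; apply: leq_trans h _; rewrite leq_exp2l.
rewrite (phi_chunks z (lt _ am)) (phi_chunks z (lt _ bm)) big_distrlr /=.
transitivity (\sum_(ij <- allpairs pair (iota 0 J) (iota 0 J))
    (z ^+ (s * ij.1) * phi z (chunk s ij.1 a)) *
    (z ^+ (s * ij.2) * phi z (chunk s ij.2 b))); last first.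
  by rewrite big_allpairs_dep /= /index_iota !subn0.
rewrite /wprod; elim: (allpairs _ _ _) => [|ij l IH]; first by rewrite big_nil.
rewrite big_cons /= phi_xor IH phi_shl phi_ct; congr (_ + _).
by rewrite mulnDr exprD mulrACA.
Qed.

Lemma phi_wmul z m s J a b : z ^+ m = 1 ->
  (m <= s * J)%N -> (a < 2 ^ m)%N -> (b < 2 ^ m)%N ->
  phi z (wmul m s J a b) = phi z a * phi z b.
Proof.
move=> zm mJ am bm; rewrite /wmul phi_xor -(phi_wprod _ mJ) //.
by rewrite [RHS](phi_split z _ m) zm mul1r.
Qed.

Fixpoint bpoly k a : {poly L} :=
  if k is k'.+1 then (odd a)%:R%:P + bpoly k' a./2 * 'X else 0.

Lemma horner_bpoly z k a : (bpoly k a).[z] = phif z k a.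
Proof.
elim: k a => [|k IH] a /=; first by rewrite horner0.
by rewrite hornerD hornerC hornerMX IH mulrC.
Qed.

Lemma size_bpoly k a : (size (bpoly k a) <= k)%N.
Proof.
elim: k a => [|k IH] a /=; first by rewrite size_poly0.
rewrite addrC -cons_poly_def size_cons_poly.
by case: ifP => // _; rewrite ltnS.
Qed.

Lemma bpoly_eq0 k a : (a < 2 ^ k)%N -> bpoly k a = 0 -> a = 0%N.
Proof.
elim: k a => [|k IH] a ak /= e; first by lia.
have e0 : (bpoly k.+1 a).[0] = 0 by rewrite /= e horner0.
move: e0; rewrite /= hornerD hornerC hornerMX mulr0 addr0 => o0.
have ev : odd a = false by move: o0; case: odd => // /eqP; rewrite oner_eq0.
have : bpoly k a./2 = 0.
  by move: e; rewrite ev add0r => /eqP; rewrite mulf_eq0 polyX_eq0 orbF => /eqP.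
by move/(IH _ (half_lt_pow2 ak)); lia.
Qed.

Lemma phif_sqr z k a : phif (z ^+ 2) k a = phif z k a ^+ 2.
Proof.
elim: k a => [|k IH] a /=; first by rewrite expr0n.
rewrite IH sqrrD mulr2n (addrr_pchar2 char2) addr0 exprMn.
by case: odd; rewrite ?expr1n ?expr0n.
Qed.

Variables (z : L) (l : nat).
Hypothesis zP : (3 ^ l.+1).-primitive_root z.
Let h := (3 ^ l)%N.

(** By Frobenius, all the powers $z^{2^i}$ are roots of the polynomial with coefficients in $F_2$
    given by [a]. As 2 has order $2h$ modulo the order of [z], these are $2h$ distinct roots, while
    the degree is below $2h$. *)
Lemma phi_inj0 a : (a < 2 ^ (h + h))%N -> phi z a = 0 -> a = 0%N.
Proof.
move=> ah e; apply: (bpoly_eq0 ah); apply/eqP; apply: contraT => p0.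
pose rs := [seq z ^+ (2 ^ i) | i <- iota 0 (h + h)].
have /(max_poly_roots p0) : all (root (bpoly (h + h) a)) rs.
  apply/allP => _ /mapP[i _ ->]; rewrite /root horner_bpoly.
  elim: i => [|i IH]; first by rewrite expr1 phif_stable // e.
  by rewrite expnS mulnC exprM phif_sqr expf_eq0.
have us : uniq rs.
  rewrite map_inj_in_uniq ?iota_uniq // => i j.
  rewrite !mem_iota !add0n /= => ih jh.
  wlog ij : i j ih jh / (i <= j)%N.
    by move=> W; case: (leqP i j) => [|/ltnW] ij // eij; [|apply/esym]; apply: W.
  move/eqP; rewrite (eq_prim_root_expr zP) eq_sym eqn_mod_dvd ?leq_exp2l //.
  have -> : (2 ^ j - 2 ^ i = 2 ^ i * (2 ^ (j - i) - 1))%N.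
    by rewrite mulnBr muln1 -expnD subnKC.
  rewrite Gauss_dvdr ?coprimeXl ?coprimeXr // => /dvdn_expn2_sub1 d.
  have [e0|e0] := posnP (j - i); first by lia.
  by have := dvdn_leq e0 d; rewrite -/h; lia.
move/(_ us); rewrite size_map size_iota => lt.
by have := leq_trans lt (size_bpoly _ _); rewrite ltnn.
Qed.

Lemma phi_inj a b : (a < 2 ^ (h + h))%N -> (b < 2 ^ (h + h))%N ->
  phi z a = phi z b -> a = b.
Proof.
move=> ah bh e.
have : Nat.lxor a b = 0%N.
  by apply: phi_inj0; rewrite ?lxor_lt // phi_xor e (addrr_pchar2 char2).
exact: Nat.lxor_eq.
Qed.

(** $z^h$ is a primitive cube root of unity. *)
Lemma prim3_sum0 : z ^+ h ^+ 2 = 1 + z ^+ h.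
Proof.
have n1 : z ^+ h != 1.
  rewrite -(expr0 z) (eq_prim_root_expr zP) eqn_mod_dvd // subn0.
  by rewrite gtnNdvd ?expn_gt0 // ltn_exp2l.
have c1 : (z ^+ h) ^+ 3 = 1 by rewrite -exprM -expnSr prim_expr_order.
have N (x : L) : - x = x by rewrite (oppr_pchar2 char2).
have /eqP : (z ^+ h - 1) * (z ^+ h ^+ 2 + (z ^+ h + 1)) = 0.
  have fact (w : L) : (w - 1) * (w ^+ 2 + (w + 1)) = w ^+ 3 - 1 by ring.
  by rewrite fact c1 subrr.
rewrite mulf_eq0 subr_eq0 (negbTE n1) /= addr_eq0 N => /eqP ->.
by rewrite addrC.
Qed.

Lemma phi_eq0 a : (a < 2 ^ (h * 3))%N ->
  (phi z a == 0) = (a %% 2 ^ h == a %/ 2 ^ h %% 2 ^ h)%N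
                && (a %/ 2 ^ h %% 2 ^ h == a %/ 2 ^ (h + h))%N.
Proof.
move=> ah.
set a0 := (a %% _)%N; set a1 := (_ %% _)%N; set a2 := (a %/ 2 ^ (h + h))%N.
have h0 : (a0 < 2 ^ h)%N by rewrite ltn_mod expn_gt0.
have h1 : (a1 < 2 ^ h)%N by rewrite ltn_mod expn_gt0.
have h2 : (a2 < 2 ^ h)%N.
  by rewrite ltn_divLR ?expn_gt0 // -expnD (_ : h + (h + h) = h * 3)%N //; lia.
have e : phi z a = phi z a0 + z ^+ h * (phi z a1 + z ^+ h * phi z a2).
  rewrite (phi_split z a h) (phi_split z (a %/ _) h); congr (_ + _ * (_ + _ * phi z _)).
  by rewrite -divnMA -expnD.
(* The relation $z^{2h} = 1 + z^h$ folds the top block into the other two and leaves $2h$ bits, to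
   which injectivity applies. *)
have {}e : phi z a = phi z (Nat.lxor a0 a2 + 2 ^ h * Nat.lxor a1 a2).
  have x0 := lxor_lt h0 h2.
  rewrite (phi_split z (_ + _) h).
  have -> : ((Nat.lxor a0 a2 + 2 ^ h * Nat.lxor a1 a2) %% 2 ^ h = Nat.lxor a0 a2)%N.
    by rewrite mulnC addnC modnMDl modn_small.
  have -> : ((Nat.lxor a0 a2 + 2 ^ h * Nat.lxor a1 a2) %/ 2 ^ h = Nat.lxor a1 a2)%N.
    by rewrite mulnC addnC divnMDl ?expn_gt0 // divn_small ?addn0.
  rewrite !phi_xor e mulrDr mulrA -expr2 prim3_sum0; move: (z ^+ h) => w; ring.
rewrite e.
apply/eqP/andP => [|[/eqP-> /eqP->]]; last by rewrite Nat.lxor_nilpotent muln0.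
have lt : (Nat.lxor a0 a2 + 2 ^ h * Nat.lxor a1 a2 < 2 ^ (h + h))%N.
  have x0 := lxor_lt h0 h2; have x1 := lxor_lt h1 h2.
  by rewrite expnD; nia.
move/(phi_inj0 lt)/eqP; rewrite addn_eq0 muln_eq0 expn_eq0 /= => /andP[/eqP x0 /eqP x1].
by rewrite (Nat.lxor_eq _ _ x0) (Nat.lxor_eq _ _ x1).
Qed.

End Evaluation.

(** * Division-free block inversion *)

(** A power of two given as a repeated sum, so that a matrix of size [sz j.+1] is by conversion a $2
    \times 2$ block matrix, without casts. *)
Fixpoint sz j := if j is i.+1 then sz i + sz i else 1.

Lemma szE j : sz j = 2 ^ j.
Proof. by elim: j => //= j ->; rewrite expnS mul2n addnn. Qed.

Lemma sz_gt0 j : 0 < sz j.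
Proof. by rewrite szE expn_gt0. Qed.

Section Inversion.
Local Open Scope ring_scope.

Variables (L : fieldType) (char2 : 2%N \in [pchar L]).

Lemma addmm2 m n (A : 'M[L]_(m, n)) : A + A = 0.
Proof. by apply/matrixP => i j; rewrite !mxE (addrr_pchar2 char2). Qed.

Lemma addmm2K m n (A B : 'M[L]_(m, n)) : A + B = 0 -> A = B.
Proof. by move=> e; rewrite -[A]addr0 -(addmm2 B) addrA e add0r. Qed.

(* [dfi A] is a pair [(N, d)] with [N *m A = d%:M]. *)
Fixpoint dfi j : 'M[L]_(sz j) -> 'M[L]_(sz j) * L :=
  match j return 'M[L]_(sz j) -> 'M[L]_(sz j) * L with
  | 0 => fun A => (1%:M, A ord0 ord0)
  | i.+1 => fun A =>
    let rA := dfi (ulsubmx A) in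
    let X1 := rA.1 *m ursubmx A in
    let rS := dfi (rA.2 *: drsubmx A + dlsubmx A *m X1) in
    let X2 := X1 *m rS.1 in
    let X3 := dlsubmx A *m rA.1 in
    (block_mx (rS.2 *: rA.1 + X2 *m X3) (rA.2 *: X2)
              (rA.2 *: (rS.1 *m X3)) ((rA.2 * rA.2) *: rS.1),
     rA.2 * rS.2)
  end.

(* Every leading principal submatrix is nonsingular. *)
Definition nd m (A : 'M[L]_m) := forall t (x : 'rV_m),
  (forall i : 'I_m, (t <= i)%N -> x 0 i = 0) ->
  (forall i : 'I_m, (i < t)%N -> (x *m A) 0 i = 0) -> x = 0.

Lemma nd_ul m n (A : 'M[L]_m) B C (D : 'M[L]_n) : nd (block_mx A B C D) -> nd A.
Proof.
move=> ndM t x xt xA.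
have : row_mx x 0 = 0 :> 'rV_(m + n).
  apply: (ndM (minn t m)) => i.
    case: (split_ordP i) => k ->; rewrite ?row_mxEl ?row_mxEr ?mxE //= => h.
    by apply: xt; have := ltn_ord k; lia.
  case: (split_ordP i) => k -> /= h; last by lia.
  by rewrite mul_row_block row_mxEl mul0mx addr0 xA //; lia.
by rewrite -row_mx0 => /eq_row_mx[].
Qed.

(** A row [y] killed by a leading part of the scaled Schur complement extends to [(y C N, d y)],
    which is killed by the leading part of the whole matrix that is larger by [m]. *)
Lemma nd_schur m n (A : 'M[L]_m) B C (D : 'M[L]_n) N d :
  nd (block_mx A B C D) -> N *m A = d%:M -> d != 0 ->
  nd (d *: D + C *m (N *m B)).
Proof.
move=> ndM NA d0 t y yt yS.
have : row_mx (y *m (C *m N)) (d *: y) = 0 :> 'rV_(m + n).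
  apply: (ndM (m + t)%N) => i.
    case: (split_ordP i) => k -> /=; first by have := ltn_ord k; lia.
    by rewrite leq_add2l row_mxEr !mxE => /yt ->; rewrite mulr0.
  rewrite mul_row_block.
  case: (split_ordP i) => k -> /=.
    move=> _; rewrite row_mxEl -mulmxA -(mulmxA C) NA mul_mx_scalar.
    by rewrite -!scalemxAr -scalemxAl addmm2 mxE.
  rewrite ltn_add2l row_mxEr => /yS <-; congr ((_ : 'rV_n) 0 k).
  by rewrite mulmxDr addrC -scalemxAr -scalemxAl !mulmxA.
rewrite -row_mx0 => /eq_row_mx[_ /eqP].
by rewrite scaler_eq0 (negbTE d0) => /eqP.
Qed.

(** Block elimination with the denominators of both halves kept. [E1] to [E4] evaluate the products
    with the four blocks; the unwanted terms occur twice and cancel in characteristic 2. *)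
Lemma dfi_correct j (A : 'M[L]_(sz j)) : nd A ->
  (dfi A).2 != 0 /\ (dfi A).1 *m A = (dfi A).2%:M.
Proof.
elim: j A => [|j IH] A ndA /=.
  split; last first.
    by rewrite mul1mx; apply/matrixP => a b; rewrite !ord1 !mxE eqxx mulr1n.
  apply/eqP => a0; have : delta_mx 0 0 = 0 :> 'rV[L]_1.
    apply: (ndA 1%N) => i; rewrite ord1 // => _.
    by rewrite -rowE mxE.
  by move/matrixP/(_ 0 0)/eqP; rewrite !mxE !eqxx oner_eq0.
have eA Y : Y *m A = Y *m block_mx (ulsubmx A) (ursubmx A) (dlsubmx A) (drsubmx A).
  by rewrite submxK.
rewrite eA; move: ndA; rewrite -{1}[A]submxK; set A1 := ulsubmx A; set B := ursubmx A; set C := dlsubmx A.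
set D := drsubmx A => ndA.
have [d0 NA] := IH _ (nd_ul ndA).
set dA := (dfi A1).2 in d0 NA *; set N := (dfi A1).1 in NA *.
have [e0 NS] := IH _ (nd_schur ndA NA d0).
set S := _ + _ in e0 NS *.
set dS := (dfi S).2 in e0 NS *; set M := (dfi S).1 in NS *.
split; first by rewrite mulf_neq0.
rewrite mulmx_block scalar_mx_block.
have E1 : N *m B *m M *m (C *m N) *m A1 = dA *: (N *m B *m M *m C).
  by rewrite -!mulmxA NA mul_mx_scalar -!scalemxAr.
have E2 : N *m B *m M *m (C *m N) *m B + dA *: (N *m B *m M *m D) = dS *: (N *m B).
  rewrite (_ : _ + _ = N *m B *m (M *m S)); first by rewrite NS mul_mx_scalar.
  by rewrite /S !mulmxDr -!scalemxAr !mulmxA addrC.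
have E3 : M *m (C *m N) *m A1 = dA *: (M *m C).
  by rewrite -!mulmxA NA mul_mx_scalar -!scalemxAr.
have E4 : M *m (C *m N) *m B + dA *: (M *m D) = dS%:M.
  by rewrite -NS /S mulmxDr addrC -scalemxAr !mulmxA.
congr block_mx.
- by rewrite mulmxDl E1 -!scalemxAl NA -addrA addmm2 addr0 scale_scalar_mx mulrC.
- rewrite mulmxDl -!scalemxAl -addrA E2.
  by rewrite addmm2.
- by rewrite -!scalemxAl E3 scalerA addmm2.
- by rewrite -!scalemxAl -scalerA -scalerDr E4 scale_scalar_mx.
Qed.

Lemma det_row0 m (A : 'M[L]_m) (x : 'rV_m) : \det A != 0 -> x *m A = 0 -> x = 0.
Proof.
move=> d0 xA; have uA : A \in unitmx by rewrite unitmxE unitfE.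
by rewrite -[x](mulmxK uA) xA mul0mx.
Qed.

(** Its determinant is the leading principal minor of order [t], but the size remains [n] and the
    entries keep their places, so that the bound for masked matrices applies to it. *)
Definition lead n t (M : 'M[L]_n) :=
  \matrix_(i, j) (if (i < t)%N && (j < t)%N then M i j else (i == j)%:R).

Lemma nd_lead n (M : 'M[L]_n) :
  (forall t, (t <= n)%N -> \det (lead t M) != 0) -> nd M.
Proof.
move=> H t x xt xM; apply: (det_row0 (H (minn t n) (geq_minr _ _))).
apply/rowP => j; rewrite !mxE.
have [jt|jt] := ltnP j t.
  transitivity ((x *m M) 0 j); last exact: xM.
  rewrite mxE; apply: eq_bigr => i _; rewrite !mxE !leq_min !ltn_ord jt !andbT.
  by case: ltnP => // /xt ->; rewrite !mul0r.
rewrite big1 // => i _; rewrite !mxE !leq_min [(j < t)%N]ltnNge jt /= andbF.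
by case: eqP => [->|]; rewrite ?mulr0 // xt // mul0r.
Qed.

(** [M] completed by an identity block. Since [N] is not syntactically a sum [n + r], [insub]
    replaces [block_mx] and spares a cast. *)
Definition pad n N (M : 'M[L]_n) : 'M[L]_N :=
  \matrix_(i, j) (if insub (i : nat) is Some i' then
                    if insub (j : nat) is Some j' then M i' j' else 0
                  else ((i : nat) == j)%:R).

Section Padding.
Variables (n N : nat) (nN : (n <= N)%N).
Let w := widen_ord nN.

Lemma padE (M : 'M[L]_n) i j : pad N M (w i) (w j) = M i j.
Proof. by rewrite mxE !insubT ?ltn_ord //= => hi hj; congr (M _ _); apply: val_inj. Qed.

Lemma pad_out (M : 'M[L]_n) (i j : 'I_N) : (n <= i)%N || (n <= j)%N ->
  pad N M i j = (i == j)%:R.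
Proof.
move=> h; rewrite mxE.
case: insubP => [i' hi ei|hi].
  case: insubP => [j' hj ej|hj]; first by lia.
  by case: eqP => // e; move: hi hj; rewrite e; lia.
by [].
Qed.

Lemma sum_pad (F : 'I_N -> L) : (forall i : 'I_N, (n <= i)%N -> F i = 0) ->
  \sum_i F i = \sum_(i < n) F (w i).
Proof.
move=> F0; rewrite -(big_ord_narrow nN) [LHS](bigID (fun i : 'I_N => (i < n)%N)) /=.
by rewrite [X in _ + X]big1 ?addr0 // => i; rewrite -leqNgt => /F0.
Qed.

(** On the added indices the product with [pad N M] returns the coordinate itself, which is
    therefore zero on either side of [t]; what remains is the condition for [M]. *)
Lemma nd_pad (M : 'M[L]_n) : nd M -> nd (pad N M).
Proof.
move=> ndM t x xt xP.
have big0 (j : 'I_N) : (n <= j)%N -> x 0 j = 0.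
  move=> nj; have [|jt] := leqP t j; first exact: xt.
  have := xP j jt; rewrite mxE (bigD1 j) //= pad_out ?nj ?orbT // eqxx mulr1.
  rewrite big1 ?addr0 // => i ij; rewrite pad_out ?nj ?orbT // (negbTE ij).
  by rewrite mulr0.
have y0 : \row_i x 0 (w i) = 0.
  apply: (ndM t) => i h; first by rewrite mxE xt.
  rewrite -(xP (w i)) // !mxE sum_pad => [|j nj]; last by rewrite big0 ?mul0r.
  by apply: eq_bigr => j _; rewrite padE mxE.
apply/rowP => j; rewrite mxE; have [|jn] := leqP n j; first exact: big0.
have := congr1 (fun r : 'rV_n => r 0 (Ordinal jn)) y0; rewrite !mxE => <-.
by congr (x 0 _); apply: val_inj.
Qed.

Definition unpad (A : 'M[L]_N) : 'M[L]_n := \matrix_(i, j) A (w i) (w j).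

Lemma unpad_inv (A : 'M[L]_N) (M : 'M[L]_n) d :
  A *m pad N M = d%:M -> unpad A *m M = d%:M.
Proof.
move=> e; apply/matrixP => i j.
have := congr1 (fun B : 'M[L]_N => B (w i) (w j)) e; rewrite !mxE /=.
rewrite sum_pad => [e'|k nk]; last first.
  rewrite pad_out ?nk // (_ : (k == w j) = false) ?mulr0 //.
  by apply/eqP => ek; move: nk; rewrite ek /= leqNgt ltn_ord.
rewrite (_ : (i == j) = (w i == w j)) -?e' //.
by apply: eq_bigr => k _; rewrite padE !mxE.
Qed.

End Padding.

(** * Low-rank modifications of an inverse *)

Section Woodbury.
Variables (n f : nat) (M N : 'M[L]_n) (P : 'M[L]_(n, f)) (Q : 'M[L]_(f, n)).
Variable d : L.
Hypotheses (NM : N *m M = d%:M) (d0 : d != 0).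

(** With $N = d M^{-1}$ this is $d$ times the usual matrix $1 + Q M^{-1} P$. *)
Definition wood := d%:M + Q *m N *m P.

Definition trunc t : 'M[L]_f := \matrix_(i, j) ((i == j) && (i < t)%N)%:R.

Lemma mul_trunc t (x : 'rV[L]_f) (j : 'I_f) :
  (x *m trunc t) 0 j = if (j < t)%N then x 0 j else 0.
Proof.
rewrite mxE (bigD1 j) //= mxE eqxx big1 ?addr0 /=.
  by case: ltnP; rewrite ?mulr1 ?mulr0.
by move=> i ij; rewrite mxE (negbTE ij) mulr0.
Qed.

(** Let [T] project onto the first [t] coordinates. If the leading part of order [t] kills [y], then
    [z = y Q N] satisfies [z P T = d y], and so [z] is in the left kernel of [M + P T Q]. The
    hypothesis gives [z = 0], whence [d y = 0]. *)
Lemma nd_wood :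
  (forall t, (t <= f)%N -> \det (M + P *m trunc t *m Q) != 0) -> nd wood.
Proof.
move=> H t y yt yK; set T := trunc (minn t f).
have yT : y *m T = y.
  apply/rowP => j; rewrite mul_trunc leq_min ltn_ord andbT.
  by case: ltnP => // /yt.
have KT : y *m wood *m T = 0.
  apply/rowP => j; rewrite mul_trunc leq_min ltn_ord andbT [RHS]mxE.
  by case: ltnP => // /yK.
set z := y *m Q *m N.
have zP : z *m P *m T = d *: y.
  apply: addmm2K; rewrite -KT /wood mulmxDr !mulmxA mulmxDl -/z addrC.
  by rewrite mul_mx_scalar -scalemxAl yT.
have z0 : z = 0.
  apply: (det_row0 (H _ (geq_minr t f))).
  rewrite mulmxDr -/T !mulmxA zP -mulmxA NM mul_mx_scalar -scalemxAl.
  exact: addmm2.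
move/esym: zP; rewrite z0 !mul0mx => /eqP.
by rewrite scaler_eq0 (negbTE d0) => /eqP.
Qed.

Definition wood_inv (l : L) (A : 'M[L]_f) := l *: N + N *m P *m A *m Q *m N.

Lemma wood_invP l A : A *m wood = l%:M ->
  wood_inv l A *m (M + P *m Q) = (l * d)%:M.
Proof.
move=> AK; rewrite mulmxDl !mulmxDr -!scalemxAl NM scale_scalar_mx.
rewrite -[RHS]addr0 -addrA; congr (_ + _).
have -> : N *m P *m A *m Q *m N *m M = d *: (N *m P *m A *m Q).
  by rewrite -mulmxA NM mul_mx_scalar.
have -> : N *m P *m A *m Q *m N *m (P *m Q) = N *m P *m (A *m (Q *m N *m P)) *m Q.
  by rewrite !mulmxA.
have -> : A *m (Q *m N *m P) = l%:M + d *: A.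
  rewrite -AK /wood mulmxDr mul_mx_scalar addrAC addmm2 add0r //.
rewrite mulmxDr mul_mx_scalar -scalemxAr mulmxDl -!scalemxAl mulmxA.
by rewrite addrCA (addrC (d *: _)) addrA addmm2 add0r addmm2.
Qed.

End Woodbury.

End Inversion.

(** * When an entry of an inverse vanishes *)

Section InverseEntries.
Local Open Scope ring_scope.

Variables (L : finFieldType) (n : nat) (M V : 'M[L]_n) (g : L).
Hypotheses (VM : V *m M = g%:M) (g0 : g != 0).

(* Matrices with zero entries on [S * ~S] form a finite set which is stable
   under the injective map [Y |-> Y *m M]. *)
Lemma inverse_entry0 (S : {set 'I_n}) u v :
  (forall a b, a \in S -> b \notin S -> M a b = 0) ->
  u \in S -> v \notin S -> V u v = 0.
Proof.
move=> MS uS vS.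
have uM : M \in unitmx.
  have /mulmx1_unit[] // : (g^-1 *: V) *m M = 1%:M.
  by rewrite -scalemxAl VM scale_scalar_mx mulVf.
pose Z := [set Y : 'M[L]_n | [forall a, forall b, (a \in S) && (b \notin S) ==> (Y a b == 0)]].
have ZP (Y : 'M[L]_n) : reflect (forall a b, a \in S -> b \notin S -> Y a b = 0) (Y \in Z).
  rewrite inE; apply: (iffP forallP) => [h a b aS bS|h a].
    by have /forallP/(_ b) := h a; rewrite aS bS => /eqP.
  by apply/forallP => b; apply/implyP => /andP[aS bS]; rewrite h.
have inj : injective (fun Y : 'M[L]_n => Y *m M).
  by move=> Y Y' /(congr1 (mulmx^~ (invmx M))); rewrite /= !mulmxK.
have : [set Y *m M | Y in Z] = Z.
  apply/eqP; rewrite eqEcard card_imset // leqnn andbT.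
  apply/fintype.subsetP => _ /imsetP[Y /ZP YZ ->]; apply/ZP => a b aS bS.
  rewrite mxE big1 // => c _; have [cS|cS] := boolP (c \in S).
    by rewrite MS ?mulr0.
  by rewrite YZ ?mul0r.
move/setP/(_ g%:M); have -> : g%:M \in Z.
  apply/ZP => a b aS bS; rewrite mxE; case: eqP => [e|_]; last by rewrite mulr0n.
  by move: bS; rewrite -e aS.
by case/imsetP => Y /ZP YZ; rewrite -VM => /inj ->; apply: YZ.
Qed.

Definition replace_row (u v : 'I_n) (A : 'M[L]_n) :=
  \matrix_(a, b) (if a == v then (b == u)%:R else A a b).

(** The determinant is a cofactor up to sign. If the entry were zero, row [u] of [V] would not meet
    the replaced row, so that it and $g e_v$ would both be sent to $g e_u$ by a nonsingular
    matrix. *)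
Lemma inverse_entry_neq0 u v : \det (replace_row u v M) != 0 -> V u v != 0.
Proof.
move=> dW; apply/eqP => Vuv.
have : row u V - g *: delta_mx 0 v = 0.
  apply: (det_row0 dW); rewrite mulmxBl; apply/eqP; rewrite subr_eq0; apply/eqP.
  have -> : row u V *m replace_row u v M = row u V *m M.
    apply/rowP => b; rewrite !mxE; apply: eq_bigr => a _; rewrite !mxE.
    by case: eqP => // ->; rewrite Vuv !mul0r.
  rewrite -row_mul VM -scalemxAl -rowE; apply/rowP => b; rewrite !mxE eqxx.
  by rewrite eq_sym mulr_natr.
move/rowP/(_ v); rewrite !mxE Vuv !eqxx mulr1 sub0r => /eqP.
by rewrite oppr_eq0 (negbTE g0).
Qed.

End InverseEntries.

(** * Weights that certify reachability *)

Section PathMatrix.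
Local Open Scope ring_scope.

Variables (L : finFieldType) (char2 : 2%N \in [pchar L]) (n : nat).

(** The weights are 1 along a simple path and 0 elsewhere. A column in the kernel vanishes at [u]
    because of the replaced row, then at each successor along the path, and outside the path because
    those rows are those of the identity. *)
Lemma exists_path_matrix (e : rel 'I_n) u v : connect e u v ->
  exists2 X : 'M[L]_n, (forall a b, ~~ e a b -> X a b = 0) &
    \det (replace_row u v (1%:M + X)) != 0.
Proof.
move=> /connectP[p0 ep0 ->]; case: (shortenP ep0) => p ep up _ {p0 ep0}.
set q := u :: p in up; set t := last u p.
pose nxt a := nth u q (index a q).+1.
have it : nth u q (size p) = t by rewrite /t /q (last_nth u).
have itq : index t q = size p by rewrite -it index_uniq.
have lt a : a \in q -> a != t -> (index a q < size p)%N.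
  move=> aq at_; rewrite ltn_neqAle -ltnS index_mem aq andbT.
  by apply: contra at_ => /eqP ea; rewrite -it -ea nth_index.
exists (\matrix_(a, b) [&& a \in q, a != t & b == nxt a]%:R).
  move=> a b eab; rewrite mxE; case: and3P => // [[aq at_ /eqP eb]].
  have := (pathP u ep) _ (lt a aq at_); rewrite -/q nth_index // => h.
  by move: eab; rewrite eb /nxt /= h.
rewrite -det_tr; apply/negP => /det0P[x x0 xW].
have W0 a : \sum_b x 0 b * replace_row u t
    (1%:M + \matrix_(a, b) [&& a \in q, a != t & b == nxt a]%:R) a b = 0.
  have h := congr1 (fun r : 'rV_n => r 0 a) xW; rewrite [RHS]mxE /= in h.
  rewrite -[RHS]h mxE; apply: eq_bigr => b _; by rewrite [in RHS]mxE.
have xu : x 0 u = 0.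
  rewrite -(W0 t) (bigD1 u) //= !mxE !eqxx mulr1 big1 ?addr0 // => b bu.
  by rewrite !mxE eqxx (negbTE bu) mulr0.
have xout a : a \notin q -> x 0 a = 0.
  move=> aq; have at_ : a != t by apply: contra aq => /eqP->; apply: mem_last.
  rewrite -(W0 a) (bigD1 a) //= !mxE (negbTE at_) (negbTE aq) eqxx addr0 mulr1.
  rewrite big1 ?addr0 // => b ba; rewrite !mxE (negbTE at_) (negbTE aq) addr0.
  by rewrite eq_sym (negbTE ba) mulr0.
have xin a : a \in q -> a != t -> x 0 (nxt a) = x 0 a.
  move=> aq at_.
  have := W0 a; under eq_bigr do rewrite !mxE (negbTE at_) aq mulrDr /=.
  rewrite big_split /= (bigD1 a) //= eqxx mulr1 big1 ?addr0; last first.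
    by move=> b ba; rewrite eq_sym (negbTE ba) mulr0.
  rewrite (bigD1 (nxt a)) //= eqxx mulr1 big1 ?addr0; last first.
    by move=> b /negbTE->; rewrite mulr0.
  by move/eqP; rewrite addr_eq0 (oppr_pchar2 char2) => /eqP.
have xq i : (i <= size p)%N -> x 0 (nth u q i) = 0.
  elim: i => [|i IH] ip; first by [].
  have iq : (i < size q)%N by rewrite ltnS ltnW.
  have := xin (nth u q i) (mem_nth _ iq); rewrite /nxt index_uniq // => ->.
    by rewrite IH // ltnW.
  by rewrite -it nth_uniq // neq_ltn ip.
case/eqP: x0; apply/rowP => a; rewrite mxE; have [aq|] := boolP (a \in q); last exact: xout.
by rewrite -(nth_index u aq) xq // -ltnS index_mem.
Qed.

End PathMatrix.

(** * A Schwartz-Zippel bound for determinants *)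

Section SchwartzZippel.
Local Open Scope ring_scope.

Variables (L : finFieldType) (n : nat).

Definition mask (m : 'I_n -> 'I_n -> bool) (X : 'M[L]_n) :=
  \matrix_(i, j) (if m i j then X i j else 0).

Definition line_poly (A B : 'M[L]_n) : {poly L} :=
  \det (map_mx polyC A + 'X *: map_mx polyC B).

Lemma horner_line_poly A B y : (line_poly A B).[y] = \det (A + y *: B).
Proof.
rewrite -/(horner_eval y _) -det_map_mx; congr (\det _).
apply/matrixP => i j; rewrite !mxE /= /horner_eval.
by rewrite hornerD hornerM !hornerC hornerX.
Qed.

Lemma size_line_poly A B : (size (line_poly A B) <= n.+1)%N.
Proof.
apply: (leq_trans (size_sum _ _ _)); apply/bigmax_leqP => s _.
rewrite -signr_odd -[(-1) ^+ _]/((-1) ^+ _) size_Msign.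
apply: (leq_trans (size_prod_leq _ _)).
set W := (_ + _ : 'M[{poly L}]_n).
have : (\sum_(i : 'I_n) size (W i (s i)) <= \sum_(i : 'I_n) 2)%N.
  apply: leq_sum => i _; rewrite /W !mxE addrC.
  rewrite mulrC -cons_poly_def.
  by rewrite size_cons_poly; case: ifP => // _; rewrite ltnS size_polyC_leq1.
have -> : #|(xpredT : pred 'I_n)| = n by rewrite cardT size_enum_ord.
by rewrite sum_nat_const card_ord; move: (\sum_(i < n) _)%N => q; lia.
Qed.

(* On every line through [X0], the determinant is a polynomial of degree at most
   [n] in the parameter, and it is nonzero at [X0]. *)
Lemma card_det0 (C X0 : 'M[L]_n) m : \det (C + mask m X0) != 0 ->
  (#|[set X | \det (C + mask m X) == 0%R]| * #|L|.-1 <= n * #|{: 'M[L]_n}|)%N.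
Proof.
move=> d0; set bad := [set X | _].
(* The pairs [(y, X)] with [y] nonzero and [sg y X] bad are counted twice. For fixed [y] the map is
   a bijection, which gives [#|bad|] pairs; for fixed [X] there are at most [n], the roots of
   [line_poly]. *)
pose sg (y : L) (X : 'M[L]_n) := X0 + y *: (X - X0).
have maskE y X : C + mask m (sg y X) = (C + mask m X0) + y *: mask m (X - X0).
  apply/matrixP => i j; rewrite !mxE; case: (m i j); last by rewrite mulr0 !addr0.
  by rewrite !addrA.
have sg_bij y : y != 0 -> bijective (sg y).
  move=> y0; exists (fun Y => X0 + y^-1 *: (Y - X0)) => X; rewrite /sg.
    by rewrite [X0 + _ - X0]addrAC subrr add0r scalerA mulVf // scale1r addrC subrK.
  by rewrite [X0 + _ - X0]addrAC subrr add0r scalerA mulfV // scale1r addrC subrK.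
have cnt y : y != 0 -> #|bad| = (\sum_(X : 'M[L]_n) (sg y X \in bad))%N.
  move=> y0; rewrite -sum1_card big_mkcond /= (reindex (sg y)) /=; last first.
    exact/onW_bij/sg_bij.
  by apply: eq_bigr => X _; case: (sg y X \in bad).
have -> : (#|bad| * #|L|.-1 = \sum_(y : L | y != 0%R) \sum_(X : 'M[L]_n) (sg y X \in bad))%N.
  rewrite (eq_bigr (fun=> #|bad|)) => [|y y0]; last by rewrite -cnt.
  by rewrite sum_nat_const mulnC -(cardC1 (0 : L)).
rewrite exchange_big /= mulnC -sum_nat_const; apply: leq_sum => X _.
have p0 : line_poly (C + mask m X0) (mask m (X - X0)) != 0.
  apply: contra d0 => /eqP e.
  by rewrite -[X in \det X]addr0 -(scale0r (mask m (X - X0))) -horner_line_poly e horner0.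
have -> : (\sum_(y : L | y != 0%R) (sg y X \in bad))%N =
    size [seq y <- enum L | (y != 0) && (sg y X \in bad)].
  rewrite (eq_bigr (fun y => if sg y X \in bad then 1 else 0)%N); last first.
    by move=> y _; case: ifP.
  by rewrite -big_mkcondr sum1_card cardE enumT.
rewrite -ltnS; apply: leq_trans (size_line_poly (C + mask m X0) (mask m (X - X0))).
apply: max_poly_roots => //; last by rewrite filter_uniq ?enum_uniq.
apply/allP => y; rewrite mem_filter => /andP[/andP[_]]; rewrite inE maskE => h _.
by rewrite /root horner_line_poly.
Qed.

End SchwartzZippel.

(** * Batches of updates as low-rank modifications *)

(** This keeps the number of prefixes in the union bound, and the addresses used by an update,
    polynomial in [n]. *)
Lemma size_batch n (B : seq (update n)) : uniq B -> size B <= 2 * (n * n) + n.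
Proof.
move=> uB.
have u2 : uniq (map (@update_code n) B).
  by rewrite map_inj_uniq //; apply: can_inj (@update_codeK n).
rewrite -(size_map (@update_code n)) -(card_uniqP u2); apply: leq_trans (max_card _) _.
by rewrite !card_sum card_prod card_ord; lia.
Qed.

Section Batch.
Local Open Scope ring_scope.

Variables (L : finFieldType) (char2 : 2%N \in [pchar L]).
Variables (n : nat) (G : rel 'I_n) (B : seq (update n)).

Definition utail (x : update n) :=
  match x with InsEdge u _ | DelEdge u _ | DelNode u => u end.
Definition uhead (x : update n) :=
  match x with InsEdge _ v | DelEdge _ v | DelNode v => v end.
Definition unode (x : update n) := if x is DelNode _ then true else false.

(* The edges present once the updates of the prefix [C] of [B] have been carried
   out; edge updates which [B] overrules are void. *)
Definition present (C : seq (update n)) : rel 'I_n := fun u v =>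
  (DelNode u \notin C) &&
  (if DelNode u \in B then G u v
   else (G u v || ((InsEdge u v \in C) && (DelEdge u v \notin B)))
          && (DelEdge u v \notin C)).

Lemma present_nil : present [::] =2 G.
Proof. by move=> u v; rewrite /present !in_nil /= orbF andbT if_same. Qed.

Lemma present_alive u v : present B u v =
  [&& alive B u, G u v || (InsEdge u v \in B) & DelEdge u v \notin B].
Proof.
rewrite /present /alive; case: (DelNode u \in B) => //=.
by case: (DelEdge u v \in B); rewrite ?andbF ?andbT.
Qed.

(** In [present] a deleted node keeps its incoming edges but is a sink, so that no path with an
    alive end can pass through it. *)
Lemma connect_present u v : alive B u -> alive B v ->
  connect (present B) u v = connect (updated G B) u v.
Proof.
move=> au av; apply/connectP/connectP => -[p pp e]; exists p => //.
  have : alive B (last u p) by rewrite -e.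
  elim: p u {au e} pp => //= x p IH u /andP[ux xp] al.
  have ax : alive B x.
    by case: p {IH} xp al => //= y p /andP[]; rewrite present_alive => /and3P[].
  rewrite IH // andbT; move: ux; rewrite present_alive /updated ax.
  by case/and3P => -> -> ->.
apply: sub_path pp => a b; rewrite present_alive.
by case/and4P => -> _ -> ->.
Qed.

Section Matrices.
Variable X : 'M[L]_n.

(** The change of the matrix entry. An update that is overruled or changes nothing keeps its column
    of [uP] with scale 0, so that the factors always have inner size [size B]. *)
Definition uscale (x : update n) : L :=
  match x with
  | DelNode _ => 1
  | InsEdge u v =>
    if [&& ~~ G u v, DelNode u \notin B & DelEdge u v \notin B] then X u v else 0
  | DelEdge u v => if G u v && (DelNode u \notin B) then X u v else 0
  end.

(** Deleting a node subtracts its row in the original graph wherever it stands in the batch, because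
    [present] voids all edge updates leaving that node. *)
Definition urow (x : update n) (v : 'I_n) : L :=
  if unode x then mask G X (uhead x) v else uscale x * (v == uhead x)%:R.

Definition bmat (C : seq (update n)) : 'M[L]_n := 1%:M + mask (present C) X.

Lemma bmat_nil : bmat [::] = 1%:M + mask G X.
Proof. by congr (_ + _); apply/matrixP => u v; rewrite !mxE present_nil. Qed.

Lemma addrr2 (x : L) : x + x = 0.
Proof. exact: (addrr_pchar2 char2). Qed.

(** Adding the rank-one term inserts what is absent and removes what is present; applied twice it
    would cancel, whence [x \notin C]. *)
Lemma bmat_rcons C x : {subset C <= B} -> x \in B -> x \notin C ->
  bmat (rcons C x) = bmat C + \matrix_(a, b) ((a == utail x)%:R * urow x b).
Proof.
move=> CB xB xC; rewrite /bmat -addrA; congr (_ + _); apply/matrixP => a b.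
have eNI u v w : (DelNode w == InsEdge u v :> update n) = false by [].
have eND u v w : (DelNode w == DelEdge u v :> update n) = false by [].
have eNN u w : (DelNode w == DelNode u :> update n) = (w == u) by [].
have eID u v w z : (InsEdge w z == DelEdge u v :> update n) = false by [].
have eDI u v w z : (DelEdge w z == InsEdge u v :> update n) = false by [].
have eIN u w z : (InsEdge w z == DelNode u :> update n) = false by [].
have eDN u w z : (DelEdge w z == DelNode u :> update n) = false by [].
have eII u v w z : (InsEdge w z == InsEdge u v :> update n) = (w == u) && (z == v) by [].
have eDD u v w z : (DelEdge w z == DelEdge u v :> update n) = (w == u) && (z == v) by [].
have nC y : (y \notin B) -> (y \notin C) by apply: contra; apply: CB.
rewrite !mxE /present !mem_rcons !inE; case: x xB xC => [u v|u v|u] xB xC;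
  rewrite ?(eNI, eND, eNN, eID, eDI, eIN, eDN, eII, eDD) /urow /=.
- case: (eqVneq a u) => [->|_]; last by rewrite mul0r addr0.
  rewrite mul1r; case: (eqVneq b v) => [->|_]; last by rewrite mulr0 addr0.
  rewrite mulr1 /= (negbTE xC); case: (boolP (DelNode u \in B)) => uB /=.
    by rewrite andbF addr0.
  rewrite (nC _ uB) /= orbF; case: (boolP (DelEdge u v \in B)) => dB /=.
    by rewrite andbF orbF addr0.
  by rewrite (nC _ dB) /= !andbT orbT; case: (G u v); rewrite ?addr0 ?add0r.
- case: (eqVneq a u) => [->|_]; last by rewrite mul0r addr0.
  rewrite mul1r; case: (eqVneq b v) => [->|_]; last by rewrite mulr0 addr0.
  rewrite mulr1 /= (negbTE xC) xB; case: (boolP (DelNode u \in B)) => uB /=.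
    by rewrite andbF addr0.
  by rewrite (nC _ uB) /= !andbF !orbF !andbT; case: (G u v); rewrite ?addr0 ?addrr2.
case: (eqVneq a u) => [->|_]; last by rewrite mul0r addr0.
by rewrite mul1r !mxE /= xB (negbTE xC) /= addrr2.
Qed.

Definition ux (j : 'I_(size B)) := tnth (in_tuple B) j.
Definition uP : 'M[L]_(n, size B) := \matrix_(a, j) (a == utail (ux j))%:R.
Definition uQ : 'M[L]_(size B, n) := \matrix_(j, b) urow (ux j) b.

Lemma mul_truncE t a b :
  (uP *m trunc L (size B) t *m uQ) a b = \sum_(j < size B | (j < t)%N) uP a j * uQ j b.
Proof.
rewrite mxE [RHS]big_mkcond; apply: eq_bigr => j _.
rewrite -[(uP *m _) a j]/((uP *m trunc L (size B) t) a j) mxE (bigD1 j) //= big1 => [|i ij].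
  by rewrite addr0 !mxE eqxx /=; case: ltnP; rewrite ?mulr1 // mulr0 mul0r.
by rewrite !mxE (negbTE ij) mulr0.
Qed.

Hypothesis uB : uniq B.

Lemma bmat_take t : (t <= size B)%N ->
  bmat (take t B) = 1%:M + mask G X + uP *m trunc L (size B) t *m uQ.
Proof.
elim: t => [|t IH] tB.
  rewrite take0 bmat_nil; apply/matrixP => a b.
  by rewrite [RHS]mxE mul_truncE big_pred0 ?addr0 // => j; rewrite ltn0.
pose i := Ordinal tB; have iE : nth (ux i) B t = ux i by rewrite [in RHS]/ux (tnth_nth (ux i)).
rewrite (take_nth (ux i)) // iE bmat_rcons; last 3 first.
- by move=> x; apply: mem_take.
- by rewrite -iE mem_nth.
- rewrite -iE; have := uB; rewrite -{1}(cat_take_drop t B) cat_uniq => /and3P[_ /hasPn h _].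
  apply: (h (nth (ux i) B t)); rewrite (drop_nth (ux i)) // mem_head //.
rewrite IH ?(ltnW tB) // -addrA; congr (_ + _); apply/matrixP => a b.
rewrite [LHS]mxE !mul_truncE [RHS](bigD1 i) /=; last by rewrite ltnS.
rewrite addrC; congr (_ + _); first by rewrite !mxE.
apply: eq_bigl => j; rewrite ltnS ltn_neqAle andbC; congr (_ && _).
Qed.

Lemma bmat_full : bmat B = 1%:M + mask G X + uP *m uQ.
Proof.
rewrite -{1}(take_size B) bmat_take //; congr (_ + _ *m _).
rewrite (_ : trunc _ _ _ = 1%:M) ?mulmx1 //.
by apply/matrixP => i j; rewrite !mxE ltn_ord andbT.
Qed.

Section Values.
Variables (N : 'M[L]_n) (d : L).
Hypotheses (Nd : N *m (1%:M + mask G X) = d%:M) (d0 : d != 0).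

(** An entry of [uQ *m N] in constant time. For a node deletion the naive product runs over a whole
    row, but $(1 + X) N = d$ turns it into an entry of $N$, plus $d$ on the diagonal. *)
Definition qn (x : update n) v : L :=
  uscale x * N (uhead x) v + (if unode x && (uhead x == v) then d else 0).

Lemma uQN j v : (uQ *m N) j v = qn (ux j) v.
Proof.
have MN : (1%:M + mask G X) *m N = d%:M.
  have /mulmx1C : (d^-1 *: N) *m (1%:M + mask G X) = 1%:M.
    by rewrite -scalemxAl Nd scale_scalar_mx mulVf.
  move=> h; have -> : (1%:M + mask G X) *m N = d *: ((1%:M + mask G X) *m (d^-1 *: N)).
    by rewrite -scalemxAr scalerA mulfV // scale1r.
  by rewrite h scalemx1.
rewrite /qn mxE; case nE : (unode (ux j)).
  have sE : uscale (ux j) = 1 by case: (ux j) nE.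
  have := congr1 (fun M : 'M[L]_n => M (uhead (ux j)) v) MN.
  rewrite mulmxDl mul1mx mxE [X in _ + X = _]mxE [RHS]mxE sE mul1r /= => e.
  rewrite (eq_bigr (fun b => mask G X (uhead (ux j)) b * N b v)); last first.
    by move=> b _; rewrite mxE /urow nE.
  have -> : (if uhead (ux j) == v then d else 0) = d *+ (uhead (ux j) == v).
    by case: eqP.
  by rewrite -e addrA addrr2 add0r.
rewrite addr0 (bigD1 (uhead (ux j))) //= big1 => [|b hb]; rewrite !mxE /urow nE.
  by rewrite eqxx mulr1 addr0.
by rewrite (negbTE hb) mulr0 mul0r.
Qed.

Lemma mul_uP m (A : 'M[L]_(m, n)) i j : (A *m uP) i j = A i (utail (ux j)).
Proof.
rewrite mxE (bigD1 (utail (ux j))) //= big1 => [|b hb]; rewrite !mxE.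
  by rewrite eqxx mulr1 addr0.
by rewrite (negbTE hb) mulr0.
Qed.

Lemma wood_entry i j :
  wood N uP uQ d i j = (if i == j then d else 0) + qn (ux i) (utail (ux j)).
Proof.
rewrite /wood mxE mul_uP uQN; congr (_ + _).
by rewrite mxE; case: eqP.
Qed.

Variables (K : 'M[L]_(size B)) (l : L).

Lemma wood_inv_entry u v : wood_inv N uP uQ l K u v =
  l * N u v + \sum_i N u (utail (ux i)) * \sum_j K i j * qn (ux j) v.
Proof.
rewrite /wood_inv mxE mxE -!mulmxA; congr (_ + _).
rewrite mulmxA mxE; apply: eq_bigr => i _; rewrite mul_uP; congr (_ * _).
by rewrite mxE; apply: eq_bigr => j _; rewrite uQN.
Qed.

Hypotheses (Kl : K *m wood N uP uQ d = l%:M) (l0 : l != 0).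

Lemma wood_inv_neq0 u v : alive B u -> alive B v ->
  (connect (present B) u v -> \det (replace_row u v (bmat B)) != 0) ->
  (wood_inv N uP uQ l K u v != 0) = connect (updated G B) u v.
Proof.
move=> au av hdet; rewrite -connect_present //.
have VM := wood_invP char2 Nd Kl; rewrite -bmat_full in VM.
have ld : l * d != 0 by rewrite mulf_neq0.
case: (boolP (connect (present B) u v)) => uv.
  exact: (inverse_entry_neq0 VM ld (hdet uv)).
apply/negbTE; rewrite negbK; apply/eqP.
apply: (inverse_entry0 VM ld (S := [set a | connect (present B) u a])).
- move=> a b; rewrite !inE => ua ub; rewrite !mxE.
  have ab : ~~ present B a b.
    by apply: contra ub => ab; apply: connect_trans ua (connect1 ab).
  rewrite (negbTE ab) addr0 (_ : (a == b) = false) //.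
  by apply/eqP => e; rewrite e (negbTE ub) in ua.
- by rewrite inE connect0.
- by rewrite inE.
Qed.

End Values.
End Matrices.

(** One condition for each use of randomness: the inversion in preprocessing, the inversion of the
    small matrix, by way of [nd_wood], and the nonvanishing of the entries at reachable pairs. *)
Definition good_matrix (X : 'M[L]_n) :=
  [&& [forall t : 'I_n.+1, \det (lead t (1%:M + mask G X)) != 0],
      [forall t : 'I_(size B).+1, \det (bmat X (take t B)) != 0] &
      [forall u, forall v, connect (present B) u v ==>
         (\det (replace_row u v (bmat X B)) != 0)]].

Lemma card_bigcup (I T : finType) (P : I -> {set T}) :
  (#|\bigcup_i P i| <= \sum_i #|P i|)%N.
Proof.
elim/big_rec2: _ => [|i k S _ le]; first by rewrite cards0.
by apply: leq_trans (leq_card_setU _ _) _; rewrite leq_add2l.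
Qed.

Lemma card_union (I T : finType) (P : I -> {set T}) q b :
  (forall i, #|P i| * q <= b)%N -> (#|\bigcup_i P i| * q <= #|I| * b)%N.
Proof.
move=> h; apply: leq_trans (leq_mul (card_bigcup P) (leqnn q)) _.
by rewrite big_distrl /= -sum_nat_const; apply: leq_sum => i _; apply: h.
Qed.

Lemma mask0 (m : rel 'I_n) : mask m (0 : 'M[L]_n) = 0.
Proof. by apply/matrixP => i j; rewrite !mxE if_same. Qed.

(** A union bound. Each determinant is nonzero for some weights: zero weights, which give the
    identity, for the first two families, and those of [exists_path_matrix] for the third. *)
Lemma card_bad_matrix :
  (#|[set X | ~~ good_matrix X]| * #|L|.-1
     <= (n.+1 + ((size B).+1 + n * n)) * (n * #|{: 'M[L]_n}|))%N.
Proof.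
pose S1 (t : 'I_n.+1) := [set X : 'M[L]_n | \det (lead t (1%:M + mask G X)) == 0].
pose S2 (t : 'I_(size B).+1) := [set X : 'M[L]_n | \det (bmat X (take t B)) == 0].
pose S3 (p : 'I_n * 'I_n) := [set X : 'M[L]_n | connect (present B) p.1 p.2 &&
   (\det (replace_row p.1 p.2 (bmat X B)) == 0)].
have sub : [set X | ~~ good_matrix X] \subset
    \bigcup_t S1 t :|: (\bigcup_t S2 t :|: \bigcup_p S3 p).
  apply/fintype.subsetP => X; rewrite !inE !negb_and => /or3P[] /forallPn[t ht].
  - by apply/orP; left; apply/bigcupP; exists t => //; rewrite inE -[_ == 0]negbK.
  - by apply/orP; right; apply/orP; left; apply/bigcupP; exists t => //; rewrite inE -[_ == 0]negbK.
  apply/orP; right; apply/orP; right; move/forallPn: ht => [v]; rewrite negb_imply negbK => h.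
  by apply/bigcupP; exists (t, v) => //; rewrite inE.
have det1 : \det (1%:M + 0 : 'M[L]_n) != 0 by rewrite addr0 det1 oner_neq0.
have b1 t : (#|S1 t| * #|L|.-1 <= n * #|{: 'M[L]_n}|)%N.
  pose m (a b : 'I_n) := [&& (a < t)%N, (b < t)%N & G a b].
  have -> : S1 t = [set X | \det (1%:M + mask m X) == 0].
    apply/setP => X; rewrite !inE; congr (\det _ == 0); apply/matrixP => a b.
    rewrite !mxE /m; case: (a < t)%N => /=; last by rewrite addr0.
    by case: (b < t)%N => //=; rewrite addr0.
  by apply: (@card_det0 _ _ _ 0); rewrite mask0.
have b2 t : (#|S2 t| * #|L|.-1 <= n * #|{: 'M[L]_n}|)%N.
  by apply: (@card_det0 _ _ _ 0); rewrite mask0.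
have b3 p : (#|S3 p| * #|L|.-1 <= n * #|{: 'M[L]_n}|)%N.
  case: p => u v; case: (boolP (connect (present B) u v)) => uv; last first.
    rewrite (_ : S3 _ = finset.set0) ?cards0 //; apply/setP => X; rewrite !inE /=.
    by rewrite (negbTE uv).
  have [X0 hX0 d0] := exists_path_matrix char2 uv.
  pose m a b := (a != v) && present B a b.
  have E (X : 'M[L]_n) : replace_row u v (1%:M + mask (present B) X) =
      replace_row u v 1%:M + mask m X.
    by apply/matrixP => a b; rewrite !mxE /m; case: (a == v); rewrite /= ?addr0.
  have -> : S3 (u, v) = [set X | \det (replace_row u v 1%:M + mask m X) == 0].
    by apply/setP => X; rewrite !inE /= uv /= /bmat E.
  apply: (@card_det0 _ _ _ X0); rewrite -E (_ : mask _ _ = X0) //.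
  apply/matrixP => a b; rewrite mxE; case: ifPn => // h; by rewrite hX0.
have := subset_leq_card sub => le.
apply: leq_trans (leq_mul le (leqnn _)) _.
have e3 : #|{: 'I_n * 'I_n}| = (n * n)%N by rewrite card_prod card_ord.
have := card_union b1; have := card_union b2; have := card_union b3.
rewrite !card_ord e3 => h3 h2 h1.
have u1 := leq_card_setU (\bigcup_t S1 t) (\bigcup_t S2 t :|: \bigcup_p S3 p).
have u2 := leq_card_setU (\bigcup_t S2 t) (\bigcup_p S3 p).
apply: leq_trans (leq_mul u1 (leqnn _)) _.
apply: leq_trans (leq_mul (leq_add (leqnn _) u2) (leqnn _)) _.
by rewrite !mulnDl !leq_add.
Qed.

End Batch.

(** * Random matrices read off the tape *)

(** The number of tapes over [F] is a product over the positions, in which [F] does not occur: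
    reading distinct positions through a map with fibers of equal size yields a uniform result. *)
Lemma card_fiber (W T : nat) (I Y : finType) (pos : I -> 'I_T) (g : 'I_W -> Y) c
  (F : {ffun I -> Y}) : injective pos -> (forall y, #|[set x | g x == y]| = c) ->
  #|[set r : T.-tuple 'I_W | [ffun i => g (tnth r (pos i))] == F]| =
    foldr muln 1 [seq (if j \in codom pos then c else W) | j : 'I_T].
Proof.
move=> inj hg; pose Fm (j : 'I_T) : pred 'I_W :=
  [pred x | [forall i, (pos i == j) ==> (g x == F i)]].
have -> : foldr muln 1 [seq (if j \in codom pos then c else W) | j : 'I_T] = #|family Fm|.
  rewrite card_family; congr (foldr _ _ _); apply: eq_map => j; case: ifP => hj.
    have [i jE] := codomP hj; rewrite -(hg (F i)) cardsE; apply: eq_card => x.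
    rewrite !inE; apply/eqP/forallP => [e i'|/(_ i)]; last first.
      by rewrite jE eqxx => /eqP.
    by apply/implyP => /eqP e'; move: e'; rewrite jE => /inj ->; rewrite e.
  rewrite -[LHS](card_ord W); apply: eq_card => x; rewrite !inE; apply/esym/forallP => i.
  apply/implyP => /eqP e; have := codom_f pos i; by rewrite e hj.
pose to (r : T.-tuple 'I_W) : {ffun 'I_T -> 'I_W} := [ffun j => tnth r j].
have to_inj : injective to.
  by move=> r r' e; apply: eq_from_tnth => j; have := congr1 (fun h : {ffun _ -> _} => h j) e; rewrite !ffunE.
rewrite -(card_imset _ to_inj); apply: eq_card => f; apply/imsetP/familyP => [[r]|h].
  rewrite inE => /eqP e -> j; rewrite inE ffunE; apply/forallP => i.
  by apply/implyP => /eqP <-; rewrite -e ffunE.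
exists [tuple f j | j < T]; last by apply/ffunP => j; rewrite ffunE tnth_mktuple.
rewrite inE; apply/eqP/ffunP => i; rewrite ffunE tnth_mktuple.
by have := h (pos i); rewrite inE => /forallP/(_ i); rewrite eqxx => /eqP.
Qed.

Lemma card_uniform (W T : nat) (I Y : finType) (pos : I -> 'I_T) (g : 'I_W -> Y) c
  (P : pred {ffun I -> Y}) : injective pos -> (forall y, #|[set x | g x == y]| = c) ->
  #|[set r : T.-tuple 'I_W | P [ffun i => g (tnth r (pos i))]]| * #|{ffun I -> Y}| =
  #|[set F | P F]| * #|{: T.-tuple 'I_W}|.
Proof.
move=> inj hg; set k := foldr muln 1 [seq (if j \in codom pos then c else W) | j : 'I_T].
have H (Q : pred {ffun I -> Y}) :
    #|[set r : T.-tuple 'I_W | Q [ffun i => g (tnth r (pos i))]]| = #|[set F | Q F]| * k.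
  pose f (r : T.-tuple 'I_W) : {ffun I -> Y} := [ffun i => g (tnth r (pos i))].
  have -> : #|[set r : T.-tuple 'I_W | Q [ffun i => g (tnth r (pos i))]]| =
      \sum_(r : T.-tuple 'I_W | Q (f r)) 1 by rewrite sum1dep_card.
  rewrite (partition_big f Q) //=.
  rewrite (eq_bigr (fun=> k)) => [|F QF].
    by rewrite sum_nat_const cardsE.
  rewrite /k -(card_fiber F inj hg) -sum1dep_card; apply: eq_bigl => r.
  by case: eqP => [e|]; rewrite ?andbF // andbT -/(f r) e.
have -> : #|{: T.-tuple 'I_W}| = #|{ffun I -> Y}| * k.
  have e1 : [set r : T.-tuple 'I_W | xpredT [ffun i => g (tnth r (pos i))]] = [set: T.-tuple 'I_W].
    by apply/setP => r; rewrite !inE.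
  have e2 : [set F : {ffun I -> Y} | xpredT F] = [set: {ffun I -> Y}].
    by apply/setP => r; rewrite !inE.
  by have := H xpredT; rewrite e1 e2 !cardsT.
by rewrite H mulnCA mulnA mulnC mulnA.
Qed.

Section Words.
Local Open Scope ring_scope.
Variables (L : finFieldType) (l : nat) (z : L).
Hypotheses (char2 : 2%N \in [pchar L]) (cL : #|L| = (2 ^ (2 * 3 ^ l))%N).
Hypothesis zP : (3 ^ l.+1).-primitive_root z.

Let q := (2 ^ (2 * 3 ^ l))%N.

Lemma phi_surj (y : L) : exists2 a : nat, (a < q)%N & phi z a = y.
Proof.
pose f (a : 'I_q) := phi z a.
have inj : injective f.
  move=> a b /(phi_inj char2 zP) e; apply: val_inj; apply: e.
    by rewrite addnn -mul2n.
  by rewrite addnn -mul2n.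
have : y \in codom f.
  by rewrite (inj_card_onto inj) // card_ord cL.
by case/codomP => a ->; exists (val a); rewrite ?ltn_ord.
Qed.

Lemma card_phi_fiber W c (y : L) : W = (c * q)%N ->
  #|[set x : 'I_W | phi z (x %% q) == y]| = c.
Proof.
move=> ->.
have [a aq <-] := phi_surj y.
have lt (i : 'I_c) : (i * q + a < c * q)%N.
  apply: (@leq_trans (i * q + q)); first by rewrite ltn_add2l.
  by rewrite -mulSnr leq_mul2r ltn_ord orbT.
pose f (i : 'I_c) := Ordinal (lt i).
have inj : injective f.
  move=> i j /(congr1 val) /= /addIn /eqP; rewrite eqn_mul2r => /orP[/eqP q0|/eqP e].
    by move: aq; rewrite q0.
  exact: val_inj.
rewrite -[RHS](card_ord c) -(card_imset _ inj); apply: eq_card => x; rewrite inE.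
have q0 : (0 < q)%N by rewrite expn_gt0.
apply/eqP/imsetP => [e|[i _ ->]]; last by rewrite /= modnMDl modn_small.
have {}e : (x %% q = a)%N.
  by apply: (phi_inj char2 zP) => //; rewrite addnn -mul2n //; apply: ltn_pmod.
have xc : (x %/ q < c)%N by rewrite ltn_divLR.
exists (Ordinal xc) => //; apply: val_inj; rewrite /= {1}(divn_eq x q) e //.
Qed.

Variables (n T W c : nat) (pos : 'I_n -> 'I_n -> nat).
Hypothesis WE : W = (c * q)%N.
Hypothesis pos_lt : forall u v, (pos u v < T)%N.
Hypothesis pos_inj : forall u v u' v', pos u v = pos u' v' -> u = u' /\ v = v'.

(** Only the low bits of a random word are used; on them [phi] is a bijection onto the field, and
    [W] is a multiple of [q], so that each entry is uniform. *)
Definition tape_matrix (rs : seq nat) : 'M[L]_n :=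
  \matrix_(u, v) phi z (nth 0%N rs (pos u v) %% q).

Lemma card_tape_matrix (P : pred 'M[L]_n) :
  (#|[set r : T.-tuple 'I_W | P (tape_matrix (map val r))]| * #|{: 'M[L]_n}| =
   #|[set X | P X]| * #|{: T.-tuple 'I_W}|)%N.
Proof.
pose ps (p : 'I_n * 'I_n) := Ordinal (pos_lt p.1 p.2).
have ps_inj : injective ps.
  by move=> [u v] [u' v'] /(congr1 val) /= /pos_inj[-> ->].
pose g (x : 'I_W) := phi z (x %% q).
have hg y : #|[set x | g x == y]| = c by apply: card_phi_fiber.
pose mat (F : {ffun 'I_n * 'I_n -> L}) := \matrix_(u, v) F (u, v).
have mat_inj : injective mat.
  move=> F F' /matrixP e; apply/ffunP => -[u v]; by have := e u v; rewrite !mxE.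
have mat_bij : bijective mat.
  apply: inj_card_bij => //; by rewrite card_mx card_ffun card_prod !card_ord.
have := card_uniform (fun F => P (mat F)) ps_inj hg.
have -> : #|[set F | P (mat F)]| = #|[set X | P X]|.
  rewrite -(card_imset _ mat_inj); apply: eq_card => X; rewrite inE.
  have [m' mK m'K] := mat_bij.
  apply/imsetP/idP => [[F]|PX]; first by rewrite inE => PF ->.
  by exists (m' X); rewrite ?inE m'K.
rewrite (bij_eq_card mat_bij) => <-; congr (_ * _)%N; apply: eq_card => r; rewrite !inE.
congr (P _); apply/matrixP => u v; rewrite !mxE ffunE /g.
pose x0 := tnth r (ps (u, v)); have e : x0 = nth x0 r (pos u v) := tnth_nth x0 r (ps (u, v)).
by rewrite -/x0 (nth_map x0) ?size_tuple // -e.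
Qed.

End Words.

(** * The probability of success *)

Section Success.
Local Open Scope ring_scope.
Variables (R : realType) (O : oracle) (n : nat) (G : rel 'I_n) (B : seq (update n)).
Variables (t1 t2 t3 : nat).

Notation tp t := (t.-tuple 'I_(2 ^ word_size O n)).

Lemma card_tp_gt0 t : (0 < #|{: tp t}|)%N.
Proof. by rewrite card_tuple card_ord !expn_gt0. Qed.

(** The good event depends on the preprocessing tape alone, so that the other two factors of the
    product space cancel. *)
Lemma success_ge (good : pred (tp t1)) :
  (forall r1 r2 r3, good r1 -> all_correct G B (r1 : tape O n t1) (r2 : tape O n t2)
     (r3 : {ffun 'I_n * 'I_n -> tape O n t3})) ->
  #|[set r1 | good r1]|%:R / #|{: tp t1}|%:R <= success_prob R O G B t1 t2 t3.
Proof.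
move=> h; pose E (r : tape O n t1 * tape O n t2 * {ffun 'I_n * 'I_n -> tape O n t3}) :=
  all_correct G B r.1.1 r.1.2 r.2.
rewrite -[success_prob _ _ _ _ _ _ _]/(#|(E : pred (tp t1 * tp t2 * {ffun 'I_n * 'I_n -> tp t3})%type)|%:R
  / #|{: tp t1 * tp t2 * {ffun 'I_n * 'I_n -> tp t3}}|%:R).
have f0 : (0 < #|{: {ffun 'I_n * 'I_n -> tp t3}}|)%N.
  by rewrite card_ffun expn_gt0 card_tp_gt0.
have le : (#|[set r1 | good r1]| * #|{: tp t2}| *
    #|{: {ffun 'I_n * 'I_n -> tp t3}}| <= #|(E : pred (tp t1 * tp t2 * {ffun 'I_n * 'I_n -> tp t3})%type)|)%N.
  rewrite -(cardsT (tp t2)) -(cardsT {ffun 'I_n * 'I_n -> tp t3}) -!cardsX.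
  apply: subset_leq_card; apply/fintype.subsetP.
  move=> [[r1 r2] r3]; rewrite !inE !andbT /= => g.
  by rewrite unfold_in /E /=; apply: h.
have u1 : #|{: tp t1}|%:R != 0 :> R by rewrite pnatr_eq0 -lt0n card_tp_gt0.
have u2 : #|{: tp t2}|%:R != 0 :> R by rewrite pnatr_eq0 -lt0n card_tp_gt0.
have u3 : #|{: {ffun 'I_n * 'I_n -> tp t3}}|%:R != 0 :> R by rewrite pnatr_eq0 -lt0n.
rewrite !card_prod.
have -> : #|[set r1 | good r1]|%:R / #|{: tp t1}|%:R =
   (#|[set r1 | good r1]| * #|{: tp t2}| * #|{: {ffun 'I_n * 'I_n -> tp t3}}|)%N%:R /
   (#|{: tp t1}| * #|{: tp t2}| * #|{: {ffun 'I_n * 'I_n -> tp t3}}|)%N%:R :> R.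
  by rewrite !natrM; field; rewrite u1 u2 u3.
by apply: ler_wpM2r; rewrite ?invr_ge0 ?ler0n // ler_nat.
Qed.

Lemma success_bound (k l c : nat) (L : finFieldType) (z : L)
  (pos : 'I_n -> 'I_n -> nat) :
  2%N \in [pchar L] -> #|L| = (2 ^ (2 * 3 ^ l))%N ->
  (3 ^ l.+1).-primitive_root z ->
  (2 ^ word_size O n = c * 2 ^ (2 * 3 ^ l))%N ->
  ((k + 7) * bitlen n <= 2 * 3 ^ l)%N -> uniq B ->
  (forall u v, (pos u v < t1)%N) ->
  (forall u v u' v', pos u v = pos u' v' -> u = u' /\ v = v') ->
  (forall r1 r2 r3, good_matrix G B (tape_matrix l z pos (tape_words r1)) ->
     all_correct G B (r1 : tape O n t1) (r2 : tape O n t2)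
     (r3 : {ffun 'I_n * 'I_n -> tape O n t3})) ->
  1 - n%:R ^- k <= success_prob R O G B t1 t2 t3.
Proof.
move=> char2 cL zP WE kl uB pos_lt pos_inj h; apply: le_trans (success_ge h).
have t0 := card_tp_gt0 t1.
have M0 : (0 < #|{: 'M[L]_n}|)%N by apply/card_gt0P; exists 0.
have := card_tape_matrix char2 cL zP WE pos_lt pos_inj (good_matrix G B).
set g2 := #|[set r : _ | _]|; set g1 := #|[set X | _]| => e.
have -> : g1%:R / #|{: tp t1}|%:R = g2%:R / #|{: 'M[L]_n}|%:R :> R.
  apply/eqP; rewrite eqr_div ?pnatr_eq0 -?lt0n // -!natrM eqr_nat; apply/eqP.
  by rewrite e.
have := card_bad_matrix char2 G B; set bad := #|_| => hb.
have eg : (g2 + bad = #|{: 'M[L]_n}|)%N.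
  rewrite -(cardC (good_matrix G B)) /g2 /bad !cardsE; congr (_ + _)%N.
set M := #|_| in eg M0 hb *.
have -> : g2%:R / M%:R = 1 - bad%:R / M%:R :> R.
  rewrite -eg natrD; field; rewrite -natrD eg pnatr_eq0; lia.
rewrite lerD2l lerN2.
(* For [n = 0] the number [n%:R ^- k] may vanish, but then no matrix is bad. *)
case: (posnP n) => [n0|n0].
  have : bad = 0%N.
    have nM : (n * M = 0)%N by rewrite {1}n0.
    rewrite nM muln0 cL in hb.
    have q1 : (1 < 2 ^ (2 * 3 ^ l))%N by rewrite -{1}(expn0 2) ltn_exp2l // muln_gt0 expn_gt0.
    have : (bad * 1 <= 0)%N.
      by apply: leq_trans hb; rewrite leq_mul2l -subn1 subn_gt0 q1 orbT.
    by rewrite muln1 leqn0 => /eqP.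
  by move=> ->; rewrite mul0r invr_ge0 exprn_ge0.
have nk : 0 < n%:R ^+ k :> R by rewrite exprn_gt0 // ltr0n.
rewrite ler_pdivrMr ?ltr0n // mulrC ler_pdivlMr // -natrX -natrM ler_nat.
have sB := size_batch uB.
(* There are at most $3n^2 + 2n + 2 \le 7n^2$ determinants of degree at most $n$, and an error of
   $n^{-k}$ is wanted. Of the exponent $k + 7$, four powers of $n + 1$ absorb the factor 7 and the
   predecessor, as $(n+1)^4 \ge 16$. *)
have q_le : (7 * n ^ (k + 3) <= (2 ^ (2 * 3 ^ l)).-1)%N.
  have nb : (n.+1 <= 2 ^ bitlen n)%N by rewrite trunc_log_ltn.
  have h1 : ((n.+1) ^ (k + 7) <= 2 ^ (2 * 3 ^ l))%N.
    apply: (@leq_trans ((2 ^ bitlen n) ^ (k + 7))); first by rewrite leq_exp2r // addn_gt0 orbT.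
    by rewrite -expnM leq_exp2l // mulnC.
  have h2 : (n ^ (k + 3) <= n.+1 ^ (k + 3))%N by rewrite leq_exp2r ?addn_gt0 ?orbT.
  have h3 : (2 ^ 4 <= n.+1 ^ 4)%N by rewrite leq_exp2r.
  have n1 : (0 < n ^ (k + 3))%N by rewrite expn_gt0 n0.
  have h4 := leq_mul h2 h3; rewrite -expnD -addnA in h4.
  have h5 := leq_trans h4 h1; move: h5.
  by rewrite (_ : 2 ^ 4 = 16)%N //; move: (n ^ (k + 3))%N (2 ^ _)%N n1 => a b; lia.
have c7 : ((n.+1 + ((size B).+1 + n * n)) * n <= 7 * n ^ 3)%N by rewrite !expnS expn0; nia.
rewrite cL in hb; set q := (2 ^ _)%N in hb q_le.
have n1 : (0 < n ^ (k + 3))%N by rewrite expn_gt0 n0.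
have q0 : (0 < q.-1)%N by apply: leq_trans q_le; rewrite muln_gt0.
rewrite -(leq_pmul2r q0); apply: (@leq_trans (n ^ k * (7 * n ^ 3 * M))).
  rewrite mulnAC mulnC -mulnA leq_mul2l; apply/orP; right; rewrite mulnC.
  by rewrite mulnC; apply: leq_trans hb _; rewrite (mulnA _ n M) (mulnA 7) leq_mul2r c7 orbT.
rewrite mulnA (mulnC M) leq_mul2r; apply/orP; right.
apply: leq_trans q_le; rewrite mulnCA -expnD //.
Qed.

End Success.

(** * Triples with cost bounds *)

Fixpoint mv (c : cmd) : seq nat :=
  match c with
  | Asg v _ | Rnd v => [:: v]
  | Sq c d | Cond _ c d => mv c ++ mv d
  | Loop _ c => mv c
  | _ => [::]
  end.

Fixpoint ma (c : cmd) : seq nat :=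
  match c with
  | Sto a _ _ => [:: a]
  | Sq c d | Cond _ c d => ma c ++ ma d
  | Loop _ c => ma c
  | _ => [::]
  end.

Definition frame (vs cs : seq nat) (e e' : env) :=
  (forall v, v \notin vs -> vr e' v = vr e v) /\
  (forall a, a \notin cs -> ar e' a =1 ar e a).

Lemma frame_refl vs cs e : frame vs cs e e.
Proof. by split. Qed.

Lemma frame_trans vs cs e1 e2 e3 :
  frame vs cs e1 e2 -> frame vs cs e2 e3 -> frame vs cs e1 e3.
Proof.
move=> [v1 a1] [v2 a2]; split=> [v h|a h i]; first by rewrite v2 // v1.
by rewrite a2 // a1.
Qed.

Lemma frameW vs cs us ds e e' : {subset vs <= us} -> {subset cs <= ds} ->
  frame vs cs e e' -> frame us ds e e'.
Proof.
move=> vu cd [v1 a1]; split=> [v h|a h i].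
  by apply: v1; apply: contra h; apply: vu.
by apply: a1; apply: contra h; apply: cd.
Qed.

Definition For v nv c :=
  Sq (Asg v (K 0))
     (Loop (Bin OpLt (V v) (V nv)) (Sq c (Asg v (Bin OpAdd (V v) (K 1))))).

(* Meaningful for loop-free commands only. *)
Fixpoint cc (c : cmd) : nat :=
  match c with
  | Skip => 0
  | Asg v x => (ecost x).+1
  | Sto a i x => size (ccmd 0 (Sto a i x))
  | Rnd v => 1
  | Sq c d => cc c + cc d
  | Cond x c d => (ecost x).+3 + (cc c + cc d)
  | Loop _ _ => 0
  end.

Fixpoint lf (c : cmd) : bool :=
  match c with
  | Sq c d | Cond _ c d => lf c && lf d
  | Loop _ _ | Rnd _ => false
  | _ => true
  end.

Section Triples.

Variables (w : nat) (ins : seq (seq nat)) (rho : nat -> nat).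
Hypothesis w_large : 7 < w.
Hypothesis small_ins : forall i j, nth 0 (nth [::] ins i) j < 2 ^ w.
Hypothesis small_len : forall i, size (nth [::] ins i) < 2 ^ w.

Notation bs := (bs w ins rho).
Notation ev := (ev ins).
Notation safe := (safe w ins).

Lemma bs_frame c t e t' e' : bs c t e t' e' -> frame (mv c) (ma c) e e'.
Proof.
elim=> {c t e t' e'} /=.
- by move=> *; apply: frame_refl.
- move=> v x t e _; split=> [u|a _ i] //=.
  by rewrite mem_seq1 => /negbTE->.
- move=> a i x t e _ _ _ _; split=> [u|b] //=.
  by rewrite mem_seq1 => /negbTE-> j.
- move=> v t e; split=> [u|a _ i] //=.
  by rewrite mem_seq1 => /negbTE->.
- move=> c d t e t1 e1 t2 e2 _ f1 _ f2; apply: (frame_trans (e2 := e1)).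
    by apply: frameW f1 => x; rewrite mem_cat => ->.
  by apply: frameW f2 => x; rewrite mem_cat orbC => ->.
- by move=> x c d t e t1 e1 _ _ _; apply: frameW => u; rewrite mem_cat => ->.
- by move=> x c d t e t1 e1 _ _ _; apply: frameW => u; rewrite mem_cat orbC => ->.
- by move=> *; apply: frame_refl.
- by move=> x c t e t1 e1 t2 e2 _ _ _ f1 _ f2; apply: frame_trans f1 f2.
Qed.

(** Total correctness from a fixed environment with a time bound. The starting time is arbitrary, so
    a triple suits everything except the drawing of random words. *)
Definition tri c e T (Q : env -> Prop) :=
  wf w e -> forall t, exists t' e', [/\ bs c t e t' e', t' <= t + T & Q e'].

Lemma tri_conseq c e T T' (Q Q' : env -> Prop) : tri c e T Q -> T <= T' ->
  (forall e', frame (mv c) (ma c) e e' -> wf w e' -> Q e' -> Q' e') ->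
  tri c e T' Q'.
Proof.
move=> h TT QQ we t; have [t' [e' [b l q]]] := h we t.
exists t', e'; split=> //; first by lia.
by apply: QQ => //; [apply: bs_frame b | apply: (bs_wf w_large small_ins small_len b)].
Qed.

Lemma tri_seq c d e T1 T2 T (P Q : env -> Prop) : tri c e T1 P -> T1 + T2 <= T ->
  (forall e1, P e1 -> frame (mv c) (ma c) e e1 -> wf w e1 -> tri d e1 T2 Q) ->
  tri (Sq c d) e T Q.
Proof.
move=> h le k we t; have [t1 [e1 [b1 l1 p1]]] := h we t.
have w1 := bs_wf w_large small_ins small_len b1 we.
have [t2 [e2 [b2 l2 q2]]] := k e1 p1 (bs_frame b1) w1 w1 t1.
exists t2, e2; split=> //; last by lia.
exact: bs_sq b1 b2.
Qed.

Lemma tri_cond x c d e T1 T2 T (Q : env -> Prop) :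
  safe e x -> (ecost x).+3 + (T1 + T2) <= T ->
  (ev e x != 0 -> tri c e T1 Q) -> (ev e x = 0 -> tri d e T2 Q) ->
  tri (Cond x c d) e T Q.
Proof.
move=> sx le h1 h2 we t; have [ex|ex] := eqVneq (ev e x) 0.
  have [t' [e' [b l q]]] := h2 ex we (t + (ecost x).+1).
  by exists t'.+2, e'; split=> //; [apply: bs_false | lia].
have [t' [e' [b l q]]] := h1 ex we (t + (ecost x).+1).
by exists t', e'; split=> //; [apply: bs_true | lia].
Qed.

(** Symbolic execution of a loop-free command: [xe] is its final environment and [xs] its safety
    condition, so that its triple is obtained by computation. *)
Fixpoint xe (e : env) (c : cmd) : env :=
  match c with
  | Asg v x => setv e v (ev e x)
  | Sto a i x => seta e a (ev e i) (ev e x)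
  | Sq c d => xe (xe e c) d
  | Cond x c d => if ev e x != 0 then xe e c else xe e d
  | _ => e
  end.

Fixpoint xs (e : env) (c : cmd) : Prop :=
  match c with
  | Asg v x => safe e x
  | Sto a i x => [/\ safe e i, safe e x, a < 32 & ev e i < lim w]
  | Sq c d => xs e c /\ xs (xe e c) d
  | Cond x c d => safe e x /\ (if ev e x != 0 then xs e c else xs e d)
  | _ => True
  end.

Lemma tri_sl c e T (Q : env -> Prop) : lf c -> cc c <= T -> xs e c -> Q (xe e c) ->
  tri c e T Q.
Proof.
move=> + le + q _ t; suff h : forall e t, lf c -> xs e c ->
    exists2 t', bs c t e t' (xe e c) & t' <= t + cc c.
  move=> lc xc; have [t' b l] := h e t lc xc.
  by exists t', (xe e c); split=> //; lia.
elim: c {le e q t} => //=.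
- by move=> e t _ _; exists t; [constructor|rewrite addn0].
- by move=> v x e t _ sx; exists (t + (ecost x).+1); [constructor|].
- by move=> a i x e t _ [s1 s2 s3 s4]; eexists; [constructor|].
- move=> c IHc d IHd e t /andP[lc ld] [sc sd].
  have [t1 b1 l1] := IHc e t lc sc; have [t2 b2 l2] := IHd _ t1 ld sd.
  by exists t2; [apply: bs_sq b1 b2 | lia].
- move=> x c IHc d IHd e t /andP[lc ld] [sx]; case: ifP => ex sc.
    have [t1 b1 l1] := IHc e (t + (ecost x).+1) lc sc.
    by exists t1; [apply: bs_true | lia].
  have [t1 b1 l1] := IHd e (t + (ecost x).+1) ld sc.
  by exists t1.+2; [apply: bs_false => //; apply/eqP/negbFE | lia].
Qed.

Lemma tri_loop_end x c e (Q : env -> Prop) : safe e x -> ev e x = 0 -> Q e ->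
  tri (Loop x c) e (ecost x).+3 Q.
Proof.
by move=> sx ex q _ t; eexists; exists e; split; [apply: bs_stop | | ].
Qed.

Lemma tri_loop_step x c e T1 T2 T (P Q : env -> Prop) : safe e x -> ev e x != 0 ->
  tri c e T1 P -> (ecost x).+3 + (T1 + T2) <= T ->
  (forall e1, P e1 -> frame (mv c) (ma c) e e1 -> wf w e1 -> tri (Loop x c) e1 T2 Q) ->
  tri (Loop x c) e T Q.
Proof.
move=> sx ex h le k we t; have [t1 [e1 [b1 l1 p1]]] := h we (t + (ecost x).+1).
have w1 := bs_wf w_large small_ins small_len b1 we.
have [t2 [e2 [b2 l2 q2]]] := k e1 p1 (bs_frame b1) w1 w1 t1.+2.
by exists t2, e2; split=> //; [apply: bs_iter b1 b2 | lia].
Qed.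

(** An iteration costs 6 steps for the test and its jumps and 4 for the increment; initialization
    costs 2 and the final test 6. *)
Lemma tri_forv v nv c n (kap : nat -> nat) (I : nat -> env -> Prop) e0 T :
  [&& v != nv, v \notin mv c & nv \notin mv c] -> vr e0 nv = n ->
  \sum_(0 <= i < n) (kap i + 10) + 8 <= T ->
  I 0 (setv e0 v 0) ->
  (forall i e, i < n -> vr e v = i -> frame (v :: mv c) (ma c) e0 e -> wf w e ->
     I i e -> tri c e (kap i) (fun e' => I i.+1 (setv e' v i.+1))) ->
  tri (For v nv c) e0 T (fun e => I n e /\ frame (v :: mv c) (ma c) e0 e).
Proof.
move=> /and3P[vnv vc nvc] en le I0 step.
have w1 : 1 < 2 ^ w by rewrite -{1}(expn0 2) ltn_exp2l //; lia.
have c3 : ecost (Bin OpLt (V v) (V nv)) = 3 by [].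
apply: (@tri_seq _ _ _ 2 (\sum_(0 <= i < n) (kap i + 10) + 6) _
    (fun e => [/\ I 0 e, vr e v = 0 & frame (v :: mv c) (ma c) e0 e])).
- apply: tri_sl => //=; first by rewrite expn_gt0.
  split=> //; first by rewrite eqxx.
  by split=> [u|a _ i] //=; rewrite inE negb_or => /andP[/negbTE->].
- by lia.
move=> e1 [I1 v1 f1] _ _.
suff H : forall k i e, k + i = n -> I i e -> vr e v = i ->
    frame (v :: mv c) (ma c) e0 e ->
    tri (Loop (Bin OpLt (V v) (V nv)) (Sq c (Asg v (Bin OpAdd (V v) (K 1))))) e
        (\sum_(i <= i < n) (kap i + 10) + 6)
        (fun e => I n e /\ frame (v :: mv c) (ma c) e0 e).
  by apply: (H n 0) => //; rewrite addn0.
elim=> [|k IH] i e.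
  rewrite add0n => -> In en' fe; rewrite big_geq //.
  apply: tri_loop_end => //=.
  have nve : vr e nv = n by rewrite fe.1 // in_cons negb_or eq_sym vnv.
  by rewrite en' nve ltnn.
move=> ki Ii ei fe we.
have lin : i < n by lia.
have nv_e : vr e nv = n by rewrite fe.1 // in_cons negb_or eq_sym vnv.
move: we; apply: (tri_loop_step (T1 := kap i + 4) (T2 := \sum_(i.+1 <= i < n) (kap i + 10) + 6)
   (P := fun e => [/\ I i.+1 e, vr e v = i.+1 & frame (v :: mv c) (ma c) e0 e])) => //=.
- by rewrite ei nv_e lin.
- move=> we'; move: (we').
  apply: (tri_seq (T1 := kap i) (T2 := 4) (step i e lin ei fe we' Ii)) => //.
  move=> e2 I2 f2 w2; have v2 : vr e2 v = i by rewrite f2.1.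
  apply: tri_sl => //=.
    split=> //; rewrite v2 addn1; apply: leq_ltn_trans lin _.
    by rewrite -nv_e; case: we'.
  rewrite v2 addn1; split=> //; first by rewrite eqxx.
  apply: (frame_trans fe); split=> [u|a h j] /=; last by rewrite f2.2.
  by rewrite inE negb_or => /andP[/negbTE-> /f2.1].
- by rewrite c3 (big_ltn lin); move: (\sum_(i.+1 <= _ < n) _) => q; lia.
by move=> e3 [I3 v3 f3] _ _; apply: IH => //; lia.
Qed.

Lemma tri_for v nv c n kap (I : nat -> env -> Prop) e0 T :
  [&& v != nv, v \notin mv c & nv \notin mv c] -> vr e0 nv = n ->
  n * (kap + 10) + 8 <= T ->
  I 0 (setv e0 v 0) ->
  (forall i e, i < n -> vr e v = i -> frame (v :: mv c) (ma c) e0 e -> wf w e ->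
     I i e -> tri c e kap (fun e' => I i.+1 (setv e' v i.+1))) ->
  tri (For v nv c) e0 T (fun e => I n e /\ frame (v :: mv c) (ma c) e0 e).
Proof.
move=> h1 h2 h3; apply: (tri_forv (kap := fun=> kap)) => //.
by rewrite sum_nat_const_nat subn0.
Qed.

Notation trc c e Q := (tri c e (cc c) Q).

Lemma trc_asg v x d e Q : safe e x ->
  trc d (setv e v (ev e x)) Q -> trc (Sq (Asg v x) d) e Q.
Proof.
move=> sx h; apply: (tri_seq (T1 := (ecost x).+1) (T2 := cc d)
  (P := fun e1 => e1 = setv e v (ev e x))) => //; first exact: tri_sl.
by move=> _ -> _ _.
Qed.

Lemma trc_sto a i x d e Q : safe e i -> safe e x -> a < 32 -> ev e i < lim w ->
  trc d (seta e a (ev e i) (ev e x)) Q -> trc (Sq (Sto a i x) d) e Q.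
Proof.
move=> si sx ha hi h; apply: (tri_seq (T1 := cc (Sto a i x)) (T2 := cc d)
  (P := fun e1 => e1 = seta e a (ev e i) (ev e x))) => //; first exact: tri_sl.
by move=> _ -> _ _.
Qed.

Lemma trc_seq c d e (P Q : env -> Prop) : trc c e P ->
  (forall e1, P e1 -> frame (mv c) (ma c) e e1 -> wf w e1 -> trc d e1 Q) ->
  trc (Sq c d) e Q.
Proof. by move=> h k; apply: tri_seq h _ k. Qed.

Lemma trc_cond x c d e (Q : env -> Prop) : safe e x ->
  (ev e x != 0 -> trc c e Q) -> (ev e x = 0 -> trc d e Q) -> trc (Cond x c d) e Q.
Proof. by move=> sx; apply: tri_cond. Qed.

(** The addresses are distinct, so the body may assume that its own cell and all cells outside the
    range still hold their initial values. This covers updates in place. *)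
Lemma tri_fill2 vi ni vj nj a n m (addr F : nat -> nat -> nat) c e0 T :
  [&& uniq [:: vi; vj; ni], uniq [:: vi; vj; nj] &
      all [predC mv c] [:: vi; vj; ni; nj]] ->
  ma c = [:: a] -> vr e0 ni = n -> vr e0 nj = m ->
  n * (m * (cc c + 10) + 18) + 8 <= T ->
  (forall i j i' j', i < n -> j < m -> i' < n -> j' < m ->
     addr i j = addr i' j' -> i = i' /\ j = j') ->
  (forall i j e, i < n -> j < m -> vr e vi = i -> vr e vj = j ->
     frame (vi :: vj :: mv c) [:: a] e0 e -> wf w e ->
     ar e a (addr i j) = ar e0 a (addr i j) ->
     (forall x, (forall i j, i < n -> j < m -> x <> addr i j) ->
        ar e a x = ar e0 a x) ->
     trc c e (fun e' => ar e' a (addr i j) = F i j /\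
        forall x, x <> addr i j -> ar e' a x = ar e a x)) ->
  tri (For vi ni (For vj nj c)) e0 T (fun e =>
    [/\ forall i j, i < n -> j < m -> ar e a (addr i j) = F i j,
        forall x, (forall i j, i < n -> j < m -> x <> addr i j) ->
          ar e a x = ar e0 a x &
        frame (vi :: vj :: mv c) [:: a] e0 e]).
Proof.
move=> /and3P[/= /and3P[u1 u2 _] /and3P[u3 u4 _] /and5P[u5 u6 u7 u8 _]] ac en em le inj step.
move: u1 u2 u3 u4; rewrite !inE !negb_or => /andP[ij ini] jni /andP[_ inj'] jnj.
pose I i j e := [/\ forall i' j', i' < n -> j' < m ->
    ar e a (addr i' j') = if (i' < i) || ((i' == i) && (j' < j)) then F i' j'
                          else ar e0 a (addr i' j') &
    forall x, (forall i j, i < n -> j < m -> x <> addr i j) -> ar e a x = ar e0 a x].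
have sub e e' : frame (vi :: mv (For vj nj c)) (ma (For vj nj c)) e e' ->
    frame (vi :: vj :: mv c) [:: a] e e'.
  rewrite -ac; apply: frameW => x /=; last by rewrite cats0.
  by rewrite !inE mem_cat inE => /or4P[]->; rewrite ?orbT.
have nin x : vj != x -> x \notin mv c -> x \notin mv (For vj nj c).
  by rewrite /= !inE mem_cat inE !negb_or eq_sym => -> ->.
apply: (tri_conseq (T := n * ((m * (cc c + 10) + 8) + 10) + 8)
   (Q := fun e => I n 0 e /\ frame (vi :: mv (For vj nj c)) (ma (For vj nj c)) e0 e)) => //; last first.
- move=> e' _ _ [[I1 I2] /sub f]; split=> // i j hi hj; by rewrite I1 // hi.
- by apply: leq_trans le; rewrite -addnA.
apply: (tri_for (I := fun i => I i 0)) => //=.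
- by rewrite ini !nin // eq_sym.
- by split=> // i' j' _ _; rewrite ltn0 andbF.
move=> i e hi ei fe we Ie.
have fe' : frame (vi :: vj :: mv c) [:: a] e0 e by apply: sub.
apply: (tri_conseq (T := m * (cc c + 10) + 8)
   (Q := fun e' => I i m e' /\ frame (vj :: mv c) (ma c) e e')) => //; last first.
  move=> e' _ _ [[I1 I2] _]; split=> //= i' j' hi' hj'.
  by rewrite I1 // hj' andbT ltn0 andbF orbF; congr (if _ then _ else _); lia.
apply: (tri_for (I := fun j e => I i j e)) => //=.
- by rewrite jnj u6 u8.
- by rewrite fe'.1 // !inE !negb_or eq_sym inj' eq_sym jnj u8.
move=> j e1 hj ej f1 w1 [I1 I2].
have f01 : frame (vi :: vj :: mv c) [:: a] e0 e1.
  apply: frame_trans fe' _; rewrite -ac.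
  by apply: frameW f1 => // x; rewrite !inE => ->; rewrite orbT.
have e1i : vr e1 vi = i by rewrite f1.1 // !inE !negb_or ij u5.
apply: (tri_conseq (step i j e1 hi hj e1i ej f01 w1 _ I2)) => //.
  by rewrite I1 // ltnn eqxx ltnn.
move=> e2 _ _ [E1 E2]; split=> /= [i' j' hi' hj'|x hx].
  have [/andP[/eqP -> /eqP ->]|ne] := boolP ((i' == i) && (j' == j)).
    by rewrite E1 eqxx ltnS leqnn orbT.
  rewrite E2 ?I1 //; last by move=> /inj[] // e3 e4; move: ne; rewrite e3 e4 !eqxx.
  rewrite ltnS [j' <= j]leq_eqVlt.
  by move: ne; case: eqP => //= _; case: eqP.
by rewrite E2 ?I2 //; apply: hx.
Qed.

End Triples.

(** * Field arithmetic and straight-line programs on the word RAM *)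

Notation "x +' y" := (Bin OpAdd x y) (at level 50, left associativity).
Notation "x -' y" := (Bin OpSub x y) (at level 50, left associativity).
Notation "x *' y" := (Bin OpMul x y) (at level 40, left associativity).
Notation "x ;; y" := (Sq x y) (at level 85, right associativity).

(** Variable 0 is register 0, where the machine expects the length of the output. The cells of an
    output below [HDR] hold its parameters. *)
Notation vlen := 0.
Notation vn := 1.
Notation vBL := 2.
Notation vPW := 3.
Notation vPM := 4.
Notation vPH := 5.
Notation vN := 6.
Notation vE := 7.
Notation vMB := 8.
Notation vS := 30.
Notation vlev := 31.
Notation vcnt := 32.

Notation aSIM := 1.
Notation aSB := 2.
Notation aSL := 3.
Notation aVAL := 4.

Notation HDR := 16.

Section Mul.

Variables (tb : bool) (J : nat).

(* The multiplication table is part of the data structure, which is array 0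
   during preprocessing and input 0 afterwards. *)
Definition tabE x := if tb then Arr 0 (K HDR +' x) else Inp 0 (K HDR +' x).

Definition chunkE a i :=
  Bin OpMod (Bin OpShr (V a) (V vBL *' K i)) (V vPW).

(** The double loop over chunks is unrolled in the program text: [J] is to be a constant, so that a
    field product takes constant time. *)
Definition prodE a b :=
  foldr (fun ij acc =>
           Bin OpXor
             (Bin OpShl (tabE (chunkE a ij.1 *' V vPW +' chunkE b ij.2))
                (V vBL *' K (ij.1 + ij.2)))
             acc)
    (K 0) (allpairs pair (iota 0 J) (iota 0 J)).

Definition mulc d x y :=
  Asg 20 x ;; Asg 21 y ;; Asg 22 (prodE 20 21) ;;
  Asg d (Bin OpXor (Bin OpMod (V 22) (V vPM)) (Bin OpDiv (V 22) (V vPM))).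

(** An operand beyond the current list denotes 0, the default value of [nth] in [slp_step]. *)
Definition slp_fetch d x :=
  Cond (Bin OpLt (V x) (V vcnt)) (Asg d (Arr aVAL (V x))) (Asg d (K 0)).

(** In characteristic 2 the codes for addition and subtraction call for the same operation, and a
    constant matters only modulo 2. *)
Definition slp_step_c :=
  Asg 36 (Arr aSIM (V 33)) ;; Asg 37 (Arr aSIM (V 33 +' K 1)) ;;
  Asg 38 (Arr aSIM (V 33 +' K 2)) ;;
  Cond (V 36)
    (slp_fetch 40 37 ;; slp_fetch 41 38 ;;
     Cond (Bin OpEq (V 36) (K 3)) (mulc 39 (V 40) (V 41))
       (Asg 39 (Bin OpXor (V 40) (V 41))))
    (Asg 39 (Bin OpMod (V 37) (K 2))) ;;
  Sto aVAL (V vcnt) (V 39) ;;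
  Asg vcnt (V vcnt +' K 1) ;; Asg 33 (V 33 +' K 3).

Definition slp_run_c :=
  Asg 33 (Arr aSB (V vlev)) ;; Asg 34 (Arr aSL (V vlev)) ;;
  For 35 34 slp_step_c.

End Mul.

Ltac mulb U := repeat match goal with
  | |- context [muln ?x ?y] =>
    lazymatch goal with
    | H : is_true (muln x y <= U * U) |- _ => fail
    | _ => assert (is_true (muln x y <= U * U)) by (apply: leq_mul; lia)
    end
  end.

Section MulSpec.

Variables (w : nat) (ins : seq (seq nat)) (rho : nat -> nat).
Hypothesis w_large : 7 < w.
Hypothesis small_ins : forall i j, nth 0 (nth [::] ins i) j < 2 ^ w.
Hypothesis small_len : forall i, size (nth [::] ins i) < 2 ^ w.

Variables (tb : bool) (s J m U : nat).
Hypotheses (mJ : m <= s * J) (s0 : 0 < s) (Jw : 2 * (s * J) <= w).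
Hypotheses (Ularge : 1000 <= U) (Ulim : 1000 * (U * U) <= lim w).
Hypothesis sU : 2 ^ s <= U.

Notation tri := (tri w ins rho).

(** [U] bounds counts and side lengths, whereas addresses are quadratic in them; linear terms are
    absorbed into the quadratic budget granted by [Ulim]. *)
Lemma UU : 1000 * U <= U * U. Proof. by rewrite leq_mul2r Ularge orbT. Qed.
Lemma lim_w : lim w <= 2 ^ w. Proof. by rewrite /lim leq_exp2l // leq_subr. Qed.

Definition data e i := if tb then ar e 0 i else nth 0 (nth [::] ins 0) i.

Record params e : Prop := Params {
  p_BL : vr e vBL = s;
  p_PW : vr e vPW = 2 ^ s;
  p_PM : vr e vPM = 2 ^ m;
  p_tab : forall x y, x < 2 ^ s -> y < 2 ^ s -> data e (HDR + (x * 2 ^ s + y)) = ct x y }.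

Lemma prodEP e a b : params e -> vr e a < 2 ^ m -> vr e b < 2 ^ m ->
  safe w ins e (prodE tb J a b) /\
  ev ins e (prodE tb J a b) = wprod s J (vr e a) (vr e b).
Proof.
move=> pe am bm; rewrite /prodE /wprod.
have lw := lim_w; have uu := UU.
have ww : w < 2 ^ w by apply: ltn_expl.
have : all (fun ij => (ij.1 < J) && (ij.2 < J)) (allpairs pair (iota 0 J) (iota 0 J)).
  apply/allP => ij /allpairsP[[i j] [/= hi hj ->]] /=.
  by move: hi hj; rewrite !mem_iota /= !add0n => -> ->.
have J1 : 0 < s * J -> J <= s * J by move=> _; rewrite leq_pmull.
elim: (allpairs _ _ _) => [|[i j] l IH] /=.
  by rewrite expn_gt0.
move=> /andP[/andP[iJ jJ] /IH[sl el]]; rewrite el.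
have siJ : s * i <= s * J by rewrite leq_mul2l ltnW ?orbT.
have sjJ : s * j <= s * J by rewrite leq_mul2l ltnW ?orbT.
have sijJ : s * (i + j) = s * i + s * j by rewrite mulnDr.
have chE v k : ev ins e (chunkE v k) = chunk s k (vr e v).
  by rewrite /= (p_BL pe) (p_PW pe).
have chl v k : chunk s k (vr e v) < 2 ^ s by rewrite ltn_mod expn_gt0.
have JJ : J <= s * J by rewrite leq_pmull.
have xb : chunk s i (vr e a) * 2 ^ s <= U * U.
  by apply: leq_mul => //; apply: leq_trans sU; apply: ltnW.
have yb : chunk s j (vr e b) <= U by apply: leq_trans sU; apply: ltnW.
have idx : ev ins e (chunkE a i *' V vPW +' chunkE b j) =
    chunk s i (vr e a) * 2 ^ s + chunk s j (vr e b).
  by rewrite -!chE /= (p_PW pe).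
have sch v k : k < J -> safe w ins e (chunkE v k).
  move=> kJ; have skJ : s * k <= s * J by rewrite leq_mul2l ltnW ?orbT.
  by rewrite /= (p_BL pe); do !split=> //; lia.
have evt : ev ins e (tabE tb (chunkE a i *' V vPW +' chunkE b j)) =
    ct (chunk s i (vr e a)) (chunk s j (vr e b)).
  by rewrite -(p_tab pe) // /tabE /data -idx; case: (tb).
have sidx : safe w ins e (K HDR +' (chunkE a i *' V vPW +' chunkE b j)) /\
    ev ins e (K HDR +' (chunkE a i *' V vPW +' chunkE b j)) < lim w.
  have E : ev ins e (K HDR +' (chunkE a i *' V vPW +' chunkE b j)) =
    HDR + (chunk s i (vr e a) * 2 ^ s + chunk s j (vr e b)) by rewrite -idx.
  split; last by rewrite E; lia.
  split; [by rewrite /=; lia| |by rewrite /bsafe idx /=; lia].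
  split; [|exact: sch|].
    split; [exact: sch|by []|].
    by change (ev ins e (chunkE a i) * vr e vPW < 2 ^ w); rewrite chE (p_PW pe); lia.
  change (ev ins e (chunkE a i *' V vPW +' chunkE b j) < 2 ^ w).
  by rewrite idx; lia.
split; last first.
  by rewrite evt (p_BL pe).
split=> //; split.
- by rewrite /tabE; case: (tb) => //=; case: sidx.
- by split=> //=; rewrite ?(p_BL pe); lia.
rewrite /bsafe evt /= (p_BL pe).
apply: (leq_trans (ct_shift_lt s i j am bm)).
by rewrite leq_exp2l //; lia.
Qed.

Lemma mulcP d x y e : params e -> safe w ins e x ->
  safe w ins (setv e 20 (ev ins e x)) y ->
  ev ins (setv e 20 (ev ins e x)) y = ev ins e y ->
  ev ins e x < 2 ^ m -> ev ins e y < 2 ^ m ->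
  tri (mulc tb J d x y) e (cc (mulc tb J d x y))
    (fun e' => vr e' d = wmul m s J (ev ins e x) (ev ins e y) /\
               e' = Env (vr e') (ar e)).
Proof.
move=> pe sx sy ey xm ym.
set e2 := setv (setv e 20 (ev ins e x)) 21 (ev ins e y).
have pe2 : params e2 by case: pe.
have [] := @prodEP e2 20 21 pe2; rewrite /= ?eqxx //.
move=> sp ep; apply: tri_sl => //=.
  by rewrite ey -/e2.
rewrite ey -/e2 ep !eqxx /= (p_PM pe); split=> //.
Qed.

End MulSpec.

(** * Matrix operations on the word RAM *)

Lemma nth_allpairs (S T R : Type) (f : S -> T -> R) x0 y0 z0 s t i j :
  i < size s -> j < size t ->
  nth z0 (allpairs f s t) (i * size t + j) = f (nth x0 s i) (nth y0 t j).
Proof.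
elim: s i => // x s IH [|i] hi hj /=.
  by rewrite nth_cat size_map mul0n hj (nth_map y0).
rewrite nth_cat size_map mulSn -addnA ltnNge leq_addr /= addKn.
exact: IH.
Qed.

Lemma size_entries (T : Type) n (A : 'M[T]_n) : size (entries A) = n * n.
Proof. by rewrite size_allpairs size_enum_ord. Qed.

Lemma nth_entries (T : Type) n (A : 'M[T]_n) x0 (i j : 'I_n) :
  nth x0 (entries A) (i * n + j) = A i j.
Proof.
have := @nth_allpairs _ _ _ (fun i j => A i j) i j x0 (enum 'I_n) (enum 'I_n) i j.
by rewrite size_enum_ord !nth_ord_enum => ->.
Qed.

Lemma fill_le n c : 0 < n -> n * (n * (c + 10) + 18) + 8 <= (c + 40) * (n * n + 1).
Proof. by move=> n0; nia. Qed.

Lemma row_inj N i j i' j' : j < N -> j' < N ->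
  i * N + j = i' * N + j' -> i = i' /\ j = j'.
Proof.
move=> h h' E; have N0 : 0 < N by lia.
have := congr1 (divn^~ N) E; rewrite /= !divnMDl // !divn_small // !addn0 => ei.
by split=> //; move: E; rewrite ei => /addnI.
Qed.

Section Gemm.

Variables (tb : bool) (J : nat).

Definition load_c a o d :=
  Sto aVAL (V d +' V 50 *' V vS +' V 51) (Arr a (V o +' V 50 *' V vN +' V 51)).

Definition store_c a :=
  Sto a (V 50 *' V vN +' V 51) (Arr aVAL (V 56 +' V 50 *' V vS +' V 51)).

Definition for2 c := For 50 vS (For 51 vS c).

(** A block lies in its ambient matrix with row stride [vN], whereas a straight-line program expects
    contiguous entries; hence the copies. The product consists of the last [vS * vS] values. *)
Definition gemm a1 o1 a2 o2 a :=
  Asg 57 (K 0) ;; Asg 58 (V vS *' V vS) ;;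
  for2 (load_c a1 o1 57) ;; for2 (load_c a2 o2 58) ;;
  Asg vcnt (V 58 +' V 58) ;;
  slp_run_c tb J ;;
  Asg 56 (V vcnt -' V 58) ;;
  for2 (store_c a).

Definition lin_c al a1 o1 o3 oa :=
  Asg 52 (Arr a1 (V o1 +' V 50 *' V vN +' V 51)) ;;
  mulc tb J 53 (V al) (V 52) ;;
  Sto 0 (V o3 +' V 50 *' V vN +' V 51)
    (if oa is Some a then Bin OpXor (V 53) (Arr a (V 50 *' V vN +' V 51))
     else V 53).

Definition lin al a1 o1 o3 oa := for2 (lin_c al a1 o1 o3 oa).

End Gemm.

Section GemmSpec.

Variables (w : nat) (ins : seq (seq nat)) (rho : nat -> nat).
Hypothesis w_large : 7 < w.
Hypothesis small_ins : forall i j, nth 0 (nth [::] ins i) j < 2 ^ w.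
Hypothesis small_len : forall i, size (nth [::] ins i) < 2 ^ w.

Variables (tb : bool) (s J m U : nat).
Hypotheses (m0 : 0 < m) (mJ : m <= s * J) (s0 : 0 < s) (Jw : 2 * (s * J) <= w).
Hypotheses (Ularge : 1000 <= U) (Ulim : 1000 * (U * U) <= lim w).
Hypothesis sU : 2 ^ s <= U.

Variables (L : fieldType) (z : L).
Hypotheses (char2 : (2%N \in [pchar L])%R) (zm : (z ^+ m = 1)%R).

Notation tri := (tri w ins rho).
Notation trc c e Q := (tri c e (cc c) Q).
Notation params := (params ins tb s m).
Notation phi := (phi z).

Let mul_P := mulcP (ins := ins) (tb := tb) rho w_large mJ s0 Jw Ularge Ulim sU.
Let uu := UU Ularge.
Let lw := lim_w w.
Let xorP a b := phi_xor char2 z a b.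
Let mulP' a b := phi_wmul char2 zm mJ (a := a) (b := b).
Let seqP := tri_seq (ins := ins) (rho := rho) w_large small_ins small_len.
Let conseqP := tri_conseq (ins := ins) (rho := rho) w_large small_ins small_len.
Let trcasgP := trc_asg (ins := ins) (rho := rho) w_large small_ins small_len.
Let trcseqP := trc_seq (ins := ins) (rho := rho) w_large small_ins small_len.

(** The cells of array 0 that multiplication relies on and that must not be overwritten; after
    preprocessing the table is a read-only input. *)
Definition tabsz := if tb then HDR + 2 ^ s * 2 ^ s else 0.

Lemma params_eq e e' : params e ->
  (forall v, v \in [:: vBL; vPW; vPM] -> vr e' v = vr e v) ->
  (forall i, i < tabsz -> ar e' 0 i = ar e 0 i) -> params e'.
Proof.
move=> [b p q t] hv ha; split; rewrite ?hv //.
move=> x y hx hy; rewrite -t // /data; move: ha; rewrite /tabsz.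
case: (tb) => // ha; apply: ha; rewrite ltn_add2l -addnS; apply: (@leq_trans (x * 2 ^ s + 2 ^ s)).
  by rewrite leq_add2l.
by rewrite -mulSnr leq_mul2r hx orbT.
Qed.

Definition fw x (y : L) := x < 2 ^ m /\ phi x = y.

Definition vals e (vs : seq L) :=
  forall i, i < size vs -> fw (ar e aVAL i) (nth 0%R vs i).

Definition slp_val (vs : seq L) i : L :=
  match i with
  | SConst k => k%:R
  | SAdd a b => vs`_a + vs`_b
  | SSub a b => vs`_a - vs`_b
  | SMul a b => vs`_a * vs`_b
  end%R.

Lemma fw0 : fw 0 0%R.
Proof. by split; rewrite ?expn_gt0. Qed.

Lemma slp_fetchP d x e vs : vals e vs -> vr e vcnt = size vs ->
  size vs <= 10 * (U * U) ->
  trc (slp_fetch d x) e (fun e' => fw (vr e' d) (nth 0%R vs (vr e x))).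
Proof.
move=> hv hc hs; apply: trc_cond => //= [|/eqP]; rewrite hc.
  case: ltnP => // h _; apply: tri_sl => //=; last by rewrite eqxx; apply: hv.
  by split=> //; lia.
case: ltnP => // h _; apply: tri_sl => //=; first by rewrite expn_gt0.
by rewrite eqxx nth_default //; apply: fw0.
Qed.

Lemma slp_stepP e vs i p : params e -> vals e vs -> vr e vcnt = size vs ->
  vr e 33 = p -> (forall r, r < 3 -> ar e aSIM (p + r) = nth 0 (slp_instr_words i) r) ->
  p <= U * U -> size vs <= 10 * (U * U) ->
  trc (slp_step_c tb J) e (fun e' =>
    [/\ vals e' (slp_step vs i), vr e' vcnt = (size vs).+1 & vr e' 33 = p.+3]).
Proof.
move=> pe hv hc hp hi pU sU'.
have w1 : 1 < 2 ^ w by rewrite -{1}(expn0 2) ltn_exp2l //; lia.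
have i0 := hi 0 isT; have i1 := hi 1 isT; have i2 := hi 2 isT.
rewrite addn0 in i0.
apply: trcasgP => /=; first by split=> //; lia.
apply: trcasgP => /=; first by split=> //; [split=> //; lia | lia].
apply: trcasgP => /=; first by split=> //; [split=> //; lia | lia].
rewrite hp i0 i1 i2.
set e1 := setv _ 38 _.
have v36 : vr e1 36 = nth 0 (slp_instr_words i) 0 by [].
have v37 : vr e1 37 = nth 0 (slp_instr_words i) 1 by [].
have v38 : vr e1 38 = nth 0 (slp_instr_words i) 2 by [].
have c1 : vr e1 vcnt = size vs by [].
have p1 : vr e1 33 = p by [].
have pe1 : params e1.
  by apply: (params_eq pe) => // v; rewrite !inE => /or3P[] /eqP->.
have hv1 : vals e1 vs by [].
clearbody e1.
apply: (trcseqP (P := fun e2 => fw (vr e2 39) (slp_val vs i))).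
  apply: trc_cond => //; rewrite [ev _ _ _]/= v36; last first.
    case: (i) v37 => // k v37 _; rewrite /= in v37.
    apply: tri_sl => //=; first by split=> //; lia.
    rewrite v37 modn2; split; last exact: phi_odd.
    apply: (@leq_ltn_trans 1); first by case: odd.
    by rewrite -{1}(expn0 2) ltn_exp2l.
  move=> nc; apply: (trcseqP (slp_fetchP _ _ hv1 c1 sU')) => e2 f40 fr2 _.
  have c2 : vr e2 vcnt = size vs by rewrite fr2.1.
  have hv2 : vals e2 vs by move=> k hk; rewrite fr2.2 //; apply: hv1.
  apply: (trcseqP (slp_fetchP _ _ hv2 c2 sU')) => e3 f41 fr3 _.
  have v36' : vr e3 36 = nth 0 (slp_instr_words i) 0 by rewrite fr3.1 // fr2.1.
  have {}f40 : fw (vr e3 40) (nth 0%R vs (vr e1 37)) by rewrite fr3.1.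
  have {}f41 : fw (vr e3 41) (nth 0%R vs (vr e1 38)).
    by rewrite (_ : vr e1 38 = vr e2 38) // fr2.1.
  have pe3 : params e3.
    apply: (params_eq pe1) => [v|k _]; last by rewrite fr3.2 // fr2.2.
    by rewrite !inE => /or3P[] /eqP->; rewrite fr3.1 // fr2.1.
  rewrite v37 in f40; rewrite v38 in f41.
  have [[l40 h40] [l41 h41]] := (f40, f41).
  have w3 : 3 < 2 ^ w by lia.
  have sf : safe w ins e3 (Bin OpEq (V 36) (K 3)) by rewrite /=; split.
  apply: trc_cond => //.
    rewrite [ev _ _ _]/= v36' => h3.
    apply: (conseqP (mul_P 39 (x := V 40) (y := V 41) pe3 _ _ _ _ _)) => //=.
    move=> e4 _ _ [-> _]; split; first exact: wmul_lt.
    by rewrite mulP' // h40 h41; case: (i) h3.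
  rewrite [ev _ _ _]/= v36' => h3.
  apply: tri_sl => //=; split; first exact: lxor_lt.
  rewrite xorP h40 h41; case: (i) h3 nc => //= a b _ _.
  by rewrite (oppr_pchar2 char2).
move=> e2 [l39 h39] fr2 _.
have c2 : vr e2 vcnt = size vs by rewrite fr2.1.
have p2 : vr e2 33 = p by rewrite fr2.1.
have hv2 : vals e2 vs by move=> k hk; rewrite fr2.2 //; apply: hv1.
apply: tri_sl => //=; rewrite c2 p2.
  by do !split=> //; lia.
rewrite ?eqxx addn1 addn3 /slp_step; split=> // k.
rewrite size_rcons ltnS leq_eqVlt nth_rcons /= => /orP[/eqP->|hk].
  by rewrite eqxx ltnn; split.
by rewrite hk (_ : (k == size vs) = false) ?ltn_eqF //; apply: hv2.
Qed.

Definition slp_at e b (sl : slp) :=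
  forall q, q < size sl -> forall r, r < 3 ->
    ar e aSIM (b + 3 * q + r) = nth 0 (slp_instr_words (nth (SConst 0) sl q)) r.

Lemma slp_runP e j b sl vs : params e -> vals e vs -> vr e vcnt = size vs ->
  vr e vlev = j -> ar e aSB j = b -> ar e aSL j = size sl -> slp_at e b sl ->
  j <= U -> b <= U -> 3 * size sl <= U -> size vs <= 5 * (U * U) ->
  tri (slp_run_c tb J) e (size sl * (cc (slp_step_c tb J) + 10) + 30) (fun e' =>
    vals e' (slp_eval vs sl) /\ vr e' vcnt = size vs + size sl).
Proof.
move=> pe hv hc hj hb hl hsl jU bU lU sU'.
apply: (seqP (T1 := 8) (T2 := size sl * (cc (slp_step_c tb J) + 10) + 20)
   (P := fun e1 => e1 = setv e 33 b)).
- by apply: tri_sl => //=; [split=> //; lia | rewrite hj hb].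
- by lia.
move=> _ -> _ _.
apply: (seqP (T1 := 8) (T2 := size sl * (cc (slp_step_c tb J) + 10) + 8)
   (P := fun e1 => e1 = setv (setv e 33 b) 34 (size sl))).
- by apply: tri_sl => //=; [split=> //; lia | rewrite hj hl].
- by lia.
move=> _ -> _ _.
set e1 := setv _ 34 _.
pose I q (e' : env) := [/\ vals e' (slp_eval vs (take q sl)),
   vr e' vcnt = size vs + q & vr e' 33 = b + 3 * q].
have sz_eval q : size (slp_eval vs (take q sl)) = size vs + size (take q sl).
  elim: q (vs) => [|q IH] us; rewrite ?take0 ?addn0 //.
  elim: (take _ _) us => [|i l IHl] us /=; rewrite ?addn0 // IHl size_rcons addSnnS //.
apply: (conseqP (T := size sl * (cc (slp_step_c tb J) + 10) + 8)
   (Q := fun e' => I (size sl) e' /\ frame (35 :: mv (slp_step_c tb J)) (ma (slp_step_c tb J)) e1 e')).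
- apply: (tri_for w_large small_ins small_len) => //.
    by split; rewrite ?take0 ?addn0 ?muln0 //= addn0.
  move=> q e' hq eq f1 w' [I1 I2 I3].
  have pe' : params e'.
    apply: (params_eq pe) => [v|k _]; last by rewrite f1.2.
    by rewrite !inE => /or3P[] /eqP->; rewrite f1.1.
  have szt : size (slp_eval vs (take q sl)) = size vs + q.
    by rewrite sz_eval size_takel // ltnW.
  apply: (conseqP (slp_stepP (i := nth (SConst 0) sl q) pe' I1 _ I3 _ _ _)) => //.
  + by rewrite I2 szt.
  + by move=> r hr; rewrite f1.2 // hsl.
  + by lia.
  + by rewrite szt; lia.
  move=> e2 _ _ [J1 J2 J3]; split=> /=.
  + by rewrite (take_nth (SConst 0) hq) /slp_eval foldl_rcons.
  + by rewrite J2 szt addnS.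
  + by rewrite J3; lia.
- by [].
by move=> e' _ _ [[I1 I2 _] _]; rewrite take_size in I1.
Qed.

Definition mem e a o N k (A : 'M[L]_k) :=
  forall i j : 'I_k, fw (ar e a (o + i * N + j)) (A i j).

Lemma mem_eq e e' a o N k (A : 'M[L]_k) : mem e a o N A ->
  (forall i j, i < k -> j < k -> ar e' a (o + i * N + j) = ar e a (o + i * N + j)) ->
  mem e' a o N A.
Proof. by move=> h he i j; rewrite he. Qed.

Section Level.

Variables (j : nat) (sl : slp).
Let S := sz j.
Hypothesis slP : slp_multiplies S sl.

Lemma load_fill a o d k N e (A : 'M[L]_S) : vr e vN = N -> vr e vS = S ->
  vr e d = k -> S <= N -> N <= U -> mem e a (vr e o) N A -> vr e o <= 3 * (U * U) ->
  k <= 2 * (U * U) -> a < 32 -> a != aVAL -> [&& o != 50, o != 51, d != 50 & d != 51] ->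
  tri (for2 (load_c a o d)) e ((cc (load_c a o d) + 40) * (S * S + 1)) (fun e' =>
    [/\ forall i j : 'I_S, fw (ar e' aVAL (k + i * S + j)) (A i j),
        forall x, x < k -> ar e' aVAL x = ar e aVAL x &
        frame [:: 50; 51] [:: aVAL] e e']).
Proof.
move=> eN eS ek SN NU hm oU kU a32 aV /and4P[no50 no51 d50 d51].
have S0 : 0 < S := sz_gt0 j.
apply: (conseqP (tri_fill2 (a := aVAL) (n := S) (m := S) w_large small_ins small_len
   (addr := fun i j => k + i * S + j)
   (F := fun i j => ar e a (vr e o + i * N + j)) (T := (cc (load_c a o d) + 40) * (S * S + 1)) _ _ _ _ _ _ _)) => //.
- exact: fill_le.
- by move=> i q i' q' _ hq _ hq'; rewrite -!addnA => /addnI; apply: row_inj.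
- move=> i q e1 hi hq ei eq f1 w1 _ _.
  rewrite [mv _]/= in f1; have [g1 g2] := f1.
  have o1 : vr e1 o = vr e o.
    apply: g1.
    rewrite !inE !negb_or.
    by rewrite no50 no51.
  have d1 : vr e1 d = k by rewrite -ek; apply: g1; rewrite !inE !negb_or d50 d51.
  have N1 : vr e1 vN = N by rewrite g1.
  have S1 : vr e1 vS = S by rewrite g1.
  have iS : i * S <= U * U by apply: leq_mul; lia.
  have iN : i * N <= U * U by apply: leq_mul; lia.
  apply: tri_sl => //=; rewrite o1 d1 N1 S1 ei eq.
    by do !split=> //; lia.
  rewrite !eqxx; split=> [|x hx]; first by rewrite g2 // inE.
  by case: eqP.
move=> e' _ _ [F1 F2 f1]; split=> [i q|x hx|//].
  by rewrite F1 //; apply: hm.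
by apply: F2 => i q _ _; lia.
Qed.

Lemma store_fill a k N e (A : 'M[L]_S) : vr e vN = N -> vr e vS = S ->
  vr e 56 = k -> S <= N -> N <= U -> k <= 20 * (U * U) -> a < 32 -> a != aVAL ->
  (forall i j : 'I_S, fw (ar e aVAL (k + i * S + j)) (A i j)) ->
  tri (for2 (store_c a)) e ((cc (store_c a) + 40) * (S * S + 1)) (fun e' => mem e' a 0 N A).
Proof.
move=> eN eS ek SN NU kU a32 aV hv.
have S0 : 0 < S := sz_gt0 j.
apply: (conseqP (tri_fill2 (a := a) (n := S) (m := S) w_large small_ins small_len
   (addr := fun i j => i * N + j)
   (F := fun i j => ar e aVAL (k + i * S + j)) (T := (cc (store_c a) + 40) * (S * S + 1)) _ _ _ _ _ _ _)) => //.
- exact: fill_le.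
- by move=> i q i' q' _ hq _ hq'; apply: row_inj; lia.
- move=> i q e1 hi hq ei eq f1 w1 _ _.
  rewrite [mv _]/= in f1; have [g1 g2] := f1.
  have d1 : vr e1 56 = k by rewrite g1.
  have N1 : vr e1 vN = N by rewrite g1.
  have S1 : vr e1 vS = S by rewrite g1.
  have iS : i * S <= U * U by apply: leq_mul; lia.
  have iN : i * N <= U * U by apply: leq_mul; lia.
  apply: tri_sl => //=; rewrite d1 N1 S1 ei eq.
    by do !split=> //; lia.
  rewrite !eqxx; split=> [|x hx]; first by rewrite g2 // inE eq_sym.
  by case: eqP.
move=> e' _ _ [F1 F2 f1] i q.
by rewrite add0n F1.
Qed.

Definition gemm_cost a1 o1 a2 o2 a :=
  (cc (load_c a1 o1 57) + cc (load_c a2 o2 58) + cc (store_c a) +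
   cc (slp_step_c tb J) + 300).

Lemma gemmP e a1 o1 a2 o2 a N b (A B : 'M[L]_S) : params e ->
  vr e vN = N -> vr e vS = S -> vr e vlev = j ->
  ar e aSB j = b -> ar e aSL j = size sl -> slp_at e b sl ->
  j <= U -> b <= U -> 3 * size sl <= U -> S <= N -> N <= U ->
  mem e a1 (vr e o1) N A -> mem e a2 (vr e o2) N B ->
  vr e o1 <= 3 * (U * U) -> vr e o2 <= 3 * (U * U) ->
  [&& a1 < 32, a2 < 32, a < 32, a1 != aVAL, a2 != aVAL & a != aVAL] ->
  all [predC [:: 50; 51; 57; 58]] [:: o1; o2] ->
  tri (gemm tb J a1 o1 a2 o2 a) e
    (gemm_cost a1 o1 a2 o2 a * (size sl + S * S + 1))
    (fun e' => mem e' a 0 N (A *m B)%R).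
Proof.
move=> pe eN eS ej eb el hsl jU bU lU SN NU hA hB oU1 oU2.
move=> /and5P[a1l a2l al a1v /andP[a2v av]] /= /and3P[].
rewrite !inE !negb_or => /and4P[no11 no12 no13 no14] /and4P[no21 no22 no23 no24] _.
have S0 : 0 < S := sz_gt0 j.
have SS : S * S <= U * U by apply: leq_mul; lia.
have SSm : S <= S * S by rewrite leq_pmulr.
rewrite /gemm_cost.
set c1 := cc (load_c a1 o1 57); set c2 := cc (load_c a2 o2 58).
set c3 := cc (store_c a); set c4 := cc (slp_step_c tb J).
set R3 := (c3 + 40) * (S * S + 1).
set R4 := size sl * (c4 + 10) + 30.
set R2 := (c2 + 40) * (S * S + 1).
set R1 := (c1 + 40) * (S * S + 1).
apply: (conseqP (T := 2 + (4 + (R1 + (R2 + (4 + (R4 + (4 + R3)))))))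
  (Q := fun e' => mem e' a 0 N (A *m B)%R)) => //; last first.
  by rewrite /R1 /R2 /R3 /R4; nia.
apply: (seqP (T1 := 2) (P := fun e1 => e1 = setv e 57 0)) => //.
  by apply: tri_sl => //=; rewrite expn_gt0.
move=> _ -> _ _.
apply: (seqP (T1 := 4) (P := fun e1 => e1 = setv (setv e 57 0) 58 (S * S))) => //.
  by apply: tri_sl => //=; rewrite eS //; split=> //; lia.
move=> _ -> _ _; set e1 := setv _ 58 _.
have h1 : mem e1 a1 (vr e1 o1) N A by rewrite /= (negbTE no13) (negbTE no14).
have o1e : vr e1 o1 <= 3 * (U * U) by rewrite /= (negbTE no13) (negbTE no14).
apply: (seqP (load_fill (k := 0) (N := N) (A := A) _ _ _ _ _ h1 o1e _ _ _ _)) => //=.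
  by rewrite no11 no12.
move=> e2 [v2 _ [g2 k2]] _ _.
have o2e : vr e2 o2 = vr e o2.
  by rewrite g2 /= ?(negbTE no23) ?(negbTE no24) // !inE negb_or no21.
have h2 : mem e2 a2 (vr e2 o2) N B.
  by rewrite o2e => x y; rewrite k2 ?inE //; apply: hB.
have N2 : vr e2 vN = N by rewrite g2.
have S2 : vr e2 vS = S by rewrite g2.
have d2 : vr e2 58 = S * S by rewrite g2.
have c2b : [&& o2 != 50, o2 != 51, 58 != 50 & 58 != 51] by rewrite no21 no22.
have o2b : vr e2 o2 <= 3 * (U * U) by rewrite o2e.
have SS2 : S * S <= 2 * (U * U) by lia.
apply: (seqP (load_fill N2 S2 d2 SN NU h2 o2b SS2 a2l a2v c2b)) => //.
move=> e3 [v3 b3 [g3 k3]] _ _.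
apply: (seqP (T1 := 4) (P := fun e4 => e4 = setv e3 vcnt (S * S + S * S))) => //.
  by apply: tri_sl => //=; rewrite g3 // g2 //=; split=> //; lia.
move=> _ -> _ _; set e4 := setv _ _ _.
have g4 v : v \notin [:: 50; 51; 57; 58; vcnt] -> vr e4 v = vr e v.
  rewrite !inE !negb_or => /and5P[n1 n2 n3 n4 n5].
  rewrite /= (negbTE n5) g3 ?inE ?negb_or ?n1 // g2 ?inE ?negb_or ?n1 //=.
  by rewrite (negbTE n4) (negbTE n3).
have k4 c : c != aVAL -> ar e4 c =1 ar e c.
  by move=> hc x; rewrite /= k3 ?inE // k2 ?inE.
have pe4 : params e4.
  apply: (params_eq pe) => [v|x _]; last by rewrite k4.
  by rewrite !inE => /or3P[] /eqP->; rewrite g4.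
have va : vals e4 (entries A ++ entries B).
  move=> q; rewrite size_cat !size_entries nth_cat size_entries => hq.
  have dm p : p < S * S -> exists i k : 'I_S, p = i * S + k.
    move=> hp; have hd : p %/ S < S by rewrite ltn_divLR.
    have hm : p %% S < S by rewrite ltn_mod.
    by exists (Ordinal hd), (Ordinal hm); apply: divn_eq.
  case: ltnP => h.
    have [i [k ek]] := dm q h; rewrite ek nth_entries /= b3 -?ek // ek.
    by rewrite -[_ + _]add0n addnA; apply: v2.
  have [|i [k ek]] := dm (q - S * S); first by lia.
  rewrite ek nth_entries (_ : q = S * S + i * S + k); last by lia.
  exact: v3.
have sva : size (entries A ++ entries B) = S * S + S * S.
  by rewrite size_cat !size_entries.
apply: (seqP (slp_runP (j := j) (b := b) (sl := sl) pe4 va _ _ _ _ _ _ _ _ _)) => //.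
- by rewrite g4.
- by rewrite k4.
- by rewrite k4.
- by move=> q hq r hr; rewrite k4 // hsl.
- by rewrite sva; lia.
move=> e5 [v5 c5] f5 _; rewrite sva in c5.
have d5 : vr e5 58 = S * S by rewrite f5.1 //= g3 // g2.
apply: (seqP (T1 := 4) (P := fun e6 => e6 = setv e5 56 (S * S + size sl))) => //.
  apply: tri_sl => //=; rewrite c5 d5; last by congr setv; lia.
  by split=> //; lia.
move=> _ -> _ _.
have mulS := slP A B; rewrite /= in mulS.
have se : size (slp_eval (entries A ++ entries B) sl) = S * S + S * S + size sl.
  rewrite -sva; elim: (sl) (entries A ++ entries B) => [|i l IHl] us; rewrite ?addn0 //=.
  by rewrite IHl size_rcons addSnnS.
apply: (store_fill (k := S * S + size sl)) => //=.
- by rewrite f5.1 // g4.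
- by rewrite f5.1 // g4.
- by lia.
move=> i k.
have kS := ltn_ord k; have iS : i * S + S <= S * S by rewrite -mulSnr leq_mul2r ltn_ord orbT.
have hq : S * S + size sl + i * S + k < size (slp_eval (entries A ++ entries B) sl).
  by rewrite se; lia.
have := v5 _ hq; rewrite -(nth_entries (A *m B)%R 0%R i k) -mulS nth_drop se.
by rewrite (_ : S * S + size sl + i * S + k =
  S * S + S * S + size sl - S * S + (i * S + k)) //; lia.
Qed.

(** A source in array 0 must be the target block itself: each cell is then read just before it is
    overwritten, and no other read interferes. *)
Lemma linP e al a1 o1 o3 oa N x (A B : 'M[L]_S) : params e ->
  vr e vN = N -> vr e vS = S -> S <= N -> N <= U ->
  mem e a1 (vr e o1) N A -> (if oa is Some a then mem e a 0 N B else B = 0%R) ->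
  fw (vr e al) x -> vr e o1 <= 3 * (U * U) -> vr e o3 <= 3 * (U * U) ->
  tabsz <= vr e o3 -> (if a1 == 0 then vr e o1 == vr e o3 else true) ->
  (if oa is Some a then (0 < a) && (a < 32) else true) -> a1 < 32 ->
  all [predC [:: 50; 51; 52; 53; 20; 21; 22]] [:: al; o1; o3] ->
  tri (lin tb J al a1 o1 o3 oa) e
    ((cc (lin_c tb J al a1 o1 o3 oa) + 40) * (S * S + 1))
    (fun e' => mem e' 0 (vr e o3) N (x *: A + B)%R /\
       forall y, (forall i k, i < S -> k < S -> y <> vr e o3 + i * N + k) ->
         ar e' 0 y = ar e 0 y).
Proof.
move=> pe eN eS SN NU hA hB hx oU1 oU3 ot oo oal a1l /= /and4P[].
rewrite !inE !negb_or => /and5P[l1 l2 l3 l4 /and3P[l5 l6 l7]].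
move=> /and5P[p1 p2 p3 p4 /and3P[p5 p6 p7]] /and5P[q1 q2 q3 q4 /and3P[q5 q6 q7]] _.
have S0 : 0 < S := sz_gt0 j.
pose ad i k := vr e o3 + i * N + k.
pose Bw i k := if oa is Some a then ar e a (i * N + k) else 0.
pose F i k := Nat.lxor (wmul m s J (vr e al) (ar e a1 (vr e o1 + i * N + k))) (Bw i k).
have mvl : mv (lin_c tb J al a1 o1 o3 oa) = [:: 52; 20; 21; 22; 53] by [].
apply: (conseqP (tri_fill2 (a := 0) (n := S) (m := S) w_large small_ins small_len
   (addr := ad) (F := F) (T := (cc (lin_c tb J al a1 o1 o3 oa) + 40) * (S * S + 1)) _ _ _ _ _ _ _)) => //.
- exact: fill_le.
- by move=> i q i' q' _ hq _ hq'; rewrite /ad -!addnA => /addnI; apply: row_inj; lia.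
- move=> i q e1 hi hq ei eq f1 w1 own out.
  rewrite mvl in f1.
  have [g1 g2] := f1.
  have N1 : vr e1 vN = N by rewrite g1.
  have o1' : vr e1 o1 = vr e o1 by rewrite g1 // !inE !negb_or p1 p2 p3 p4 p5 p6 p7.
  have o3' : vr e1 o3 = vr e o3 by rewrite g1 // !inE !negb_or q1 q2 q3 q4 q5 q6 q7.
  have al' : vr e1 al = vr e al by rewrite g1 // !inE !negb_or l1 l2 l3 l4 l5 l6 l7.
  have iN : i * N <= U * U by apply: leq_mul; lia.
  have rd : ar e1 a1 (vr e o1 + i * N + q) = ar e a1 (vr e o1 + i * N + q).
    move: oo; case: (eqVneq a1 0) => [-> /eqP E|n0 _]; last by rewrite g2 // inE.
    by rewrite E -/(ad i q) own.
  apply: trcasgP => /=; first by rewrite o1' N1 ei eq; do !split=> //; lia.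
  rewrite o1' N1 ei eq rd; set v := ar e a1 _.
  have fv : fw v (A (Ordinal hi) (Ordinal hq)) := hA (Ordinal hi) (Ordinal hq).
  set e2 := setv e1 52 v.
  have al2 : vr e2 al = vr e al by rewrite /= (negbTE l3).
  have pe2 : params e2.
    apply: (params_eq pe) => [u|y hy] /=.
      by rewrite !inE => /or3P[] /eqP->; rewrite /= g1.
    by rewrite out // => i' q' _ _; rewrite /ad; lia.
  have [v1 v2] := fv; have [x1 x2] := hx.
  apply: (trcseqP (mul_P 53 (x := V al) (y := V 52) pe2 _ _ _ _ _)) => //=.
    by rewrite (negbTE l3) al'.
  rewrite (negbTE l3) al' => e3 [v53 ->] [g3 k3] _.
  have E53 : vr e3 53 = wmul m s J (vr e al) v by [].
  have o33 : vr e3 o3 = vr e o3.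
    by rewrite g3 /= ?(negbTE q3) // !inE !negb_or q4 q5 q6 q7.
  have e3i : vr e3 50 = i by rewrite g3 //=.
  have e3q : vr e3 51 = q by rewrite g3 //=.
  have e3N : vr e3 vN = N by rewrite g3 //=.
  have wl : wmul m s J (vr e al) v < 2 ^ m by apply: wmul_lt.
  apply: tri_sl => //=; rewrite ?o33 ?e3i ?e3q ?e3N.
    split=> //; [by do !split=> //; lia | | by lia].
    case: (oa) oal => //= a /andP[a0 a32]; do !split=> //; lia.
  rewrite !eqxx; split=> [|y hy]; last by case: eqP.
  rewrite /F /Bw -/v; case: (oa) oal => [a /andP[a0 a32]|_] /=.
    by rewrite E53 e3i e3q e3N g2 // inE -lt0n.
  by rewrite E53 Nat.lxor_0_r.
move=> e' _ _ [F1 F2 f1]; split=> // i q.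
rewrite F1 // /F; have [v1 v2] := hA i q; have [x1 x2] := hx.
have [b1 b2] : fw (Bw i q) (B i q).
  rewrite /Bw; case: (oa) hB => [a hB|->]; last by rewrite mxE; apply: fw0.
  by have := hB i q; rewrite add0n.
split; first by apply: lxor_lt => //; apply: wmul_lt.
by rewrite xorP mulP' // x2 v2 b2 !mxE.
Qed.

End Level.
End GemmSpec.

(** * Block inversion on the word RAM *)

Section Inv.

Variables (tb : bool) (J : nat).

Definition leaf_c :=
  Asg 69 (V vMB +' V 60 *' V vN +' V 60) ;;
  Sto 5 (V 62) (Arr 0 (V 69)) ;; Asg 62 (V 62 +' K 1) ;;
  Sto 0 (V 69) (K 1) ;; Asg 60 (V 60 +' K 1) ;; Asg vlev (K 0) ;;
  Asg vS (K 1) ;; Asg 61 (K 0).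

(* Offsets of the four blocks of the block of size [2 * S] at row [V 69]. *)
Definition offs_c :=
  Asg 63 (V vMB +' V 69 *' V vN +' V 69) ;; Asg 64 (V 63 +' V vS) ;;
  Asg 65 (V 63 +' V vS *' V vN) ;; Asg 66 (V 65 +' V vS).

(** The Schur complement replaces the lower right block; the two off-diagonal blocks are left in
    place for [post_c]. The scratch arrays do not survive the inversion of the complement, so
    [post_c] recomputes the products. *)
Definition mid_c :=
  (Asg 69 (V 60 -' V vS) ;; offs_c) ;;
  gemm tb J 0 63 0 64 6 ;; gemm tb J 0 65 6 71 7 ;;
  Asg 67 (Arr 5 (V 62 -' K 1)) ;;
  lin tb J 67 0 66 66 (Some 7) ;; Asg 61 (K 1).

(** All five products are put into scratch arrays before any block is overwritten, since each block
    of the result depends on several blocks of the input. *)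
Definition post_c :=
  (Asg 69 (V 60 -' (V vS +' V vS)) ;; offs_c) ;;
  gemm tb J 0 63 0 64 6 ;; gemm tb J 6 71 0 66 7 ;;
  gemm tb J 0 65 0 63 8 ;; gemm tb J 7 71 8 71 9 ;;
  gemm tb J 0 66 8 71 10 ;;
  (Asg 68 (Arr 5 (V 62 -' K 1)) ;; Asg 67 (Arr 5 (V 62 -' K 2))) ;;
  lin tb J 68 0 63 63 (Some 9) ;; lin tb J 67 7 71 64 None ;;
  lin tb J 67 10 71 65 None ;; mulc tb J 70 (V 67) (V 67) ;;
  lin tb J 70 0 66 66 None ;; mulc tb J 70 (V 67) (V 68) ;;
  Sto 5 (V 62 -' K 2) (V 70) ;; Asg 62 (V 62 -' K 1) ;;
  Asg vlev (V vlev +' K 1) ;; Asg vS (V vS +' V vS).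

(** The recursion as a flat loop. When a block of size [vS] ending at row [V 60] is done, the parity
    of [V 60] divided by [vS] tells whether it is the left half of its parent, to be followed by
    elimination, or the right half, to be followed by merging. [V 61] asks for a new leaf, and array
    5 is the stack of denominators, of height [V 62]. *)
Definition inv_body :=
  Cond (V 61) leaf_c
    (Cond (Bin OpMod (Bin OpDiv (V 60) (V vS)) (K 2)) mid_c post_c).

Definition inv_loop := Loop (Bin OpOr (V 61) (Bin OpLt (V vlev) (V vE))) inv_body.

Definition inv_c :=
  (Asg 60 (K 0) ;; Asg 61 (K 1) ;; Asg 62 (K 0) ;; Asg 71 (K 0) ;; Asg vlev (K 0)) ;;
  inv_loop ;; Asg 11 (Arr 5 (K 0)).

Definition inv_const :=
  gemm_cost tb J 0 63 0 64 6 + gemm_cost tb J 0 65 6 71 7 +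
  gemm_cost tb J 6 71 0 66 7 + gemm_cost tb J 0 65 0 63 8 +
  gemm_cost tb J 7 71 8 71 9 + gemm_cost tb J 0 66 8 71 10 +
  cc (lin_c tb J 67 0 66 66 (Some 7)) + cc (lin_c tb J 68 0 63 63 (Some 9)) +
  cc (lin_c tb J 67 7 71 64 None) + cc (lin_c tb J 67 10 71 65 None) +
  cc (lin_c tb J 70 0 66 66 None) + cc (mulc tb J 70 (V 67) (V 67)) +
  cc (mulc tb J 70 (V 67) (V 68)) + 1000.

End Inv.

Section InvSpec.

Variables (w : nat) (ins : seq (seq nat)) (rho : nat -> nat).
Hypothesis w_large : 7 < w.
Hypothesis small_ins : forall i j, nth 0 (nth [::] ins i) j < 2 ^ w.
Hypothesis small_len : forall i, size (nth [::] ins i) < 2 ^ w.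

Variables (tb : bool) (s J m U : nat).
Hypotheses (m0 : 0 < m) (mJ : m <= s * J) (s0 : 0 < s) (Jw : 2 * (s * J) <= w).
Hypotheses (Ularge : 1000 <= U) (Ulim : 1000 * (U * U) <= lim w).
Hypothesis sU : 2 ^ s <= U.

Variables (L : fieldType) (z : L).
Hypotheses (char2 : (2%N \in [pchar L])%R) (zm : (z ^+ m = 1)%R).

Variables (E MB : nat) (bs : nat -> nat) (sls : nat -> slp).
Hypothesis slsP : forall i, slp_multiplies (sz i) (sls i).
Let N := sz E.
Hypotheses (EU : E <= U) (NU : N <= U) (MBU : MB <= U * U).
Hypothesis bsU : forall i, i < E -> bs i <= U /\ 3 * size (sls i) <= U.
Hypothesis MBt : tabsz tb s <= MB.

Notation tri := (tri w ins rho).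
Notation trc c e Q := (tri c e (cc c) Q).
Notation fw := (fw m z).
Notation mem := (mem m z).

Let mul_P := mulcP (ins := ins) (tb := tb) rho w_large mJ s0 Jw Ularge Ulim sU.
Let uu := UU Ularge.
Let lw := lim_w w.
Let seqP := tri_seq (ins := ins) (rho := rho) w_large small_ins small_len.
Let conseqP := tri_conseq (ins := ins) (rho := rho) w_large small_ins small_len.
Let condP := tri_cond (ins := ins) (rho := rho) w_large.
Let gem_P := gemmP (ins := ins) rho w_large small_ins small_len (tb := tb) m0 mJ s0 Jw Ularge Ulim sU char2 zm.
Let lin_P := linP (ins := ins) rho w_large small_ins small_len (tb := tb) m0 mJ s0 Jw Ularge Ulim sU char2 zm.

Record rdy e : Prop := Rdy {
  r_par : params ins tb s m e;
  r_N : vr e vN = N;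
  r_E : vr e vE = E;
  r_MB : vr e vMB = MB;
  r_z : vr e 71 = 0;
  r_slp : forall i, i < E ->
    [/\ ar e aSB i = bs i, ar e aSL i = size (sls i) & slp_at e (bs i) (sls i)] }.

Lemma rdy_frame vs cs e e' : rdy e -> frame vs cs e e' ->
  all [predC vs] [:: vBL; vPW; vPM; vN; vE; vMB; 71] ->
  all [predC cs] [:: aSIM; aSB; aSL] ->
  (forall i, i < MB -> ar e' 0 i = ar e 0 i) -> rdy e'.
Proof.
move=> [p n_ e_ b_ z_ sl_] [fv fa] /allP hv /allP hc h0; split.
- apply: (params_eq p) => [v hin|i hi].
    by apply: fv; apply: hv; move: hin; rewrite !inE => /or3P[]->; rewrite ?orbT.
  by apply: h0; apply: leq_trans hi MBt.
- by rewrite fv //; apply: hv.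
- by rewrite fv //; apply: hv.
- by rewrite fv //; apply: hv.
- by rewrite fv //; apply: hv.
move=> i hi; have [s1 s2 s3] := sl_ i hi; split.
- by rewrite fa //; apply: hc.
- by rewrite fa //; apply: hc.
- by move=> q hq r hr; rewrite fa ?s3 //; apply: hc.
Qed.

Lemma mem_block e a o S (A B C D : 'M[L]_S) :
  mem e a o N (block_mx A B C D) <->
  [/\ mem e a o N A, mem e a (o + S) N B, mem e a (o + S * N) N C &
      mem e a (o + S * N + S) N D].
Proof.
split=> [h|[hA hB hC hD] i k].
  split=> i k.
  - by have := h (lshift S i) (lshift S k); rewrite block_mxEul.
  - have := h (lshift S i) (rshift S k); rewrite block_mxEur /=.
    by rewrite (_ : o + i * N + (S + k) = o + S + i * N + k) //; lia.
  - have := h (rshift S i) (lshift S k); rewrite block_mxEdl /= mulnDl.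
    by rewrite (_ : o + (S * N + i * N) + k = o + S * N + i * N + k) //; lia.
  - have := h (rshift S i) (rshift S k); rewrite block_mxEdr /= mulnDl.
    by rewrite (_ : o + (S * N + i * N) + (S + k) = o + S * N + S + i * N + k) //; lia.
case: (split_ordP i) => i' ->; case: (split_ordP k) => k' -> /=.
- by rewrite block_mxEul; apply: hA.
- rewrite block_mxEur (_ : o + i' * N + (S + k') = o + S + i' * N + k'); last by lia.
  exact: hB.
- rewrite block_mxEdl mulnDl (_ : o + (S * N + i' * N) + k' = o + S * N + i' * N + k'); last by lia.
  exact: hC.
- rewrite block_mxEdr mulnDl (_ : o + (S * N + i' * N) + (S + k') = o + S * N + S + i' * N + k'); last by lia.
  exact: hD.
Qed.

Definition cell r q := MB + r * N + q.
Definition inblk r q S y := exists i k, [/\ i < S, k < S & y = cell (r + i) (q + k)].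

Lemma cell_add r q i k : cell r q + i * N + k = cell (r + i) (q + k).
Proof. by rewrite /cell mulnDl; lia. Qed.

Lemma cell_inj r q r' q' : q < N -> q' < N -> cell r q = cell r' q' -> r = r' /\ q = q'.
Proof. by move=> h h' e; apply: (row_inj h h'); move: e; rewrite /cell; lia. Qed.

Lemma inblk_sub c S r q y : r = c \/ r = c + S -> q = c \/ q = c + S ->
  inblk r q S y -> inblk c c (S + S) y.
Proof.
move=> hr hq [i [k [hi hk ->]]]; exists (r + i - c), (q + k - c).
split; [lia|lia|congr cell; lia].
Qed.

Lemma mem_out e e' r q S (A : 'M[L]_S) r' q' S' :
  mem e 0 (cell r q) N A ->
  (forall y, ~ inblk r' q' S' y -> ar e' 0 y = ar e 0 y) ->
  q + S <= N -> q' + S' <= N ->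
  [|| r + S <= r', r' + S' <= r, q + S <= q' | q' + S' <= q] ->
  mem e' 0 (cell r q) N A.
Proof.
move=> h he qN qN' dis; apply: (mem_eq h) => i k hi hk; apply: he.
rewrite cell_add => -[i' [k' [hi' hk' /cell_inj[]]]]; lia.
Qed.

Lemma inblk_le r q S y : inblk r q S y -> MB <= y.
Proof. by move=> [i [k [_ _ ->]]]; rewrite /cell; lia. Qed.

Lemma cell_le r q : r <= N -> q <= N -> cell r q <= 3 * (U * U).
Proof.
move=> hr hq; have : r * N <= U * U by apply: leq_mul; lia.
by rewrite /cell; lia.
Qed.

Section Step.

Variable j : nat.
Hypothesis jE : j < E.
Let S := sz j.

Let S0 : 0 < S := sz_gt0 j.
Let SS : S * S <= U * U.
Proof.
have : S <= N by rewrite /S /N !szE leq_exp2l // ltnW.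
by move=> h; apply: leq_mul; lia.
Qed.

Lemma gem_step e a1 o1 a2 o2 a (A B : 'M[L]_S) : rdy e -> vr e vS = S ->
  vr e vlev = j -> mem e a1 (vr e o1) N A -> mem e a2 (vr e o2) N B ->
  vr e o1 <= 3 * (U * U) -> vr e o2 <= 3 * (U * U) ->
  [&& a1 < 32, a2 < 32, a < 32, a1 != aVAL, a2 != aVAL & a != aVAL] ->
  all [predC [:: 50; 51; 57; 58]] [:: o1; o2] ->
  all [predC ma (gemm tb J a1 o1 a2 o2 a)] [:: 0; aSIM; aSB; aSL] ->
  all [predC mv (gemm tb J a1 o1 a2 o2 a)] [:: vBL; vPW; vPM; vN; vE; vMB; 71] ->
  tri (gemm tb J a1 o1 a2 o2 a) e
    (gemm_cost tb J a1 o1 a2 o2 a * (size (sls j) + S * S + 1))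
    (fun e' => rdy e' /\ mem e' a 0 N (A *m B)%R).
Proof.
move=> re eS ej hA hB oU1 oU2 ha hq hm hv.
have [s1 s2 s3] := r_slp re jE; have [b1 b2] := bsU jE.
apply: (conseqP (gem_P (slsP (i := j)) (r_par re) (r_N re) eS ej s1 s2 s3 _ b1 b2 _ NU hA hB oU1 oU2 ha hq)) => //.
- by apply: leq_trans EU; apply: ltnW.
- by rewrite /N !szE leq_exp2l // ltnW.
move=> e' fr _ hC; split=> //; have [m0' m1] := andP hm.
apply: (rdy_frame re fr) => // i _.
by rewrite fr.2.
Qed.

Lemma lin_step e al a1 o1 o3 oa x (A B : 'M[L]_S) r q : rdy e -> vr e vS = S ->
  mem e a1 (vr e o1) N A -> (if oa is Some a then mem e a 0 N B else B = 0%R) ->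
  fw (vr e al) x -> vr e o1 <= 3 * (U * U) -> vr e o3 = cell r q ->
  r <= N -> q <= N ->
  (if a1 == 0 then vr e o1 == vr e o3 else true) ->
  (if oa is Some a then (0 < a) && (a < 32) else true) -> a1 < 32 ->
  all [predC [:: 50; 51; 52; 53; 20; 21; 22]] [:: al; o1; o3] ->
  tri (lin tb J al a1 o1 o3 oa) e
    ((cc (lin_c tb J al a1 o1 o3 oa) + 40) * (size (sls j) + S * S + 1))
    (fun e' => [/\ rdy e', mem e' 0 (cell r q) N (x *: A + B)%R &
       forall y, ~ inblk r q S y -> ar e' 0 y = ar e 0 y]).
Proof.
move=> re eS hA hB hx oU1 e3 rN qN hoo hoa ha1 hall.
have c3 : vr e o3 <= 3 * (U * U) by rewrite e3 cell_le.
have t3 : tabsz tb s <= vr e o3 by rewrite e3 /cell; have := MBt; lia.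
have SN : S <= N by rewrite /N /S !szE leq_exp2l // ltnW.
apply: (conseqP (lin_P (r_par re) (r_N re) eS SN NU hA hB hx oU1 c3 t3 hoo hoa ha1 hall)).
  by rewrite leq_mul2l -addnA leq_addl orbT.
move=> e' fr _ [hC out]; rewrite e3 in hC out.
have out' y : ~ inblk r q S y -> ar e' 0 y = ar e 0 y.
  move=> hy; apply: out => i k hi hk ey; apply: hy; exists i, k; split=> //.
  by rewrite ey cell_add.
split=> //.
apply: (rdy_frame re fr) => // i hi.
by apply: out' => /inblk_le; lia.
Qed.

Lemma offsP e c x : rdy e -> vr e vS = S -> safe w ins e x -> ev ins e x = c ->
  c + S + S <= N -> cc (Asg 69 x ;; offs_c) <= 100 ->
  tri (Asg 69 x ;; offs_c) e 100 (fun e' =>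
    [/\ rdy e', vr e' vS = S & [/\ vr e' 63 = cell c c, vr e' 64 = cell c (c + S),
        vr e' 65 = cell (c + S) c & vr e' 66 = cell (c + S) (c + S)]]).
Proof.
move=> re eS sx ex cN hc.
have cN2 : c * N <= U * U by apply: leq_mul; lia.
have SN2 : S * N <= U * U by apply: leq_mul; lia.
apply: (conseqP (T := 100) (Q := fun e' => [/\ vr e' 63 = cell c c, vr e' 64 = cell c (c + S),
        vr e' 65 = cell (c + S) c & vr e' 66 = cell (c + S) (c + S)])) => //.
- apply: tri_sl => //.
    rewrite /= ex eS (r_N re) (r_MB re); do !split=> //; lia.
  rewrite /= ex eS (r_N re) (r_MB re) /cell mulnDl; split=> //; lia.
move=> e' fr _ h; split=> //.
  by apply: (rdy_frame re fr) => // i _; rewrite fr.2.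
by rewrite fr.1.
Qed.

Variables (e0 : env) (c sp : nat).
Hypotheses (cN : c + S + S <= N) (spU : sp + 2 <= U).

Lemma midP (x : L) (A B C D : 'M[L]_S) : rdy e0 -> vr e0 vS = S ->
  vr e0 vlev = j -> vr e0 60 = c + S -> vr e0 62 = sp.+1 ->
  fw (ar e0 5 sp) x ->
  mem e0 0 (cell c c) N A -> mem e0 0 (cell c (c + S)) N B ->
  mem e0 0 (cell (c + S) c) N C -> mem e0 0 (cell (c + S) (c + S)) N D ->
  tri (mid_c tb J) e0 (inv_const tb J * (size (sls j) + S * S + 1))
    (fun e' => [/\ rdy e', vr e' 61 = 1,
       mem e' 0 (cell (c + S) (c + S)) N (x *: D + C *m (A *m B))%R &
       forall y, ~ inblk (c + S) (c + S) S y -> ar e' 0 y = ar e0 0 y]).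
Proof.
move=> re eS ej e60 e62 fx hA hB hC hD.
set X := size (sls j) + S * S + 1.
have X0 : 0 < X by rewrite /X; lia.
have n_ : c <= N /\ c + S <= N by lia.
have [n1 n2] := n_.
have cl r q : r <= N -> q <= N -> cell r q <= 3 * (U * U) := @cell_le r q.
apply: (conseqP (T := 100 + (gemm_cost tb J 0 63 0 64 6 * X + (gemm_cost tb J 0 65 6 71 7 * X +
   (20 + ((cc (lin_c tb J 67 0 66 66 (Some 7)) + 40) * X + 10)))))
   (Q := fun e' => [/\ rdy e', vr e' 61 = 1,
       mem e' 0 (cell (c + S) (c + S)) N (x *: D + C *m (A *m B))%R &
       forall y, ~ inblk (c + S) (c + S) S y -> ar e' 0 y = ar e0 0 y])) => //; last first.
  rewrite /inv_const.
  generalize (gemm_cost tb J 0 63 0 64 6) (gemm_cost tb J 0 65 6 71 7)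
    (gemm_cost tb J 6 71 0 66 7) (gemm_cost tb J 0 65 0 63 8)
    (gemm_cost tb J 7 71 8 71 9) (gemm_cost tb J 0 66 8 71 10)
    (cc (lin_c tb J 67 0 66 66 (Some 7))) (cc (lin_c tb J 68 0 63 63 (Some 9)))
    (cc (lin_c tb J 67 7 71 64 None)) (cc (lin_c tb J 67 10 71 65 None))
    (cc (lin_c tb J 70 0 66 66 None)) (cc (mulc tb J 70 (V 67) (V 67)))
    (cc (mulc tb J 70 (V 67) (V 68))) => k1 k2 k3 k4 k5 k6 k7 k8 k9 k10 k11 k12 k13.
  by rewrite !mulnDl; lia.
apply: (seqP (offsP (c := c) re eS _ _ cN _)) => //=.
- by split=> //; rewrite e60 eS; lia.
- by rewrite e60 eS; lia.
move=> e1 [re1 eS1 [ o1 o2 o3 o4]] fr1 _.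
have m1 a o k (M : 'M[L]_k) : mem e0 a o N M -> mem e1 a o N M.
  by move=> h; apply: (mem_eq h) => ? ? _ _; rewrite fr1.2.
have ej1 : vr e1 vlev = j by rewrite fr1.1.
apply: (seqP (gem_step (A := A) (B := B) re1 eS1 ej1 _ _ _ _ _ _ _ _)) => //; rewrite ?o1 ?o2 ?cl //; try exact: m1.
move=> e2 [re2 h2] fr2 _.
have m2 o k (M : 'M[L]_k) : mem e1 0 o N M -> mem e2 0 o N M.
  by move=> h; apply: (mem_eq h) => ? ? _ _; rewrite fr2.2.
have eS2 : vr e2 vS = S by rewrite fr2.1.
have ej2 : vr e2 vlev = j by rewrite fr2.1.
have z2 := r_z re2.
have o32 : vr e2 65 = cell (c + S) c by rewrite fr2.1.
apply: (seqP (gem_step (A := C) (B := (A *m B)%R) re2 eS2 ej2 _ _ _ _ _ _ _ _)) => //; rewrite ?o32 ?z2 ?cl //.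
  by apply/m2/m1.
move=> e3 [re3 h3] fr3 _.
apply: (seqP (T1 := 20) (P := fun e4 => e4 = setv e3 67 (ar e0 5 sp))) => //.
  apply: tri_sl => //=.
    split=> //; rewrite fr3.1 // fr2.1 // fr1.1 // e62 ?subSS ?subn0; last by lia.
    by split=> //; lia.
  rewrite fr3.1 // fr2.1 // fr1.1 // e62 subSS subn0.
  by rewrite fr3.2 // fr2.2 // fr1.2.
move=> _ -> _ _; set e4 := setv _ _ _.
have fr4 : frame [:: 67] [::] e3 e4.
  by split=> [v|//] /=; rewrite inE => /negbTE->.
have re4 : rdy e4 by apply: (rdy_frame re3 fr4).
have e4S : vr e4 vS = S by rewrite /= fr3.1.
have o44 : vr e4 66 = cell (c + S) (c + S) by rewrite /= fr3.1 // fr2.1.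
have hD4 : mem e4 0 (vr e4 66) N D.
  rewrite o44; apply: mem_eq (m2 _ _ _ (m1 _ _ _ _ hD)) _ => ? ? _ _.
  by rewrite /= fr3.2.
have h34 : mem e4 7 0 N (C *m (A *m B))%R by [].
have fx4 : fw (vr e4 67) x by [].
have oU4 : vr e4 66 <= 3 * (U * U) by rewrite o44 cl.
have w1 : 1 < 2 ^ w by lia.
apply: (seqP (lin_step (oa := Some 7) (r := c + S) (q := c + S) re4 e4S hD4 h34 fx4 oU4 o44 _ _ _ _ _ _)) => //=.
move=> e5 [re5 h5 out5] fr5 _.
apply: tri_sl => //=; split=> //.
  have fr6 : frame [:: 61] [::] e5 (setv e5 61 1).
    by split=> [v|//] /=; rewrite inE => /negbTE->.
  exact: (rdy_frame re5 fr6).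
by move=> y hy; rewrite out5 //= fr3.2 // fr2.2 // fr1.2.
Qed.

Lemma postP (x y : L) (A B C D : 'M[L]_S) : rdy e0 -> vr e0 vS = S ->
  vr e0 vlev = j -> vr e0 60 = c + S + S -> vr e0 62 = sp.+2 ->
  fw (ar e0 5 sp) x -> fw (ar e0 5 sp.+1) y ->
  mem e0 0 (cell c c) N A -> mem e0 0 (cell c (c + S)) N B ->
  mem e0 0 (cell (c + S) c) N C -> mem e0 0 (cell (c + S) (c + S)) N D ->
  tri (post_c tb J) e0 (inv_const tb J * (size (sls j) + S * S + 1))
    (fun e' => [/\ rdy e', vr e' vS = S + S,
       mem e' 0 (cell c c) N
         (block_mx (y *: A + (A *m B *m D) *m (C *m A)) (x *: (A *m B *m D))
            (x *: (D *m (C *m A))) ((x * x) *: D))%R,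
       [/\ vr e' 62 = sp.+1, vr e' vlev = j.+1, fw (ar e' 5 sp) (x * y)%R &
          forall i, i < sp -> ar e' 5 i = ar e0 5 i] &
       forall y, ~ inblk c c (S + S) y -> ar e' 0 y = ar e0 0 y]).
Proof.
move=> re eS ej e60 e62 fx fy hA hB hC hD.
set X := size (sls j) + S * S + 1.
have X0 : 0 < X by rewrite /X; lia.
have n_ : c <= N /\ c + S <= N by lia.
have [n1 n2] := n_.
have cl r q : r <= N -> q <= N -> cell r q <= 3 * (U * U) := @cell_le r q.
set X1 := (A *m B)%R; set X2 := (X1 *m D)%R; set X3 := (C *m A)%R.
set Q := fun e' => _.
apply: (conseqP (T := 100 + (gemm_cost tb J 0 63 0 64 6 * X + (gemm_cost tb J 6 71 0 66 7 * X +
   (gemm_cost tb J 0 65 0 63 8 * X + (gemm_cost tb J 7 71 8 71 9 * X + (gemm_cost tb J 0 66 8 71 10 * X +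
   (40 + ((cc (lin_c tb J 68 0 63 63 (Some 9)) + 40) * X + ((cc (lin_c tb J 67 7 71 64 None) + 40) * X +
   ((cc (lin_c tb J 67 10 71 65 None) + 40) * X + (cc (mulc tb J 70 (V 67) (V 67)) +
   ((cc (lin_c tb J 70 0 66 66 None) + 40) * X + (cc (mulc tb J 70 (V 67) (V 68)) + 60)))))))))))))
   (Q := Q)) => //; last first.
  rewrite /inv_const.
  generalize (gemm_cost tb J 0 63 0 64 6) (gemm_cost tb J 0 65 6 71 7)
    (gemm_cost tb J 6 71 0 66 7) (gemm_cost tb J 0 65 0 63 8)
    (gemm_cost tb J 7 71 8 71 9) (gemm_cost tb J 0 66 8 71 10)
    (cc (lin_c tb J 67 0 66 66 (Some 7))) (cc (lin_c tb J 68 0 63 63 (Some 9)))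
    (cc (lin_c tb J 67 7 71 64 None)) (cc (lin_c tb J 67 10 71 65 None))
    (cc (lin_c tb J 70 0 66 66 None)) (cc (mulc tb J 70 (V 67) (V 67)))
    (cc (mulc tb J 70 (V 67) (V 68))) => k1 k2 k3 k4 k5 k6 k7 k8 k9 k10 k11 k12 k13.
  have h12 := leq_pmulr k12 X0; have h13 := leq_pmulr k13 X0.
  by rewrite !mulnDl; lia.
apply: (seqP (offsP (c := c) re eS _ _ cN _)) => //=.
- by split=> //; rewrite ?e60 ?eS; do ?split=> //; lia.
- by rewrite e60 eS; lia.
move=> e1 [re1 eS1 [ o1 o2 o3 o4]] fr1 _.
have m1 a o k (M : 'M[L]_k) : mem e0 a o N M -> mem e1 a o N M.
  by move=> h; apply: (mem_eq h) => ? ? _ _; rewrite fr1.2.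
have ej1 : vr e1 vlev = j by rewrite fr1.1.
apply: (seqP (gem_step (A := A) (B := B) re1 eS1 ej1 _ _ _ _ _ _ _ _)) => //; rewrite ?o1 ?o2 ?cl //; try exact: m1.
move=> e2 [re2 h2] fr2 _.
have m2 o k (M : 'M[L]_k) : mem e0 0 o N M -> mem e2 0 o N M.
  by move=> h; apply: (mem_eq (m1 _ _ _ _ h)) => ? ? _ _; rewrite fr2.2.
have eS2 : vr e2 vS = S by rewrite fr2.1.
have ej2 : vr e2 vlev = j by rewrite fr2.1.
have z2 := r_z re2.
have o42 : vr e2 66 = cell (c + S) (c + S) by rewrite fr2.1.
apply: (seqP (gem_step (A := X1) (B := D) re2 eS2 ej2 _ _ _ _ _ _ _ _)) => //; rewrite ?o42 ?z2 ?cl //; try exact: m2.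
move=> e3 [re3 h3] fr3 _.
have m3 o k (M : 'M[L]_k) : mem e0 0 o N M -> mem e3 0 o N M.
  by move=> h; apply: (mem_eq (m2 _ _ _ h)) => ? ? _ _; rewrite fr3.2.
have eS3 : vr e3 vS = S by rewrite fr3.1.
have ej3 : vr e3 vlev = j by rewrite fr3.1.
have o33 : vr e3 65 = cell (c + S) c by rewrite fr3.1 // fr2.1.
have o13 : vr e3 63 = cell c c by rewrite fr3.1 // fr2.1.
apply: (seqP (gem_step (A := C) (B := A) re3 eS3 ej3 _ _ _ _ _ _ _ _)) => //; rewrite ?o33 ?o13 ?cl //; try exact: m3.
move=> e4 [re4 h4] fr4 _.
have m4 o k (M : 'M[L]_k) : mem e0 0 o N M -> mem e4 0 o N M.
  by move=> h; apply: (mem_eq (m3 _ _ _ h)) => ? ? _ _; rewrite fr4.2.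
have eS4 : vr e4 vS = S by rewrite fr4.1.
have ej4 : vr e4 vlev = j by rewrite fr4.1.
have z4 := r_z re4.
have h34 : mem e4 7 0 N X2 by apply: (mem_eq h3) => ? ? _ _; rewrite fr4.2.
apply: (seqP (gem_step (A := X2) (B := X3) re4 eS4 ej4 _ _ _ _ _ _ _ _)) => //; rewrite ?z4 //.
move=> e5 [re5 h5] fr5 _.
have m5 o k (M : 'M[L]_k) : mem e0 0 o N M -> mem e5 0 o N M.
  by move=> h; apply: (mem_eq (m4 _ _ _ h)) => ? ? _ _; rewrite fr5.2.
have eS5 : vr e5 vS = S by rewrite fr5.1.
have ej5 : vr e5 vlev = j by rewrite fr5.1.
have z5 := r_z re5.
have h45 : mem e5 8 0 N X3 by apply: (mem_eq h4) => ? ? _ _; rewrite fr5.2.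
have o45 : vr e5 66 = cell (c + S) (c + S) by rewrite fr5.1 // fr4.1 // fr3.1.
apply: (seqP (gem_step (A := D) (B := X3) re5 eS5 ej5 _ _ _ _ _ _ _ _)) => //; rewrite ?o45 ?z5 ?cl //; try exact: m5.
move=> e6 [re6 h6] fr6 _.
have m6 o k (M : 'M[L]_k) : mem e0 0 o N M -> mem e6 0 o N M.
  by move=> h; apply: (mem_eq (m5 _ _ _ h)) => ? ? _ _; rewrite fr6.2.
have h36 : mem e6 7 0 N X2 by apply: (mem_eq h34) => ? ? _ _; rewrite fr6.2 // fr5.2.
have h56 : mem e6 9 0 N (X2 *m X3)%R by apply: (mem_eq h5) => ? ? _ _; rewrite fr6.2.
have a60 : ar e6 0 =1 ar e0 0.
  by move=> ?; rewrite fr6.2 // fr5.2 // fr4.2 // fr3.2 // fr2.2 // fr1.2.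
have a65 : ar e6 5 =1 ar e0 5.
  by move=> ?; rewrite fr6.2 // fr5.2 // fr4.2 // fr3.2 // fr2.2 // fr1.2.
have v62 : vr e6 62 = sp.+2 by rewrite fr6.1 // fr5.1 // fr4.1 // fr3.1 // fr2.1 // fr1.1.
have lev6 : vr e6 vlev = j by rewrite fr6.1.
have eS6 : vr e6 vS = S by rewrite fr6.1.
have v63 : vr e6 63 = cell c c by rewrite fr6.1 // fr5.1 // fr4.1.
have v64 : vr e6 64 = cell c (c + S) by rewrite fr6.1 // fr5.1 // fr4.1 // fr3.1 // fr2.1.
have v65 : vr e6 65 = cell (c + S) c by rewrite fr6.1 // fr5.1 // fr4.1.
have v66 : vr e6 66 = cell (c + S) (c + S) by rewrite fr6.1.
have v71 := r_z re6.
clear fr1 fr2 fr3 fr4 fr5 fr6 h2 h3 h4 h5 h34 h45.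
apply: (seqP (T1 := 40) (P := fun e7 => e7 = setv (setv e6 68 (ar e0 5 sp.+1)) 67 (ar e0 5 sp))) => //.
  apply: tri_sl => //=; rewrite v62.
    by do !split=> //; lia.
  by rewrite !subSS !subn0 !a65.
move=> _ -> _ _; set e7 := setv _ _ _.
have fr7 : frame [:: 67; 68] [::] e6 e7.
  by split=> [v|//] /=; rewrite !inE negb_or => /andP[/negbTE-> /negbTE->].
have re7 : rdy e7 by apply: (rdy_frame re6 fr7).
have hA7 : mem e7 0 (vr e7 63) N A by rewrite /= v63; apply: m6.
apply: (seqP (lin_step (B := (X2 *m X3)%R) (oa := Some 9) (al := 68) (x := y) (r := c) (q := c) re7 _ hA7 _ _ _ _ _ _ _ _ _ _)) => //=.
  by rewrite v63 cl.
move=> e8 [re8 hA8 out8] fr8 _.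
have h38 : mem e8 7 0 N X2 by apply: (mem_eq h36) => ? ? _ _; rewrite fr8.2.
have z8 := r_z re8.
apply: (seqP (lin_step (A := X2) (B := 0%R) (oa := None) (x := x) (r := c) (q := c + S) re8 _ _ _ _ _ _ _ _ _ _ _ _)) => //; rewrite ?z8 //.
- by rewrite fr8.1.
- by rewrite fr8.1.
- by rewrite fr8.1.
move=> e9 [re9 hB9 out9] fr9 _.
have h69 : mem e9 10 0 N (D *m X3)%R by apply: (mem_eq h6) => ? ? _ _; rewrite fr9.2 // fr8.2.
have z9 := r_z re9.
apply: (seqP (lin_step (A := (D *m X3)%R) (B := 0%R) (oa := None) (x := x) (r := c + S) (q := c) re9 _ _ _ _ _ _ _ _ _ _ _ _)) => //; rewrite ?z9 //.
- by rewrite fr9.1 // fr8.1.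
- by rewrite fr9.1 // fr8.1.
- by rewrite fr9.1 // fr8.1.
move=> e10 [re10 hC10 out10] fr10 _.
have [[fx1 fx2] [fy1 fy2]] := (fx, fy).
have v67 : vr e10 67 = ar e0 5 sp by rewrite fr10.1 // fr9.1 // fr8.1.
have v68 : vr e10 68 = ar e0 5 sp.+1 by rewrite fr10.1 // fr9.1 // fr8.1.
apply: (seqP (mul_P 70 (x := V 67) (y := V 67) (r_par re10) _ _ _ _ _)) => //=; rewrite ?v67 //.
move=> e11 [v70 e11E] fr11 _.
have re11 : rdy e11 by apply: (rdy_frame re10 fr11) => // i _; rewrite e11E.
have mul' a b := phi_wmul char2 zm mJ (a := a) (b := b).
have f70 : fw (vr e11 70) (x * x)%R.
  by rewrite v70; split; [apply: wmul_lt | rewrite mul' // fx2].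
have v66' : vr e11 66 = cell (c + S) (c + S) by rewrite fr11.1 // fr10.1 // fr9.1 // fr8.1.
have oU11 : vr e11 66 <= 3 * (U * U) by rewrite v66' cl.
have hD11 : mem e11 0 (vr e11 66) N D.
  have hD7 : mem e7 0 (cell (c + S) (c + S)) N D by apply: m6.
  have hD8 := mem_out hD7 out8; have hD9 := mem_out (hD8 _ _ _) out9.
  have hD10 := mem_out (hD9 _ _ _ _ _ _) out10.
  rewrite v66' e11E; apply: hD10; lia.
apply: (seqP (lin_step (B := 0%R) (oa := None) (x := (x * x)%R) (r := c + S) (q := c + S) re11 _ hD11 _ f70 oU11 v66' _ _ _ _ _ _)) => //=.
  by rewrite fr11.1 // fr10.1 // fr9.1 // fr8.1.
move=> e12 [re12 hD12 out12] fr12 _.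
have v67' : vr e12 67 = ar e0 5 sp by rewrite fr12.1 // fr11.1.
have v68' : vr e12 68 = ar e0 5 sp.+1 by rewrite fr12.1 // fr11.1.
apply: (seqP (mul_P 70 (x := V 67) (y := V 68) (r_par re12) _ _ _ _ _)) => //=; rewrite ?v67' ?v68' //.
move=> e13 [w70 e13E] fr13 _.
have re13 : rdy e13 by apply: (rdy_frame re12 fr13) => // i _; rewrite e13E.
have a13 a i : ar e13 a i = ar e12 a i by rewrite e13E.
have v62' : vr e13 62 = sp.+2 by rewrite fr13.1 // fr12.1 // fr11.1 // fr10.1 // fr9.1 // fr8.1.
have vlev' : vr e13 vlev = j by rewrite fr13.1 // fr12.1 // fr11.1 // fr10.1 // fr9.1 // fr8.1.
have vS' : vr e13 vS = S by rewrite fr13.1 // fr12.1 // fr11.1 // fr10.1 // fr9.1 // fr8.1.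
have a5 i : ar e13 5 i = ar e0 5 i.
  by rewrite a13 fr12.2 // e11E fr10.2 // fr9.2 // fr8.2 //= a65.
have SU : S <= U by lia.
apply: tri_sl => //=.
  by rewrite v62' vlev' vS'; do !split=> //; lia.
rewrite v62' vlev' vS' !subSS !subn0.
set e14 := (X in Q X).
have a14 a i : ar e14 a i = if (a == 5) && (i == sp) then vr e13 70 else ar e13 a i by [].
have v14 : [/\ vr e14 62 = sp.+1, vr e14 vlev = j.+1 & vr e14 vS = S + S].
  by split=> //=; rewrite ?addn1 ?muln2 ?addnn.
have fr14 : frame [:: 62; vlev; vS] [:: 5] e13 e14.
  split=> [v|a h i]; first by rewrite /= !inE !negb_or => /and3P[/negbTE-> /negbTE-> /negbTE->].
  by rewrite a14; move: h; rewrite inE => /negbTE->.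
have re14 := rdy_frame re13 fr14.
have w70' := w70.
clearbody e14.
case: v14 => v14a v14b v14c.
rewrite /Q; split=> //; try exact: re14.
- apply/mem_block.
  have c1 : cell c c + S = cell c (c + S) by rewrite /cell; lia.
  have c2 : cell c c + S * N = cell (c + S) c by rewrite /cell mulnDl; lia.
  have c3 : cell (c + S) c + S = cell (c + S) (c + S) by rewrite /cell; lia.
  rewrite c2 c1 c3.
  have tr o k (M : 'M[L]_k) : mem e12 0 o N M -> mem e14 0 o N M.
    by move=> h; apply: (mem_eq h) => i k' _ _; rewrite a14 a13.
  split; apply: tr.
  + have A9 := mem_out hA8 out9; have A10 := mem_out (A9 _ _ _) out10.
    have A11 : mem e11 0 (cell c c) N (y *: A + X2 *m X3)%R by rewrite e11E; apply: A10; lia.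
    by apply: (mem_out A11 out12); lia.
  + rewrite addr0 in hB9; have B10 := mem_out hB9 out10.
    have B11 : mem e11 0 (cell c (c + S)) N (x *: X2)%R by rewrite e11E; apply: B10; lia.
    by apply: (mem_out B11 out12); lia.
  + rewrite addr0 in hC10.
    have C11 : mem e11 0 (cell (c + S) c) N (x *: (D *m X3))%R by rewrite e11E.
    by apply: (mem_out C11 out12); lia.
  + by rewrite addr0 in hD12.
- split=> //.
  + rewrite a14 !eqxx /= w70; split; first exact: wmul_lt.
    by rewrite mul' // fx2 fy2.
  + by move=> i hi; rewrite a14 (_ : (i == sp) = false) ?andbF ?a5 //; apply/eqP; lia.
move=> y0 hy.
have nb r q : (r = c \/ r = c + S) -> (q = c \/ q = c + S) -> ~ inblk r q S y0.
  by move=> hr hq hb; apply: hy; apply: inblk_sub hr hq hb.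
have l := @or_introl; have r := @or_intror.
have e11a a i : ar e11 a i = ar e10 a i by rewrite e11E.
rewrite a14 /= a13 out12 ?e11a; last by apply: nb; right.
rewrite out10; last by apply: nb; [right|left].
rewrite out9; last by apply: nb; [left|right].
by rewrite out8 //=; apply: nb; left.
Qed.

End Step.

Fixpoint icost j :=
  if j is i.+1 then
    2 * icost i + 2 * (inv_const tb J * (size (sls i) + sz i * sz i + 1) + 200)
  else 200.

Lemma leafP e c sp (A : 'M[L]_(sz 0)) : rdy e -> vr e 60 = c -> vr e 62 = sp ->
  c < N -> sp + 2 <= U -> mem e 0 (cell c c) N A ->
  tri leaf_c e 150 (fun e' =>
    [/\ rdy e', vr e' vS = 1, mem e' 0 (cell c c) N (dfi A).1,
       [/\ vr e' 62 = sp.+1, vr e' 60 = c.+1, vr e' 61 = 0, vr e' vlev = 0 &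
           fw (ar e' 5 sp) (dfi A).2 /\ forall i, i < sp -> ar e' 5 i = ar e 5 i] &
       forall y, ~ inblk c c 1 y -> ar e' 0 y = ar e 0 y]).
Proof.
move=> re e60 e62 cN spU hA.
have cN2 : c * N <= U * U by apply: leq_mul; lia.
have h := hA ord0 ord0; rewrite mul0n !addn0 in h.
apply: (conseqP (T := 150) (Q := fun e' =>
    [/\ vr e' vS = 1, mem e' 0 (cell c c) N (dfi A).1,
       [/\ vr e' 62 = sp.+1, vr e' 60 = c.+1, vr e' 61 = 0, vr e' vlev = 0 &
           fw (ar e' 5 sp) (dfi A).2 /\ forall i, i < sp -> ar e' 5 i = ar e 5 i] &
       forall y, ~ inblk c c 1 y -> ar e' 0 y = ar e 0 y])) => //; last first.
  move=> e' fr _ [h1 h2 h3 h4]; split=> //.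
  by apply: (rdy_frame re fr) => // i hi; apply: h4 => /inblk_le; lia.
apply: tri_sl => //=; rewrite e60 e62 (r_N re) (r_MB re) -/(cell c c).
  have := cell_le (r := c) (q := c); rewrite /cell => cl.
  by do !split=> //; lia.
split=> //.
- move=> i k; rewrite !ord1 mul0n !addn0 /= eqxx mxE eqxx.
  split; last by rewrite phi1.
  by rewrite -{1}(expn0 2) ltn_exp2l.
- rewrite !addn1; split=> //; rewrite !eqxx /=; split=> // i hi.
  by rewrite (_ : (i == sp) = false) ?andbF //; apply/eqP; lia.
move=> y hy; case: eqP => // ey; case: hy; exists 0, 0; split=> //.
by rewrite ey !addn0.
Qed.

(** Stated with a continuation, because one flat loop performs all levels: inverting a block is an
    initial segment of its iterations, after which the same loop goes on. *)
Lemma invP j : j <= E -> forall e c sp (A : 'M[L]_(sz j)) T (Q : env -> Prop),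
  rdy e -> vr e 60 = c -> vr e 61 = 1 -> vr e 62 = sp -> sz j %| c ->
  c + sz j <= N -> sp + j + 2 <= U -> mem e 0 (cell c c) N A ->
  (forall e', [/\ rdy e', vr e' vS = sz j, mem e' 0 (cell c c) N (dfi A).1,
       [/\ vr e' 62 = sp.+1, vr e' 60 = c + sz j, vr e' 61 = 0, vr e' vlev = j &
           fw (ar e' 5 sp) (dfi A).2 /\ forall i, i < sp -> ar e' 5 i = ar e 5 i] &
       forall y, ~ inblk c c (sz j) y -> ar e' 0 y = ar e 0 y] ->
     frame (mv (inv_loop tb J)) (ma (inv_loop tb J)) e e' ->
     tri (inv_loop tb J) e' T Q) ->
  tri (inv_loop tb J) e (icost j + T) Q.
Proof.
have loopstep := tri_loop_step (ins := ins) (rho := rho) w_large small_ins small_len.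
elim: j => [|j IH] jE e c sp A T Q re e60 e61 e62 dv cN spU hA k.
  apply: (loopstep _ _ _ 160 T _ (fun e' => [/\ rdy e', vr e' vS = 1, mem e' 0 (cell c c) N (dfi A).1,
       [/\ vr e' 62 = sp.+1, vr e' 60 = c.+1, vr e' 61 = 0, vr e' vlev = 0 &
           fw (ar e' 5 sp) (dfi A).2 /\ forall i, i < sp -> ar e' 5 i = ar e 5 i] &
       forall y, ~ inblk c c 1 y -> ar e' 0 y = ar e 0 y])) => //=.
  - by rewrite e61; case: (_ < _).
  - apply: (condP (T1 := 150) (T2 := 0)) => //; last by rewrite [ev _ _ _]/= e61.
    by move=> _; apply: leafP => //; rewrite /= in cN; lia.
  - by rewrite (_ : ecost _ = 5) //; lia.
  by move=> e1 h fr _; apply: k fr; case: h => ? ? ? [] *; split=> //; rewrite addn1.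
have jE' : j < E by [].
have dvj : sz j %| c by apply: dvdn_trans dv; rewrite /= addnn -muln2 dvdn_mulr.
pose S := sz j; have S0 : 0 < S := sz_gt0 j.
have cN' : c + S + S <= N by rewrite -addnA.
have h4 := hA; rewrite -(submxK A) in h4; move/mem_block: h4.
have c1 : cell c c + S = cell c (c + S) by rewrite /cell; lia.
have c2 : cell c c + S * N = cell (c + S) c by rewrite /cell mulnDl; lia.
have c3 : cell (c + S) c + S = cell (c + S) (c + S) by rewrite /cell; lia.
rewrite -/S c2 c1 c3; set A1 := ulsubmx A; set B := ursubmx A; set C := dlsubmx A.
set D := drsubmx A => -[hA1 hB hC hD].
set G := inv_const tb J * (size (sls j) + sz j * sz j + 1) + 200.
have -> : icost j.+1 + T = icost j + (G + (icost j + (G + T))).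
  by rewrite /= -/G mul2n -addnn mul2n -addnn; lia.
apply: (IH (ltnW jE) e c sp A1) => //; [lia|lia|].
move=> e1 [re1 eS1 hN1 [s1 c1' f1 l1 [d1 st1]] out1] fr1.
have out1' r q (M : 'M[L]_S) : mem e 0 (cell r q) N M -> q + S <= N ->
    [|| c + S <= r, r + S <= c, c + S <= q | q + S <= c] -> mem e1 0 (cell r q) N M.
  by move=> h qN dis; apply: (mem_out h out1); rewrite -/S; lia.
have hB1 : mem e1 0 (cell c (c + S)) N B by apply: out1' => //; lia.
have hC1 : mem e1 0 (cell (c + S) c) N C by apply: out1' => //; lia.
have hD1 : mem e1 0 (cell (c + S) (c + S)) N D by apply: out1' => //; lia.
have [qq eqq] : exists q, c = q * (S + S) by move/dvdnP: dv.
have divS : (c + S) %/ S = qq.*2.+1.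
  rewrite eqq (_ : qq * (S + S) + S = (qq.*2.+1) * S) ?mulnK //.
  by rewrite mulSn -addnn mulnDl mulnDr addnC.
have divSS : (c + S + S) %/ S = qq.*2.+2.
  rewrite eqq (_ : qq * (S + S) + S + S = (qq.*2.+2) * S) ?mulnK //.
  by rewrite !mulSn -addnn mulnDl mulnDr; lia.
have G200 : 200 <= G by rewrite /G leq_addl.
have w2 : 2 < 2 ^ w by apply: (@leq_trans (2 ^ 2)) => //; rewrite leq_exp2l //; apply: leq_trans w_large.
have sM e' : safe w ins e' (Bin OpMod (Bin OpDiv (V 60) (V vS)) (K 2)) by [].
have stepM := midP jE' (c := c) (sp := sp) cN' _ re1 eS1 l1 c1' s1 d1 hN1 hB1 hC1 hD1.
set PM := fun e' => _ in stepM.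
have {}stepM : tri (inv_body tb J) e1 (G - 100)
    (fun e' => PM e' /\ frame (mv (mid_c tb J)) (ma (mid_c tb J)) e1 e').
  apply: (condP (T1 := 0) (T2 := G - 110)) => //.
  - by rewrite (_ : ecost _ = 1) //; move: (G) G200 => g g2; clear -g2; lia.
  - by rewrite [ev _ _ _]/= f1.
  move=> _; apply: (condP (T1 := G - 200) (T2 := 0)) => //.
  - by rewrite (_ : ecost _ = 5) //; move: (G) G200 => g g2; clear -g2; lia.
  - by move=> _; apply: (conseqP (stepM _)) => //; rewrite ?/G ?addnK //; lia.
  by rewrite [ev _ _ _]/= c1' eS1 divS modn2 /= odd_double.
apply: (loopstep _ _ _ (G - 100) (icost j + (G + T)) _ (fun e' => PM e' /\ frame (mv (mid_c tb J)) (ma (mid_c tb J)) e1 e')) => //.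
- by rewrite [ev _ _ _]/= f1 l1 (r_E re1) jE'.
- by rewrite (_ : ecost _ = 5) //; lia.
move=> e2 [[re2 f2 hD2 out2] fr2] fr2' _.
set X := (_ + _)%R in hD2.
apply: (IH (ltnW jE) e2 (c + S) sp.+1 X) => //.
- by rewrite fr2.1 // c1'.
- by rewrite fr2.1 // s1.
- by rewrite dvdn_addr.
- by lia.
move=> e3 [re3 eS3 hN3 [s3 c3' f3 l3 [d3 st3]] out3] fr3.
have keep r q (M : 'M[L]_S) : mem e1 0 (cell r q) N M -> q + S <= N ->
    [|| r + S <= c + S, c + S + S <= r, q + S <= c + S | c + S + S <= q] -> mem e3 0 (cell r q) N M.
  move=> h qN dis; have h2 := mem_out h out2 qN cN' dis.
  exact: (mem_out h2 out3 qN cN' dis).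
have n2 : c + S <= N := leq_trans (leq_addr _ _) cN'.
have hN3' : mem e3 0 (cell c c) N (dfi A1).1 by apply: keep; rewrite ?leqnn.
have hB3 : mem e3 0 (cell c (c + S)) N B by apply: keep; rewrite ?leqnn.
have hC3 : mem e3 0 (cell (c + S) c) N C by apply: keep; rewrite ?leqnn ?orbT.
have d13 : fw (ar e3 5 sp) (dfi A1).2 by rewrite st3 // fr2.2.
have spU' : sp + 2 <= U by lia.
have stepP := postP jE' (c := c) (sp := sp) cN' spU' re3 eS3 l3 c3' s3 d13 d3 hN3' hB3 hC3 hN3.
set PP := fun e' => _ in stepP.
have {}stepP : tri (inv_body tb J) e3 (G - 100)
    (fun e' => PP e' /\ frame (mv (post_c tb J)) (ma (post_c tb J)) e3 e').
  apply: (condP (T1 := 0) (T2 := G - 110)) => //.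
  - by rewrite (_ : ecost _ = 1) //; move: (G) G200 => g g2; clear -g2; lia.
  - by rewrite [ev _ _ _]/= f3.
  move=> _; apply: (condP (T1 := 0) (T2 := G - 200)) => //.
  - by rewrite (_ : ecost _ = 5) //; move: (G) G200 => g g2; clear -g2; lia.
  - by rewrite [ev _ _ _]/= c3' eS3 divSS modn2 /= odd_double.
  by move=> _; apply: (conseqP stepP) => //; rewrite /G addnK.
apply: (loopstep _ _ _ (G - 100) T _ (fun e' => PP e' /\ frame (mv (post_c tb J)) (ma (post_c tb J)) e3 e')) => //.
- by rewrite [ev _ _ _]/= f3 l3 (r_E re3) jE'.
- by rewrite (_ : ecost _ = 5) //; lia.
move=> e4 [[re4 eS4 hN4 [s4 l4 d4 st4] out4] fr4] fr4' _.
apply: k; last first.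
  apply: (frame_trans fr1); apply: (frame_trans _ (frame_trans fr3 fr4')).
  exact: fr2'.
split=> //.
- split=> //; [by rewrite fr4.1 // c3' -addnA | by rewrite fr4.1 |].
  split=> // i hi; rewrite st4 // st3; last by lia.
  by rewrite fr2.2 // st1.
move=> y hy.
have nb r q : (r = c \/ r = c + S) -> (q = c \/ q = c + S) -> ~ inblk r q S y.
  by move=> hr hq hb; apply: hy; apply: inblk_sub hr hq hb.
rewrite out4 // out3; last by apply: nb; right.
rewrite out2; last by apply: nb; right.
by rewrite out1 //; apply: nb; left.
Qed.

Lemma inv_cP e (A : 'M[L]_(sz E)) :
  params ins tb s m e -> vr e vN = N -> vr e vE = E -> vr e vMB = MB ->
  (forall i, i < E ->
    [/\ ar e aSB i = bs i, ar e aSL i = size (sls i) & slp_at e (bs i) (sls i)]) ->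
  mem e 0 MB N A -> E + 2 <= U ->
  tri (inv_c tb J) e (icost E + 100) (fun e' =>
    [/\ mem e' 0 MB N (dfi A).1, fw (vr e' 11) (dfi A).2 &
       forall y, y < MB -> ar e' 0 y = ar e 0 y]).
Proof.
move=> pe eN eE eM hs hA EU2.
have c0 : cell 0 0 = MB by rewrite /cell; lia.
have w2 : 1000 < 2 ^ w by lia.
pose e1 := setv (setv (setv (setv (setv e 60 0) 61 1) 62 0) 71 0) vlev 0.
apply: (seqP (T1 := 20) (T2 := icost E + 60) (P := fun e' => e' = e1)) => //.
- by apply: tri_sl => //=; do !split=> //; lia.
- by lia.
move=> _ -> _ _.
have re1 : rdy e1.
  split=> //; apply: (params_eq pe) => // v.
  by rewrite !inE => /or3P[] /eqP->.
apply: (seqP (T1 := icost E + 20) (T2 := 20) (P := fun e' =>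
    [/\ mem e' 0 MB N (dfi A).1, fw (ar e' 5 0) (dfi A).2 &
       forall y, y < MB -> ar e' 0 y = ar e 0 y])); last 2 first.
- by lia.
- move=> e2 [h1 h2 h3] _ _; apply: tri_sl => //=.
  by do !split=> //; lia.
have hA0 : mem e1 0 (cell 0 0) N A by rewrite c0.
apply: (invP (leqnn E) (c := 0) (sp := 0) (A := A) re1) => //.
move=> e' [re' _ h1 [_ _ f' l' [d' _]] out] _.
apply: (tri_conseq (T := 8) w_large small_ins small_len (Q := fun x => x = e')) => //.
  by apply: tri_loop_end => //; rewrite [ev _ _ _]/= f' l' (r_E re') ltnn.
move=> _ _ _ ->; rewrite c0 in h1; split=> // y hy.
by rewrite out // => /inblk_le; lia.
Qed.

End InvSpec.

(** * Simulating the program that generates the straight-line programs *)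

Section Sim.

Variable p : program.

Definition instr_regs i : seq nat :=
  match i with
  | Halt => [::]
  | Const d _ | InSize d _ | Rand d => [:: d]
  | Op _ d a b => [:: d; a; b]
  | Get d a | Put d a | Read d _ a => [:: d; a]
  | Jump a _ => [:: a]
  end.

Definition instr_consts i : seq nat :=
  match i with Const _ k => [:: k] | _ => [::] end.

Definition nregs := (foldr maxn 0 (flatten (map instr_regs p))).+1.
(** The literals of the simulator must fit into its words even for small [n]; this bound therefore
    enters the word factor of the oracle. *)
Definition cbound := foldr maxn (size p) (flatten (map instr_consts p)).

Definition sreg r := 100 + r.

Definition next_c := Asg 90 (V 90 +' K 1).

(** The simulated machine has shorter words. Variable 90 is its program counter, 91 its modulus, 92
    its word size, 93 the start of its memory, and 94 its only input. A shift by at least the word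
    size yields 0 and is tested for first, since it could overflow the outer word. *)
Definition sim_instr i : cmd :=
  match i with
  | Halt => Asg 90 (K (size p))
  | Const d k => Asg (sreg d) (Bin OpMod (K k) (V 91)) ;; next_c
  | Op OpSub d a b =>
      Asg (sreg d) (Bin OpMod (V (sreg a) +' V 91 -' V (sreg b)) (V 91)) ;; next_c
  | Op OpShl d a b =>
      Cond (Bin OpLt (V (sreg b)) (V 92))
        (Asg (sreg d) (Bin OpMod (Bin OpShl (V (sreg a)) (V (sreg b))) (V 91)))
        (Asg (sreg d) (K 0)) ;; next_c
  | Op o d a b =>
      Asg (sreg d) (Bin OpMod (Bin o (V (sreg a)) (V (sreg b))) (V 91)) ;; next_c
  | Get d a => Asg (sreg d) (Arr aSIM (V 93 +' V (sreg a))) ;; next_c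
  | Put a b => Sto aSIM (V 93 +' V (sreg a)) (V (sreg b)) ;; next_c
  | Read d 0 a =>
      Cond (V (sreg a)) (Asg (sreg d) (K 0))
        (Asg (sreg d) (Bin OpMod (V 94) (V 91))) ;; next_c
  | Read d _ a => Asg (sreg d) (K 0) ;; next_c
  | InSize d i => Asg (sreg d) (Bin OpMod (K (i == 0)) (V 91)) ;; next_c
  | Rand d => Asg (sreg d) (K 0) ;; next_c
  | Jump a l => Cond (V (sreg a)) (Asg 90 (K (minn l (size p)))) next_c
  end.

Definition sim_body : cmd :=
  foldr (fun i c => Cond (Bin OpEq (V 90) (K i)) (sim_instr (nth Halt p i)) c)
    Skip (iota 0 (size p)).

Definition sim_loop := Loop (Bin OpLt (V 90) (K (size p))) sim_body.

Definition reset_c : cmd :=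
  foldr (fun r c => Asg (sreg r) (K 0) ;; c) (Asg 90 (K 0)) (iota 0 nregs).

Definition sim_cost := cc sim_body + 20.

Lemma mv_sim v : v < 100 -> v != 90 ->
  (v \notin mv sim_body) && (v \notin mv reset_c).
Proof.
move=> v1 v2; have ns r : (v == sreg r) = false by apply/eqP; rewrite /sreg; lia.
apply/andP; split; last first.
  rewrite /reset_c; elim: (iota _ _) => [|r l IH] /=; first by rewrite inE.
  by rewrite inE ns.
rewrite /sim_body; elim: (iota _ _) => //= i l IH; rewrite mem_cat negb_or IH andbT.
case: (nth Halt p i) => [|d k|o d a b|d a|a b|d q a|d q|d|a q] /=;
  rewrite ?inE ?ns ?(negbTE v2) //.
- by case: o; rewrite /= !inE ?ns ?(negbTE v2).
- by case: q => [|q]; rewrite /= !inE ?ns ?(negbTE v2).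
Qed.

Lemma ma_sim a : a \in ma sim_body ++ ma reset_c -> a = aSIM.
Proof.
rewrite mem_cat => /orP[|]; last first.
  by rewrite /reset_c; elim: (iota _ _).
rewrite /sim_body; elim: (iota _ _) => //= i l IH; rewrite mem_cat => /orP[|//].
case: (nth Halt p i) => [|d k|o d b c|d b|c b|d q b|d q|d|b q] //=.
- by case: o.
- by rewrite inE => /eqP.
- by case: q.
Qed.

End Sim.

Section SimSpec.

Variables (w : nat) (ins : seq (seq nat)) (rho : nat -> nat).
Hypothesis w_large : 7 < w.
Hypothesis small_ins : forall i j, nth 0 (nth [::] ins i) j < 2 ^ w.
Hypothesis small_len : forall i, size (nth [::] ins i) < 2 ^ w.

Notation tri := (tri w ins rho).
Notation trc c e Q := (tri c e (cc c) Q).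

Let seqP := tri_seq (ins := ins) (rho := rho) w_large small_ins small_len.
Let conseqP := tri_conseq (ins := ins) (rho := rho) w_large small_ins small_len.

Variables (p : program) (U : nat).
Hypotheses (Ularge : 1000 <= U) (Ulim : 1000 * (U * U) <= lim w).
Hypothesis cU : cbound p <= U.

Let uu := UU Ularge.
Let lw := lim_w w.

Section OneRun.

Variables (w' base n : nat).
Hypotheses (baseU : base + 2 ^ w' <= U) (nU : n <= U) (wU : w' <= U).
Let W := 2 ^ w'.
Let W0 : 0 < W. Proof. by rewrite expn_gt0. Qed.
Let stp' := fun s => step w' p [:: [:: n]] s 0.

(** A jump may lead anywhere beyond the program, which amounts to halting; capping the counter at
    [size p] keeps it a small word. *)
Record srel e (s : state) : Prop := Srel {
  s_pc : vr e 90 = minn (pc s) (size p);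
  s_W : vr e 91 = W;
  s_w : vr e 92 = w';
  s_b : vr e 93 = base;
  s_n : vr e 94 = n;
  s_reg : forall r, r < nregs p -> vr e (sreg r) = regs s r;
  s_regW : forall r, regs s r < W;
  s_mem : forall a, a < W -> ar e aSIM (base + a) = memory s a;
  s_memW : forall a, memory s a < W }.

Lemma instr_reg_lt i r : i < size p -> r \in instr_regs (nth Halt p i) -> r < nregs p.
Proof.
move=> ip hr; have : r \in flatten (map instr_regs p).
  apply/flattenP; exists (instr_regs (nth Halt p i)) => //.
  by rewrite -(nth_map _ [::]) // mem_nth ?size_map.
rewrite /nregs ltnS; elim: (flatten _) => //= x l IH.
rewrite inE leq_max => /orP[/eqP->|/IH->]; rewrite ?leqnn ?orbT //.
Qed.

Lemma foldr_maxn_ge x l : x <= foldr maxn x l.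
Proof. by elim: l => //= y l IH; rewrite leq_max IH orbT. Qed.

Lemma instr_const_le i k : i < size p -> k \in instr_consts (nth Halt p i) -> k <= cbound p.
Proof.
move=> ip hk; have : k \in flatten (map instr_consts p).
  apply/flattenP; exists (instr_consts (nth Halt p i)) => //.
  by rewrite -(nth_map _ [::]) // mem_nth ?size_map.
rewrite /cbound; elim: (flatten _) => //= x l IH.
rewrite inE leq_max => /orP[/eqP->|/IH->]; rewrite ?leqnn ?orbT //.
Qed.

Lemma size_cbound : size p <= cbound p.
Proof. exact: foldr_maxn_ge. Qed.

Definition same_out e e' := forall x, ~~ (base <= x < base + W) -> ar e' aSIM x = ar e aSIM x.

Lemma sim_set e e' s d x : srel e s -> d < nregs p -> x < W ->
  pc s < size p ->
  e' = setv (setv e (sreg d) x) 90 (pc s + 1) ->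
  srel e' (State (pc s).+1 [eta regs s with d |-> x] (memory s)).
Proof.
move=> se hd xW pp ->; case: se => h1 h2 h3 h4 h5 h6 h7 h8 h9.
have ns v : v < 100 -> (v == sreg d) = false by move=> h; apply/eqP; rewrite /sreg; lia.
split=> //=.
- by rewrite addn1; apply/esym/minn_idPl.
- move=> r hr.
  by rewrite /sreg eqn_add2l; case: eqP => // _; apply: h6.
- by move=> r; case: eqP => // _; apply: h7.
Qed.

Lemma sim_instrP e s : srel e s -> pc s < size p -> nth Halt p (pc s) <> Halt ->
  trc (sim_instr p (nth Halt p (pc s))) e
    (fun e' => srel e' (stp' s) /\ same_out e e').
Proof.
move=> se pp nh; have [h1 h2 h3 h4 h5 h6 h7 h8 h9] := se.
have rl r := @instr_reg_lt _ r pp.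
have cl k := @instr_const_le _ k pp.
have sp := size_cbound.
have WU : W <= U by rewrite /W; lia.
have w1 : 1 < 2 ^ w by lia.
have pc90 : vr e 90 = pc s by rewrite h1; apply/minn_idPl/ltnW.
have n90 r : (90 == sreg r) = false by apply/eqP; rewrite /sreg; lia.
have n91 r : (91 == sreg r) = false by apply/eqP; rewrite /sreg; lia.
have so e' : ar e' aSIM =1 ar e aSIM -> same_out e e' by move=> h x _.
have stE : stp' s = match nth Halt p (pc s) with
  | Halt => s
  | Const d k => State (pc s).+1 [eta regs s with d |-> (k %% W)] (memory s)
  | Op o d a b => State (pc s).+1 [eta regs s with d |-> (eval_binop w' o (regs s a) (regs s b) %% W)] (memory s)
  | Get d a => State (pc s).+1 [eta regs s with d |-> (memory s (regs s a) %% W)] (memory s)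
  | Put a b => State (pc s).+1 (regs s) [eta memory s with regs s a |-> regs s b]
  | Read d i a => State (pc s).+1 [eta regs s with d |-> (nth 0 (nth [::] [:: [:: n]] i) (regs s a) %% W)] (memory s)
  | InSize d i => State (pc s).+1 [eta regs s with d |-> (size (nth [::] [:: [:: n]] i) %% W)] (memory s)
  | Rand d => State (pc s).+1 [eta regs s with d |-> (0 %% W)] (memory s)
  | Jump a l => State (if regs s a == 0 then (pc s).+1 else l) (regs s) (memory s)
  end by rewrite /stp' /step /current; case: (nth Halt p (pc s)).
rewrite stE {stE}.
case: (nth Halt p (pc s)) nh rl cl => //= [d k|o d a b|d a|a b|d i a|d i|d|a l] _ rl cl.
- apply: tri_sl => //=; rewrite ?n90 ?pc90 ?h2.
    by have := cl k (mem_head _ _); do !split=> //; lia.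
  split; last exact: so.
  by apply: (sim_set se) => //; [apply: rl; rewrite inE | rewrite ltn_mod].
- have hd : d < nregs p by apply: rl; rewrite !inE eqxx.
  have ha : a < nregs p by apply: rl; rewrite !inE eqxx orbT.
  have hb : b < nregs p by apply: rl; rewrite !inE eqxx !orbT.
  have aW := h7 a; have bW := h7 b.
  have aw : regs s a < 2 ^ w by lia.
  have bw : regs s b < 2 ^ w by lia.
  have abU : regs s a * regs s b <= U * U by apply: leq_mul; lia.
  have M x : x %% W < W by rewrite ltn_mod.
  case: o; apply: tri_sl => //=; rewrite ?n90 ?pc90 ?h2 ?h3 ?h6 //;
    try (by do !split=> //; lia);
    try (by split; [exact: (sim_set se) | exact: so]).
  + case: ltnP => hbw /=; rewrite ?n90 ?pc90; do !split=> //; try lia.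
    have : regs s a * 2 ^ regs s b <= U * U.
      apply: leq_mul; first by lia.
      by apply: leq_trans WU; rewrite leq_exp2l // ltnW.
    by lia.
  + split; last by case: ltnP => _; apply: so.
    case: ltnP => hbw /=; rewrite ?n90 ?pc90; first exact: (sim_set se).
    apply: (sim_set se) => //; rewrite (_ : _ %% W = 0) //; apply/eqP.
    by rewrite -/(W %| _) dvdn_mull // /W dvdn_exp2l.
- have hd : d < nregs p by apply: rl; rewrite !inE eqxx.
  have ha : a < nregs p by apply: rl; rewrite !inE eqxx orbT.
  have aW := h7 a.
  apply: tri_sl => //=; rewrite ?n90 ?pc90 ?h4 ?h6 ?h8 //.
    by do !split=> //; lia.
  by split; [rewrite modn_small //; exact: (sim_set se) | exact: so].
- have ha : a < nregs p by apply: rl; rewrite !inE eqxx.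
  have hb : b < nregs p by apply: rl; rewrite !inE eqxx orbT.
  have aW := h7 a.
  apply: tri_sl => //=; rewrite ?pc90 ?h4 ?h6 //.
    by do !split=> //; lia.
  split; last first.
    move=> x hx /=; case: eqP => // ex; move: hx; rewrite ex leq_addr ltn_add2l aW.
    by [].
  split=> //=.
  + by rewrite addn1; apply/esym/minn_idPl.
  + by move=> c cW; rewrite eqn_add2l; case: eqP => // _; apply: h8.
  + by move=> c; case: eqP => // _; apply: h7.
- have hd : d < nregs p by apply: rl; case: (i); rewrite !inE eqxx.
  have ha : a < nregs p by apply: rl; case: (i); rewrite !inE eqxx orbT.
  have aW := h7 a.
  case: i {rl cl} => [|i] /=; apply: tri_sl => //=; rewrite ?n90 ?pc90 ?h6 //.
  + by case: eqP => _ /=; rewrite ?n90 ?pc90; do !split=> //; lia.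
  + split; last by case: eqP => _; apply: so.
    case: (regs s a) => [|k] /=; rewrite ?n90 ?pc90 ?h5 ?h2.
      by apply: (sim_set se) => //; rewrite ltn_mod.
    by rewrite nth_nil mod0n; apply: (sim_set se).
  + by do !split=> //; lia.
  split; last exact: so.
  by rewrite !nth_nil mod0n; apply: (sim_set se).
- have hd : d < nregs p by apply: rl; rewrite !inE eqxx.
  apply: tri_sl => //=; rewrite ?n90 ?pc90 ?h2.
    by case: (i); do !split=> //=; lia.
  split; last exact: so.
  rewrite (_ : size _ = (i == 0)); last by case: (i) => // k; rewrite /= nth_nil.
  by apply: (sim_set se) => //; rewrite ltn_mod.
- have hd : d < nregs p by apply: rl; rewrite !inE eqxx.
  apply: tri_sl => //=; rewrite ?n90 ?pc90.
    by do !split=> //; lia.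
  by split; [rewrite mod0n; exact: (sim_set se) | exact: so].
have ha : a < nregs p by apply: rl; rewrite !inE eqxx.
apply: tri_sl => //=; rewrite ?pc90 ?h6 //.
  by case: eqP => _ /=; rewrite ?pc90; do !split=> //; have := geq_minr l (size p); lia.
split; last by case: eqP.
by case: eqP => _ /=; split=> //=; rewrite addn1; apply/esym/minn_idPl.
Qed.

Lemma sim_bodyP e (Q : env -> Prop) : vr e 90 < size p ->
  trc (sim_instr p (nth Halt p (vr e 90))) e Q -> tri (sim_body p) e (cc (sim_body p)) Q.
Proof.
move=> hp h; have sp := size_cbound.
suff H l : vr e 90 \in l -> all (fun i => i < size p) l ->
    trc (foldr (fun i c => Cond (Bin OpEq (V 90) (K i)) (sim_instr p (nth Halt p i)) c) Skip l) e Q.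
  apply: H; first by rewrite mem_iota.
  by apply/allP => i; rewrite mem_iota.
elim: l => //= i l IH; rewrite inE => hin /andP[ip al].
apply: trc_cond => //=; first by split=> //; lia.
  by case: (vr e 90 =P i) => [<- _|_].
case: eqP hin => // _ /= hin _; exact: IH.
Qed.

Lemma sim_loopP T : forall e s, srel e s ->
  halted p (iter T stp' s) ->
  tri (sim_loop p) e (T.+1 * sim_cost p + 20) (fun e' =>
    [/\ forall r, r < nregs p -> vr e' (sreg r) = regs (iter T stp' s) r,
        forall a, a < W -> ar e' aSIM (base + a) = memory (iter T stp' s) a &
        same_out e e']).
Proof.
have sp := size_cbound.
have hst s : halted p s -> forall T, iter T stp' s = s.
  move=> hs; elim=> //= k ->; rewrite /stp' /step; move: hs; rewrite /halted.
  by case: (current p s).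
have loopstep := tri_loop_step (ins := ins) (rho := rho) w_large small_ins small_len.
have sg : forall e, safe w ins e (Bin OpLt (V 90) (K (size p))) by move=> e /=; split=> //; lia.
have fin e s T' : srel e s -> halted p s ->
    tri (sim_loop p) e (T'.+1 * sim_cost p + 20) (fun e' =>
    [/\ forall r, r < nregs p -> vr e' (sreg r) = regs s r,
        forall a, a < W -> ar e' aSIM (base + a) = memory s a &
        same_out e e']).
  move=> se hs; have [h1 h2 h3 h4 h5 h6 h7 h8 h9] := se.
  have [pp|pp] := ltnP (pc s) (size p); last first.
    apply: (tri_conseq (T := 6) w_large small_ins small_len (Q := fun x => x = e)).
    - by apply: tri_loop_end => //; rewrite [ev _ _ _]/= h1 (minn_idPr pp) ltnn.
    - by lia.
    - by move=> _ _ _ ->.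
  have pc90 : vr e 90 = pc s by rewrite h1; apply/minn_idPl/ltnW.
  have nh : nth Halt p (pc s) = Halt by move: hs; rewrite /halted /current; case: nth.
  apply: (loopstep _ _ _ (cc (sim_body p)) 6 _ (fun e' => e' = setv e 90 (size p))) => //.
  - by rewrite /= pc90 pp.
  - apply: sim_bodyP; rewrite pc90 // nh; apply: tri_sl => //=; lia.
  - by rewrite (_ : ecost _ = 3) // /sim_cost mulSn; lia.
  move=> _ -> _ _.
  apply: (tri_conseq (T := 6) w_large small_ins small_len (Q := fun x => x = setv e 90 (size p))) => //.
    by apply: tri_loop_end => //; rewrite [ev _ _ _]/= ltnn.
  by move=> _ _ _ ->; split.
elim: T => [|T IH] e s se hs; first exact: fin.
have [hss|hss] := boolP (halted p s).
  by rewrite hst // in hs *; apply: fin.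
have [h1 h2 h3 h4 h5 h6 h7 h8 h9] := se.
have pp : pc s < size p.
  by rewrite ltnNge; apply: contra hss => h; rewrite /halted /current nth_default.
have nh : nth Halt p (pc s) <> Halt by move=> h; move: hss; rewrite /halted /current h.
have pc90 : vr e 90 = pc s by rewrite h1; apply/minn_idPl/ltnW.
rewrite iterSr in hs *.
apply: (loopstep _ _ _ (cc (sim_body p)) (T.+1 * sim_cost p + 20) _ (fun e' => srel e' (stp' s) /\ same_out e e')) => //.
- by rewrite /= pc90 pp.
- by apply: sim_bodyP; rewrite pc90 //; apply: sim_instrP.
- rewrite (_ : ecost _ = 3) // [T.+2 * _]mulSn.
  by move: (T.+1 * _) => q; rewrite /sim_cost; lia.
move=> e1 [se1 so1] _ _.
apply: (conseqP (IH e1 (stp' s) se1 hs)) => // e2 _ _ [g1 g2 g3]; split=> // x hx.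
by rewrite g3 // so1.
Qed.

End OneRun.

End SimSpec.

(** * Generating the straight-line programs of all levels *)

Lemma step_reg_lt w p ins s : (forall r, regs s r < 2 ^ w) ->
  forall r, regs (step w p ins s 0) r < 2 ^ w.
Proof.
move=> h r; rewrite /step; have w0 : 0 < 2 ^ w by rewrite expn_gt0.
by case: (current p s) => [|? ?|? ? ? ?|? ?|? ?|? ? ?|? ?|?|? ?] //=; case: eqP => // _;
  rewrite ltn_mod.
Qed.

Lemma foldl_nseq0 w p ins T s :
  foldl (step w p ins) s (nseq T 0) = iter T (fun s => step w p ins s 0) s.
Proof. by elim: T s => // T IH s; rewrite iterSr -IH. Qed.

Lemma nth_flatten_words (sl : slp) q r : q < size sl -> r < 3 ->
  nth 0 (flatten (map slp_instr_words sl)) (3 * q + r) =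
  nth 0 (slp_instr_words (nth (SConst 0) sl q)) r.
Proof.
have s3 i : size (slp_instr_words i) = 3 by case: i.
elim: sl q => // i sl IH [|q] hq hr /=; rewrite nth_cat s3.
  by rewrite muln0 hr.
by rewrite mulnS -addnA ltnNge leq_addr /= addKn IH.
Qed.

Lemma size_flatten_words (sl : slp) :
  size (flatten (map slp_instr_words sl)) = 3 * size sl.
Proof. by elim: sl => //= i sl IH; rewrite size_cat IH mulnS; case: i. Qed.

Section Prep.

Variables (p : program) (c : nat).

(** Each level simulates in a fresh, hence zero, region of [aSIM], as long as the address space of
    its words. The generated program stays where it was output; only its address and its length,
    with three words per instruction, are recorded. *)
Definition prep_body :=
  reset_c p ;; sim_loop p ;;
  Sto aSB (V 95) (V 93) ;;
  Sto aSL (V 95) (Bin OpDiv (V (sreg 0)) (K 3)) ;;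
  Asg 93 (V 93 +' V 91) ;; Asg 91 (V 91 *' K (2 ^ c)) ;;
  Asg 92 (V 92 +' K c) ;; Asg 94 (V 94 +' V 94).

Definition prep_c :=
  (Asg 91 (K (2 ^ c)) ;; Asg 92 (K c) ;; Asg 93 (K 0) ;; Asg 94 (K 1)) ;;
  For 95 vE prep_body.

Definition prep_const := cc (reset_c p) + 2 * sim_cost p + 200.

Lemma mv_bodyE :
  mv prep_body = mv (reset_c p) ++ (mv (sim_body p) ++ [:: 93; 91; 92; 94]).
Proof. by []. Qed.

Lemma mv_prepE : mv prep_c = [:: 91; 92; 93; 94; 95] ++
  (mv (reset_c p) ++ (mv (sim_body p) ++ [:: 93; 91; 92; 94])) ++ [:: 95].
Proof. by []. Qed.

Lemma mv_prep v : v < 90 -> v \notin mv prep_c.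
Proof.
move=> hv; have v1 : v < 100 by lia.
have v2 : v != 90 by rewrite ltn_eqF.
have /andP[h1 h2] := @mv_sim p v v1 v2.
rewrite mv_prepE; move: h1 h2; move: (mv (sim_body p)) (mv (reset_c p)) => a b h1 h2.
rewrite !(mem_cat, inE) (negbTE h1) (negbTE h2); lia.
Qed.

Lemma ma_prep a : a \in ma prep_c -> a \in [:: aSIM; aSB; aSL].
Proof.
rewrite /prep_c /prep_body /= cats0 !mem_cat => /orP[h|/orP[h|]].
- by rewrite (@ma_sim p a) // mem_cat h orbT.
- by rewrite (@ma_sim p a) // mem_cat h.
by rewrite !inE => /orP[] /eqP ->.
Qed.

Variables (w : nat) (ins : seq (seq nat)) (rho : nat -> nat).
Hypothesis w_large : 7 < w.
Hypothesis small_ins : forall i j, nth 0 (nth [::] ins i) j < 2 ^ w.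
Hypothesis small_len : forall i, size (nth [::] ins i) < 2 ^ w.

Variable (U : nat).
Hypotheses (Ularge : 1000 <= U) (Ulim : 1000 * (U * U) <= lim w).
Hypothesis cU : cbound p <= U.

Notation tri := (tri w ins rho).
Notation trc c e Q := (tri c e (cc c) Q).

Let uu := UU Ularge.
Let lw := lim_w w.
Let seqP := tri_seq (ins := ins) (rho := rho) w_large small_ins small_len.
Let conseqP := tri_conseq (ins := ins) (rho := rho) w_large small_ins small_len.

Variables (E : nat) (sls : nat -> slp) (t : nat -> nat).

Definition pbase j := \sum_(0 <= i < j) 2 ^ (c * i.+1).

Hypothesis baseU : pbase E + 2 ^ (c * E.+1) <= U.
Hypothesis EU : sz E <= U.
Hypothesis slsP : forall j, j < E ->
  run (c * j.+1) p [:: [:: sz j]] (nseq (t j) 0) =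
    Some (flatten (map slp_instr_words (sls j))).

Lemma resetP e : trc (reset_c p) e (fun e' =>
  vr e' 90 = 0 /\ forall r, r < nregs p -> vr e' (sreg r) = 0).
Proof.
have w0 : 0 < 2 ^ w by rewrite expn_gt0.
suff H l e1 : trc (foldr (fun r c => Asg (sreg r) (K 0) ;; c) (Asg 90 (K 0)) l) e1
    (fun e' => vr e' 90 = 0 /\
       forall r, r \in l \/ vr e1 (sreg r) = 0 -> vr e' (sreg r) = 0).
  apply: (conseqP (H (iota 0 (nregs p)) e)) => // e' _ _ [h1 h2]; split=> // r hr.
  by apply: h2; left; rewrite mem_iota.
elim: l e1 => [|x l IH] e1.
  by apply: tri_sl => //=; split=> // r [].
rewrite [foldr _ _ _]/=; apply: trc_asg => //; apply: (conseqP (IH _)) => // e' _ _ [h1 h2]; split=> // r hr.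
apply: h2; rewrite /= eqn_add2l; move: hr; rewrite inE.
case: (eqVneq r x) => [_|ne] /=; first by right.
by case=> [->|->]; [left|right].
Qed.

Definition slps_ready j e := forall i, i < j ->
  [/\ ar e aSB i = pbase i, ar e aSL i = size (sls i) & slp_at e (pbase i) (sls i)].

Lemma pbaseS j : pbase j.+1 = pbase j + 2 ^ (c * j.+1).
Proof. by rewrite /pbase big_nat_recr. Qed.

Lemma pbase_le i j : i <= j -> pbase i <= pbase j.
Proof.
move=> ij; rewrite -(subnKC ij); elim: (j - i) => [|k IH]; first by rewrite addn0.
by rewrite addnS pbaseS; lia.
Qed.

Lemma pbaseU j : j < E -> pbase j + 2 ^ (c * j.+1) <= U.
Proof.
move=> jE; rewrite -pbaseS; apply: leq_trans baseU.
by apply: leq_trans (pbase_le jE) _; rewrite leq_addr.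
Qed.

(** The output length is the content of a register, hence a word. So the code fits into the region
    of its level. *)
Lemma size_sls j : j < E -> 3 * size (sls j) < 2 ^ (c * j.+1).
Proof.
move=> jE; have := slsP jE; rewrite /run; case: ifP => // hh [] h.
rewrite -size_flatten_words -h size_mkseq foldl_nseq0.
suff H T : forall r, regs (iter T (fun s => step (c * j.+1) p [:: [:: sz j]] s 0) init_state) r
    < 2 ^ (c * j.+1) by apply: H.
elim: T => [|T IH] r /=; first by rewrite expn_gt0.
exact: step_reg_lt.
Qed.

Lemma prep_bodyP j e : j < E -> vr e 95 = j -> vr e vE = E ->
  vr e 91 = 2 ^ (c * j.+1) -> vr e 92 = c * j.+1 -> vr e 93 = pbase j ->
  vr e 94 = sz j -> slps_ready j e -> (forall x, pbase j <= x -> ar e aSIM x = 0) ->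
  tri prep_body e ((t j).+1 * sim_cost p + cc (reset_c p) + 80) (fun e' =>
    [/\ vr e' 91 = 2 ^ (c * j.+2), vr e' 92 = c * j.+2, vr e' 93 = pbase j.+1,
        vr e' 94 = sz j.+1 &
        slps_ready j.+1 e' /\ forall x, pbase j.+1 <= x -> ar e' aSIM x = 0]).
Proof.
move=> jE e95 eE e91 e92 e93 e94 rd z0.
have bU := pbaseU jE.
have WU : 2 ^ (c * j.+2) <= U.
  apply: leq_trans baseU; apply: leq_trans (leq_addl _ _).
  by rewrite leq_exp2l // leq_mul2l ltnS jE orbT.
have c2U : 2 ^ c <= U.
  by apply: leq_trans WU; rewrite leq_exp2l // leq_pmulr.
have wle k : k < 2 ^ k by apply: ltn_expl.
have szU : sz j + sz j <= U.
  by apply: leq_trans EU; rewrite -/(sz j.+1) !szE leq_exp2l.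
have jU : j < U.
  by apply: leq_trans EU; rewrite szE; apply: leq_trans (wle j) _; rewrite leq_exp2l // ltnW.
have cjU : c * j.+2 <= U by have := wle (c * j.+2); lia.
have cjE : c * j.+2 = c * j.+1 + c by rewrite mulnS addnC.
rewrite /prep_body; refine (seqP (resetP (e := e)) (T2 := (t j).+1 * sim_cost p + 80) _ _); first by lia.
move=> e1 [r90 rr] fr1 _.
have k1 v : 90 < v < 100 -> vr e1 v = vr e v.
  move=> hv; rewrite fr1.1 //; have v1 : v < 100 by lia.
  have v2 : v != 90 by lia.
  by have /andP[] := @mv_sim p v v1 v2.
have a1 a : ar e1 a =1 ar e a.
  move=> x; rewrite fr1.2 // /reset_c; elim: (iota _ _) => //.
have se : srel p (c * j.+1) (pbase j) (sz j) e1 init_state.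
  split=> //=; rewrite ?r90 ?(k1 91) ?(k1 92) ?(k1 93) ?(k1 94) ?min0n ?expn_gt0 //.
  by move=> a ha; rewrite a1 z0 // leq_addr.
have := slsP jE; rewrite /run foldl_nseq0; case: ifP => // hh [] hres.
set sf := iter _ _ _ in hh hres.
have wjU : c * j.+1 <= U by lia.
have r0 : regs sf 0 = 3 * size (sls j).
  by rewrite -size_flatten_words -hres size_mkseq.
apply: (seqP (sim_loopP rho w_large small_ins small_len Ularge Ulim cU bU _ wjU (T := t j) se hh) (T2 := 60)).
- by lia.
- by lia.
move=> e2 [g1 g2 g3] fr2 _.
have k2 v : 90 < v < 100 -> vr e2 v = vr e v.
  move=> hv; rewrite fr2.1 ?k1 //; have v1 : v < 100 by lia.
  have v2 : v != 90 by lia.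
  by have /andP[] := @mv_sim p v v1 v2.
have a2 a : a != aSIM -> ar e2 a =1 ar e a.
  move=> ha x; rewrite fr2.2 ?a1 //; apply: contra ha => h.
  by rewrite (@ma_sim p a) // mem_cat h.
have v95 : vr e2 95 = j by rewrite k2.
have v93 : vr e2 93 = pbase j by rewrite k2.
have v91 : vr e2 91 = 2 ^ (c * j.+1) by rewrite k2.
have v92 : vr e2 92 = c * j.+1 by rewrite k2.
have v94 : vr e2 94 = sz j by rewrite k2.
have v100 : vr e2 (sreg 0) = 3 * size (sls j) by rewrite g1.
have pE : 2 ^ (c * j.+1) * 2 ^ c = 2 ^ (c * j.+2) by rewrite -expnD cjE.
have wlt : 2 ^ (c * j.+1) < 2 ^ w by lia.
apply: tri_sl => //.
  rewrite /= v95 v93 v91 v92 v94 pE.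
  by do !split=> //; lia.
rewrite /= v95 v93 v91 v92 v94 pE; split=> //.
  by rewrite pbaseS.
split=> [i|x].
  rewrite ltnS leq_eqVlt => /orP[/eqP->|hi].
    rewrite /= !eqxx /= v100 mulKn //; split=> // q hq r hr /=.
    rewrite -addnA g2; last first.
      by have := size_sls jE; lia.
    rewrite -nth_flatten_words // -hres nth_mkseq // r0; lia.
  have [b1 b2 b3] := rd i hi.
  rewrite /= (_ : (i == j) = false) ?andbF /=; last by apply/eqP; lia.
  split; [by rewrite a2 | by rewrite a2 |].
  move=> q hq r hr /=; rewrite g3 ?a1 ?b3 //.
  have hs := size_sls (ltn_trans hi jE).
  have := pbase_le hi; rewrite pbaseS; lia.
rewrite pbaseS /= => hx; rewrite g3 ?a1 ?z0 //; lia.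
Qed.

Lemma prepP e T : vr e vE = E -> (forall x, ar e aSIM x = 0) ->
  \sum_(0 <= j < E) ((t j).+1 * prep_const) + 100 <= T ->
  tri prep_c e T (fun e' => slps_ready E e').
Proof.
move=> eE z0 le.
have c2U : 2 ^ c <= U.
  apply: leq_trans baseU; apply: leq_trans (leq_addl _ _).
  by rewrite leq_exp2l // leq_pmulr.
have cU' : c < 2 ^ c by apply: ltn_expl.
pose I j e := [/\ vr e 91 = 2 ^ (c * j.+1), vr e 92 = c * j.+1, vr e 93 = pbase j,
        vr e 94 = sz j &
        slps_ready j e /\ forall x, pbase j <= x -> ar e aSIM x = 0].
apply: (seqP (T1 := 20) (P := fun e1 => I 0 e1) (T2 := \sum_(0 <= j < E) ((t j).+1 * prep_const) + 8)); last 2 first.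
- by lia.
- move=> e1 I1 fr1 _.
  apply: (conseqP (T := \sum_(0 <= j < E) ((t j).+1 * prep_const) + 8)
     (Q := fun e' => I E e' /\ frame (95 :: mv prep_body) (ma prep_body) e1 e')) => //; last first.
    by move=> e' _ _ [[_ _ _ _ []]].
  have n95 : (95 \notin mv prep_body) && (vE \notin mv prep_body).
    have /andP[h1 h2] := @mv_sim p 95 isT isT; have /andP[h3 h4] := @mv_sim p vE isT isT.
    by rewrite mv_bodyE !mem_cat !negb_or h1 h2 h3 h4.
  apply: (tri_forv w_large small_ins small_len (kap := fun j => (t j).+1 * sim_cost p + cc (reset_c p) + 80)) => //.
  + by rewrite fr1.1.
  + rewrite leq_add2r; apply: leq_sum => j _.
    rewrite /prep_const; move: (cc _) (sim_cost p) (t j) => a b d; nia.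
  move=> j e2 jE e95 fr2 _ [h1 h2 h3 h4 [h5 h6]].
  have eE2 : vr e2 vE = E.
    rewrite fr2.1 ?fr1.1 // inE negb_or /=; by case/andP: n95.
  apply: (conseqP (prep_bodyP jE e95 eE2 h1 h2 h3 h4 h5 h6)) => // e3 _ _ [g1 g2 g3 g4 [g5 g6]].
apply: tri_sl => //=; first by do !split=> //; lia.
rewrite /I /pbase; split=> //=; rewrite ?muln1 ?big_geq //.
Qed.

End Prep.

(** * Preprocessing *)

Section Programs.

Variables (p : program) (c k : nat).

Definition kf := k + 7.
(** The number of chunks of $s$ = [bitlen n] bits that hold $3^{l+1}$ bits: for $l > 0$, minimality
    of $l$ gives $3^{l-1} \le kf \cdot s / 2$, hence $3^{l+1} \le 5\, kf \cdot s$. *)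
Definition Jf := 5 * kf + 3.

Definition grow_c v nv := (* v := least power of two >= V nv, V vE its logarithm *)
  (Asg v (K 1) ;; Asg vE (K 0)) ;;
  Loop (Bin OpLt (V v) (V nv)) (Asg v (V v +' V v) ;; Asg vE (V vE +' K 1)).

(** Weights are drawn first, and for all pairs: edges inserted later find their weights ready, and
    the tape positions depend on [n] only. *)
Definition rnd_c :=
  (Asg vn (Inp 0 (K 0)) ;; Asg 12 (V vn *' V vn) ;; Asg 10 (K 0)) ;;
  Loop (Bin OpLt (V 10) (V 12)) (Rnd 13 ;; Sto 11 (V 10) (V 13) ;; Asg 10 (V 10 +' K 1)).

Definition bits_c :=
  (Asg vBL (K 1) ;; Asg vPW (K 2)) ;;
  Loop (Bin OpLt (V vPW) (V vn +' K 1))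
    (Asg vBL (V vBL +' K 1) ;; Asg vPW (V vPW +' V vPW)).

Definition half_c :=
  (Asg 9 (K 1) ;; Asg vPH (K 2)) ;;
  Loop (Bin OpLt (V 9 +' V 9) (K kf *' V vBL))
    (Asg 9 (V 9 *' K 3) ;; Asg vPH (V vPH *' V vPH *' V vPH)).

(** The layout is: header, multiplication table, weights of all pairs, weights restricted to the
    edges, padded matrix. Variable 10 is the number of field elements. *)
Definition offsets_c :=
  Asg 10 (V vPH *' V vPH) ;; Asg vPM (V 10 *' V vPH) ;;
  Asg 12 (K HDR +' V vPW *' V vPW) ;; Asg 13 (V vn *' V vn) ;;
  Asg 14 (V 12 +' V 13) ;; Asg vMB (V 14 +' V 13).

(** The recursion [ctS] derives row [x] from row [x / 2], so that the table needs constant time per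
    entry. *)
Definition tab_c :=
  Sto 0 (K HDR +' (V 15 *' V vPW +' V 16))
    (Bin OpXor (Arr 0 (K HDR +' (Bin OpDiv (V 15) (K 2) *' V vPW +' V 16)) *' K 2)
               (Bin OpMod (V 15) (K 2) *' V 16)).

Definition fillX_c :=
  Sto 0 (V 12 +' (V 15 *' V vn +' V 16))
    (Bin OpMod (Arr 11 (V 15 *' V vn +' V 16)) (V 10)).

Definition fillA_c :=
  Sto 0 (V 14 +' (V 15 *' V vn +' V 16))
    (Arr 0 (V 12 +' (V 15 *' V vn +' V 16)) *' Inp 1 (V 15 *' V vn +' V 16)).

Definition fillM_c :=
  Asg 17 (Bin OpEq (V 15) (V 16)) ;;
  Cond (Bin OpAnd (Bin OpLt (V 15) (V vn)) (Bin OpLt (V 16) (V vn)))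
    (Asg 17 (Bin OpXor (V 17) (Arr 0 (V 14 +' (V 15 *' V vn +' V 16))))) Skip ;;
  Sto 0 (V vMB +' (V 15 *' V vN +' V 16)) (V 17).

Definition square_c nv b := For 15 nv (For 16 nv b).

Definition header_c :=
  Sto 0 (K 0) (V vn) ;; Sto 0 (K 1) (V vBL) ;; Sto 0 (K 2) (V vPW) ;;
  Sto 0 (K 3) (V vPM) ;; Sto 0 (K 4) (V vPH) ;; Sto 0 (K 5) (V vN) ;;
  Sto 0 (K 6) (V vMB) ;; Sto 0 (K 7) (V 12) ;; Sto 0 (K 8) (V 14).

Definition fin_c := Sto 0 (K 9) (V 11) ;; Asg vlen (V vMB +' V vN *' V vN).

Definition pre_rest :=
  bits_c ;; half_c ;; offsets_c ;; grow_c vN vn ;;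
  square_c vPW tab_c ;; square_c vn fillX_c ;; square_c vn fillA_c ;;
  square_c vN fillM_c ;; header_c ;; prep_c p c ;; inv_c true Jf ;; fin_c.

Definition pre_c := rnd_c ;; pre_rest.

(** * Updates *)

Definition restore_c :=
  Asg vn (Inp 0 (K 0)) ;; Asg vBL (Inp 0 (K 1)) ;; Asg vPW (Inp 0 (K 2)) ;;
  Asg vPM (Inp 0 (K 3)) ;; Asg vPH (Inp 0 (K 4)) ;; Asg 72 (Inp 0 (K 5)) ;;
  Asg 73 (Inp 0 (K 6)) ;; Asg 74 (Inp 0 (K 7)) ;; Asg 75 (Inp 0 (K 8)) ;;
  Asg 76 (Inp 0 (K 9)).

(* Arrays 12 and 13 mark the deleted nodes and edges. *)
Definition mark_c :=
  Asg 16 (V 15 *' K 3) ;;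
  Asg 17 (Inp 1 (V 16)) ;; Asg 18 (Inp 1 (V 16 +' K 1)) ;; Asg 19 (Inp 1 (V 16 +' K 2)) ;;
  Cond (Bin OpEq (V 17) (K 2)) (Sto 12 (V 18) (K 1))
    (Cond (V 17) (Sto 13 (V 18 *' V vn +' V 19) (K 1)) Skip).

(** An update becomes four words: tail, head, [uscale], and whether it deletes a node. For an
    insertion, the XOR of the restricted and the full weight is the full weight if the edge is new
    and 0 otherwise. *)
Definition scale_c :=
  Asg 16 (V 15 *' K 3) ;;
  Asg 17 (Inp 1 (V 16)) ;; Asg 18 (Inp 1 (V 16 +' K 1)) ;; Asg 19 (Inp 1 (V 16 +' K 2)) ;;
  Asg 23 (V 18 *' V vn +' V 19) ;;
  Asg 24 (Inp 0 (V 75 +' V 23)) ;;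
  Cond (Bin OpEq (V 17) (K 2)) (Asg 24 (K 1))
   (Cond (Arr 12 (V 18)) (Asg 24 (K 0))
     (Cond (V 17) Skip
       (Cond (Arr 13 (V 23)) (Asg 24 (K 0))
          (Asg 24 (Bin OpXor (V 24) (Inp 0 (V 74 +' V 23))))))) ;;
  Asg 25 (K HDR +' V 15 *' K 4) ;;
  Sto 0 (V 25) (V 18) ;; Sto 0 (V 25 +' K 1) (V 19) ;;
  Sto 0 (V 25 +' K 2) (V 24) ;; Sto 0 (V 25 +' K 3) (Bin OpEq (V 17) (K 2)).

(* V d := entry (V 80, V 81) of Q N, for the update stored by [lst]. *)
Definition qn_c (lst : exp -> exp) d :=
  Asg 26 (K HDR +' V 80 *' K 4) ;;
  Asg 27 (lst (V 26 +' K 1)) ;;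
  mulc false Jf d (lst (V 26 +' K 2)) (Inp 0 (V 73 +' (V 27 *' V 72 +' V 81))) ;;
  Cond (Bin OpAnd (lst (V 26 +' K 3)) (Bin OpEq (V 27) (V 81)))
    (Asg d (Bin OpXor (V d) (V 76))) Skip.

Definition fillK_c :=
  Asg 28 (Bin OpEq (V 15) (V 16)) ;;
  Cond (Bin OpAnd (Bin OpLt (V 15) (V 9)) (Bin OpLt (V 16) (V 9)))
    (Asg 80 (V 15) ;; Asg 81 (Arr 0 (K HDR +' V 16 *' K 4)) ;;
     qn_c (Arr 0) 29 ;;
     Asg 28 (Bin OpXor (V 29) (V 28 *' V 76))) Skip ;;
  Sto 0 (V vMB +' (V 15 *' V vN +' V 16)) (V 28).

Definition upd_c :=
  restore_c ;; Asg 9 (Bin OpDiv (Len 1) (K 3)) ;; grow_c vN 9 ;;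
  Asg vMB (K HDR +' V 9 *' K 4) ;;
  For 15 9 mark_c ;; For 15 9 scale_c ;; square_c vN fillK_c ;;
  prep_c p c ;; inv_c false Jf ;;
  Sto 0 (K 0) (V 9) ;; Sto 0 (K 1) (V vN) ;; Sto 0 (K 2) (V 11) ;;
  Sto 0 (K 3) (V vMB) ;; Asg vlen (V vMB +' V vN *' V vN).

(** * Queries *)

Definition inner_c :=
  Asg 80 (V 16) ;; qn_c (Inp 1) 29 ;;
  mulc false Jf 28 (Inp 1 (V vMB +' (V 15 *' V vN +' V 16))) (V 29) ;;
  Asg 82 (Bin OpXor (V 82) (V 28)).

(** Evaluating the Woodbury correction from right to left keeps a query quadratic in [f]. Meanwhile
    variable 86 records whether an endpoint of the query is deleted. *)
Definition outer_c :=
  Asg 83 (K HDR +' V 15 *' K 4) ;; Asg 17 (Inp 1 (V 83)) ;;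
  Cond (Bin OpAnd (Inp 1 (V 83 +' K 3))
          (Bin OpOr (Bin OpEq (V 17) (V 85)) (Bin OpEq (V 17) (V 81))))
    (Asg 86 (K 1)) Skip ;;
  Asg 82 (K 0) ;; For 16 9 inner_c ;;
  mulc false Jf 28 (Inp 0 (V 73 +' (V 85 *' V 72 +' V 17))) (V 82) ;;
  Asg 84 (Bin OpXor (V 84) (V 28)).

Definition zero_c :=
  Asg 16 (Bin OpMod (V 84) (V vPH)) ;;
  Asg 17 (Bin OpMod (Bin OpDiv (V 84) (V vPH)) (V vPH)) ;;
  Asg 18 (Bin OpDiv (V 84) (V vPH *' V vPH)) ;;
  Cond (Bin OpAnd (Bin OpEq (V 16) (V 17)) (Bin OpEq (V 17) (V 18)))
    (Asg 86 (K 1)) Skip ;;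
  Sto 0 (K 0) (Bin OpEq (V 86) (K 0)) ;; Asg vlen (K 1).

Definition qry_c :=
  (restore_c ;; Asg 9 (Inp 1 (K 0)) ;; Asg vN (Inp 1 (K 1)) ;; Asg 87 (Inp 1 (K 2)) ;;
   Asg vMB (Inp 1 (K 3)) ;; Asg 85 (Inp 2 (K 0)) ;; Asg 81 (Inp 2 (K 1)) ;;
   Asg 86 (K 0)) ;;
  mulc false Jf 84 (V 87) (Inp 0 (V 73 +' (V 85 *' V 72 +' V 81))) ;;
  For 15 9 outer_c ;; zero_c.

End Programs.

(** * Random words at known times *)

Section RndSpec.

Variables (w : nat) (ins : seq (seq nat)) (rho : nat -> nat).
Hypothesis w_large : 7 < w.

Definition rnd_loop := Loop (Bin OpLt (V 10) (V 12))
  (Rnd 13 ;; Sto 11 (V 10) (V 13) ;; Asg 10 (V 10 +' K 1)).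
Definition rnd_test := (ecost (Bin OpLt (V 10) (V 12))).+1.
Definition rnd_period := rnd_test + 1 + size (ccmd 0 (Sto 11 (V 10) (V 13))) +
  (ecost (V 10 +' K 1)).+1 + 2.

(* Unlike in other parts of the programs, exact running times matter here: the
   random words which are used sit at known positions of the tape. *)
Lemma rnd_loopP n2 m e t : vr e 12 = n2 -> n2 < lim w -> vr e 10 + m = n2 ->
  exists e', [/\ bs w ins rho rnd_loop t e (t + m * rnd_period + rnd_test.+2) e',
    forall i, i < m -> ar e' 11 (vr e 10 + i) = rho (t + i * rnd_period + rnd_test) %% 2 ^ w,
    forall i, i < vr e 10 -> ar e' 11 i = ar e 11 i,
    forall a, a != 11 -> ar e' a =1 ar e a &
    forall v, v \notin [:: 10; 13] -> vr e' v = vr e v].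
Proof.
have lw : lim w <= 2 ^ w by rewrite /lim leq_exp2l // leq_subr.
elim: m e t => [|m IH] e t e12 nl e10.
  rewrite addn0 in e10; exists e; split=> //; rewrite mul0n addn0.
  by apply: bs_stop => //=; rewrite e10 e12 ltnn.
set r := rho (t + rnd_test) %% 2 ^ w; set i0 := vr e 10.
pose e1 := setv (seta (setv e 13 r) 11 i0 r) 10 (i0 + 1).
have [|e' [b h1 h2 h3 h4]] := IH e1 (t + rnd_period) e12 nl.
  by rewrite /= -e10 addn1 addnS.
exists e'; split.
- apply: (bs_iter (t1 := t + rnd_period - 2) (e1 := e1)) => //=.
  + by rewrite e12 -e10; lia.
  + have -> : t + rnd_period - 2 = ((t + rnd_test).+1 +
        size (ccmd 0 (Sto 11 (V 10) (V 13)))) + (ecost (V 10 +' K 1)).+1.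
      by rewrite /rnd_period; lia.
    apply: bs_sq; first exact: bs_rnd.
    apply: bs_sq; first by apply: bs_sto => //=; rewrite -/i0; lia.
    by apply: bs_asg => //=; rewrite -/i0; split=> //; lia.
  have -> : (t + rnd_period - 2).+2 = t + rnd_period by rewrite /rnd_period; lia.
  by rewrite mulSn addnA in b *.
- move=> [|i] hi; first by rewrite addn0 h2 /= ?eqxx ?mul0n ?addn0 // -/i0; lia.
  have := h1 i hi; rewrite /= -/i0 addn1 addSnnS => ->.
  by rewrite mulSn; congr (rho _ %% _); lia.
- move=> i hi; rewrite h2 /=; last by rewrite -/i0 addn1 ltnS ltnW.
  by rewrite (_ : (i == i0) = false) ?andbF //; apply/eqP; lia.
- by move=> a ha i; rewrite h3 //= (negbTE ha).
move=> v hv; rewrite h4 //=; move: hv; rewrite !inE negb_or => /andP[/negbTE-> /negbTE->] //.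
Qed.

Definition rnd_start := 4 + (ecost (Inp 0 (K 0))).+1 + (ecost (V vn *' V vn)).+1 + (ecost (K 0)).+1.
Definition rnd_pos i := rnd_start + i * rnd_period + rnd_test.
Definition rnd_time n2 := rnd_start + n2 * rnd_period + rnd_test.+2.

Lemma rnd_cP n : nth 0 (nth [::] ins 0) 0 = n -> n * n < lim w ->
  exists e', [/\ bs w ins rho rnd_c 4 env0 (rnd_time (n * n)) e', vr e' vn = n,
    forall i, i < n * n -> ar e' 11 i = rho (rnd_pos i) %% 2 ^ w &
    forall a i, a != 11 -> ar e' a i = 0].
Proof.
move=> hn nl; have lw : lim w <= 2 ^ w by rewrite /lim leq_exp2l // leq_subr.
have w1 : 1 < 2 ^ w by rewrite -{1}(expn0 2) ltn_exp2l // (ltn_trans _ w_large).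
pose e1 := setv (setv (setv env0 1 n) 12 (n * n)) 10 0.
have [|e' [b h1 h2 h3 h4]] := @rnd_loopP (n * n) (n * n) e1 rnd_start (erefl _) nl.
  by [].
exists e'; split.
- apply: bs_sq b; rewrite /rnd_start.
  apply: bs_sq; first by apply: bs_asg => //=; lia.
  apply: bs_sq; first by apply: bs_asg => //=; rewrite hn; split=> //; lia.
  have -> : e1 = setv (setv (setv env0 1 (nth 0 (nth [::] ins 0) 0)) 12
     (nth 0 (nth [::] ins 0) 0 * nth 0 (nth [::] ins 0) 0)) 10 0 by rewrite hn.
  by apply: bs_asg => //=; lia.
- by rewrite h4.
- by move=> i hi; have := h1 i hi; rewrite /= add0n => ->.
by move=> a i ha; rewrite h3.
Qed.

End RndSpec.

Section LoopSpecs.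

Variables (w : nat) (ins : seq (seq nat)) (rho : nat -> nat).
Hypothesis w_large : 7 < w.
Hypothesis small_ins : forall i j, nth 0 (nth [::] ins i) j < 2 ^ w.
Hypothesis small_len : forall i, size (nth [::] ins i) < 2 ^ w.

Notation tri := (tri w ins rho).
Let seqP := tri_seq (ins := ins) (rho := rho) w_large small_ins small_len.
Let conseqP := tri_conseq (ins := ins) (rho := rho) w_large small_ins small_len.
Let loopstep := tri_loop_step (ins := ins) (rho := rho) w_large small_ins small_len.

Let w8 : 128 < 2 ^ w.
Proof. by rewrite -[128]/(2 ^ 7) ltn_exp2l. Qed.

Lemma growP v nv e n : v \notin [:: vE; nv] -> vE != nv -> vr e nv = n ->
  2 * (n + 1) < 2 ^ w ->
  tri (grow_c v nv) e (up_log 2 n * 20 + 20) (fun e' =>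
    vr e' v = sz (up_log 2 n) /\ vr e' vE = up_log 2 n).
Proof.
rewrite !inE negb_or => /andP[/negbTE vE' /negbTE vnv] Env enn nw; set E := up_log 2 n.
have H m e1 i : i + m = E -> vr e1 nv = n -> vr e1 v = 2 ^ i -> vr e1 vE = i ->
  tri (Loop (Bin OpLt (V v) (V nv)) (Asg v (V v +' V v) ;; Asg vE (V vE +' K 1))) e1
    (m * 20 + 10) (fun e' => vr e' v = sz E /\ vr e' vE = E).
  elim: m e1 i => [|m IH] e1 i iE en ev1 eE.
    rewrite addn0 in iE; apply: (tri_conseq (T := 6) w_large small_ins small_len (Q := fun x => x = e1)) => //.
      by apply: tri_loop_end => //; rewrite [ev _ _ _]/= ev1 en iE ltnNge up_logP.
    by move=> _ _ _ ->; rewrite ev1 eE szE iE.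
  have iltE : i < E by lia.
  have lt : 2 ^ i < n by rewrite ltnNge; apply: contraL iltE => h; rewrite -leqNgt up_log_min.
  have ilt : i < 2 ^ i by apply: ltn_expl.
  apply: (loopstep (T1 := 12) (T2 := m * 20 + 10) (P := fun e' =>
     [/\ vr e' nv = n, vr e' v = 2 ^ i.+1 & vr e' vE = i.+1])) => //.
  - by rewrite [ev _ _ _]/= ev1 en lt.
  - apply: tri_sl => //=; rewrite ?ev1 ?eE ?eqxx ?vE' ?(eq_sym vE v) ?vE' ?eE.
      by do !split=> //; lia.
    rewrite !(eq_sym nv) vnv (negbTE Env) expnS mul2n addnn addn1.
    by split.
  - by rewrite (_ : ecost _ = 3) //; lia.
  by move=> e2 [h1 h2 h3] _ _; apply: (IH e2 i.+1) => //; lia.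
apply: (seqP (T1 := 6) (T2 := E * 20 + 10) (P := fun e' =>
   [/\ vr e' nv = n, vr e' v = 1 & vr e' vE = 0])).
- apply: tri_sl => //=; first by lia.
  by rewrite (eq_sym nv v) vnv (eq_sym nv 7) (negbTE Env) vE' eqxx.
- by lia.
by move=> e1 [h1 h2 h3] _ _; apply: (H E e1 0).
Qed.

Lemma bitsP e n : vr e vn = n -> 2 * (n + 1) < 2 ^ w ->
  tri bits_c e (bitlen n * 20 + 30) (fun e' =>
    vr e' vBL = bitlen n /\ vr e' vPW = 2 ^ bitlen n).
Proof.
move=> enn nw; set s := bitlen n.
have H m e1 i : i + m = s -> 0 < i -> vr e1 vn = n -> vr e1 vBL = i -> vr e1 vPW = 2 ^ i ->
  tri (Loop (Bin OpLt (V vPW) (V vn +' K 1))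
    (Asg vBL (V vBL +' K 1) ;; Asg vPW (V vPW +' V vPW))) e1
    (m * 20 + 10) (fun e' => vr e' vBL = s /\ vr e' vPW = 2 ^ s).
  elim: m e1 i => [|m IH] e1 i iE i0 en ev1 eE.
    rewrite addn0 in iE; apply: (tri_conseq (T := 8) w_large small_ins small_len (Q := fun x => x = e1)) => //.
      apply: tri_loop_end => //; first by rewrite /= en; do !split=> //; lia.
      by rewrite [LHS]/= eE en iE addn1 ltnS leqNgt trunc_log_ltn.
    by move=> _ _ _ ->; rewrite ev1 eE iE.
  have lt : 2 ^ i <= n.
    have iT : i <= trunc_log 2 n by move: iE; rewrite /s /bitlen; lia.
    have n0 : 0 < n by rewrite lt0n; apply/eqP => z; move: iT; rewrite z trunc_log0; lia.
    by apply: (@leq_trans (2 ^ trunc_log 2 n)); [rewrite leq_exp2l | apply: trunc_logP].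
  have ilt : i < 2 ^ i by apply: ltn_expl.
  apply: (loopstep (T1 := 12) (T2 := m * 20 + 10) (P := fun e' =>
     [/\ vr e' vn = n, vr e' vBL = i.+1 & vr e' vPW = 2 ^ i.+1])) => //.
  - by rewrite /= en; do !split=> //; lia.
  - by rewrite [X in X != 0]/= eE en addn1 ltnS lt.
  - apply: tri_sl => //=; rewrite ?ev1 ?eE; first by do !split=> //; lia.
    by rewrite expnS mul2n addnn addn1.
  by move=> e2 [h1 h2 h3] _ _; apply: (IH e2 i.+1) => //; lia.
apply: (seqP (T1 := 6) (T2 := s * 20 + 10) (P := fun e' =>
   [/\ vr e' vn = n, vr e' vBL = 1 & vr e' vPW = 2 ^ 1])).
- by apply: tri_sl => //=; lia.
- by lia.
move=> e1 [h1 h2 h3] _ _; apply: (conseqP (T := s.-1 * 20 + 10)); last by move=> ? _ _; exact.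
  by apply: (H s.-1 e1 1) => //; rewrite /s /bitlen; lia.
by rewrite leq_add2r leq_mul2r leq_pred orbT.
Qed.

Lemma halfP k e s : vr e vBL = s -> kf k * s < 2 ^ w -> kf k < 2 ^ w ->
  let l := up_log 3 (uphalf (kf k * s)) in 3 ^ l * 3 < w ->
  tri (half_c k) e (l * 30 + 30) (fun e' =>
    vr e' 9 = 3 ^ l /\ vr e' vPH = 2 ^ 3 ^ l).
Proof.
move=> es ksw kw l lw.
have ww : w < 2 ^ w by apply: ltn_expl.
have H m e1 i : i + m = l -> vr e1 vBL = s -> vr e1 9 = 3 ^ i -> vr e1 vPH = 2 ^ 3 ^ i ->
  tri (Loop (Bin OpLt (V 9 +' V 9) (K (kf k) *' V vBL))
    (Asg 9 (V 9 *' K 3) ;; Asg vPH (V vPH *' V vPH *' V vPH))) e1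
    (m * 30 + 12) (fun e' => vr e' 9 = 3 ^ l /\ vr e' vPH = 2 ^ 3 ^ l).
  elim: m e1 i => [|m IH] e1 i iE en ev1 eE.
    have il : 3 ^ i <= 3 ^ l by rewrite leq_exp2l //; lia.
    rewrite addn0 in iE; apply: (tri_conseq (T := 10) w_large small_ins small_len (Q := fun x => x = e1)) => //.
      apply: tri_loop_end => //; first by rewrite /= en ev1; do !split=> //; lia.
      rewrite [LHS]/= en ev1 iE; have : uphalf (kf k * s) <= 3 ^ l by apply: up_logP.
      by move: (3 ^ l) (kf k * s) => a b; lia.
    by move=> _ _ _ ->; rewrite ev1 eE iE.
  have il : 3 ^ i * 3 <= 3 ^ l by rewrite -expnSr leq_exp2l //; lia.
  have lt : 3 ^ i + 3 ^ i < kf k * s.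
    have : i < l by lia.
    rewrite ltnNge => h; rewrite ltnNge; apply: contra h => h; apply: up_log_min => //.
    by move: h; move: (3 ^ i) (kf k * s) => a b; lia.
  have p3 : 2 ^ 3 ^ i * 2 ^ 3 ^ i * 2 ^ 3 ^ i = 2 ^ 3 ^ i.+1.
    by rewrite -!expnD; congr (2 ^ _); rewrite expnS; lia.
  have p2 : 2 ^ 3 ^ i * 2 ^ 3 ^ i < 2 ^ w by rewrite -expnD ltn_exp2l //; lia.
  have p4 : 2 ^ 3 ^ i.+1 < 2 ^ w by rewrite ltn_exp2l // expnSr; lia.
  apply: (loopstep (T1 := 16) (T2 := m * 30 + 12) (P := fun e' =>
     [/\ vr e' vBL = s, vr e' 9 = 3 ^ i.+1 & vr e' vPH = 2 ^ 3 ^ i.+1])) => //.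
  - by rewrite /= en ev1; do !split=> //; lia.
  - by rewrite [X in X != 0]/= en ev1 lt.
  - apply: tri_sl => //=; rewrite ?ev1 ?eE ?p3; first by do !split=> //; lia.
    by rewrite expnSr.
  - by rewrite (_ : ecost _ = 7) //; lia.
  by move=> e2 [h1 h2 h3] _ _; apply: (IH e2 i.+1) => //; lia.
apply: (seqP (T1 := 6) (T2 := l * 30 + 12) (P := fun e' =>
   [/\ vr e' vBL = s, vr e' 9 = 3 ^ 0 & vr e' vPH = 2 ^ 3 ^ 0])).
- by apply: tri_sl => //=; lia.
- by lia.
by move=> e1 [h1 h2 h3] _ _; apply: (H l e1 0).
Qed.

End LoopSpecs.

(** * Specification of preprocessing *)

Section PreSpec.

Variables (p : program) (c k : nat).
Variables (w : nat) (ins : seq (seq nat)) (rho : nat -> nat).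
Hypothesis w_large : 7 < w.
Hypothesis small_ins : forall i j, nth 0 (nth [::] ins i) j < 2 ^ w.
Hypothesis small_len : forall i, size (nth [::] ins i) < 2 ^ w.

Variables (n l U : nat).
Notation s := (bitlen n).
Notation J := (Jf k).
Notation h := (3 ^ l).
Notation m := (h * 3).
Hypothesis lE : l = up_log 3 (uphalf (kf k * s)).
Hypotheses (mJ : m <= s * J) (Jw : 2 * (s * J) <= w) (kw : kf k * s < w).
Hypotheses (Ularge : 1000 <= U) (Ulim : 1000 * (U * U) <= lim w).
Hypothesis sU4 : 4 * 2 ^ s <= U.
Hypothesis cU : cbound p <= U.

Notation E := (up_log 2 n).
Notation N := (sz E).
Hypotheses (NU : N <= U) (EU2 : E + 2 <= U).

Definition XO := HDR + 2 ^ s * 2 ^ s.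
Definition AO := XO + n * n.
Definition MO := AO + n * n.

Variables (sls : nat -> slp) (t : nat -> nat).
Hypothesis slsM : forall i, slp_multiplies (sz i) (sls i).
Hypothesis baseU : pbase c E + 2 ^ (c * E.+1) <= U.
Hypothesis slsP : forall j, j < E ->
  run (c * j.+1) p [:: [:: sz j]] (nseq (t j) 0) =
    Some (flatten (map slp_instr_words (sls j))).

Variables (L : finFieldType) (z : L).
Hypotheses (char2 : (2%N \in [pchar L])%R) (zm : (z ^+ m = 1)%R).

Notation tri := (tri w ins rho).
Notation trc c e Q := (tri c e (cc c) Q).
Notation fw := (fw m z).
Notation mem := (mem m z).

Let uu := UU Ularge.
Let lw := lim_w w.
Let seqP := tri_seq (ins := ins) (rho := rho) w_large small_ins small_len.
Let conseqP := tri_conseq (ins := ins) (rho := rho) w_large small_ins small_len.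

Let ns : n < 2 ^ s. Proof. by rewrite trunc_log_ltn. Qed.
Let nU : 4 * n < U. Proof. by lia. Qed.
Let ssU : 16 * (2 ^ s * 2 ^ s) <= U * U.
Proof. have := leq_mul sU4 sU4; lia. Qed.
Let nnU : 16 * (n * n) <= U * U.
Proof. have := leq_mul (ltnW nU) (ltnW nU); lia. Qed.
Let NNU : N * N <= U * U. Proof. exact: leq_mul. Qed.
Let s0 : 0 < s. Proof. by []. Qed.
Let h0 : 0 < h. Proof. by rewrite expn_gt0. Qed.
Let m0 : 0 < m. Proof. by rewrite muln_gt0 h0. Qed.
Let sU : 2 ^ s <= U. Proof. lia. Qed.

Record hv e : Prop := Hv {
  hv_n : vr e vn = n; hv_BL : vr e vBL = s; hv_PW : vr e vPW = 2 ^ s;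
  hv_PH : vr e vPH = 2 ^ h; hv_10 : vr e 10 = 2 ^ (h + h); hv_PM : vr e vPM = 2 ^ m;
  hv_X : vr e 12 = XO; hv_A : vr e 14 = AO; hv_MB : vr e vMB = MO;
  hv_N : vr e vN = N; hv_E : vr e vE = E }.

Lemma hv_frame vs cs e e' : hv e -> frame vs cs e e' ->
  all [predC vs] [:: vn; vBL; vPW; vPH; 10; vPM; 12; 14; vMB; vN; vE] -> hv e'.
Proof.
move=> [h1 h2 h3 h4 h5 h6 h7 h8 h9 h10 h11] [fv _] /allP hs.
by split; rewrite fv //; apply: hs.
Qed.

Lemma setupP e (Q : env -> Prop) T1 T d : vr e vn = n ->
  (forall e', hv e' -> ar e' = ar e -> tri d e' T1 Q) ->
  (2 * s + E + l + 6) * 30 + T1 <= T ->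
  tri (bits_c ;; half_c k ;; offsets_c ;; grow_c vN vn ;; d) e T Q.
Proof.
move=> en kd le.
have mw : m < w by lia.
have pw i : i <= w -> i < 2 ^ w by move=> hi; apply: leq_ltn_trans hi _; apply: ltn_expl.
have kfw : kf k < 2 ^ w by apply: pw; apply: leq_trans (ltnW kw); rewrite leq_pmulr.
have same c0 e1 e2 : ma c0 = [::] -> frame (mv c0) (ma c0) e1 e2 -> ar e2 = ar e1.
  by move=> -> [_ h]; apply/funext => a; apply/funext => i; rewrite h.
apply: (seqP (bitsP rho w_large small_ins small_len en _) (T2 := (s + E + l + 5) * 30 + T1)); [lia|lia|].
move=> e1 [s1 pw1] fr1 _; have en1 : vr e1 vn = n by rewrite fr1.1.
apply: (seqP (halfP rho w_large small_ins small_len s1 (pw _ (ltnW kw)) kfw _) (T2 := (s + E + 4) * 30 + T1)).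
- by rewrite -lE.
- by rewrite -lE; lia.
rewrite -lE => e2 [h2 ph2] fr2 _.
have e2s : vr e2 vBL = s by rewrite fr2.1.
have e2w : vr e2 vPW = 2 ^ s by rewrite fr2.1.
have e2n : vr e2 vn = n by rewrite fr2.1.
have p2 : 2 ^ h * 2 ^ h = 2 ^ (h + h) by rewrite expnD.
have p3 : 2 ^ (h + h) * 2 ^ h = 2 ^ m by rewrite -expnD; congr (2 ^ _); lia.
have p2w : 2 ^ (h + h) < 2 ^ w by rewrite ltn_exp2l //; lia.
have p3w : 2 ^ m < 2 ^ w by rewrite ltn_exp2l.
apply: (seqP (T1 := 60) (T2 := (s + E + 2) * 30 + T1) (P := fun e' =>
  [/\ vr e' vn = n, vr e' vBL = s, vr e' vPW = 2 ^ s, vr e' vPH = 2 ^ h & 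
   [/\ vr e' 10 = 2 ^ (h + h), vr e' vPM = 2 ^ m, vr e' 12 = XO,
    vr e' 14 = AO & vr e' vMB = MO]])).
- apply: tri_sl => //=; rewrite e2n e2w ph2 p2 p3 //.
  by do !split=> //; lia.
- by lia.
move=> e3 [g1 g2 g3 g4 [g5 g6 g7 g8 g9]] fr3 _.
apply: (seqP (growP rho w_large small_ins small_len _ _ g1 _) (T2 := T1)) => //; [lia|lia|].
move=> e4 [v4 E4] fr4 _; apply: kd.
  by split; rewrite ?v4 ?E4 // fr4.1.
by rewrite (same _ _ _ _ fr4) // (same _ _ _ _ fr3) // (same _ _ _ _ fr2) // (same _ _ _ _ fr1).
Qed.

Notation PW := (2 ^ s).

Lemma tabP e : hv e -> (forall i, HDR <= i -> ar e 0 i = 0) ->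
  tri (square_c vPW tab_c) e (PW * (PW * (cc tab_c + 10) + 18) + 8) (fun e' =>
    [/\ hv e', forall x y, x < PW -> y < PW -> ar e' 0 (HDR + (x * PW + y)) = ct x y &
       forall a, a != 0 -> ar e' a =1 ar e a]).
Proof.
move=> he z0.
pose I i e' := hv e' /\ [/\ forall x y, x < i -> y < PW -> ar e' 0 (HDR + (x * PW + y)) = ct x y,
   forall a, HDR + i * PW <= a -> ar e' 0 a = 0 & forall a, a != 0 -> ar e' a =1 ar e a].
pose I2 i j e' := hv e' /\ [/\ forall x y, x < i -> y < PW -> ar e' 0 (HDR + (x * PW + y)) = ct x y,
   forall y, y < j -> ar e' 0 (HDR + (i * PW + y)) = ct i y,
   forall a, HDR + (i * PW + j) <= a -> ar e' 0 a = 0 & forall a, a != 0 -> ar e' a =1 ar e a].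
apply: (conseqP (T := PW * (PW * (cc tab_c + 10) + 18) + 8) (Q := fun e' => I PW e' /\
   frame (15 :: mv (For 16 vPW tab_c)) (ma (For 16 vPW tab_c)) e e')) => //; last first.
  by move=> e' _ _ [[h1 [h2 _ h3]] _].
apply: (tri_for w_large small_ins small_len (kap := PW * (cc tab_c + 10) + 8)) => //.
- exact: hv_PW.
- by rewrite -addnA.
- split; last by split=> // a ha; apply: z0; lia.
  by apply: (hv_frame (vs := [:: 15]) (cs := [::]) he) => //; split=> // v /=; rewrite inE => /negbTE->.
move=> i e1 iP e15 fr1 _ [h1 [h2 h3 h4]].
apply: (conseqP (T := PW * (cc tab_c + 10) + 8) (Q := fun e' => I2 i PW e' /\
   frame (16 :: mv tab_c) (ma tab_c) e1 e')) => //; last first.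
  move=> e' fr' _ [[g1 [g2 g3 g4 g5]] fr2]; split.
    by apply: (hv_frame (vs := [:: 15]) (cs := [::]) g1) => //; split=> // v /=; rewrite inE => /negbTE->.
  split=> // [x y|a ha].
    by rewrite ltnS leq_eqVlt => /orP[/eqP->|]; [apply: g3 | apply: g2].
  by apply: g4; rewrite mulSn in ha; lia.
apply: (tri_for w_large small_ins small_len (kap := cc tab_c)) => //.
- exact: hv_PW.
- split; last by split=> // a ha; apply: h3; lia.
  by apply: (hv_frame (vs := [:: 16]) (cs := [::]) h1) => //; split=> // v /=; rewrite inE => /negbTE->.
move=> j e2 jP e16 fr2 _ [g1 [g2 g3 g4 g5]].
have v15 : vr e2 15 = i by rewrite fr2.1.
have v3 := hv_PW g1.
have iw : i * PW + PW <= PW * PW by rewrite -mulSnr leq_mul2r iP orbT.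
have i2w : i %/ 2 * PW + PW <= PW * PW by rewrite -mulSnr leq_mul2r; apply/orP; right; lia.
(* In row 0 the entry read is the one about to be written, and its initial value 0 is already
   correct. *)
have rd : ar e2 0 (HDR + (i %/ 2 * PW + j)) = ct (i %/ 2) j.
  case: (posnP i) => [iz|i0]; last by apply: g2 => //; rewrite ltn_divLR //; lia.
  by rewrite iz div0n g4 // iz; lia.
have ctl x : x < PW -> ct x j < PW * PW by move=> xP; rewrite -expnD; apply: ct_lt.
have ci : i %/ 2 < PW by apply: leq_ltn_trans iP; apply: leq_div.
have cti := ctl _ ci.
have mi : i %% 2 < 2 by rewrite ltn_mod.
have mj : i %% 2 * j <= j by move: (i %% 2) mi => [|[|]] //; lia.
apply: tri_sl => //=; rewrite v15 e16 v3 rd.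
  by do !split=> //; lia.
have ctE : Nat.lxor (ct (i %/ 2) j * 2) (i %% 2 * j) = ct i j.
  by rewrite [RHS]ctS -divn2 modn2.
rewrite ctE; split.
  by apply: (hv_frame (vs := [:: 16]) (cs := [:: 0]) g1) => //; split=> [v|[|a] //] /=; rewrite inE => /negbTE->.
split=> /=.
- move=> x y xi yP; rewrite (_ : (_ == _) = false) ?g2 //; apply/eqP => /addnI e'.
  by have [] := row_inj yP jP e'; lia.
- move=> y; rewrite ltnS leq_eqVlt => /orP[/eqP->|yj]; first by rewrite eqxx.
  by rewrite (_ : (_ == _) = false) ?g3 //; apply/eqP; lia.
- by move=> a ha; rewrite (_ : (_ == _) = false) ?g4 //; [lia|apply/eqP; lia].
- by move=> [|a] // ha x; rewrite g5.
Qed.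

Variable RND : nat -> nat.
Variable Gb : nat -> nat.
Hypothesis Gb_lt : forall i, Gb i < 2.
Hypothesis insG : forall i, i < n * n -> nth 0 (nth [::] ins 1) i = Gb i.

Definition Xw i := RND i %% 2 ^ (h + h).

Lemma Xw_lt i : Xw i < 2 ^ m.
Proof.
apply: (@leq_trans (2 ^ (h + h))); first by rewrite ltn_mod expn_gt0.
by rewrite leq_exp2l //; lia.
Qed.

Lemma fillXP e : hv e -> (forall i, i < n * n -> ar e 11 i = RND i) ->
  tri (square_c vn fillX_c) e (n * (n * (cc fillX_c + 10) + 18) + 8) (fun e' =>
    [/\ forall i j, i < n -> j < n -> ar e' 0 (XO + (i * n + j)) = Xw (i * n + j),
       forall x, (forall i j, i < n -> j < n -> x <> XO + (i * n + j)) -> ar e' 0 x = ar e 0 x &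
       frame [:: 15; 16] [:: 0] e e']).
Proof.
move=> he hr.
apply: (tri_fill2 w_large small_ins small_len (addr := fun i j => XO + (i * n + j))
   (F := fun i j => Xw (i * n + j))) => //; try exact: hv_n.
- by move=> i j i' j' _ jn _ jn' /addnI; apply: row_inj.
move=> i j e1 iN jN e15 e16 fr _ _ _.
have he1 : hv e1 by apply: (hv_frame he fr).
have ij : i * n + j < n * n by apply: (@leq_trans (i * n + n)); [lia|rewrite -mulSnr leq_mul2r iN orbT].
apply: tri_sl => //=; rewrite e15 e16 ?(hv_n he1) ?(hv_X he1) ?(hv_10 he1) /XO.
  by do !split=> //; lia.
rewrite fr.2 // hr // eqxx; split=> // x /eqP/negbTE hx.
by rewrite -/XO hx.
Qed.

Lemma fillAP e : hv e ->
  (forall i j, i < n -> j < n -> ar e 0 (XO + (i * n + j)) = Xw (i * n + j)) ->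
  tri (square_c vn fillA_c) e (n * (n * (cc fillA_c + 10) + 18) + 8) (fun e' =>
    [/\ forall i j, i < n -> j < n -> ar e' 0 (AO + (i * n + j)) = Xw (i * n + j) * Gb (i * n + j),
       forall x, (forall i j, i < n -> j < n -> x <> AO + (i * n + j)) -> ar e' 0 x = ar e 0 x &
       frame [:: 15; 16] [:: 0] e e']).
Proof.
move=> he hr.
apply: (tri_fill2 w_large small_ins small_len (addr := fun i j => AO + (i * n + j))
   (F := fun i j => Xw (i * n + j) * Gb (i * n + j))) => //; try exact: hv_n.
- by move=> i j i' j' _ jn _ jn' /addnI; apply: row_inj.
move=> i j e1 iN jN e15 e16 fr _ _ out.
have he1 : hv e1 by apply: (hv_frame he fr).
have ij : i * n + j < n * n by apply: (@leq_trans (i * n + n)); [lia|rewrite -mulSnr leq_mul2r iN orbT].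
have rd : ar e1 0 (XO + (i * n + j)) = Xw (i * n + j).
  rewrite out ?hr // => i' j' _ _; rewrite /AO; lia.
have mw : 2 ^ m < 2 ^ w by rewrite ltn_exp2l //; lia.
have gl : Xw (i * n + j) * Gb (i * n + j) < 2 ^ w.
  have := Xw_lt (i * n + j); have := Gb_lt (i * n + j).
  by case: (Gb _) => [|[|]] // _ h; lia.
apply: tri_sl => //=; rewrite e15 e16 (hv_n he1) (hv_X he1) (hv_A he1) rd insG //.
  by rewrite /AO /XO; do !split=> //; lia.
rewrite eqxx; split=> // x /eqP/negbTE hx.
by rewrite hx.
Qed.

Definition Xm : 'M[L]_n := (\matrix_(u, v) phi z (Xw (u * n + v)))%R.
Definition Gr (u v : 'I_n) : bool := Gb (u * n + v) == 1.

Lemma fw_mask (u v : 'I_n) :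
  fw (Xw (u * n + v) * Gb (u * n + v)) (mask Gr Xm u v).
Proof.
rewrite /fw !mxE /Gr; have := Gb_lt (u * n + v); case: (Gb _) => [|[|]] //= _.
  by rewrite muln0 expn_gt0.
by rewrite muln1 Xw_lt.
Qed.

Definition Mbase : 'M[L]_N := pad N (1%:M + mask Gr Xm)%R.

Lemma fillMP e : hv e ->
  (forall i j, i < n -> j < n -> ar e 0 (AO + (i * n + j)) = Xw (i * n + j) * Gb (i * n + j)) ->
  tri (square_c vN fillM_c) e (N * (N * (cc fillM_c + 10) + 18) + 8) (fun e' =>
    [/\ mem e' 0 MO N Mbase, forall x, x < MO -> ar e' 0 x = ar e 0 x &
       frame [:: 15; 16; 17; 17] [:: 0] e e']).
Proof.
move=> he hr.
pose F i j := let a := nat_of_bool (i == j) in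
  if (i < n) && (j < n) then Nat.lxor a (Xw (i * n + j) * Gb (i * n + j)) else a.
apply: (conseqP (tri_fill2 w_large small_ins small_len (addr := fun i j => MO + (i * N + j))
   (F := F) (a := 0) (n := N) (m := N) (T := N * (N * (cc fillM_c + 10) + 18) + 8) _ _ _ _ _ _ _)) => //;
  try exact: hv_N.
- by move=> i j i' j' _ jn _ jn' /addnI; apply: row_inj.
- move=> i j e1 iN jN e15 e16 fr _ _ out.
  have he1 : hv e1 by apply: (hv_frame he fr).
  have ij : i * N + j < N * N by apply: (@leq_trans (i * N + N)); [lia|rewrite -mulSnr leq_mul2r iN orbT].
  have w2 : 2 < 2 ^ w by lia.
  have cd : Nat.land (vr e1 15 < vr e1 vn) (vr e1 16 < vr e1 vn) = ((i < n) && (j < n)) :> nat.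
    by rewrite e15 e16 (hv_n he1); case: (i < n); case: (j < n).
  rewrite /F; case C : ((i < n) && (j < n)) in cd *; last first.
    apply: tri_sl => //=; rewrite cd /= ?e15 ?e16 ?(hv_n he1) ?(hv_A he1) ?(hv_N he1) ?(hv_MB he1).
      by rewrite /MO /AO /XO; do !split=> //; lia.
    by rewrite eqxx; split=> // x /eqP/negbTE ->.
  have [iN' jN'] := andP C.
  have ij' : i * n + j < n * n by apply: (@leq_trans (i * n + n)); [lia|rewrite -mulSnr leq_mul2r iN' orbT].
  have rd : ar e1 0 (AO + (i * n + j)) = Xw (i * n + j) * Gb (i * n + j).
    by rewrite out ?hr // => i' j' _ _; rewrite /MO; lia.
  apply: tri_sl => //=; rewrite cd /= ?e15 ?e16 ?(hv_n he1) ?(hv_A he1) ?(hv_N he1) ?(hv_MB he1) ?rd.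
    by rewrite /MO /AO /XO; do !split=> //; lia.
  by rewrite eqxx; split=> // x /eqP/negbTE ->.
move=> e' _ _ [h1 h2 h3]; split=> //.
  move=> i j; rewrite -addnA h1 // /F /Mbase mxE.
  have b2 (b : bool) : b < 2 ^ m by apply: (@leq_ltn_trans 1); [case: b|rewrite -{1}(expn0 2) ltn_exp2l].
  have b3 (b : bool) : phi z b = (b%:R)%R :> L by case: b; rewrite ?phi0 ?phi1.
  case: insubP => [i' -> ei|/negbTE-> /=]; last by split; rewrite ?b2 ?b3.
  case: insubP => [j' -> ej|/negbTE nj]; last first.
    rewrite nj andbF (_ : (i == j :> nat) = false); first by split; [apply: (b2 false)|apply: phi0].
    by apply/eqP => ij; move: nj; rewrite -ij -ei /= ltn_ord.
  have [g1 g2] := fw_mask i' j'; rewrite -ei -ej /=; split; first by apply: lxor_lt.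
  by rewrite phi_xor // g2 b3 [RHS]mxE; congr (_ + _)%R; rewrite mxE.
by move=> x hx; apply: h2 => i j _ _; lia.
Qed.

Record dspec (D : nat -> nat) : Prop := Dspec {
  d_n : D 0 = n; d_BL : D 1 = s; d_PW : D 2 = 2 ^ s; d_PM : D 3 = 2 ^ m; d_PH : D 4 = 2 ^ h;
  d_N : D 5 = N; d_MB : D 6 = MO; d_X : D 7 = XO; d_A : D 8 = AO;
  d_d : fw (D 9) (dfi Mbase).2;
  d_tab : forall x y, x < PW -> y < PW -> D (HDR + (x * PW + y)) = ct x y;
  d_Xw : forall u v : 'I_n, fw (D (XO + (u * n + v))) (Xm u v);
  d_Aw : forall u v : 'I_n, fw (D (AO + (u * n + v))) (mask Gr Xm u v);
  d_Nw : forall i j : 'I_N, fw (D (MO + i * N + j)) ((dfi Mbase).1 i j) }.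

Definition pre_cost :=
  (2 * s + E + l + 6) * 30 + (PW * (PW * (cc tab_c + 10) + 18) + 8) +
  (n * (n * (cc fillX_c + 10) + 18) + 8) + (n * (n * (cc fillA_c + 10) + 18) + 8) +
  (N * (N * (cc fillM_c + 10) + 18) + 8) + 1000 +
  (\sum_(0 <= j < E) ((t j).+1 * prep_const p) + 100) + (icost true J sls E + 100).

Lemma pre_restP e : vr e vn = n -> (forall i, i < n * n -> ar e 11 i = RND i) ->
  (forall a i, a != 11 -> ar e a i = 0) ->
  tri (pre_rest p c k) e pre_cost (fun e' =>
    dspec (ar e' 0) /\ vr e' vlen = MO + N * N).
Proof.
move=> en hr z0.
set T1 := PW * (PW * (cc tab_c + 10) + 18) + 8.
set T2 := n * (n * (cc fillX_c + 10) + 18) + 8.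
set T3 := n * (n * (cc fillA_c + 10) + 18) + 8.
set T4 := N * (N * (cc fillM_c + 10) + 18) + 8.
set T5 := \sum_(0 <= j < E) ((t j).+1 * prep_const p) + 100.
set T6 := icost true J sls E + 100.
rewrite /pre_rest; apply: (setupP (T1 := T1 + (T2 + (T3 + (T4 + (500 + (T5 + (T6 + 500)))))))) => //; last first.
  by rewrite /pre_cost -/T1 -/T2 -/T3 -/T4 -/T5 -/T6; lia.
move=> e0 hv0 ar0; rewrite -ar0 in hr z0.
apply: (seqP (tabP hv0 _)) => //; first by move=> i _; apply: z0.
move=> e1 [hv1 tb1 a1] _ _.
apply: (seqP (fillXP hv1 _)) => //; first by move=> i hi; rewrite a1 // hr.
move=> e2 [x2 o2 fr2] _ _; have hv2 := hv_frame hv1 fr2 isT.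
apply: (seqP (fillAP hv2 x2)) => //.
move=> e3 [x3 o3 fr3] _ _; have hv3 := hv_frame hv2 fr3 isT.
apply: (seqP (fillMP hv3 x3)) => //.
move=> e4 [x4 o4 fr4] _ _; have hv4 := hv_frame hv3 fr4 isT.
have ijn i j : i < n -> j < n -> i * n + j < n * n.
  by move=> iN jN; apply: (@leq_trans (i * n + n)); [lia|rewrite -mulSnr leq_mul2r iN orbT].
have ijw i j : i < PW -> j < PW -> i * PW + j < PW * PW.
  by move=> iN jN; apply: (@leq_trans (i * PW + PW)); [lia|rewrite -mulSnr leq_mul2r iN orbT].
have tb4 x y : x < PW -> y < PW -> ar e4 0 (HDR + (x * PW + y)) = ct x y.
  move=> xP yP; have xy := ijw x y xP yP.
  rewrite o4 ?o3 ?o2 ?tb1 //; first [by rewrite /MO /AO /XO; lia | by move=> i j _ _; rewrite /AO /XO; lia].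
have X4 i j : i < n -> j < n -> ar e4 0 (XO + (i * n + j)) = Xw (i * n + j).
  move=> iN jN; have ij := ijn i j iN jN.
  rewrite o4 ?o3 ?x2 //; first [by rewrite /MO /AO; lia | by move=> ? ? _ _; rewrite /AO; lia].
have A4 i j : i < n -> j < n -> ar e4 0 (AO + (i * n + j)) = Xw (i * n + j) * Gb (i * n + j).
  by move=> iN jN; have ij := ijn i j iN jN; rewrite o4 ?x3 // /MO; lia.
have n4 a : a != 0 -> a != 11 -> ar e4 a =1 fun=> 0.
  by move=> h1 h2 i; rewrite fr4.2 ?inE // fr3.2 ?inE // fr2.2 ?inE // a1 // z0.
have MOU : MO + N * N <= 3 * (U * U) by rewrite /MO /AO /XO; lia.
have w16 : 16 < 2 ^ w by lia.
pose hd (D : nat -> nat) := [/\ D 0 = n, D 1 = s, D 2 = PW, D 3 = 2 ^ m & 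
   [/\ D 4 = 2 ^ h, D 5 = N, D 6 = MO, D 7 = XO & D 8 = AO]].
apply: (seqP (T1 := 500) (T2 := T5 + (T6 + 500)) (P := fun e' =>
  [/\ hd (ar e' 0), forall i, HDR <= i -> ar e' 0 i = ar e4 0 i & frame [::] [:: 0] e4 e'])) => //.
  apply: tri_sl => //; first by rewrite /=; do !split=> //; lia.
  rewrite /= (hv_n hv4) (hv_BL hv4) (hv_PW hv4) (hv_PM hv4) (hv_PH hv4) (hv_N hv4) (hv_MB hv4)
    (hv_X hv4) (hv_A hv4); split=> //.
  - move=> i hi; do 9 (rewrite (_ : (i == _) = false) ?andbF; last by apply/eqP; lia); done.
  - by split=> // [[|a]] // _ i.
move=> e5 [hd5 o5 fr5] _ _; have hv5 := hv_frame hv4 fr5 isT.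
apply: (seqP (prepP rho w_large small_ins small_len Ularge Ulim cU baseU NU slsP (hv_E hv5) _ (leqnn _))) => //.
  by move=> x; rewrite fr5.2 // n4.
move=> e6 rd6 fr6 _.
have v6 v : v < 90 -> vr e6 v = vr e5 v.
  by move=> hv'; apply: fr6.1; apply: mv_prep.
have a6 : ar e6 0 =1 ar e5 0.
  by move=> i; apply: fr6.2; apply/negP => /ma_prep.
have tab6 x y : x < PW -> y < PW -> ar e6 0 (HDR + (x * PW + y)) = ct x y.
  by move=> xP yP; rewrite a6 o5 ?tb4 // leq_addr.
have par6 : params ins true s m e6.
  by split=> //; rewrite ?v6 // ?(hv_BL hv5) ?(hv_PW hv5) ?(hv_PM hv5).
have mem6 : mem e6 0 MO N Mbase.
  by apply: (mem_eq x4) => i j hi hj; rewrite a6 o5 // /MO /AO /XO; lia.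
have sE i : i < E -> 3 * size (sls i) <= U.
  move=> hi; apply: leq_trans (ltnW (size_sls slsP hi)) _.
  by have h := pbaseU w_large Ularge Ulim cU baseU NU hi; apply: leq_trans h; apply: leq_addl.
apply: (seqP (inv_cP rho w_large small_ins small_len m0 mJ s0 Jw Ularge Ulim sU char2 zm
   (MB := MO) (bs := pbase c) slsM _ NU _ _ _ par6 _ _ _ rd6 mem6 EU2)) => //.
- by apply: leq_trans EU2; rewrite leq_addr.
- by rewrite /MO /AO /XO; lia.
- move=> i hi; split; last exact: sE.
  by have h := pbaseU w_large Ularge Ulim cU baseU NU hi; apply: leq_trans h; apply: leq_addr.
- by rewrite /tabsz /MO /AO /XO; lia.
- by rewrite v6 // (hv_N hv5).
- by rewrite v6 // (hv_E hv5).
- by rewrite v6 // (hv_MB hv5).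
move=> e7 [h71 h72 h73] fr7 _.
have vN7 : vr e7 vN = N by rewrite fr7.1 // v6 // (hv_N hv5).
have vMB7 : vr e7 vMB = MO by rewrite fr7.1 // v6 // (hv_MB hv5).
have a7 i : i < MO -> i != 9 -> ar (xe ins e7 fin_c) 0 i = ar e5 0 i.
  by move=> hi /negbTE h9; rewrite /= h9 h73 // a6.
apply: tri_sl => //; first by rewrite /= vN7 vMB7; do !split=> //; lia.
have MO16 : HDR + PW * PW <= MO by rewrite /MO /AO /XO; lia.
split; last by rewrite /= vN7 vMB7.
case: hd5 => [g0 g1 g2 g3 [g4 g5 g6 g7 g8]].
have b7 i : i < 9 -> ar (xe ins e7 fin_c) 0 i = ar e5 0 i by move=> hi; apply: a7; lia.
split; [exact: etrans (b7 0 isT) g0|exact: etrans (b7 1 isT) g1|exact: etrans (b7 2 isT) g2|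
  exact: etrans (b7 3 isT) g3|exact: etrans (b7 4 isT) g4|exact: etrans (b7 5 isT) g5|
  exact: etrans (b7 6 isT) g6|exact: etrans (b7 7 isT) g7|exact: etrans (b7 8 isT) g8|
  exact: h72| | | |].
- move=> x y xP yP; have xy := ijw x y xP yP; rewrite a7; [|lia|apply/eqP; lia].
  by rewrite o5 ?tb4 // leq_addr.
- move=> u v; have ij := ijn u v (ltn_ord u) (ltn_ord v).
  rewrite a7; [|by rewrite /MO /AO; lia|by apply/eqP; rewrite /XO; lia].
  have -> : ar e5 0 (XO + (u * n + v)) = ar e4 0 (XO + (u * n + v)) by apply: o5; rewrite /XO; lia.
  by rewrite X4 // /fw mxE; split=> //; apply: Xw_lt.
- move=> u v; have ij := ijn u v (ltn_ord u) (ltn_ord v).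
  rewrite a7; [|by rewrite /MO; lia|by apply/eqP; rewrite /AO /XO; lia].
  have -> : ar e5 0 (AO + (u * n + v)) = ar e4 0 (AO + (u * n + v)) by apply: o5; rewrite /AO /XO; lia.
  by rewrite A4 //; apply: fw_mask.
have keep y : y != 9 -> ar (xe ins e7 fin_c) 0 y = ar e7 0 y by move=> /negbTE h9; rewrite /= h9.
move=> i j; rewrite keep; [exact: h71 | lia].
Qed.

End PreSpec.

Definition uop n (x : update n) : nat :=
  match x with InsEdge _ _ => 0 | DelEdge _ _ => 1 | DelNode _ => 2 end.

Lemma nth_update_words n (B : seq (update n)) x0 j : j < size B ->
  [/\ nth 0 (flatten (map (@update_words n) B)) (j * 3) = uop (nth x0 B j),
      nth 0 (flatten (map (@update_words n) B)) (j * 3 + 1) = utail (nth x0 B j) &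
      nth 0 (flatten (map (@update_words n) B)) (j * 3 + 2) = uhead (nth x0 B j)].
Proof.
elim: B j => // x B IH [|j] /= hj; first by case: x.
by have [h1 h2 h3] := IH j hj; split; rewrite mulSn -?addnA; case: x.
Qed.

Lemma size_update_words n (B : seq (update n)) :
  size (flatten (map (@update_words n) B)) = size B * 3.
Proof. by elim: B => //= x B IH; rewrite size_cat IH mulSn; case: x. Qed.

Lemma sum_ltS (V : nmodType) f (F : 'I_f -> V) i0 (h : i0 < f) :
  (\sum_(i < f | (i < i0.+1)%N) F i =
   \sum_(i < f | (i < i0)%N) F i + F (Ordinal h))%R.
Proof.
rewrite (bigD1 (Ordinal h)) //= addrC; congr (_ + _)%R; apply: eq_bigl => i.
by rewrite ltnS ltn_neqAle andbC.
Qed.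

(** * Specification of the update *)

Section UpdSpec.

Variables (p : program) (c k : nat).
Variables (w : nat) (ins : seq (seq nat)) (rho : nat -> nat).
Hypothesis w_large : 7 < w.
Hypothesis small_ins : forall i j, nth 0 (nth [::] ins i) j < 2 ^ w.
Hypothesis small_len : forall i, size (nth [::] ins i) < 2 ^ w.

Variables (n l U : nat).
Notation s := (bitlen n).
Notation J := (Jf k).
Notation h := (3 ^ l).
Notation m := (h * 3).
Hypotheses (mJ : m <= s * J) (Jw : 2 * (s * J) <= w).
Hypotheses (Ularge : 1000 <= U) (Ulim : 1000 * (U * U) <= lim w).
Hypothesis sU4 : 4 * 2 ^ s <= U.
Notation N := (sz (up_log 2 n)).
Hypothesis NU : N <= U.

Variables (L : finFieldType) (z : L).
Hypotheses (char2 : (2%N \in [pchar L])%R) (zm : (z ^+ m = 1)%R).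
Variables (RND Gb : nat -> nat).

Notation X := (Xm n l z RND).
Notation G := (@Gr n Gb).
Notation Mb := (Mbase n l z RND Gb).
Notation D := (nth 0 (nth [::] ins 0)).
Notation MO := (MO n).
Notation XO := (XO n).
Notation AO := (AO n).
Hypothesis dsp : dspec n l z RND Gb D.

Variable B : seq (update n).
Notation f := (size B).
Hypothesis fU : 4 * f + 16 <= U.

Notation tri := (tri w ins rho).
Notation trc c e Q := (tri c e (cc c) Q).
Notation fw := (fw m z).
Notation mem := (mem m z).
Notation ux := (@ux n B).

Let uu := UU Ularge.
Let lw := lim_w w.
Let seqP := tri_seq (ins := ins) (rho := rho) w_large small_ins small_len.
Let conseqP := tri_conseq (ins := ins) (rho := rho) w_large small_ins small_len.
Let ns : n < 2 ^ s. Proof. by rewrite trunc_log_ltn. Qed.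
Let nU : 4 * n < U. Proof. lia. Qed.
Let ssU : 16 * (2 ^ s * 2 ^ s) <= U * U.
Proof. have := leq_mul sU4 sU4; lia. Qed.
Let nnU : 16 * (n * n) <= U * U.
Proof. have := leq_mul (ltnW nU) (ltnW nU); lia. Qed.
Let NNU : N * N <= U * U. Proof. exact: leq_mul. Qed.
Let s0 : 0 < s. Proof. by []. Qed.
Let h0 : 0 < h. Proof. by rewrite expn_gt0. Qed.
Let m0 : 0 < m. Proof. by rewrite muln_gt0 h0. Qed.
Let sU : 2 ^ s <= U. Proof. lia. Qed.
Let MOU : MO + N * N <= 3 * (U * U). Proof. by rewrite /MO /AO /XO; lia. Qed.
Let mul_P := mulcP (ins := ins) (tb := false) rho w_large mJ s0 Jw Ularge Ulim sU.

Lemma leqnN : n <= N. Proof. by rewrite szE up_logP. Qed.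

Definition Ninv : 'M[L]_n := unpad leqnN (dfi Mb).1.
Definition dinv : L := (dfi Mb).2.

Lemma D_N (u v : 'I_n) : fw (D (MO + (u * N + v))) (Ninv u v).
Proof. by rewrite /Ninv mxE addnA; apply: (d_Nw dsp (widen_ord leqnN u) (widen_ord leqnN v)). Qed.

Record hu e : Prop := Hu {
  hu_n : vr e vn = n; hu_BL : vr e vBL = s; hu_PW : vr e vPW = 2 ^ s;
  hu_PM : vr e vPM = 2 ^ m; hu_PH : vr e vPH = 2 ^ h; hu_N : vr e 72 = N;
  hu_MO : vr e 73 = MO; hu_X : vr e 74 = XO; hu_A : vr e 75 = AO;
  hu_d : vr e 76 = D 9 }.

Lemma hu_frame vs cs e e' : hu e -> frame vs cs e e' ->
  all [predC vs] [:: vn; vBL; vPW; vPM; vPH; 72; 73; 74; 75; 76] -> hu e'.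
Proof.
move=> [h1 h2 h3 h4 h5 h6 h7 h8 h9 h10] [fv _] /allP hs.
by split; rewrite fv //; apply: hs.
Qed.

Lemma hu_params e : hu e -> params ins false s m e.
Proof.
by move=> he; split; [exact: hu_BL | exact: hu_PW | exact: hu_PM | exact: d_tab dsp].
Qed.

Lemma restoreP e : tri restore_c e 100 (fun e' => hu e' /\ frame [:: vn; vBL; vPW; vPM; vPH; 72; 73; 74; 75; 76] [::] e e').
Proof.
have w16 : 16 < 2 ^ w by lia.
apply: (conseqP (T := cc restore_c) (Q := hu)) => //.
apply: tri_sl => //; first by rewrite /=; do !split=> //; lia.
split=> /=; [exact: d_n dsp|exact: d_BL dsp|exact: d_PW dsp|exact: d_PM dsp|exact: d_PH dsp|
  exact: d_N dsp|exact: d_MB dsp|exact: d_X dsp|exact: d_A dsp|by []].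
Qed.

(** ** Entries of the low-rank factors *)

Section Entries.

Variable lst_w : nat -> nat -> nat.
(** [lst_w] abstracts from the place of the list of updates, which is array 0 during the update and
    an input during a query. *)
Definition lst_ok (j : 'I_f) :=
  [/\ lst_w j 0 = utail (ux j), lst_w j 1 = uhead (ux j),
      fw (lst_w j 2) (uscale G B X (ux j)) & lst_w j 3 = unode (ux j)].

Definition qnw j v :=
  let a := wmul m s J (lst_w j 2) (D (MO + (lst_w j 1 * N + v))) in
  if (lst_w j 3 != 0) && (lst_w j 1 == v) then Nat.lxor a (D 9) else a.

Lemma qnwP (j : 'I_f) (v : 'I_n) : lst_ok j ->
  fw (qnw j v) (qn G B X Ninv dinv (ux j) v).
Proof.
move=> [_ l1 [l2 l2'] l3]; have [g1 g2] := D_N (uhead (ux j)) v.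
have [d1 d2] := d_d dsp.
have al := wmul_lt s J l2 g1; have ae := phi_wmul char2 zm mJ l2 g1.
rewrite /qnw /qn l1 l3 /=; set a := wmul _ _ _ _ _ in al ae *.
case: (unode (ux j)) => /=; last by rewrite addr0 /fw ae l2' g2.
have -> : (uhead (ux j) == v :> nat) = (uhead (ux j) == v) by [].
case: eqP => _; last by rewrite addr0 /fw ae l2' g2.
by split; [apply: lxor_lt | rewrite phi_xor // ae l2' g2 d2].
Qed.

Definition lstE (ui : bool) := if ui then Inp 1 else Arr 0.
Definition lv (ui : bool) (e : env) i := if ui then nth 0 (nth [::] ins 1) i else ar e 0 i.

Lemma qnP (ui : bool) e (j : 'I_f) (v : 'I_n) : hu e -> lst_ok j ->
  vr e 80 = j -> vr e 81 = v ->
  (forall r, r < 4 -> lv ui e (HDR + j * 4 + r) = lst_w j r) ->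
  trc (qn_c k (lstE ui) 29) e (fun e' => vr e' 29 = qnw j v /\ ar e' = ar e).
Proof.
move=> he lok e80 e81 hl; have jf := ltn_ord j.
have [_ l1 [l2 _] l3] := lok; have [g1 _] := D_N (uhead (ux j)) v.
have w32 : 32 < 2 ^ w by lia.
have uN : uhead (ux j) * N + v < N * N.
  have a1 := ltn_ord (uhead (ux j)); have a2 := ltn_ord v; have a3 := leqnN.
  apply: (@leq_trans (uhead (ux j) * N + N)); first by lia.
  by rewrite -mulSnr leq_mul2r; apply/orP; right; lia.
rewrite /qn_c; apply: trc_asg => //; first by rewrite /= e80; do !split=> //; lia.
set e1 := setv _ 26 _.
have e126 : vr e1 26 = HDR + j * 4 by rewrite /= e80.
have f1 : frame [:: 26] [::] e e1 by split=> // v' /=; rewrite inE => /negbTE->.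
have he1 := hu_frame he f1 isT.
have evl r (e' : env) : r < 4 -> vr e' 26 = HDR + j * 4 -> ar e' = ar e ->
    safe w ins e' (lstE ui (V 26 +' K r)) /\ ev ins e' (lstE ui (V 26 +' K r)) = lst_w j r.
  move=> r4 h26 a'; rewrite -hl // /lv /lstE; case: (ui) => /=; rewrite h26 ?a'; do !split=> //; lia.
have [sf1 ev1] := evl 1 e1 isT e126 erefl.
apply: trc_asg => //; rewrite ev1 l1.
set e2 := setv e1 27 _.
have f2 : frame [:: 27] [::] e1 e2 by split=> // v' /=; rewrite inE => /negbTE->.
have he2 := hu_frame he1 f2 isT.
have [sf2 ev2] := evl 2 e2 isT e126 erefl.
have e281 : vr e2 81 = v by [].
have MOw : MO + (uhead (ux j) * N + v) < lim w by lia.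
have evD (e' : env) : vr e' 73 = MO -> vr e' 27 = uhead (ux j) -> vr e' 72 = N -> vr e' 81 = v ->
    safe w ins e' (Inp 0 (V 73 +' (V 27 *' V 72 +' V 81))) /\
    ev ins e' (Inp 0 (V 73 +' (V 27 *' V 72 +' V 81))) = D (MO + (uhead (ux j) * N + v)).
  by move=> h1 h2 h3 h4; rewrite /= h1 h2 h3 h4; do !split=> //; lia.
have [sD eD] := evD e2 (hu_MO he2) erefl (hu_N he2) e281.
apply: (trc_seq w_large small_ins small_len (mul_P 29 (hu_params he2) sf2 _ _ _ _)).
- by have [] := evD (setv e2 20 (ev ins e2 (lstE ui (V 26 +' K 2)))) (hu_MO he2) erefl (hu_N he2) e281.
- have [_ ->] := evD (setv e2 20 (ev ins e2 (lstE ui (V 26 +' K 2)))) (hu_MO he2) erefl (hu_N he2) e281.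
  by rewrite eD.
- by rewrite ev2.
- by rewrite eD.
rewrite ev2 eD => e3 [w29 e3E] f3 _.
have a3 : ar e3 = ar e by rewrite e3E.
have v26 : vr e3 26 = HDR + j * 4 by rewrite f3.1.
have v27 : vr e3 27 = uhead (ux j) by rewrite f3.1.
have v81 : vr e3 81 = v by rewrite f3.1.
have v76 : vr e3 76 = D 9 by rewrite f3.1 // (hu_d he2).
have [sf3 ev3] := evl 3 e3 isT v26 a3.
have evc : ev ins e3 (Bin OpAnd (lstE ui (V 26 +' K 3)) (Bin OpEq (V 27) (V 81))) =
    ((lst_w j 3 != 0) && (lst_w j 1 == v)).
  rewrite [LHS]/= [X in Nat.land X _]ev3 v27 v81 l1 l3.
  by case: (unode _); case: (_ == _).
apply: trc_cond => //.
  rewrite evc /qnw => hc; apply: tri_sl => //=.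
  by rewrite w29 v76 -l1; case: (_ && _) hc.
rewrite evc /qnw => hc; apply: tri_sl => //=.
by rewrite w29 -l1; case: (_ && _) hc.
Qed.

End Entries.

(** ** The update *)

Hypothesis insB : nth [::] ins 1 = flatten (map (@update_words n) B).

Lemma uxE (x0 : update n) i (hi : i < f) : nth x0 B i = ux (Ordinal hi).
Proof. by rewrite /ux (tnth_nth x0). Qed.

Lemma ins_update i (hi : i < f) :
  [/\ nth 0 (nth [::] ins 1) (i * 3) = uop (ux (Ordinal hi)),
      nth 0 (nth [::] ins 1) (i * 3 + 1) = utail (ux (Ordinal hi)) &
      nth 0 (nth [::] ins 1) (i * 3 + 2) = uhead (ux (Ordinal hi))].
Proof. by rewrite insB -(uxE (ux (Ordinal hi))); apply: nth_update_words. Qed.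

Lemma pair_lt (u v : 'I_n) : u * n + v < n * n.
Proof.
have hu := ltn_ord u; have hv := ltn_ord v.
by apply: (@leq_trans (u * n + n)); [lia|rewrite -mulSnr leq_mul2r hu orbT].
Qed.

Lemma pair_eq (u v u' v' : 'I_n) : (u * n + v == u' * n + v') = (u == u') && (v == v').
Proof.
apply/eqP/andP => [|[/eqP-> /eqP->] //].
by move=> /(row_inj (ltn_ord v) (ltn_ord v'))[/ord_inj -> /ord_inj ->].
Qed.

Definition marks (C : seq (update n)) e :=
  (forall u : 'I_n, ar e 12 u = (DelNode u \in C)) /\
  (forall u v : 'I_n, ar e 13 (u * n + v) = (DelEdge u v \in C)).

Lemma markP e : hu e -> vr e 9 = f -> ar e 12 =1 (fun=> 0) -> ar e 13 =1 (fun=> 0) ->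
  tri (For 15 9 mark_c) e (f * (cc mark_c + 10) + 8) (fun e' =>
    marks B e' /\ frame [:: 15; 16; 17; 18; 19] [:: 12; 13] e e').
Proof.
move=> he e9 z12 z13.
apply: (conseqP (T := f * (cc mark_c + 10) + 8) (Q := fun e' =>
   marks (take f B) e' /\ frame (15 :: mv mark_c) (ma mark_c) e e')) => //; last first.
  by move=> e' _ _ []; rewrite take_size.
apply: (tri_for (I := fun i => marks (take i B)) w_large small_ins small_len) => //.
  by rewrite take0; split=> [u|u v]; rewrite /= ?z12 ?z13.
move=> i e1 hi e15 fr _ [m1 m2].
have [ o1 o2 o3] := ins_update hi; set x := ux (Ordinal hi) in o1 o2 o3.
have tk : take i.+1 B = rcons (take i B) x by rewrite (take_nth x) // uxE.
have v1 : vr e1 vn = n by rewrite fr.1 // (hu_n he).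
have w32 : 32 < 2 ^ w by lia.
have safe3 : xs w ins e1 (Asg 16 (V 15 *' K 3) ;;
  Asg 17 (Inp 1 (V 16)) ;; Asg 18 (Inp 1 (V 16 +' K 1)) ;; Asg 19 (Inp 1 (V 16 +' K 2))).
  by rewrite /= e15; do !split=> //; lia.
have meq (A : eqType) (a b : A) C : (a \in rcons C b) = (a == b) || (a \in C).
  by rewrite mem_rcons inE.
move: o1 o2 o3; rewrite tk; case: x {tk} => [u v|u v|u] /= o1 o2 o3.
- apply: tri_sl => //=; rewrite e15 o1 /=; first by do !split=> //; lia.
  by split=> [u'|u' v'] /=; rewrite meq /= ?m1 ?m2.
- have uv := pair_lt u v.
  apply: tri_sl => //=; rewrite e15 o1 o2 o3 v1 /=; first by do !split=> //; lia.
  split=> [u'|u' v'] /=; rewrite meq /= ?m1 // pair_eq.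
  rewrite (_ : (DelEdge u' v' == DelEdge u v) = (u' == u) && (v' == v)) //.
  by case: (_ && _).
have un := ltn_ord u.
apply: tri_sl => //=; rewrite e15 o1 o2 /=; first by do !split=> //; lia.
split=> [u'|u' v'] /=; rewrite meq /= ?m2 // m1.
rewrite (_ : (DelNode u' == DelNode u) = (u' == u)) // (_ : (u' == u :> nat) = (u' == u)) //.
by case: (_ == _).
Qed.

Definition lwe e j r := ar e 0 (HDR + j * 4 + r).

Lemma scaleP e : hu e -> vr e 9 = f -> marks B e ->
  tri (For 15 9 scale_c) e (f * (cc scale_c + 10) + 8) (fun e' =>
    (forall j, lst_ok (lwe e') j) /\ frame (15 :: mv scale_c) [:: 0] e e').
Proof.
move=> he e9 [m1 m2].
apply: (conseqP (T := f * (cc scale_c + 10) + 8) (Q := fun e' =>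
   (forall j : 'I_f, j < f -> lst_ok (lwe e') j) /\ frame (15 :: mv scale_c) (ma scale_c) e e')) => //; last first.
  move=> e' _ _ [h1 h2]; split=> [j|]; first exact: h1.
  by apply: (frameW _ _ h2) => // a; rewrite !inE => /or4P[] /eqP->.
apply: (tri_for (I := fun i e' => forall j : 'I_f, j < i -> lst_ok (lwe e') j) w_large small_ins small_len) => //.
move=> i e1 hi e15 fr _ lok.
have [ o1 o2 o3] := ins_update hi; set x := ux (Ordinal hi) in o1 o2 o3.
have he1 := hu_frame he fr isT.
have w32 : 32 < 2 ^ w by lia.
have uv := pair_lt (utail x) (uhead x).
have AOw : AO + n * n <= lim w by rewrite /AO /XO; lia.
have XOw : XO + n * n <= lim w by rewrite /XO; lia.
have un := ltn_ord (utail x); have vnn := ltn_ord (uhead x).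
set ij := utail x * n + uhead x in uv *.
rewrite /scale_c.
do 1 (apply: trc_asg => //; first by rewrite /= ?e15; do !split=> //; lia).
apply: trc_asg => //.
do 4 (apply: trc_asg => //; first by rewrite /= ?e15 ?o2 ?o3 ?(hu_n he1) ?(hu_A he1) -/ij; do !split=> //; lia).
set e2 := setv _ 24 _.
have f2 : frame [:: 16; 17; 18; 19; 23; 24] [::] e1 e2.
  by split=> // v /=; rewrite !inE !negb_or => /and5P[/negbTE-> /negbTE-> /negbTE-> /negbTE-> /andP[/negbTE-> /negbTE->]].
have he2 := hu_frame he1 f2 isT.
have v17 : vr e2 17 = uop x by rewrite /= e15 o1.
have v18 : vr e2 18 = utail x by rewrite /= e15 o2.
have v19 : vr e2 19 = uhead x by rewrite /= e15 o3.
have v23 : vr e2 23 = ij by rewrite /= e15 o2 o3 (hu_n he1).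
have v24 : vr e2 24 = D (AO + ij) by rewrite /= e15 o2 o3 (hu_n he1) (hu_A he1).
have v15 : vr e2 15 = i by [].
have a2 : ar e2 = ar e1 by [].
clearbody e2.
have m12 : ar e2 12 (utail x) = (DelNode (utail x) \in B) by rewrite a2 fr.2 // m1.
have m13 : ar e2 13 ij = (DelEdge (utail x) (uhead x) \in B) by rewrite a2 fr.2 // m2.
have fwA := d_Aw dsp (utail x) (uhead x); have fwX := d_Xw dsp (utail x) (uhead x).
rewrite -/ij in fwA fwX.
have ijw : ij < lim w by lia.
have utw : utail x < lim w by lia.
have m2w : 2 ^ m < 2 ^ w by rewrite ltn_exp2l //; lia.
have fw0 : fw 0 0%R by split; [rewrite expn_gt0|apply: phi0].
apply: (trc_seq w_large small_ins small_len (P := fun e' =>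
   fw (vr e' 24) (uscale G B X x) /\ ar e' = ar e2)).
  move: v17 v18 v19 m12 m13 fwA fwX utw.
  case E : x => [u v|u v|u] /= v17 v18 v19 m12 m13 fwA fwX utw.
  - apply: tri_sl => //=; rewrite v17 /= v18 m12.
      rewrite v23 m13; case: (DelNode u \in B); case: (DelEdge u v \in B) => /=;
        rewrite ?(hu_X he2); do !split=> //; lia.
    case: (DelNode u \in B) => /=; first by rewrite andbF.
    rewrite ?v17 /= v23 m13; case: (DelEdge u v \in B) => /=; first by rewrite !andbF.
    rewrite v24 (hu_X he2) andbT; split=> //; case: fwA => A1; case: fwX => X1 X2 A2.
    split; first exact: lxor_lt.
    rewrite phi_xor // A2 X2 !mxE; case: (G u v) => /=; last by rewrite add0r.
    by rewrite (addrr_pchar2 char2).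
  - apply: tri_sl => //=; rewrite v17 /= v18 m12.
      by case: (DelNode u \in B) => /=; do !split=> //; lia.
    case: (DelNode u \in B) => /=; first by rewrite andbF.
    by rewrite ?v17 /= v24 andbT; split=> //; move: fwA; rewrite !mxE.
  apply: tri_sl => //=; rewrite v17 //=; first by do !split=> //; lia.
  by split=> //; split; [rewrite -{1}(expn0 2) ltn_exp2l|apply: phi1].
move=> e3 [h24 a3] f3 _.
have w15 : vr e3 15 = i by rewrite f3.1.
have w17 : vr e3 17 = uop x by rewrite f3.1.
have w18 : vr e3 18 = utail x by rewrite f3.1.
have w19 : vr e3 19 = uhead x by rewrite f3.1.
apply: tri_sl => //=; rewrite w15 ?w17 ?w18 ?w19; first by do !split=> //; lia.
move=> j; rewrite ltnS leq_eqVlt => /orP[/eqP ji|ji].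
  have jE : ux j = x by rewrite /x; congr (ux _); apply: val_inj.
  rewrite /lst_ok /lwe jE ji /=.
  split; do ![rewrite (_ : (_ == _) = true); last by (apply/eqP; lia)
             |rewrite (_ : (_ == _) = false); last by (apply/eqP; lia)] => //.
  by case: (x).
have [l0 l1 l2 l3] := lok j ji.
have kp r : r < 4 -> lwe (seta (seta (seta (seta (setv e3 25 (HDR + i * 4)) 0 (HDR + i * 4) (utail x))
    0 (HDR + i * 4 + 1) (uhead x)) 0 (HDR + i * 4 + 2) (vr e3 24)) 0 (HDR + i * 4 + 3) (uop x == 2)) j r = lwe e1 j r.
  move=> r4; rewrite /lwe /=; do 4 (rewrite (_ : (_ == _) = false); last by (apply/eqP; lia)).
  by rewrite a3 a2.
by split; rewrite -?l0 -?l1 -?l3; [exact: (kp 0)|exact: (kp 1)|have := kp 2 isT; rewrite /lwe /= => ->|exact: (kp 3)].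
Qed.

Notation E' := (up_log 2 f).
Notation N' := (sz E').
Hypotheses (NU' : N' <= U) (EU2 : E' + 2 <= U).

Definition MK := HDR + f * 4.

(** The closed form of [wood_entry], which is the Woodbury matrix only when preprocessing succeeded.
    With it the programs are specified for all random words, as the resource bounds require. *)
Definition Kmat : 'M[L]_N' := pad N' (\matrix_(i < f, j < f)
  ((if i == j then dinv else 0) + qn G B X Ninv dinv (ux i) (utail (ux j))))%R.

Let MKU : MK + N' * N' <= 3 * (U * U).
Proof. have : N' * N' <= U * U by [apply: leq_mul]; rewrite /MK; lia. Qed.

Lemma fillKP e : hu e -> vr e 9 = f -> vr e vN = N' -> vr e vMB = MK ->
  (forall j, lst_ok (lwe e) j) ->
  tri (square_c vN (fillK_c k)) e (N' * (N' * (cc (fillK_c k) + 10) + 18) + 8) (fun e' =>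
    [/\ mem e' 0 MK N' Kmat, forall x, x < MK -> ar e' 0 x = ar e 0 x &
       frame (15 :: 16 :: mv (fillK_c k)) [:: 0] e e']).
Proof.
move=> he e9 eN eMB lok.
pose F i j := if (i < f) && (j < f) then Nat.lxor (qnw (lwe e) i (lwe e j 0)) ((i == j) * D 9)
  else nat_of_bool (i == j).
have w32 : 32 < 2 ^ w by lia.
have [d1 d2] := d_d dsp.
have m2w : 2 ^ m < 2 ^ w by rewrite ltn_exp2l //; lia.
apply: (conseqP (tri_fill2 w_large small_ins small_len (addr := fun i j => MK + (i * N' + j))
   (F := F) (a := 0) (n := N') (m := N') (T := N' * (N' * (cc (fillK_c k) + 10) + 18) + 8) _ _ _ _ _ _ _)) => //.
- by move=> i j i' j' _ jn _ jn' /addnI; apply: row_inj.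
- move=> i j e1 iN jN e15 e16 fr _ _ out.
  have he1 := hu_frame he fr isT.
  have ij : i * N' + j < N' * N' by apply: (@leq_trans (i * N' + N')); [lia|rewrite -mulSnr leq_mul2r iN orbT].
  have x9 : vr e1 9 = f by rewrite fr.1.
  have xN : vr e1 vN = N' by rewrite fr.1.
  have xM : vr e1 vMB = MK by rewrite fr.1.
  have x76 := hu_d he1.
  have lw1 i' r : i' < f -> r < 4 -> lwe e1 i' r = lwe e i' r.
    by move=> hi' hr; rewrite /lwe out // => ? ? _ _; rewrite /MK; lia.
  rewrite /fillK_c; apply: trc_asg => //.
  set e2 := setv _ 28 _.
  have a2 : ar e2 = ar e1 by [].
  have f2 : frame [:: 28] [::] e1 e2 by split=> // v /=; rewrite inE => /negbTE->.
  have he2 := hu_frame he1 f2 isT.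
  have y28 : vr e2 28 = (i == j) by rewrite /= e15 e16.
  have y15 : vr e2 15 = i by [].
  have y16 : vr e2 16 = j by [].
  have y9 : vr e2 9 = f by [].
  have yN : vr e2 vN = N' by [].
  have yM : vr e2 vMB = MK by [].
  clearbody e2.
  have cd : Nat.land (i < f) (j < f) = ((i < f) && (j < f)) :> nat by case: (i < f); case: (j < f).
  apply: (trc_seq w_large small_ins small_len (P := fun e' => vr e' 28 = F i j /\ ar e' = ar e2)).
    apply: trc_cond => //.
      rewrite [ev _ _ _]/= y15 y16 y9 cd => hc.
      have [iF jF] : i < f /\ j < f by apply/andP; case: (_ && _) hc.
      apply: trc_asg => //; apply: trc_asg => //.
        by rewrite /= y16; do !split=> //; lia.
      set e3 := setv _ 81 _.
      have f3 : frame [:: 80; 81] [::] e2 e3.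
        by split=> // v /=; rewrite !inE negb_or => /andP[/negbTE-> /negbTE->].
      have he3 := hu_frame he2 f3 isT.
      have l0 : lwe e j 0 = utail (ux (Ordinal jF)) by have [] := lok (Ordinal jF).
      have z81 : vr e3 81 = utail (ux (Ordinal jF)).
        by rewrite /= y16 a2 -[_ + _ * _]addn0 -[ar _ _ _]/(lwe e1 j 0) lw1.
      have z80 : vr e3 80 = Ordinal iF by rewrite /= y15.
      have z28 : vr e3 28 = (i == j) by rewrite /= y28.
      have a3 : ar e3 = ar e2 by [].
      clearbody e3.
      apply: (trc_seq w_large small_ins small_len (qnP (ui := false) he3 (lok (Ordinal iF)) z80 z81 _)).
        by move=> r hr; rewrite /lv a3 a2 -[ar _ _ _]/(lwe e1 i r) lw1.
      move=> e4 [v29 a4] f4 _.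
      have v28 : vr e4 28 = (i == j) by rewrite f4.1.
      have v76 : vr e4 76 = D 9 by rewrite f4.1 // (hu_d he3).
      apply: tri_sl => //=; rewrite v28 v76 ?v29.
        by do !split=> //; case: (i == j); lia.
      by rewrite a4 a3 /F iF jF l0.
    rewrite [ev _ _ _]/= y15 y16 y9 cd => hc.
    by apply: tri_sl => //=; rewrite y28 /F; case: (_ && _) hc.
  move=> e3 [z28 a3] f3 _.
  have z15 : vr e3 15 = i by rewrite f3.1.
  have z16 : vr e3 16 = j by rewrite f3.1.
  have zN : vr e3 vN = N' by rewrite f3.1.
  have zM : vr e3 vMB = MK by rewrite f3.1.
  apply: tri_sl => //=; rewrite z15 z16 zN zM ?z28; first by do !split=> //; lia.
  by rewrite eqxx; split=> // x /eqP/negbTE ->; rewrite a3 a2.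
move=> e' _ _ [h1 h2 h3]; split=> //.
  move=> i j; rewrite -addnA h1 // /F /Kmat mxE.
  have b2 (b : bool) : b < 2 ^ m by apply: (@leq_ltn_trans 1); [case: b|rewrite -{1}(expn0 2) ltn_exp2l].
  have b3 (b : bool) : phi z b = (b%:R)%R :> L by case: b; rewrite ?phi0 ?phi1.
  case: insubP => [i' -> ei|/negbTE-> /=]; last by split; rewrite ?b2 ?b3.
  case: insubP => [j' -> ej|/negbTE nj]; last first.
    rewrite nj andbF (_ : (i == j :> nat) = false); first by split; [apply: (b2 false)|apply: phi0].
    by apply/eqP => ij; move: nj; rewrite -ij -ei /= ltn_ord.
  have [l0 _ _ _] := lok j'; rewrite -ei -ej /= l0.
  have [g1 g2] := qnwP (utail (ux j')) (lok i').
  have -> : (i' == j' :> nat) = (i' == j') by [].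
  rewrite mxE; case: eqP => _.
    rewrite mul1n; split; first exact: lxor_lt.
    by rewrite phi_xor // g2 d2 addrC.
  rewrite mul0n; split; first by apply: lxor_lt => //; rewrite expn_gt0.
  by rewrite phi_xor // g2 phi0 addrC.
by move=> x hx; apply: h2 => i j _ _; lia.
Qed.

Record uspec (W : nat -> nat) : Prop := Uspec {
  u_f : W 0 = f; u_N : W 1 = N'; u_l : fw (W 2) (dfi Kmat).2; u_MB : W 3 = MK;
  u_lst : forall j : 'I_f, lst_ok (fun j r => W (HDR + j * 4 + r)) j;
  u_K : forall i j : 'I_N', fw (W (MK + i * N' + j)) ((dfi Kmat).1 i j) }.

Variables (sls : nat -> slp) (t : nat -> nat).
Hypothesis slsM : forall i, slp_multiplies (sz i) (sls i).
Hypothesis cU : cbound p <= U.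
Hypothesis baseU : pbase c E' + 2 ^ (c * E'.+1) <= U.
Hypothesis slsP : forall j, j < E' ->
  run (c * j.+1) p [:: [:: sz j]] (nseq (t j) 0) =
    Some (flatten (map slp_instr_words (sls j))).

Definition upd_cost :=
  E' * 20 + f * (cc mark_c + 10) + f * (cc scale_c + 10) +
  N' * (N' * (cc (fillK_c k) + 10) + 18) +
  \sum_(0 <= j < E') ((t j).+1 * prep_const p) + icost false J sls E' + 1000.

Lemma updP e : (forall a i, ar e a i = 0) ->
  tri (upd_c p c k) e upd_cost (fun e' => uspec (ar e' 0) /\ vr e' vlen = MK + N' * N').
Proof.
move=> z0; have w32 : 32 < 2 ^ w by lia.
set T2 := f * (cc mark_c + 10) + 8; set T3 := f * (cc scale_c + 10) + 8.
set T4 := N' * (N' * (cc (fillK_c k) + 10) + 18) + 8.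
set T5 := \sum_(0 <= j < E') ((t j).+1 * prep_const p) + 100.
set T6 := icost false J sls E' + 100.
rewrite /upd_c.
apply: (seqP (@restoreP e) (T2 := 10 + ((E' * 20 + 20) + (20 + (T2 + (T3 + (T4 + (T5 + (T6 + 300)))))))) ).
  by rewrite /upd_cost /T2 /T3 /T4 /T5 /T6; lia.
move=> e1 [he1 fr1] _ _.
have a1 a i : ar e1 a i = 0 by rewrite fr1.2 // z0.
apply: (seqP (T1 := 10) (P := fun e' => [/\ hu e', vr e' 9 = f & ar e' = ar e1])) => //.
  apply: tri_sl => //=; first by do !split=> //; lia.
  rewrite insB size_update_words mulnK //; split=> //.
  by apply: (hu_frame (vs := [:: 9]) (cs := [::]) he1) => //; split=> // v /=; rewrite inE => /negbTE->.
move=> e2 [he2 e29 a2] _ _.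
apply: (seqP (growP rho w_large small_ins small_len (v := vN) (nv := 9) isT isT e29 _)) => //; first by lia.
move=> e3 [e3N e3E] fr3 _.
have he3 := hu_frame he2 fr3 isT; have e39 : vr e3 9 = f by rewrite fr3.1.
apply: (seqP (T1 := 20) (P := fun e' => e' = setv e3 vMB MK)) => //.
  by apply: tri_sl => //=; rewrite e39 //; do !split=> //; lia.
move=> _ -> _ _; set e4 := setv _ vMB _.
have f4 : frame [:: vMB] [::] e3 e4 by split=> // v /=; rewrite inE => /negbTE->.
have he4 := hu_frame he3 f4 isT.
have a4 a i : ar e4 a i = 0 by rewrite /= fr3.2 // a2 a1.
have [e49 e4N e4E e4M] : [/\ vr e4 9 = f, vr e4 vN = N', vr e4 vE = E' & vr e4 vMB = MK] by [].
clearbody e4.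
apply: (seqP (markP he4 e49 _ _)) => //.
move=> e5 [m5 fr5] _ _; have he5 := hu_frame he4 fr5 isT.
have e59 : vr e5 9 = f by rewrite fr5.1.
apply: (seqP (scaleP he5 e59 m5)) => //.
move=> e6 [l6 fr6] _ _; have he6 := hu_frame he5 fr6 isT.
have e69 : vr e6 9 = f by rewrite fr6.1.
have e6N : vr e6 vN = N' by rewrite fr6.1 // fr5.1.
have e6M : vr e6 vMB = MK by rewrite fr6.1 // fr5.1.
apply: (seqP (fillKP he6 e69 e6N e6M l6)) => //.
move=> e7 [m7 o7 fr7] _ _; have he7 := hu_frame he6 fr7 isT.
have [e79 e7N e7E e7M] : [/\ vr e7 9 = f, vr e7 vN = N', vr e7 vE = E' & vr e7 vMB = MK].
  by split; rewrite fr7.1 // fr6.1 // fr5.1.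
apply: (seqP (prepP rho w_large small_ins small_len Ularge Ulim cU baseU NU' slsP e7E _ (leqnn _))) => //.
  by move=> x; rewrite fr7.2 // fr6.2 // fr5.2.
move=> e8 rd8 fr8 _.
have v8 v : v < 90 -> vr e8 v = vr e7 v by move=> hv'; apply: fr8.1; apply: mv_prep.
have a8 : ar e8 0 =1 ar e7 0 by move=> i; apply: fr8.2; apply/negP => /ma_prep.
have par8 : params ins false s m e8.
  by split; rewrite ?v8 ?(hu_BL he7) ?(hu_PW he7) ?(hu_PM he7) //; exact: d_tab dsp.
have mem8 : mem e8 0 MK N' Kmat by apply: (mem_eq m7) => i j hi hj; rewrite a8.
have pU i (hi : i < E') := pbaseU w_large Ularge Ulim cU baseU NU' hi.
apply: (seqP (inv_cP rho w_large small_ins small_len m0 mJ s0 Jw Ularge Ulim sU char2 zm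
   (MB := MK) (bs := pbase c) slsM _ NU' _ _ _ par8 _ _ _ rd8 mem8 EU2)) => //.
- by apply: leq_trans EU2; rewrite leq_addr.
- by rewrite /MK; lia.
- move=> i hi; split; first by apply: leq_trans (pU i hi); apply: leq_addr.
  apply: leq_trans (ltnW (size_sls slsP hi)) _.
  by apply: leq_trans (pU i hi); apply: leq_addl.
- by rewrite v8.
- by rewrite v8.
- by rewrite v8.
move=> e9 [h1 h2 h3] fr9 _.
have [x9 xN xM] : [/\ vr e9 9 = f, vr e9 vN = N' & vr e9 vMB = MK].
  by split; rewrite fr9.1 // v8.
apply: tri_sl => //; first by rewrite /= ?x9 ?xN ?xM; do !split=> //; lia.
split; last by rewrite /= xN xM.
have big i (x : nat) : i < 16 -> 16 <= x -> (x == i) = false by move=> ? ?; apply/eqP; lia.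
set e10 := xe _ _ _.
have keep y : 16 <= y -> ar e10 0 y = ar e9 0 y.
  by move=> hy; rewrite /e10 /= (big 3 y) // (big 2 y) // (big 1 y) // (big 0 y).
split=> //.
- move=> j; have jf := ltn_ord j; have [l0 l1 l2 l3] := l6 j.
  have E0 r : r < 4 -> ar e10 0 (HDR + j * 4 + r) = lwe e6 j r.
    move=> hr; rewrite keep; last by rewrite -addnA leq_addr.
    by rewrite h3 ?a8 ?o7 // /MK; lia.
  by rewrite /lst_ok !E0.
Qed.

End UpdSpec.

(** * Specification of the query *)

Section QrySpec.

Variables (k : nat).
Variables (w : nat) (ins : seq (seq nat)) (rho : nat -> nat).
Hypothesis w_large : 7 < w.
Hypothesis small_ins : forall i j, nth 0 (nth [::] ins i) j < 2 ^ w.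
Hypothesis small_len : forall i, size (nth [::] ins i) < 2 ^ w.

Variables (n l U : nat).
Notation s := (bitlen n).
Notation J := (Jf k).
Notation h := (3 ^ l).
Notation m := (h * 3).
Hypotheses (mJ : m <= s * J) (Jw : 2 * (s * J) <= w).
Hypotheses (Ularge : 1000 <= U) (Ulim : 1000 * (U * U) <= lim w).
Hypothesis sU4 : 4 * 2 ^ s <= U.
Notation N := (sz (up_log 2 n)).
Hypothesis NU : N <= U.

Variables (L : finFieldType) (z : L).
Hypotheses (char2 : (2%N \in [pchar L])%R) (zP : ((3 ^ l.+1)%N.-primitive_root z)%R).
Variables (RND Gb : nat -> nat).

Notation X := (Xm n l z RND).
Notation G := (@Gr n Gb).
Notation D := (nth 0 (nth [::] ins 0)).
Notation W := (nth 0 (nth [::] ins 1)).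
Notation MO := (MO n).
Hypothesis dsp : dspec n l z RND Gb D.

Variable B : seq (update n).
Notation f := (size B).
Hypothesis fU : 4 * f + 16 <= U.
Notation N' := (sz (up_log 2 f)).
Hypothesis NU' : N' <= U.
Hypothesis usp : uspec l z RND Gb B W.
Variables u v : 'I_n.
Hypotheses (insu : nth 0 (nth [::] ins 2) 0 = u) (insv : nth 0 (nth [::] ins 2) 1 = v).

Notation tri := (tri w ins rho).
Notation trc c e Q := (tri c e (cc c) Q).
Notation fw := (fw m z).
Notation ux := (@ux n B).
Notation hu := (hu ins n l).

Let uu := UU Ularge.
Let lw := lim_w w.
Let seqP := tri_seq (ins := ins) (rho := rho) w_large small_ins small_len.
Let conseqP := tri_conseq (ins := ins) (rho := rho) w_large small_ins small_len.
Let ns : n < 2 ^ s. Proof. by rewrite trunc_log_ltn. Qed.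
Let nU : 4 * n < U. Proof. lia. Qed.
Let ssU : 16 * (2 ^ s * 2 ^ s) <= U * U.
Proof. have := leq_mul sU4 sU4; lia. Qed.
Let nnU : 16 * (n * n) <= U * U.
Proof. have := leq_mul (ltnW nU) (ltnW nU); lia. Qed.
Let NNU : N * N <= U * U. Proof. exact: leq_mul. Qed.
Let NNU' : N' * N' <= U * U. Proof. exact: leq_mul. Qed.
Let s0 : 0 < s. Proof. by []. Qed.
Let h0 : 0 < h. Proof. by rewrite expn_gt0. Qed.
Let sU : 2 ^ s <= U. Proof. lia. Qed.
Let MOU : MO + N * N <= 3 * (U * U). Proof. by rewrite /MO /AO /XO; lia. Qed.
Let mul_P := mulcP (ins := ins) (tb := false) rho w_large mJ s0 Jw Ularge Ulim sU.
Let w32 : 32 < 2 ^ w. Proof. lia. Qed.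
Let zm : (z ^+ m = 1)%R.
Proof. by rewrite mulnC -expnS; apply: prim_expr_order. Qed.

Lemma leqfN : f <= N'. Proof. by rewrite szE up_logP. Qed.

Notation Nv := (Ninv n l z RND Gb).
Notation dv := (dinv n l z RND Gb).
Definition Kinv : 'M[L]_f := unpad leqfN (dfi (Kmat l z RND Gb B)).1.
Definition linv : L := (dfi (Kmat l z RND Gb B)).2.

Notation qv j := (qn G B X Nv dv (ux j) v).
Definition value : L := (linv * Nv u v +
  \sum_i Nv u (utail (ux i)) * \sum_j Kinv i j * qv j)%R.

Definition wl j r := W (HDR + j * 4 + r).

Record hq e : Prop := Hq {
  hq_u : hu e; hq_9 : vr e 9 = f; hq_N : vr e vN = N'; hq_M : vr e vMB = MK B;
  hq_85 : vr e 85 = u; hq_81 : vr e 81 = v }.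

Lemma hq_frame vs cs e e' : hq e -> frame vs cs e e' ->
  all [predC vs] [:: vn; vBL; vPW; vPM; vPH; 72; 73; 74; 75; 76; 9; vN; vMB; 85; 81] -> hq e'.
Proof.
move=> [h1 h2 h3 h4 h5 h6] fr hs; have hs' := allP hs.
split; try by rewrite fr.1 //; apply: hs'.
by apply: (hu_frame h1 fr); apply/allP => x hx; apply: hs'; move: hx; rewrite !inE => /orP[->|];
  rewrite ?orbT // => /or4P[->|->|->|]; rewrite ?orbT // => /or4P[->|->|->|]; rewrite ?orbT // =>
  /orP[->|/orP[->|->]]; rewrite ?orbT.
Qed.

Lemma W_K (i j : 'I_f) : fw (W (MK B + (i * N' + j))) (Kinv i j).
Proof. by rewrite /Kinv mxE addnA; apply: (u_K usp (widen_ord leqfN i) (widen_ord leqfN j)). Qed.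

Lemma fwD a b x y : fw a x -> fw b y -> fw (Nat.lxor a b) (x + y)%R.
Proof.
move=> [a1 <-] [b1 <-]; split; first exact: lxor_lt.
exact: phi_xor.
Qed.

Lemma fwM a b x y : fw a x -> fw b y -> fw (wmul m s J a b) (x * y)%R.
Proof.
move=> [a1 <-] [b1 <-]; split; first exact: wmul_lt.
exact: phi_wmul.
Qed.

Lemma fw_zero : fw 0 0%R. Proof. by split; [rewrite expn_gt0|apply: phi0]. Qed.

Lemma innerP e (i : 'I_f) : hq e -> vr e 15 = i -> fw (vr e 82) 0%R ->
  tri (For 16 9 (inner_c k)) e (f * (cc (inner_c k) + 10) + 8) (fun e' =>
    fw (vr e' 82) (\sum_j Kinv i j * qv j)%R).
Proof.
move=> hqe e15 e82.
apply: (conseqP (T := f * (cc (inner_c k) + 10) + 8) (Q := fun e' =>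
  fw (vr e' 82) (\sum_(j < f | (j < f)%N) Kinv i j * qv j)%R /\
  frame (16 :: mv (inner_c k)) (ma (inner_c k)) e e')) => //; last first.
  by move=> e' _ _ [h1 _]; rewrite (eq_bigl (fun j : 'I_f => (j < f)%N)) // => j; rewrite ltn_ord.
apply: (tri_for (I := fun j0 e' => fw (vr e' 82) (\sum_(j < f | (j < j0)%N) Kinv i j * qv j)%R)
  w_large small_ins small_len) => //.
- exact: hq_9.
- by rewrite big_pred0.
move=> j0 e1 hj e16 fr _ I1.
have hq1 := hq_frame hqe fr isT.
have w15 : vr e1 15 = i by rewrite fr.1.
pose j := Ordinal hj; have hi := ltn_ord i.
rewrite /inner_c; apply: trc_asg => //; set e2 := setv _ 80 _.
have f2 : frame [:: 80] [::] e1 e2 by split=> // v' /=; rewrite inE => /negbTE->.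
have hq2 := hq_frame hq1 f2 isT.
have z80 : vr e2 80 = j by rewrite /= e16.
have [z15 z16 z82] : [/\ vr e2 15 = i, vr e2 16 = j & vr e2 82 = vr e1 82] by [].
clearbody e2.
have lok := u_lst usp.
apply: (trc_seq w_large small_ins small_len (qnP rho w_large small_ins small_len mJ Jw Ularge Ulim sU4 NU
  char2 dsp fU (ui := true) (hq_u hq2) (lok j) z80 (hq_81 hq2) (fun r _ => erefl _))).
move=> e3 [v29 a3] f3 _.
have hq3 := hq_frame hq2 f3 isT.
have g29 := qnwP mJ char2 zm dsp v (lok j).
have gK := W_K i j.
have [y15 y16 y82] : [/\ vr e3 15 = i, vr e3 16 = j & vr e3 82 = vr e1 82].
  by split; rewrite f3.1.
have ijN : i * N' + j < N' * N'.
  have := leqfN => fN; apply: (@leq_trans (i * N' + N')); first by rewrite /=; lia.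
  by rewrite -mulSnr leq_mul2r; apply/orP; right; lia.
have MKw : MK B + (i * N' + j) < lim w by rewrite /MK; lia.
have evK (e' : env) : vr e' vMB = MK B -> vr e' 15 = i -> vr e' vN = N' -> vr e' 16 = j ->
    safe w ins e' (Inp 1 (V vMB +' (V 15 *' V vN +' V 16))) /\
    ev ins e' (Inp 1 (V vMB +' (V 15 *' V vN +' V 16))) = W (MK B + (i * N' + j)).
  by move=> h1 h2 h3 h4; rewrite /= h1 h2 h3 h4; do !split=> //; rewrite /= in ijN; lia.
have [sK eK] := evK e3 (hq_M hq3) y15 (hq_N hq3) y16.
apply: (trc_seq w_large small_ins small_len (mul_P 28 (y := V 29) (hu_params dsp (hq_u hq3)) sK _ _ _ _)) => //.
- by rewrite eK; case: gK.
- by rewrite /= v29; case: g29.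
rewrite eK [ev _ _ _]/= v29 => e4 [v28 e4E] f4 _.
have v82 : vr e4 82 = vr e1 82 by rewrite f4.1.
apply: tri_sl => //=; rewrite v82 v28 (sum_ltS _ hj).
by apply: fwD => //; apply: fwM.
Qed.

Definition hit (x : update n) := unode x && ((utail x == u) || (utail x == v)).

Definition outer_cost := f * (cc (inner_c k) + 10) + 8 +
  cc (mulc false J 28 (Inp 0 (V 73 +' (V 85 *' V 72 +' V 17))) (V 82)) + 200.

Lemma hasE : has hit B = ~~ (alive B u && alive B v).
Proof.
rewrite negb_and /alive !negbK; apply/hasP/orP => [[[? ?|? ?|a]] aB //|[] xB].
- by rewrite /hit /= => /orP[] /eqP <-; [left|right].
- by exists (DelNode u); rewrite // /hit /= eqxx.
- by exists (DelNode v); rewrite // /hit /= eqxx orbT.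
Qed.

Lemma outerP e : hq e -> vr e 86 = 0 -> fw (vr e 84) (linv * Nv u v)%R ->
  tri (For 15 9 (outer_c k)) e (f * (outer_cost + 10) + 8) (fun e' =>
    [/\ fw (vr e' 84) value, vr e' 86 = has hit B & hq e']).
Proof.
move=> hqe e86 e84.
apply: (conseqP (T := f * (outer_cost + 10) + 8) (Q := fun e' =>
  (fw (vr e' 84) (linv * Nv u v + \sum_(i < f | (i < f)%N)
     Nv u (utail (ux i)) * \sum_j Kinv i j * qv j)%R /\ vr e' 86 = has hit (take f B)) /\
  frame (15 :: mv (outer_c k)) (ma (outer_c k)) e e')) => //; last first.
  move=> e' _ _ [[h1 h2] h3]; rewrite take_size in h2; split=> //.
    by rewrite /value [X in (_ + X)%R](eq_bigl (fun j : 'I_f => (j < f)%N)) // => j; rewrite ltn_ord.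
  exact: (hq_frame hqe h3).
apply: (tri_for (I := fun i0 e' => fw (vr e' 84) (linv * Nv u v + \sum_(i < f | (i < i0)%N)
     Nv u (utail (ux i)) * \sum_j Kinv i j * qv j)%R /\ vr e' 86 = has hit (take i0 B))
  w_large small_ins small_len) => //.
- exact: hq_9.
- by rewrite take0 /= e86; split=> //; rewrite big_pred0 // addr0.
move=> i0 e1 hi e15 fr _ [I1 I2].
have hq1 := hq_frame hqe fr isT.
pose i := Ordinal hi; have ilt : (i : nat) < f := ltn_ord i; have [l0 l1 l2 l3] := u_lst usp i.
have tk : take i0.+1 B = rcons (take i0 B) (ux i).
  by rewrite (take_nth (ux i)) // (uxE _ hi).
rewrite /outer_c.
set T5 := cc (mulc false J 28 (Inp 0 (V 73 +' (V 85 *' V 72 +' V 17))) (V 82)).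
set T4 := f * (cc (inner_c k) + 10) + 8.
apply: (seqP (T1 := 20) (T2 := 10 + (50 + (10 + (T4 + (T5 + 20))))) (P := fun e' => e' = setv e1 83 (HDR + i * 4))).
- by apply: tri_sl => //=; rewrite e15 //; do !split=> //; lia.
- by rewrite /outer_cost -/T4 -/T5; lia.
move=> _ -> _ _; set e2 := setv _ 83 _.
have ut : W (HDR + i * 4) = utail (ux i) by rewrite -l0 addn0.
apply: (seqP (T1 := 10) (T2 := 50 + (10 + (T4 + (T5 + 20)))) (P := fun e' => e' = setv e2 17 (utail (ux i)))) => //.
  by apply: tri_sl => //=; rewrite ut.
move=> _ -> _ _; set e3 := setv _ 17 _.
have f3 : frame [:: 83; 17] [::] e1 e3.
  by split=> // v' /=; rewrite !inE negb_or => /andP[/negbTE-> /negbTE->].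
have hq3 := hq_frame hq1 f3 isT.
have [z83 z17 z15 z86 z84] : [/\ vr e3 83 = HDR + i * 4, vr e3 17 = utail (ux i),
   vr e3 15 = i, vr e3 86 = vr e1 86 & vr e3 84 = vr e1 84] by [].
clearbody e3.
have evc : ev ins e3 (Bin OpAnd (Inp 1 (V 83 +' K 3))
    (Bin OpOr (Bin OpEq (V 17) (V 85)) (Bin OpEq (V 17) (V 81)))) = hit (ux i).
  rewrite [LHS]/= z83 z17 (hq_85 hq3) (hq_81 hq3) -[W _]/(wl i 3) -[wl _ _]/(W (HDR + i * 4 + 3)) l3.
  rewrite /hit (_ : (utail (ux i) == u :> nat) = (utail (ux i) == u)) // (_ : (utail (ux i) == v :> nat) = (utail (ux i) == v)) //.
  by case: (unode _); case: (_ == u); case: (_ == v).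
apply: (seqP (T1 := 50) (T2 := 10 + (T4 + (T5 + 20))) (P := fun e' =>
   vr e' 86 = has hit (take i0.+1 B))) => //.
  apply: (tri_cond (T1 := 10) (T2 := 10) w_large) => //.
  - by rewrite /= z83; move: (i : nat) ilt => j jf; do !split=> //=; lia.
  - rewrite tk has_rcons evc => hc; have -> : hit (ux i) by case: (hit _) hc.
    by apply: tri_sl => //=; do ?split=> //; lia.
  rewrite tk has_rcons evc => hc; have -> : hit (ux i) = false by case: (hit _) hc.
  by apply: tri_sl => //=; rewrite ?z86 ?I2 //; do ?split=> //; lia.
move=> e4 v86 fr4 _; have hq4 := hq_frame hq3 fr4 isT.
have [y17 y15 y84] : [/\ vr e4 17 = utail (ux i), vr e4 15 = i & vr e4 84 = vr e1 84].
  by split; rewrite fr4.1.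
apply: (seqP (T1 := 10) (T2 := T4 + (T5 + 20)) (P := fun e' => e' = setv e4 82 0)) => //.
  by apply: tri_sl => //=; lia.
move=> _ -> _ _; set e5 := setv _ 82 _.
have f5 : frame [:: 82] [::] e4 e5 by split=> // v' /=; rewrite inE => /negbTE->.
have hq5 := hq_frame hq4 f5 isT.
apply: (seqP (innerP (e := e5) (i := i) hq5 y15 fw_zero) (T2 := T5 + 20)) => //.
move=> e6 v82 fr6 _; have hq6 := hq_frame hq5 fr6 isT.
have [x17 x86 x84] : [/\ vr e6 17 = utail (ux i), vr e6 86 = has hit (take i0.+1 B) &
   vr e6 84 = vr e1 84] by split; rewrite fr6.1.
have gN := D_N dsp u (utail (ux i)).
have uN : u * N + utail (ux i) < N * N.
  have a1 := ltn_ord (utail (ux i)); have a2 := ltn_ord u; have a3 := leqnN n.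
  apply: (@leq_trans (u * N + N)); first by rewrite ltn_add2l; apply: leq_trans a3.
  by rewrite -mulSnr leq_mul2r (leq_trans a2 a3) orbT.
have evN (e' : env) : hq e' -> vr e' 17 = utail (ux i) ->
    safe w ins e' (Inp 0 (V 73 +' (V 85 *' V 72 +' V 17))) /\
    ev ins e' (Inp 0 (V 73 +' (V 85 *' V 72 +' V 17))) = D (MO + (u * N + utail (ux i))).
  move=> h1 h2; rewrite /= (hq_85 h1) (hu_N (hq_u h1)) (hu_MO (hq_u h1)) h2.
  by do !split=> //; lia.
have [sN eN] := evN e6 hq6 x17.
apply: (seqP (mul_P 28 (y := V 82) (hu_params dsp (hq_u hq6)) sN _ _ _ _) (T2 := 20)) => //.
- by rewrite eN; case: gN.
- by case: v82.
rewrite eN [ev _ _ (V 82)]/= => e7 [v28 e7E] fr7 _.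
have [t84 t86] : vr e7 84 = vr e1 84 /\ vr e7 86 = has hit (take i0.+1 B) by split; rewrite fr7.1.
apply: tri_sl => //=; rewrite t84 v28 t86; split=> //.
rewrite (sum_ltS _ hi) addrA; apply: fwD => //.
exact: fwM.
Qed.

Lemma zeroP e : hq e -> fw (vr e 84) value -> vr e 86 = has hit B ->
  tri zero_c e 100 (fun e' => ar e' 0 0 = [&& alive B u, alive B v & value != 0%R] /\ vr e' vlen = 1).
Proof.
move=> hqe [e84 e84v] e86.
have pz := phi_eq0 char2 zP e84; rewrite e84v in pz.
have pp : 2 ^ h * 2 ^ h = 2 ^ (h + h) by rewrite expnD.
have phw : 2 ^ (h + h) < 2 ^ w by rewrite ltn_exp2l //; lia.
have ph := hu_PH (hq_u hqe).
have cd : Nat.land (vr e 84 %% 2 ^ h == vr e 84 %/ 2 ^ h %% 2 ^ h)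
    (vr e 84 %/ 2 ^ h %% 2 ^ h == vr e 84 %/ 2 ^ (h + h)) = (value == 0%R).
  by rewrite pz; case: (_ == _); case: (_ == _).
have w0 : 0 < 2 ^ w by rewrite expn_gt0.
have w1 : 1 < 2 ^ w by apply: ltn_trans w32.
have hE := hasE.
apply: tri_sl => //=; rewrite ph pp cd.
  have wl : 0 < lim w by rewrite /lim expn_gt0.
  by rewrite ?pp; case: (value == 0%R) => /=; do !split.
case: (value == 0%R) => /=; first by rewrite !andbF.
by rewrite e86 hE; case: (alive B u); case: (alive B v).
Qed.

Definition qry_cost := f * (outer_cost + 10) + 8 +
  cc (mulc false J 84 (V 87) (Inp 0 (V 73 +' (V 85 *' V 72 +' V 81)))) + 400.

Lemma qryP e : tri (qry_c k) e qry_cost (fun e' =>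
  ar e' 0 0 = [&& alive B u, alive B v & value != 0%R] /\ vr e' vlen = 1).
Proof.
set T2 := cc (mulc false J 84 (V 87) (Inp 0 (V 73 +' (V 85 *' V 72 +' V 81)))).
set T3 := f * (outer_cost + 10) + 8.
apply: (seqP (T1 := 200) (T2 := T2 + (T3 + 100)) (P := fun e' =>
   [/\ hq e', vr e' 86 = 0 & vr e' 87 = W 2])).
- apply: (seqP (T1 := 100) (P := fun e' => hu e' /\
      frame [:: vn; vBL; vPW; vPM; vPH; 72; 73; 74; 75; 76] [::] e e') (T2 := 100)) => //.
    by eapply restoreP; eassumption.
  move=> e1 [he1 fr1] _ _; apply: tri_sl => //=; first by do !split=> //; lia.
  rewrite insu insv (u_f usp) (u_N usp) (u_MB usp); split=> //; split=> //.
  set e2 := setv _ 86 _.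
  have f2 : frame [:: 9; vN; 87; vMB; 85; 81; 86] [::] e1 e2.
    split=> // x /=; rewrite !inE !negb_or => /and5P[/negbTE-> /negbTE-> /negbTE-> /negbTE->].
    by move=> /and3P[/negbTE-> /negbTE-> /negbTE->].
  exact: (hu_frame he1 f2).
- by rewrite /qry_cost -/T2 -/T3; lia.
move=> e1 [hq1 e86 e87] _ _.
have gN := D_N dsp u v.
have uN : u * N + v < N * N.
  have a1 := ltn_ord v; have a2 := ltn_ord u; have a3 := leqnN n.
  apply: (@leq_trans (u * N + N)); first by lia.
  by rewrite -mulSnr leq_mul2r; apply/orP; right; lia.
have evN (e' : env) : vr e' 73 = MO -> vr e' 85 = u -> vr e' 72 = N -> vr e' 81 = v ->
    safe w ins e' (Inp 0 (V 73 +' (V 85 *' V 72 +' V 81))) /\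
    ev ins e' (Inp 0 (V 73 +' (V 85 *' V 72 +' V 81))) = D (MO + (u * N + v)).
  by move=> h1 h2 h3 h4; rewrite /= h1 h2 h3 h4; do !split=> //; lia.
have [sN eN] := evN e1 (hu_MO (hq_u hq1)) (hq_85 hq1) (hu_N (hq_u hq1)) (hq_81 hq1).
have e2P (e2 : env) : e2 = setv e1 20 (ev ins e1 (V 87)) ->
    safe w ins e2 (Inp 0 (V 73 +' (V 85 *' V 72 +' V 81))) /\
    ev ins e2 (Inp 0 (V 73 +' (V 85 *' V 72 +' V 81))) = D (MO + (u * N + v)).
  move=> ->; apply: evN; [exact: hu_MO (hq_u hq1)|exact: hq_85 hq1|exact: hu_N (hq_u hq1)|exact: hq_81 hq1].
have [s2 ev2] := e2P _ erefl.
have [ul1 ul2] := u_l usp.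
apply: (seqP (mul_P 84 (x := V 87) (hu_params dsp (hq_u hq1)) _ s2 _ _ _) (T2 := T3 + 100)) => //.
- by rewrite /= e87.
- by rewrite eN; case: gN.
rewrite eN [ev _ _ (V 87)]/= e87 => e2 [v84 e2E] fr2 _.
have hq2 := hq_frame hq1 fr2 isT.
have v86 : vr e2 86 = 0 by rewrite fr2.1.
apply: (seqP (outerP hq2 v86 _) (T2 := 100)) => //.
  by rewrite v84; apply: fwM.
by move=> e3 [h1 h2 h3] _ _; apply: zeroP.
Qed.

End QrySpec.

(** * Asymptotic bounds *)

Section Bounds.
Local Open Scope ring_scope.
Variable R : realType.

Lemma natO_le (g : nat -> nat) (h : nat -> R) (K : R) : (forall m, 0 <= h m) ->
  (forall m, (0 < m)%N -> (g m)%:R <= K * h m) -> natO g h.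
Proof.
move=> h0 gh; apply/eqO_exP; exists (`|K| + 1); first by rewrite ltr_wpDl.
near=> m; rewrite ger0_norm ?ler0n // (ger0_norm (h0 m)).
apply: (@le_trans _ _ (K * h m)); first by apply: gh; near: m; exists 1%N.
by apply: ler_wpM2r => //; apply: le_trans (ler_norm K) _; rewrite lerDl.
Unshelve. all: by end_near. Qed.

(** The finitely many values below the threshold are absorbed into the constant, since $n^\omega \ge
    1$. *)
Lemma natO_pow (t : nat -> nat) (omega : R) : 0 <= omega ->
  natO t (fun n => n%:R `^ omega) ->
  exists2 K : R, 0 <= K & forall n, (0 < n)%N -> (t n)%:R <= K * n%:R `^ omega.
Proof.
move=> w0 /eqO_exP[K K0 [n0 _ H]].
exists (K + (\sum_(i < n0) t i)%:R); first by rewrite addr_ge0 ?ler0n // ltW.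
move=> n n1; have p1 : 1 <= n%:R `^ omega.
  apply: (@le_trans _ _ (n%:R `^ 0)); first by rewrite powRr0.
  by apply: ler_powR => //; rewrite ler1n.
have p0 : 0 <= n%:R `^ omega by apply: le_trans p1.
have [nn|nn] := ltnP n n0.
  apply: (@le_trans _ _ (\sum_(i < n0) t i)%:R).
    by rewrite ler_nat (bigD1 (Ordinal nn)) //= leq_addr.
  rewrite mulrDl; apply: (@le_trans _ _ ((\sum_(i < n0) t i)%:R * n%:R `^ omega)).
    by rewrite ler_peMr // ler0n.
  by rewrite lerDr mulr_ge0 // ltW.
have := H n nn; rewrite ger0_norm ?ler0n // (ger0_norm p0) => h.
by apply: le_trans h _; rewrite mulrDl lerDl mulr_ge0 // ler0n.
Qed.

(** No sign of [omega] is presupposed, so that this form can serve to prove [2 <= omega]. *)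
Lemma natO_powT (t : nat -> nat) (omega : R) :
  natO t (fun n => n%:R `^ omega) ->
  exists2 K : R, 0 <= K & exists n0, forall n, (n0 <= n)%N -> (t n)%:R <= K * n%:R `^ omega.
Proof.
move=> /eqO_exP[K K0 [n0 _ H]]; exists K; first exact: ltW.
exists n0 => n nn; have := H n nn.
by rewrite ger0_norm ?ler0n // ger0_norm // powR_ge0.
Qed.

Lemma size_slp_eval (F : fieldType) (vs : seq F) sl :
  size (slp_eval vs sl) = (size vs + size sl)%N.
Proof.
elim: sl vs => [|i sl IH] vs /=; first by rewrite addn0.
by rewrite /slp_eval /= -/(slp_eval _ _) IH size_rcons addSnnS.
Qed.

Lemma nth_slp_eval (F : fieldType) (vs : seq F) sl i : (i < size vs)%N ->
  (slp_eval vs sl)`_i = vs`_i.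
Proof.
elim: sl vs => [|x sl IH] vs //= hi.
rewrite /slp_eval /= -/(slp_eval _ _) IH ?size_rcons ?ltnS; last exact: ltnW.
by rewrite nth_rcons hi.
Qed.

(* A shorter program would return an entry of the right-hand factor. *)
Lemma size_multiplies n sl : slp_multiplies n sl -> (n * n <= size sl)%N.
Proof.
move=> h; rewrite leqNgt; apply/negP => lt.
have := h rat 0 (const_mx 1); set vs := slp_eval _ _.
have sz_in : size (entries (0 : 'M[rat]_n) ++ entries (const_mx 1 : 'M[rat]_n)) = (n * n + n * n)%N.
  by rewrite size_cat !size_entries.
have sz_vs : size vs = (n * n + n * n + size sl)%N by rewrite size_slp_eval sz_in.
move=> /(congr1 (fun s => s`_0)); rewrite nth_drop addn0 sz_vs.
rewrite (_ : n * n + n * n + size sl - n * n = n * n + size sl)%N; last by lia.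
rewrite nth_slp_eval ?sz_in ?ltn_add2l // nth_cat size_entries ltnNge leq_addr /= addKn.
rewrite mul0mx => e.
have n0 : (0 < n)%N by rewrite lt0n; apply/eqP => z; move: lt; rewrite z.
have all1 i : (i < n * n)%N -> (entries (const_mx 1 : 'M[rat]_n))`_i = 1.
  move=> hi; have a : (i %/ n < n)%N by rewrite ltn_divLR.
  have b : (i %% n < n)%N by rewrite ltn_mod.
  by rewrite {1}(divn_eq i n) (nth_entries _ 0 (Ordinal a) (Ordinal b)) mxE.
have all0 : (entries (0 : 'M[rat]_n))`_0 = 0.
  by have := nth_entries (0 : 'M[rat]_n) 0 (Ordinal n0) (Ordinal n0); rewrite /= mul0n mxE.
by move: e; rewrite all1 // all0 => /eqP; rewrite oner_eq0.
Qed.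

Lemma pow2_powR (omega : R) j : (sz j)%:R `^ omega = (2 `^ omega) ^+ j.
Proof.
rewrite szE natrX -powR_mulrn // powRAC powR_mulrn //; exact: powR_ge0.
Qed.

Lemma bernoulli (d : R) j : 0 <= d -> 1 + d *+ j <= (1 + d) ^+ j.
Proof.
move=> d0; elim: j => [|j IH]; first by rewrite addr0 expr0.
rewrite exprS; apply: (@le_trans _ _ ((1 + d) * (1 + d *+ j))).
  rewrite mulrDl mul1r mulrDr mulr1 mulrS (addrC d) addrA lerD2l lerDl.
  by rewrite mulr_ge0 // mulrn_wge0.
by apply: ler_wpM2l => //; apply: addr_ge0.
Qed.

(** On powers of two the bounds read $4^j \le K (2^\omega)^j$ for large $j$, which forces $2^\omega
    \ge 4$. This lets $n^\omega$ absorb all quadratic costs. *)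
Lemma omega_ge2 (omega : R) (t : nat -> nat) :
  (forall n, (0 < n)%N -> (n * n <= t n)%N) ->
  natO t (fun n => n%:R `^ omega) -> 2 <= omega.
Proof.
move=> tn /natO_powT[K K0 [n0 H]]; set x := 2 `^ omega.
have x0 : 0 < x by rewrite powR_gt0.
have le j : (n0 <= sz j)%N -> 4 ^+ j <= K * x ^+ j.
  move=> hj; rewrite -pow2_powR; apply: le_trans (H _ hj).
  rewrite -natrX ler_nat; apply: leq_trans (tn _ (sz_gt0 j)).
  by rewrite szE -expnMn.
have x4 : 4 <= x.
  rewrite leNgt; apply/negP => lt; set d := 4 / x - 1.
  have d0 : 0 < d by rewrite subr_gt0 ltr_pdivlMr // mul1r.
  have [j0 hj0] : exists j0 : nat, K / d < j0%:R.
    by exists (Num.truncn (K / d)).+1; rewrite truncnS_gt.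
  pose j := maxn j0 n0.
  have hj : (n0 <= sz j)%N.
    by rewrite szE; apply: leq_trans (ltnW (ltn_expl _ _)); rewrite ?leq_maxr.
  have := le _ hj; rewrite -ler_pdivrMr ?exprn_gt0 // -expr_div_n.
  rewrite -[4 / x](subrK 1) -/d addrC leNgt => /negP; apply.
  apply: lt_le_trans (bernoulli j (ltW d0)).
  apply: (@lt_le_trans _ _ (d *+ j)); last by rewrite lerDr.
  rewrite -mulr_natr mulrC -ltr_pdivrMr //; apply: lt_le_trans hj0 _.
  by rewrite ler_nat leq_maxl.
have l2 : 0 < ln (2 : R) by rewrite ln_gt0 // ltr1n.
have e4 : 2 `^ 2 = 4 :> R by rewrite powR_mulrn ?ler0n // -natrX.
rewrite -(ler_pM2r l2) -!ln_powR -/x e4.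
by rewrite ler_ln // posrE // ltr0n.
Qed.

End Bounds.

(** * Total costs *)

Section Costs.

Variables (p : program) (c k : nat) (t : nat -> nat) (sl : nat -> slp).
Hypothesis slt : forall n, 0 < n -> size (sl n) <= t n.

Definition sls j := sl (sz j).
Definition tz j := t (sz j).
Definition flog n := up_log 3 (uphalf (kf k * bitlen n)).

Definition pre_time n := rnd_time (n * n) + pre_cost p k n (flog n) sls tz.

Definition upd_time f := 4 +
  (up_log 2 f * 20 + f * (cc mark_c + 10) + f * (cc scale_c + 10) +
  sz (up_log 2 f) * (sz (up_log 2 f) * (cc (fillK_c k) + 10) + 18) +
  \sum_(0 <= j < up_log 2 f) ((tz j).+1 * prep_const p) +
  icost false (Jf k) sls (up_log 2 f) + 1000).

Definition qry_time f := 4 +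
  (f * (f * (cc (inner_c k) + 10) + 8 +
    cc (mulc false (Jf k) 28 (Inp 0 (V 73 +' (V 85 *' V 72 +' V 17))) (V 82)) + 200 + 10) + 8 +
  cc (mulc false (Jf k) 84 (V 87) (Inp 0 (V 73 +' (V 85 *' V 72 +' V 81)))) + 400).

Definition pre_size n := MO n + sz (up_log 2 n) * sz (up_log 2 n).
Definition upd_size f := HDR + f * 4 + sz (up_log 2 f) * sz (up_log 2 f).

Lemma sz_up_log n : 0 < n -> sz (up_log 2 n) <= 2 * n.
Proof.
move=> n0; rewrite szE; case: (ltngtP n 1) => [||->]; [by lia| |by rewrite up_log1].
move=> n1; have /andP[h _] := up_log_bounds (isT : 1 < 2) n1.
have : 0 < up_log 2 n by rewrite up_log_gt0.
by move: h; case: (up_log 2 n) => //= e h _; rewrite expnS; lia.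
Qed.

Lemma sz_up_log2 n : 0 < n -> sz (up_log 2 n) * sz (up_log 2 n) <= 4 * (n * n).
Proof. by move=> n0; have := leq_mul (sz_up_log n0) (sz_up_log n0); lia. Qed.

Lemma up_log_le n : 0 < n -> up_log 2 n <= 2 * n.
Proof.
by move=> n0; apply: leq_trans (sz_up_log n0); rewrite szE; apply/ltnW/ltn_expl.
Qed.

Lemma pow_bitlen n : 0 < n -> 2 ^ bitlen n <= 2 * n.
Proof. by move=> n0; rewrite /bitlen expnS leq_mul2l trunc_logP. Qed.

Lemma lf_le n : flog n <= kf k * bitlen n.
Proof.
apply: up_log_min => //; apply: (@leq_trans (kf k * bitlen n)); first by lia.
by apply/ltnW/ltn_expl.
Qed.

Lemma square_le N q a : N * N <= 4 * q -> 0 < q ->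
  N * (N * (a + 10) + 18) + 8 <= (5 * (a + 40)) * q.
Proof.
move=> NN q0; case: (posnP N) => [->|N0]; first by rewrite mul0n; nia.
apply: leq_trans (fill_le a N0) _; rewrite -mulnA mulnCA leq_mul2l; lia.
Qed.

Lemma pre_arith q rs rt rp bl e l kv T1 T2 T3 T4 c1 c2 c3 c4 S1 S2 : 0 < q ->
  bl <= 2 * q -> e <= 2 * q -> l <= kv * (2 * q) ->
  T1 <= c1 * q -> T2 <= c2 * q -> T3 <= c3 * q -> T4 <= c4 * q ->
  rs + q * rp + rt.+2 + ((2 * bl + e + l + 6) * 30 + T1 + T2 + T3 + T4 + 1000 +
    (S1 + 100) + (S2 + 100)) <=
  (rp + (rs + rt + 2) + 30 * (2 * 2 + 2 + 2 * kv + 6) + c1 + c2 + c3 + c4 + 1200) * q +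
    (S1 + S2).
Proof.
move=> q0 *; have r1 : rs <= rs * q by rewrite leq_pmulr.
have r2 : rt <= rt * q by rewrite leq_pmulr.
lia.
Qed.

Lemma upd_arith f q e cm cs ck T S1 S2 : 0 < q -> f <= q -> e <= 2 * f ->
  T + 8 <= ck * q ->
  4 + (e * 20 + f * (cm + 10) + f * (cs + 10) + T + S1 + S2 + 1000) <=
  (1100 + cm + cs + ck) * q + (S1 + S2).
Proof.
move=> q0 fq *; have r1 : f * cm <= q * cm by rewrite leq_mul2r fq orbT.
have r2 : f * cs <= q * cs by rewrite leq_mul2r fq orbT.
lia.
Qed.

Lemma pre_nat_le : exists A, forall n, 0 < n ->
  pre_time n <= A * (n * n) + (\sum_(0 <= j < up_log 2 n) ((tz j).+1 * prep_const p) +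
    icost true (Jf k) sls (up_log 2 n)).
Proof.
exists (rnd_period + (rnd_start + rnd_test + 2) + 30 * (2 * 2 + 2 + 2 * kf k + 6) +
  5 * (cc tab_c + 40) + 5 * (cc fillX_c + 40) + 5 * (cc fillA_c + 40) +
  5 * (cc fillM_c + 40) + 1200) => n n0.
have q0 : 0 < n * n by rewrite muln_gt0 n0.
have nq : n <= n * n by rewrite leq_pmulr.
have b1 := pow_bitlen n0; have bb : bitlen n < 2 ^ bitlen n by apply: ltn_expl.
have b2 : 2 ^ bitlen n * 2 ^ bitlen n <= 4 * (n * n) by have := leq_mul b1 b1; lia.
have e1 := up_log_le n0; have e2 := sz_up_log2 n0.
have l1 : flog n <= kf k * (2 * (n * n)).
  by apply: leq_trans (lf_le n) _; rewrite leq_mul2l; apply/orP; right; lia.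
have h1 := square_le (cc tab_c) b2 q0.
have n4 : n * n <= 4 * (n * n) by lia.
have h2 := square_le (cc fillX_c) n4 q0.
have h3 := square_le (cc fillA_c) n4 q0.
have h4 := square_le (cc fillM_c) e2 q0.
by apply: pre_arith => //; lia.
Qed.

Lemma upd_nat_le : exists A, forall f, 0 < f ->
  upd_time f <= A * (f * f) + (\sum_(0 <= j < up_log 2 f) ((tz j).+1 * prep_const p) +
    icost false (Jf k) sls (up_log 2 f)).
Proof.
exists (1100 + cc mark_c + cc scale_c + 5 * (cc (fillK_c k) + 40)) => f f0.
have q0 : 0 < f * f by rewrite muln_gt0 f0.
have fq : f <= f * f by rewrite leq_pmulr.
have e1 := up_log_le f0; have e2 := sz_up_log2 f0.
have h4 := square_le (cc (fillK_c k)) e2 q0.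
exact: upd_arith.
Qed.

Lemma qry_nat_le : exists A, forall f, 0 < f -> qry_time f <= A * (f * f).
Proof.
pose a := cc (inner_c k) + 10.
pose b := cc (mulc false (Jf k) 28 (Inp 0 (V 73 +' (V 85 *' V 72 +' V 17))) (V 82)).
pose d := cc (mulc false (Jf k) 84 (V 87) (Inp 0 (V 73 +' (V 85 *' V 72 +' V 81)))).
exists (a + b + d + 700) => f f0; rewrite /qry_time -/a -/b -/d.
by move: a b d => a b d; nia.
Qed.

Lemma pre_size_le n : 0 < n -> pre_size n <= 26 * (n * n).
Proof.
move=> n0; have e2 := sz_up_log2 n0; have b1 := pow_bitlen n0.
have b2 := leq_mul b1 b1; have q0 : 0 < n * n by rewrite muln_gt0 n0.
by rewrite /pre_size /MO /AO /XO; lia.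
Qed.

Lemma upd_size_le f : 0 < f -> upd_size f <= 24 * (f * f).
Proof.
move=> f0; have e2 := sz_up_log2 f0; have fq : f <= f * f by rewrite leq_pmulr.
by rewrite /upd_size; lia.
Qed.

Section Real.
Local Open Scope ring_scope.
Variables (R : realType) (omega K : R).
Hypotheses (w2 : 2 <= omega) (K0 : 0 <= K).
Hypothesis tK : forall n, (0 < n)%N -> (t n)%:R <= K * n%:R `^ omega.

Let x := 2 `^ omega.

Let x4 : 4 <= x.
Proof.
have -> : 4 = 2 `^ 2 :> R by rewrite powR_mulrn ?ler0n // -natrX.
by apply: ler_powR => //; rewrite ler1n.
Qed.

Let x0 : 0 <= x. Proof. exact: powR_ge0. Qed.
Let xj j : 1 <= x ^+ j. Proof. by rewrite exprn_ege1 // (le_trans _ x4) // ler1n. Qed.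

Lemma tz_le j : (tz j)%:R <= K * x ^+ j.
Proof. by rewrite -pow2_powR; apply: tK; apply: sz_gt0. Qed.

(** The levels grow geometrically with ratio [x], at least 4, so the sum is of the order of its last
    term. *)
Lemma prep_sum_le q : exists2 A : R, 0 <= A & forall E,
  (\sum_(0 <= j < E) ((tz j).+1 * q))%N%:R <= A * x ^+ E.
Proof.
exists ((K + 1) * q%:R); first by rewrite mulr_ge0 ?addr_ge0 ?ler0n.
set A := _ * _; have A0 : 0 <= A by rewrite mulr_ge0 ?addr_ge0 ?ler0n.
elim=> [|E IH]; first by rewrite big_geq // mulr_ge0.
rewrite big_nat_recr //= natrD exprS.
have h : ((tz E).+1 * q)%N%:R <= A * x ^+ E.
  rewrite natrM /A mulrAC; apply: ler_wpM2r; first exact: ler0n.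
  rewrite mulrDl mul1r -natr1; apply: lerD; [exact: tz_le|exact: xj].
apply: le_trans (lerD IH h) _; rewrite -mulr2n -mulr_natl mulrCA.
by apply: ler_wpM2l => //; apply: ler_wpM2r; [rewrite exprn_ge0|apply: le_trans x4; rewrite ler_nat].
Qed.

(** Inversion makes only two recursive calls while the work per level grows by a ratio of at least
    4: the top level dominates, and no logarithm appears even for [omega = 2]. *)
Lemma icost_le tb : exists2 A : R, 0 <= A & forall j,
  (icost tb (Jf k) sls j)%:R <= A * x ^+ j.
Proof.
pose i := (inv_const tb (Jf k))%:R : R.
have i0 : 0 <= i by apply: ler0n.
(* This bounds the work outside the recursive calls: [K] accounts for the straight-line program, 2
   for the square of the block size and the additive 1. The induction then closes because $2A + A
   \le 4A$. *)
exists (2 * (i * (K + 2) + 200)).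
  by rewrite mulr_ge0 // addr_ge0 // mulr_ge0 // addr_ge0.
set A := 2 * _.
have A200 : 200 <= A.
  rewrite /A mulrDr -natrM; apply: ler_wpDl; last by rewrite ler_nat.
  by rewrite mulr_ge0 // mulr_ge0 // addr_ge0.
elim=> [|j IH]; first by rewrite expr0 mulr1.
have -> : (icost tb (Jf k) sls j.+1)%:R = 2 * (icost tb (Jf k) sls j)%:R +
    2 * (i * ((size (sls j))%:R + (sz j)%:R * (sz j)%:R + 1) + 200) :> R.
  rewrite /i [icost _ _ _ _.+1]/=; move: (inv_const tb (Jf k)) (icost _ _ _ _) (size _) (sz j).
  by move=> q a b d; rewrite !(natrD, natrM).
have s1 : (size (sls j))%:R <= K * x ^+ j.
  by apply: le_trans (tz_le j); rewrite ler_nat slt // sz_gt0.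
have s2 : (sz j)%:R * (sz j)%:R <= x ^+ j.
  rewrite szE -natrM -expnMn natrX; apply: lerXn2r => //; rewrite nnegrE //.
have xj1 := xj j; have xj0 : 0 <= x ^+ j by apply: le_trans xj1.
have h : i * ((size (sls j))%:R + (sz j)%:R * (sz j)%:R + 1) + 200 <= (i * (K + 2) + 200) * x ^+ j.
  rewrite (mulrDl (i * (K + 2)) 200 (x ^+ j)) -(mulrA i); apply: lerD.
    apply: ler_wpM2l => //; rewrite mulrDl (_ : 2 = 1 + 1) // mulrDl mul1r addrA.
    by apply: lerD => //; apply: lerD.
  by rewrite -[X in X <= _]mulr1 ler_wpM2l.
apply: (@le_trans _ _ (2 * (A * x ^+ j) + A * x ^+ j)).
  apply: lerD; first by apply: ler_wpM2l.
  by rewrite /A -mulrA; apply: ler_wpM2l.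
rewrite exprS (mulrCA A) -{2}[A * _]mul1r -mulrDl.
apply: ler_wpM2r; first by rewrite mulr_ge0 // (le_trans _ A200).
by apply: le_trans x4; rewrite natr1 ler_nat.
Qed.

Lemma up_pow n : (0 < n)%N -> x ^+ up_log 2 n <= x * n%:R `^ omega.
Proof.
move=> n0; rewrite -pow2_powR -powRM ?ler0n // -natrM.
apply: ge0_ler_powR; rewrite ?nnegrE ?ler0n //; first by apply: le_trans w2.
by rewrite ler_nat sz_up_log.
Qed.

Lemma square_pow n : (0 < n)%N -> (n * n)%N%:R <= n%:R `^ omega.
Proof.
move=> n0; rewrite natrM -expr2 -powR_mulrn ?ler0n //.
by apply: ler_powR => //; rewrite ler1n.
Qed.

Lemma natO_cost (g : nat -> nat) tb : (exists A, forall n, (0 < n)%N ->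
   (g n <= A * (n * n) + (\sum_(0 <= j < up_log 2 n) ((tz j).+1 * prep_const p) +
    icost tb (Jf k) sls (up_log 2 n)))%N) -> natO g (fun n => n%:R `^ omega).
Proof.
move=> [A gA]; have [A1 A10 h1] := prep_sum_le (prep_const p).
have [A2 A20 h2] := icost_le tb.
apply: (@natO_le _ _ _ (A%:R + (A1 + A2) * x)) => [m|n n0]; first exact: powR_ge0.
apply: (@le_trans _ _ (A * (n * n) + (\sum_(0 <= j < up_log 2 n) ((tz j).+1 * prep_const p) +
    icost tb (Jf k) sls (up_log 2 n)))%N%:R); first by rewrite ler_nat gA.
rewrite !natrD natrM mulrDl; apply: lerD.
  by apply: ler_wpM2l; rewrite ?ler0n // square_pow.
apply: (@le_trans _ _ ((A1 + A2) * x ^+ up_log 2 n)).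
  by rewrite mulrDl; apply: lerD; [apply: h1|apply: h2].
by rewrite -mulrA; apply: ler_wpM2l; [apply: addr_ge0|apply: up_pow].
Qed.

End Real.

Lemma natO_square (R : realType) (g : nat -> nat) : (exists A, forall n, 0 < n ->
   g n <= A * (n * n)) -> natO g (fun n => n%:R ^+ 2 : R)%R.
Proof.
move=> [A gA]; apply: (@natO_le _ _ _ A%:R%R) => [m|n n0].
  by rewrite exprn_ge0 ?ler0n.
by rewrite expr2 -!natrM ler_nat gA.
Qed.

End Costs.

(** * Correctness *)

(** Goodness makes both denominators nonzero and both computed inverses true ones; only then does
    [Kmat] agree with the Woodbury matrix. *)
Lemma value_correct (L : finFieldType) n l (z : L) RND Gb (B : seq (update n)) u v :
  (2%N \in [pchar L])%R -> uniq B -> good_matrix (@Gr n Gb) B (Xm n l z RND) ->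
  [&& alive B u, alive B v & value l z RND Gb B u v != 0%R] = reachable (@Gr n Gb) B u v.
Proof.
move=> char2 uB /and3P[/forallP g1 /forallP g2 /forallP g3].
rewrite /reachable; case: (boolP (alive B u)) => //= au; case: (boolP (alive B v)) => //= av.
set G := @Gr n Gb; set X := Xm n l z RND.
have ndM : nd (1%:M + mask G X)%R.
  by apply: nd_lead => t tn; have := g1 (inord t); rewrite inordK.
have [d0 dM] := dfi_correct char2 (nd_pad char2 (leqnN n) ndM).
have Nd : (Ninv n l z RND Gb *m (1%:M + mask G X) = (dinv n l z RND Gb)%:M)%R.
  exact: unpad_inv dM.
have ndW : nd (wood (Ninv n l z RND Gb) (uP L B) (uQ G B X) (dinv n l z RND Gb)).
  apply: (nd_wood char2 Nd d0) => t tf.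
  by rewrite -(bmat_take char2 G X uB tf); have := g2 (inord t); rewrite inordK.
have KE : Kmat l z RND Gb B = pad (sz (up_log 2 (size B)))
    (wood (Ninv n l z RND Gb) (uP L B) (uQ G B X) (dinv n l z RND Gb)).
  by congr (pad _ _); apply/matrixP => i j; rewrite mxE (wood_entry char2 Nd d0).
have := dfi_correct char2 (nd_pad char2 (leqfN B) ndW); rewrite -KE => -[l0 lK].
have Kl : (Kinv l z RND Gb B *m wood (Ninv n l z RND Gb) (uP L B) (uQ G B X)
    (dinv n l z RND Gb) = (linv l z RND Gb B)%:M)%R.
  by move: lK; rewrite {2}KE; apply: unpad_inv.
rewrite -(wood_inv_neq0 char2 uB Nd d0 Kl l0 au av); last first.
  by have /forallP/(_ v)/implyP := g3 u.
by rewrite (wood_inv_entry char2 Nd d0).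
Qed.

(** The specification looks only at stored cells, so it passes from the unbounded array of the
    program to the finite list which the machine returns. *)
Lemma dspec_ext (L : finFieldType) n l (z : L) RND Gb D D' :
  (forall i, i < MO n + sz (up_log 2 n) * sz (up_log 2 n) -> D' i = D i) ->
  dspec n l z RND Gb D -> dspec n l z RND Gb D'.
Proof.
move=> DD [h1 h2 h3 h4 h5 h6 h7 h8 h9 h10 h11 h12 h13 h14].
have sq N i j : i < N -> j < N -> i * N + j < N * N.
  by move=> iN jN; apply: (@leq_trans (i * N + N)); [lia|rewrite -mulSnr leq_mul2r iN orbT].
have M16 : 16 <= MO n by rewrite /MO /AO /XO; lia.
split; rewrite ?DD //; try by lia.
- by move=> x y hx hy; have hs := sq _ _ _ hx hy; rewrite DD ?h11 //; rewrite /MO /AO /XO; lia.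
- by move=> u v; have hs := sq _ _ _ (ltn_ord u) (ltn_ord v); rewrite DD //; rewrite /MO /AO /XO; lia.
- by move=> u v; have hs := sq _ _ _ (ltn_ord u) (ltn_ord v); rewrite DD //; rewrite /MO /AO /XO; lia.
by move=> i j; have hs := sq _ _ _ (ltn_ord i) (ltn_ord j); rewrite DD //; lia.
Qed.

Lemma uspec_ext (L : finFieldType) n l (z : L) RND Gb (B : seq (update n)) D D' :
  (forall i, i < upd_size (size B) -> D' i = D i) ->
  uspec l z RND Gb B D -> uspec l z RND Gb B D'.
Proof.
move=> DD [h1 h2 h3 h4 h5 h6].
have sq N i j : i < N -> j < N -> i * N + j < N * N.
  by move=> iN jN; apply: (@leq_trans (i * N + N)); [lia|rewrite -mulSnr leq_mul2r iN orbT].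
have M16 : 16 <= upd_size (size B) by rewrite /upd_size; lia.
split; rewrite ?DD //; try by lia.
- move=> j; have [l0 l1 l2 l3] := h5 j; have jB := ltn_ord j.
  have E r : r < 4 -> D' (HDR + j * 4 + r) = D (HDR + j * 4 + r).
    by move=> r4; apply: DD; rewrite /upd_size; lia.
  by rewrite /lst_ok !E.
move=> i j; have hs := sq _ _ _ (ltn_ord i) (ltn_ord j).
by rewrite DD //; rewrite /MK /upd_size; lia.
Qed.

(** * The oracle *)

Section TheOracle.

Variables (p : program) (c k : nat) (t : nat -> nat) (sl : nat -> slp).
Hypothesis slM : forall n, 0 < n -> slp_multiplies n (sl n).
Hypothesis slR : forall n, 0 < n -> run (c * bitlen n) p [:: [:: n]] (nseq (t n) 0) =
  Some (flatten (map slp_instr_words (sl n))).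

(** With $U = 2^{aU \cdot s}$, the first summand pays for the memory regions of all simulated runs,
    the second for the literals of [p], and 20 for sizes polynomial in [n]. In [Cw], [2 * aU] then
    allows addresses quadratic in $U$, and [2 * Jf k] unreduced products. *)
Definition aU := 10 * (c + 1) + cbound p + 20.
Definition Cw := 2 * aU + 2 * Jf k + 40.
Definition the_oracle :=
  Oracle Cw (compile (pre_c p c k)) (compile (upd_c p c k)) (compile (qry_c k)).

Let slsM i : slp_multiplies (sz i) (sls sl i).
Proof. by apply: slM; apply: sz_gt0. Qed.

Let slsP E j : j < E -> run (c * j.+1) p [:: [:: sz j]] (nseq (tz t j) 0) =
  Some (flatten (map slp_instr_words (sls sl j))).
Proof. by move=> _; rewrite /sls /tz -slR ?sz_gt0 // /bitlen szE trunc_expnK. Qed.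

Variable n : nat.
Notation s := (bitlen n).
Notation w := (Cw * s).
Notation U := (2 ^ (aU * s)).
Notation l := (flog k n).
Notation h := (3 ^ l).
Notation m := (h * 3).
Notation N := (sz (up_log 2 n)).

Let s0 : 0 < s. Proof. by []. Qed.
Let w_large : 7 < w.
Proof. by apply: (@leq_trans Cw); [rewrite /Cw; lia|rewrite leq_pmulr]. Qed.

Let aUs : 10 * (c + 1) * s + cbound p * s + 20 * s = aU * s.
Proof. by rewrite /aU !mulnDl. Qed.

Let ws : 2 * (aU * s) + 2 * (s * Jf k) + 40 * s = w.
Proof. by rewrite /Cw; lia. Qed.

Lemma powU e : e <= aU * s -> 2 ^ e <= U.
Proof. by move=> he; rewrite leq_exp2l. Qed.

Lemma mJ : m <= s * Jf k.
Proof.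
rewrite /Jf; case E : l => [|l']; first by rewrite expn0 mul1n; nia.
have h1 : 3 ^ l' < uphalf (kf k * s).
  rewrite ltnNge; apply/negP => le.
  by have := up_log_min (isT : 1 < 3) le; rewrite -/(flog k n) E ltnn.
rewrite expnS; move: h1; move: (3 ^ l') => q; rewrite mulnDr mulnCA (mulnC s (kf k)).
by move: (kf k * s) => y; lia.
Qed.

Let Jw : 2 * (s * Jf k) <= w. Proof. lia. Qed.
Let kw : kf k * s < w.
Proof. have : kf k * s <= s * Jf k by rewrite /Jf; nia. lia. Qed.
Let Ularge : 1000 <= U.
Proof. by apply: (@leq_trans (2 ^ 10)); rewrite // powU //; lia. Qed.
Let Ulim : 1000 * (U * U) <= lim w.
Proof.
apply: (@leq_trans (2 ^ 10 * 2 ^ (2 * (aU * s)))).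
  by rewrite mul2n -addnn expnD leq_mul2r; apply/orP; right.
by rewrite /lim -expnD leq_exp2l //; lia.
Qed.
Let sU4 : 4 * 2 ^ s <= U.
Proof. by rewrite -(expnD 2 2) powU //; lia. Qed.
Let cU : cbound p <= U.
Proof.
apply: (@leq_trans (2 ^ cbound p)); first exact/ltnW/ltn_expl.
by rewrite powU // -aUs; have := leq_pmulr (cbound p) s0; lia.
Qed.

Lemma pbase_exp E : pbase c E <= 2 ^ ((c + 1) * E).
Proof.
elim: E => [|E IH]; first by rewrite /pbase big_geq.
rewrite /pbase big_nat_recr //= -/(pbase c E).
have -> : (c + 1) * E.+1 = (c + 1) * E + c + 1 by lia.
rewrite expnD muln2 -addnn; apply: leq_add.
  by apply: leq_trans IH _; rewrite leq_exp2l // leq_addr.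
by rewrite leq_exp2l //; lia.
Qed.

(** The bound on levels serves both inversions: a batch has at most $2n^2 + n$ updates, hence at
    most $2^{2s+2}$. *)
Lemma levelU E : E <= 2 * s + 2 ->
  [/\ pbase c E + 2 ^ (c * E.+1) <= U, sz E <= U & E + 2 <= U].
Proof.
move=> Es; split.
- have -> : pbase c E + 2 ^ (c * E.+1) = pbase c E.+1 by rewrite /pbase big_nat_recr.
  apply: leq_trans (pbase_exp _) _; apply: powU; rewrite -aUs.
  have : (c + 1) * E.+1 <= (c + 1) * (10 * s) by rewrite leq_mul2l; apply/orP; right; lia.
  by lia.
- by rewrite szE powU //; lia.
apply: (@leq_trans (2 ^ (E + 2))); first exact/ltnW/ltn_expl.
by rewrite powU //; lia.
Qed.

Let ns : n < 2 ^ s. Proof. by rewrite trunc_log_ltn. Qed.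

Lemma nlevel : up_log 2 n <= 2 * s + 2.
Proof.
apply: up_log_min => //; apply: leq_trans (ltnW ns) _.
by rewrite leq_exp2l //; lia.
Qed.

Let NU : N <= U. Proof. by have [] := levelU nlevel. Qed.

Definition small (x : seq nat) := all (fun i => i < 2 ^ w) x && (size x < 2 ^ w).

Let lw : lim w <= 2 ^ w. Proof. by rewrite /lim leq_exp2l // leq_subr. Qed.
Let UU3 : 3 * (U * U) < 2 ^ w.
Proof. by have := leq_mul Ularge Ularge; lia. Qed.
Let U2w : U < 2 ^ w.
Proof. by have := leq_mul Ularge (leqnn U); lia. Qed.

Lemma smallP ins : all small ins ->
  (forall i j, nth 0 (nth [::] ins i) j < 2 ^ w) /\ (forall i, size (nth [::] ins i) < 2 ^ w).
Proof.
move=> /allP h; have H i : small (nth [::] ins i).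
  have [hi|hi] := ltnP i (size ins); first by apply: h; apply: mem_nth.
  by rewrite nth_default // /small /= expn_gt0.
split=> [i j|i]; have /andP[/allP a b] := H i; last by [].
have [hj|hj] := ltnP j (size (nth [::] ins i)); first by apply: a; apply: mem_nth.
by rewrite nth_default // expn_gt0.
Qed.

Lemma small_mkseq e q : wf w e -> q <= 3 * (U * U) -> small (mkseq (ar e 0) q).
Proof.
move=> [_ h] hq; rewrite /small size_mkseq; apply/andP; split; last by lia.
by apply/allP => _ /mapP[i _ ->]; apply: h.
Qed.

Lemma wf_env0 : wf w env0. Proof. by split=> *; rewrite expn_gt0. Qed.

Variables (L : finFieldType) (z : L).
Hypotheses (char2 : (2%N \in [pchar L])%R) (zP : ((3 ^ l.+1)%N.-primitive_root z)%R).
Let zm : (z ^+ m = 1)%R.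
Proof. by rewrite mulnC -expnS; apply: prim_expr_order. Qed.

Variable G : rel 'I_n.
Definition Gb i := nth 0 (graph_words G) i.

Lemma GbE : @Gr n Gb = G.
Proof.
apply/funext => u; apply/funext => v; rewrite /Gr /Gb /graph_words.
have := @nth_allpairs _ _ _ (fun u v => nat_of_bool (G u v)) u v 0 (enum 'I_n) (enum 'I_n) u v.
by rewrite size_enum_ord !nth_ord_enum => -> //; case: (G u v).
Qed.

Lemma Gb_lt i : Gb i < 2.
Proof.
rewrite /Gb; have [hi|hi] := ltnP i (size (graph_words G)); last by rewrite nth_default.
by have /allpairsP[[a b] [_ _ ->]] := mem_nth 0 hi; case: (G _ _).
Qed.

Definition RND (tp : seq nat) i := nth 0 tp (rnd_pos i) %% 2 ^ w.

Lemma pre_run tp : size tp = pre_time p k t sl n -> exists D,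
  [/\ run w (compile (pre_c p c k)) [:: [:: n]; graph_words G] tp = Some D,
      size D = pre_size n, small D & dspec n l z (RND tp) Gb (nth 0 D)].
Proof.
move=> st; have nU : n <= U by apply: leq_trans (ltnW ns) _; lia.
have nn : n * n <= U * U by apply: leq_mul.
have sg : size (graph_words G) = n * n by rewrite size_allpairs size_enum_ord.
have [|si sl'] := @smallP [:: [:: n]; graph_words G].
  rewrite /= /small /= sg !andbT -!andbA; apply/and4P; split; [lia|lia| |lia].
  apply/allP => x hx; have := Gb_lt (index x (graph_words G)).
  by rewrite /Gb nth_index //; lia.
have nl : n * n < lim w by lia.
have [e1 [b1 v1 r1 z1]] := rnd_cP (ins := [:: [:: n]; graph_words G]) (nth 0 tp) w_large (erefl n) nl.
have wf1 := bs_wf w_large si sl' b1 wf_env0.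
have [bu nu eu] := levelU nlevel.
have := @pre_restP p c k w _ (nth 0 tp) w_large si sl' n l U erefl mJ Jw kw Ularge Ulim sU4 cU
  nu eu (sls sl) (tz t) slsM bu (@slsP _) L z char2 zm (RND tp) Gb Gb_lt (fun _ _ => erefl) e1 v1 r1 z1.
move=> /(_ wf1 (rnd_time (n * n)))[t' [e2 [b2 l2 [d2 v2]]]].
have wf2 := bs_wf w_large si sl' b2 wf1.
have NN : N * N <= U * U by apply: leq_mul.
have szU : pre_size n <= 3 * (U * U).
  by have := leq_mul sU4 sU4; rewrite /pre_size /MO /AO /XO; nia.
exists (mkseq (ar e2 0) (pre_size n)); split.
- rewrite -[pre_size n]v2; apply: (run_compile w_large si sl' (bs_sq b1 b2)).
    by rewrite st /pre_time.
  by rewrite v2 -/(pre_size n); lia.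
- by rewrite size_mkseq.
- exact: small_mkseq.
by apply: dspec_ext d2 => i hi; rewrite nth_mkseq.
Qed.

Variable rnd : nat -> nat.
Variable B : seq (update n).
Hypothesis uB : uniq B.
Notation f := (size B).

Let fle : f <= 2 ^ (2 * s + 2).
Proof.
apply: leq_trans (size_batch uB) _.
have h1 := leq_mul (ltnW ns) (ltnW ns); rewrite -expnD addnn -mul2n in h1.
rewrite expnD; have : 2 ^ s <= 2 ^ (2 * s) by rewrite leq_exp2l //; lia.
by lia.
Qed.

Lemma flevel : up_log 2 f <= 2 * s + 2. Proof. exact: up_log_min. Qed.

Let fU : 4 * f + 16 <= U.
Proof.
apply: (@leq_trans (2 ^ (2 * s + 5))); last by rewrite powU //; lia.
have : 1 <= 2 ^ (2 * s) by rewrite expn_gt0.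
by move: fle; rewrite !expnD; lia.
Qed.

Let NU' : sz (up_log 2 f) <= U. Proof. by have [] := levelU flevel. Qed.

Lemma upd_run D tp : small D -> dspec n l z rnd Gb (nth 0 D) ->
  size tp = upd_time p k t sl f -> exists W,
  [/\ run w (compile (upd_c p c k)) [:: D; flatten (map (@update_words n) B)] tp = Some W,
      size W = upd_size f, small W & uspec l z rnd Gb B (nth 0 W)].
Proof.
move=> sD dD st; have nU : n <= U by apply: leq_trans (ltnW ns) _; lia.
have [|si sl'] := @smallP [:: D; flatten (map (@update_words n) B)].
  rewrite /= sD /small size_update_words /= !andbT; apply/andP; split; last by lia.
  apply/allP => y /flattenP[_ /mapP[x _ ->]].
  by case: x => [a b|a b|a]; rewrite !inE => /or3P[] /eqP-> /=;
    try (have := ltn_ord a; lia); try (have := ltn_ord b; lia).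
have [bu nu eu] := levelU flevel.
have := @updP p c k w [:: D; flatten (map (@update_words n) B)] (nth 0 tp) w_large si sl' n l U
  mJ Jw Ularge Ulim sU4 NU L z char2 zm rnd Gb dD B fU erefl nu eu (sls sl) (tz t) slsM cU bu
  (@slsP _) env0 (fun _ _ => erefl).
move=> /(_ wf_env0 4)[t' [e2 [b2 l2 [d2 v2]]]].
have wf2 := bs_wf w_large si sl' b2 wf_env0.
have NN : sz (up_log 2 f) * sz (up_log 2 f) <= U * U by apply: leq_mul.
have szU : upd_size f <= 3 * (U * U) by rewrite /upd_size; nia.
exists (mkseq (ar e2 0) (upd_size f)); split.
- rewrite -[upd_size f]v2; apply: (run_compile w_large si sl' b2).
    by rewrite st.
  by rewrite v2 -/(upd_size f); lia.
- by rewrite size_mkseq.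
- exact: small_mkseq.
by apply: uspec_ext d2 => i hi; rewrite nth_mkseq.
Qed.

Lemma qry_run D W u v tp : small D -> dspec n l z rnd Gb (nth 0 D) ->
  small W -> uspec l z rnd Gb B (nth 0 W) -> size tp = qry_time k f ->
  run w (compile (qry_c k)) [:: D; W; [:: val u; val v]] tp =
    Some [:: nat_of_bool [&& alive B u, alive B v & value l z rnd Gb B u v != 0%R]].
Proof.
move=> sD dD sW uW st; have nU : n <= U by apply: leq_trans (ltnW ns) _; lia.
have [|si sl'] := @smallP [:: D; W; [:: val u; val v]].
  rewrite /= sD sW /small /= !andbT -!andbA; have := ltn_ord u; have := ltn_ord v.
  by move=> h1 h2; apply/and3P; split; lia.
have := @qryP k w [:: D; W; [:: val u; val v]] (nth 0 tp) w_large si sl' n l U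
  mJ Jw Ularge Ulim sU4 NU L z char2 zP rnd Gb dD B fU NU' uW u v erefl erefl env0.
move=> /(_ wf_env0 4)[t' [e2 [b2 l2 [d2 v2]]]].
rewrite (run_compile w_large si sl' b2).
- by congr Some; rewrite v2 /mkseq /= d2.
- by rewrite st /qry_time; move: l2; rewrite /qry_cost /outer_cost; lia.
by rewrite v2; lia.
Qed.

End TheOracle.

Local Open Scope ring_scope.

Theorem theorem1p2 (R : realType) (omega : R) (k : nat)
    (omega_matmul : matmul_exponent omega) :
  exists (O : oracle)
         (pre_time upd_time qry_time pre_space upd_space : nat -> nat),
    [/\ natO pre_time (fun n => n%:R `^ omega),
        natO upd_time (fun f => f%:R `^ omega),
        natO qry_time (fun f => f%:R ^+ 2 : R),
        natO pre_space (fun n => n%:R ^+ 2 : R) &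
        natO upd_space (fun f => f%:R ^+ 2 : R)] /\
    forall (n f : nat) (G : rel 'I_n) (B : seq (update n)),
      uniq B -> size B = f ->
      resource_bounds O G B (pre_time n) (upd_time f) (qry_time f)
        (pre_space n * bitlen n) (upd_space f * bitlen n) /\
      1 - n%:R ^- k <=
        success_prob R O G B (pre_time n) (upd_time f) (qry_time f).
Proof.
have [p [c [t [sl [tO H]]]]] := omega_matmul.
have slt n : (0 < n)%N -> (size (sl n) <= t n)%N by case/H.
have slM n : (0 < n)%N -> slp_multiplies n (sl n) by case/H.
have slR n : (0 < n)%N -> run (c * bitlen n) p [:: [:: n]] (nseq (t n) 0%N) =
  Some (flatten (map slp_instr_words (sl n))) by case/H.
have w2 : 2 <= omega.
  apply: omega_ge2 tO => n n0; apply: leq_trans (slt _ n0).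
  exact: size_multiplies (slM _ n0).
have [K K0 tK] := natO_pow (le_trans (ler0n _ 2) w2) tO.
exists (the_oracle p c k), (pre_time p k t sl), (upd_time p k t sl), (qry_time k),
  (fun n => Cw p c k * pre_size n)%N, (fun f => Cw p c k * upd_size f)%N.
split.
  split.
  - exact: (natO_cost slt w2 K0 tK (pre_nat_le _ _ _ _)).
  - exact: (natO_cost slt w2 K0 tK (upd_nat_le _ _ _ _)).
  - by apply: natO_square; apply: qry_nat_le.
  - apply: natO_square; exists (Cw p c k * 26)%N => n n0.
    by rewrite -mulnA leq_mul2l pre_size_le ?orbT.
  - apply: natO_square; exists (Cw p c k * 24)%N => n n0.
    by rewrite -mulnA leq_mul2l upd_size_le ?orbT.
move=> n f G B uB <- {f}.
(* The field and its root exist in the proof only: the programs handle words and need nothing but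
   [flog k n], which they find from [n]. *)
have [L [z [char2 cL zP]]] := exists_gf2 (flog k n).
have preP := pre_run (c := c) slM slR char2 zP G.
have updP' := fun rnd => upd_run (c := c) slM slR char2 zP (G := G) (rnd := rnd) uB.
have qryP' := fun rnd => @qry_run p c k n L z char2 zP G rnd B uB.
split.
  move=> r1; have [|D [D1 D2 D3 D4]] := preP (tape_words r1).
    by rewrite size_map size_tuple.
  exists D; split=> //; first by rewrite D2 /word_size /= mulnA (mulnC (pre_size n)).
  move=> r2; have [|W [W1 W2 W3 W4]] := updP' _ D (tape_words r2) D3 D4.
    by rewrite size_map size_tuple.
  exists W; split=> //; first by rewrite W2 /word_size /= mulnA (mulnC (upd_size _)).
  move=> u v r3; rewrite /query (qryP' _ D W u v (tape_words r3) D3 D4 W3 W4) //.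
  by rewrite size_map size_tuple.
pose pos (u v : 'I_n) := rnd_pos (u * n + v).
have period0 : (0 < rnd_period)%N by rewrite /rnd_period; lia.
have q2 : (3 ^ flog k n + 3 ^ flog k n = 2 * 3 ^ flog k n)%N by rewrite addnn mul2n.
have mJ' := mJ p c k n.
have q_le : (2 * 3 ^ flog k n <= Cw p c k * bitlen n)%N.
  apply: (@leq_trans (2 * (bitlen n * Jf k))%N); first by lia.
  by rewrite /Cw; lia.
apply: (@success_bound R _ n G B _ _ _ k (flog k n)
  (2 ^ (Cw p c k * bitlen n - 2 * 3 ^ flog k n))%N L z pos char2 cL zP) => //.
- by rewrite /word_size /= -expnD subnK.
- have : (uphalf (kf k * bitlen n) <= 3 ^ flog k n)%N by apply: up_logP.
  by rewrite -/(kf k); move: (kf k * bitlen n)%N (3 ^ _)%N => a b; lia.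
- move=> u v; have uv : (u * n + v < n * n)%N by have := ltn_ord u; have := ltn_ord v; nia.
  rewrite /pos /rnd_pos /pre_time /rnd_time.
  have : (((u * n + v).+1) * rnd_period <= n * n * rnd_period)%N by rewrite leq_mul2r uv orbT.
  by rewrite mulSn; lia.
- move=> u v u' v'; rewrite /pos /rnd_pos => /addIn /addnI /eqP.
  rewrite eqn_mul2r => /orP[/eqP z0|/eqP]; first by move: period0; rewrite z0.
  by move=> /(row_inj (ltn_ord v) (ltn_ord v'))[/ord_inj -> /ord_inj ->].
move=> r1 r2 r3 good; rewrite /all_correct.
(* The stored weights are reduced modulo the word size first and modulo the order of the field
   afterwards; as the latter divides the former, they form [tape_matrix]. *)
have goodM : good_matrix (@Gr n (Gb G)) B (Xm n (flog k n) z (RND p c k n (tape_words r1))).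
  rewrite GbE (_ : Xm _ _ _ _ = tape_matrix (flog k n) z pos (tape_words r1)) //.
  apply/matrixP => a b; rewrite !mxE /Xw /RND /pos q2 modn_dvdm //.
  by rewrite dvdn_exp2l.
have [|D [D1 D2 D3 D4]] := preP (tape_words r1); first by rewrite size_map size_tuple.
rewrite /preprocess D1.
have [|W [W1 W2 W3 W4]] := updP' _ D (tape_words r2) D3 D4; first by rewrite size_map size_tuple.
rewrite /process_batch W1; apply/forallP => u; apply/forallP => v; apply/eqP.
rewrite /query (qryP' _ D W u v (tape_words (r3 (u, v))) D3 D4 W3 W4); last first.
  by rewrite size_map size_tuple.
by rewrite (value_correct u v char2 uB goodM) GbE.
Qed.
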